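(* Let $\psi:M^m\to\mathbb R^{m+1}$ be a complete, connected, orientable self-shrinker, that is, a mean curvature flow soliton with respect to the position vector field with constant $c<0$, such that $H=\langle\mathbf H,N\rangle$ is not identically zero and does not change sign with respect to the unit normal vector field $N$. If for some $p>1$ $$|H|^{2-p}|A|^p\in L^1(M,e^{c\eta}\,dM),$$ then either $\psi(M)$ is a sphere or a product of a sphere and a Euclidean factor; or $\psi(M)$ is a cylinder of the form $\gamma\times\mathbb R^{m-1}$, where $\gamma$ is a mean curvature flow soliton in a Euclidean plane.
   Context: An isometric immersion $\psi:M^m\to\mathbb R^{m+1}$ is a mean curvature flow soliton with respect to the position field $X(x)=x$ if $c\,X^\perp=\mathbf H$ along $\psi$ for some constant $c\in\mathbb R$, where $\perp$ is projection on the normal bundle and $\mathbf H=HN$ is the non-normalized mean curvature vector (the trace of the second fundamental form). $A$ is the Weingarten operator in the direction $N$. Here $\eta=\frac12|\psi|^2$ (up to an additive constant), and $dM$ is the induced volume element. Complete means $M$ with the induced metric is complete. ''Does not change sign'' means $H\ge0$ everywhere or $H\le0$ everywhere. *)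

(* Defs.v *)
(* MathComp-Analysis, over an arbitrary [R : realType]. *)
From HB Require Import structures.
From mathcomp Require Export all_boot all_order all_algebra.
From mathcomp Require Export all_classical all_reals all_analysis.

Set Implicit Arguments.
Unset Strict Implicit.
Unset Printing Implicit Defensive.

Export Order.TTheory GRing.Theory Num.Theory.
Export numFieldNormedType.Exports.

#[global] Open Scope classical_set_scope.
#[global] Open Scope ring_scope.

Section Euclidean.
Variable R : realType.

(* MathComp-Analysis norms ['rV_n] by the sup norm, which induces the same
   topology and derivatives; lengths and angles come from [dot]. *)
Definition dot n (u v : 'rV[R]_n) : R := (u *m v^T) 0 0.
Definition enorm n (u : 'rV[R]_n) : R := Num.sqrt (dot u u).

Definition partial m n (i : 'I_m) (F : 'rV[R]_m -> 'rV[R]_n) :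
  'rV[R]_m -> 'rV[R]_n := fun u => 'D_(delta_mx 0 i) F u.

(* Meaningful for [U] open. *)
Fixpoint Ck m n (k : nat) (U : set 'rV[R]_m) (F : 'rV[R]_m -> 'rV[R]_n) :
    Prop :=
  (forall u, U u -> {for u, continuous F}) /\
  match k with
  | 0 => True
  | k'.+1 => forall i : 'I_m,
      (forall u, U u -> derivable F u (delta_mx 0 i)) /\ Ck k' U (partial i F)
  end.

Definition smooth_on m n (U : set 'rV[R]_m) (F : 'rV[R]_m -> 'rV[R]_n) :=
  forall k, Ck k U F.

(* Row [i] is the [i]-th partial derivative. *)
Definition jac m n (F : 'rV[R]_m -> 'rV[R]_n) (u : 'rV[R]_m) : 'M[R]_(m, n) :=
  \matrix_i partial i F u.

(* Integral over R^m as an iterated integral; for nonnegative Borel functions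
   this is the Lebesgue integral, by Tonelli. *)
Fixpoint lebesgue_rV (m : nat) : ('rV[R]_m -> \bar R) -> \bar R :=
  match m with
  | 0 => fun f => f 0
  | m'.+1 => fun f => (\int[lebesgue_measure]_t
      lebesgue_rV (fun y : 'rV[R]_m' => f (row_mx (t%:M : 'rV[R]_1) y)))%E
  end.

Definition sphere n (a : 'rV[R]_n) (r : R) : set 'rV[R]_n :=
  [set x | enorm (x - a) = r].

(* [S] is [A x B] up to a linear isometry R^k x R^l -> R^n: the rows of [P] and
   of [Q] together form an orthonormal basis of R^n. *)
Definition is_product k l n (S : set 'rV[R]_n) (A : set 'rV[R]_k)
    (B : set 'rV[R]_l) : Prop :=
  (k + l)%N = n /\
  exists (P : 'M[R]_(k, n)) (Q : 'M[R]_(l, n)),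
    [/\ P *m P^T = 1%:M, Q *m Q^T = 1%:M, P *m Q^T = 0 &
      S = [set x | exists a b, [/\ A a, B b & x = a *m P + b *m Q]]].

End Euclidean.

Section Manifold.
Variable R : realType.

(* A homeomorphism from the open set [cdom] of [T] onto an open set of R^m; the
   values of [cmap] off [cdom] and of [cinv] off [crange] are irrelevant. *)
Record chart (m : nat) (T : topologicalType) := Chart {
  cdom : set T ;
  cmap : T -> 'rV[R]_m ;
  cinv : 'rV[R]_m -> T ;
  cdom_open : open cdom ;
  crange_open : open (cmap @` cdom) ;
  cmapK : {in cdom, cancel cmap cinv} ;
  cmap_continuous : forall p, cdom p -> {for p, continuous cmap} ;
  cinv_continuous : forall u, (cmap @` cdom) u -> {for u, continuous cinv} }.

Definition crange m T (phi : chart m T) : set 'rV[R]_m := cmap phi @` cdom phi.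

Definition transition m T (phi1 phi2 : chart m T) : 'rV[R]_m -> 'rV[R]_m :=
  cmap phi2 \o cinv phi1.

Definition overlap m T (phi1 phi2 : chart m T) : set 'rV[R]_m :=
  cmap phi1 @` (cdom phi1 `&` cdom phi2).

Definition compatible m T (phi1 phi2 : chart m T) : Prop :=
  smooth_on (overlap phi1 phi2) (transition phi1 phi2) /\
  smooth_on (overlap phi2 phi1) (transition phi2 phi1).

(* The carrier is pointed (hence nonempty) because measurable types are. *)
Record manifold (m : nat) := Manifold {
  carrier :> ptopologicalType ;
  carrier_hausdorff : hausdorff_space carrier ;
  carrier_second_countable : @second_countable carrier ;
  atlas : set (chart m carrier) ;
  chart_at : carrier -> chart m carrier ;
  chart_at_atlas : forall p, atlas (chart_at p) ;
  chart_at_dom : forall p, cdom (chart_at p) p ;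
  atlas_compatible : forall phi1 phi2, atlas phi1 -> atlas phi2 ->
    compatible phi1 phi2 }.

Definition orientable m (M : manifold m) : Prop :=
  exists O : set (chart m M),
    [/\ forall p, exists2 phi, O phi & cdom phi p,
        forall phi1 phi2, O phi1 -> atlas phi2 -> compatible phi1 phi2 &
        forall phi1 phi2, O phi1 -> O phi2 ->
          forall u, overlap phi1 phi2 u ->
            0 < \det (jac (transition phi1 phi2) u)].

Definition smooth_map m n (M : manifold m) (f : M -> 'rV[R]_n) : Prop :=
  forall phi, atlas phi -> smooth_on (crange phi) (f \o cinv phi).

Definition immersion m n (M : manifold m) (psi : M -> 'rV[R]_n) : Prop :=
  smooth_map psi /\
  forall phi, atlas phi -> forall u, crange phi u ->
    row_free (jac (psi \o cinv phi) u).

End Manifold.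

Section LocalGeometry.
Variables (R : realType) (m n : nat) (F : 'rV[R]_m -> 'rV[R]_n).
Variable u : 'rV[R]_m.

(* First fundamental form. *)
Definition gram : 'M[R]_m := jac F u *m (jac F u)^T.

Definition normal_part (v : 'rV[R]_n) : 'rV[R]_n :=
  v - v *m (jac F u)^T *m invmx gram *m jac F u.

(* Trace, for the induced metric, of the vector-valued second fundamental form
   [(d_i d_j F)^perp]. *)
Definition mean_curvature_local : 'rV[R]_n :=
  \sum_i \sum_j invmx gram i j *: normal_part (partial i (partial j F) u).

(* Second fundamental form in the normal direction [nu]. *)
Definition sff (nu : 'rV[R]_n) : 'M[R]_m :=
  \matrix_(i, j) dot (partial i (partial j F) u) nu.

(* Matrix of the Weingarten operator in the coordinate frame. *)
Definition weingarten (nu : 'rV[R]_n) : 'M[R]_m := invmx gram *m sff nu.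

End LocalGeometry.

Section Immersed.
Variables (R : realType) (m n : nat) (M : manifold R m).
Implicit Types (psi N : M -> 'rV[R]_n) (p q : M).

(* The quantities at [p] below do not depend on the chart around [p]. *)
Definition par_at psi p : 'rV[R]_m -> 'rV[R]_n := psi \o cinv (chart_at p).
Definition crd_at p : 'rV[R]_m := cmap (chart_at p) p.

Definition mean_curvature_vector psi p : 'rV[R]_n :=
  mean_curvature_local (par_at psi p) (crd_at p).

(* [c X^perp = H] along [psi], for the position field [X x = x]. *)
Definition soliton_for (c : R) psi : Prop :=
  forall p, c *: normal_part (par_at psi p) (crd_at p) (psi p)
            = mean_curvature_vector psi p.

Definition mcf_soliton psi : Prop :=
  immersion psi /\ exists c, soliton_for c psi.

Definition unit_normal psi N : Prop :=
  smooth_map N /\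
  forall p, enorm (N p) = 1 /\ jac (par_at psi p) (crd_at p) *m (N p)^T = 0.

(* Non-normalized mean curvature function [H = <H_vector, N>]. *)
Definition mean_curvature psi N p : R := dot (mean_curvature_vector psi p) (N p).

(* [|A|], with [|A|^2 = tr (A^2)] since [A] is self-adjoint. *)
Definition norm_A psi N p : R :=
  let A := weingarten (par_at psi p) (crd_at p) (N p) in Num.sqrt (\tr (A *m A)).

(* [|H|^(2-e) |A|^e]. Where [H = 0] and [2 < e] the factor [|H|^(2-e)] has the
   junk value 0; a soliton with [H] of constant sign and not identically zero
   has no such point, by the strong maximum principle. *)
Definition HA_density (e : R) psi N p : R :=
  `|mean_curvature psi N p| `^ (2 - e) * norm_A psi N p `^ e.

Definition eta psi p : R := 2^-1 * dot (psi p) (psi p).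

Definition C1_curve (g : R -> M) : Prop :=
  continuous g /\
  forall phi, atlas phi -> forall t, cdom phi (g t) ->
    derivable (cmap phi \o g) t 1 /\
    {for t, continuous ((cmap phi \o g)^`())%classic}.

Definition curve_length psi (g : R -> M) : \bar R :=
  (\int[lebesgue_measure]_(t in `[0%R, 1%R])
     (enorm ((psi \o g)^`()%classic t))%:E)%E.

(* Riemannian distance of the induced metric. Slowing down at the corners and
   at the end points turns a piecewise C^1 curve on [0, 1] into a C^1 curve on R
   of the same length, so this is the usual infimum. *)
Definition rdist psi p q : \bar R :=
  ereal_inf [set curve_length psi g | g in
    [set g : R -> M | [/\ C1_curve g, g 0 = p & g 1 = q]]].

Definition complete_immersion psi : Prop :=
  forall x : nat -> M,
    (forall e : R, 0 < e -> exists k : nat, forall i j : nat,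
       (k <= i)%N -> (k <= j)%N -> (rdist psi (x i) (x j) < e%:E)%E) ->
    exists p, forall e : R, 0 < e -> exists k : nat, forall i : nat,
       (k <= i)%N -> (rdist psi (x i) p < e%:E)%E.

Definition borel : Type := g_sigma_algebraType (@open M).
HB.instance Definition _ := Measurable.on borel.

(* [mu] is the volume element [dM] of the induced metric: in every chart it has
   density [sqrt (det g)]. As [M] is second countable, this determines [mu]. *)
Definition is_volume psi (mu : {measure set borel -> \bar R}) : Prop :=
  forall phi, atlas phi -> forall B : set borel,
    measurable B -> B `<=` cdom phi ->
    mu B = lebesgue_rV (fun u : 'rV[R]_m =>
      (\1_(cmap phi @` B) u * Num.sqrt (\det (gram (psi \o cinv phi) u)))%:E).

End Immersed.

(* Main.v *)
(** Write [s = <psi, N>], so that [H = c s]. A strong maximum principle (Hopf's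
    lemma) shows that [s] has no zero. The tensor [B = A / s] satisfies a
    Simons-type identity: the drift Laplacian of [|B|^2] for the weight
    [s^2 e^(c eta)] equals [2 |grad B|^2]. The hypothesis makes [|B|^p]
    integrable for that weight, so a Caccioppoli argument with the cutoffs
    provided by completeness (Hopf-Rinow) gives [grad B = 0].

    Hence the common kernel of [B] and [N] is a constant subspace [V], and by
    the Codazzi equation either [s] is constant, in which case [psi(M)] lies in
    (a sphere) x [V], or [B] has rank one, in which case [psi(M)] lies in
    [gamma] x [V], where [gamma] solves the soliton equation in the plane
    orthogonal to [V]. No flow on [M] is needed for the reverse inclusions: a
    point at which the distance to the target cannot be decreased at a definite
    rate is found by Ekeland's variational principle, and can only be the
    target itself. *)
From HB Require Import structures.
Require Import Defs.
From mathcomp Require Import ring lra measurable_realfun perm.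

Set Implicit Arguments.
Unset Strict Implicit.
Unset Printing Implicit Defensive.

(** * Calculus on open subsets of R^m *)

Section Calculus.
Variable R : realType.

(** Tensors on the hypersurface carry ambient indices and are killed by [N]; the only differential
    operators are the ambient components [d i] of the tangential gradient. No frame, connection or
    curvature tensor is introduced: the commutator of [d i] and [d j] plays their role, and the
    identity for [|B|^2] becomes a computation in a commutative ring.

    The exponent enters through a Kato-type inequality. For [w = |B|^2] one has
    [|grad w|^2 <= 4 w |grad B|^2], and this makes the divergence of [s^2 e^(c eta) grad w^(p/2)]
    control [|grad B|^2] for every [p > 1]. Powers of [w] are smooth because [tr B] is a nonzero
    constant, so that [w] never vanishes.

    Cutoffs built from the distance are only Lipschitz. Hence no cutoff is ever differentiated:
    integration by parts is replaced by an inequality for Lipschitz weights, proved in charts by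
    shifting difference quotients, whose constant involves only the dimension and the Lipschitz
    constant. *)

Lemma sum_continuous_at (T : topologicalType) (W : normedModType R) (I : Type)
  (r : seq I) (P : pred I) (F : I -> T -> W) (x : T) :
 (forall i, P i -> {for x, continuous (F i)}) ->
 {for x, continuous (fun y => \sum_(i <- r | P i) F i y)}.
Proof.
move=> Fc.
suff H : (\sum_(i <- r | P i) F i y) @[y --> x] --> \sum_(i <- r | P i) F i x by exact: H.
elim: r => [|i r IH].
 by rewrite big_nil; under eq_cvg do rewrite big_nil; exact: cvg_cst.
rewrite big_cons; under eq_cvg do rewrite big_cons.
by case: ifPn => // Pi; apply: cvgD => //; exact: Fc.
Qed.

Section LineDerivative.
Variable V W : normedModType R.

Lemma is_derive_line (f : V -> W) (u v : V) (t : R) :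
 derivable f (u + t *: v) v ->
 is_derive t 1 (fun s : R => f (u + s *: v)) ('D_v f (u + t *: v)).
Proof.
move=> fd; have E : (fun h : R => h^-1 *: (((fun s : R => f (u + s *: v)) \o shift t) (h *: 1)
  - f (u + t *: v))) = (fun h => h^-1 *: ((f \o shift (u + t *: v)) (h *: v) - f (u + t *: v))).
 rewrite funeqE => h /=; congr (_ *: (f _ - _)).
 by rewrite [h%:A]mulr1 scalerDl addrCA.
by split; rewrite /derivable /derive E.
Qed.

Lemma derive_nbhs_eq (f g : V -> W) (U : set V) (u v : V) : open U -> U u ->
 {in U, f =1 g} -> (derivable f u v -> derivable g u v) * ('D_v f u = 'D_v g u).
Proof.
move=> oU Uu fg.
have nfg : {near u, f =1 g}.
 by apply: filterS (open_nbhs_nbhs (conj oU Uu)) => w Uw; apply: fg; rewrite inE.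
split; last by have [->//|v0] := eqVneq v 0; [rewrite !derive0|exact: near_eq_derive].
have [->//|v0] := eqVneq v 0; first by move=> _; exact: derivable0.
by apply: near_eq_derivable.
Qed.

End LineDerivative.

(** * Boxes and the mean value inequality *)

Section Cube.
Variable m : nat.
Notation V := 'rV[R]_m.
Implicit Types (f g : V -> R) (u v w : V).

Definition e_ (i : 'I_m) : V := delta_mx 0 i.

Lemma normrv_le u (r : R) : 0 <= r -> (`|u| <= r) <-> (forall i, `|u 0 i| <= r).
Proof.
move=> r0; have -> : `|u| = \big[Num.max/0]_ij `|u ij.1 ij.2|.
 by rewrite {1}/Num.Def.normr/= mx_normrE.
split=> [H i|H].
 by apply: le_trans H; exact: (le_bigmax _ (fun ij : 'I_1 * 'I_m => `|u ij.1 ij.2|) (0, i)).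
by apply: bigmax_le => // -[j i] _ /=; rewrite ord1.
Qed.

Lemma coord_le u i : `|u 0 i| <= `|u|.
Proof. by apply: (normrv_le u (normr_ge0 u)).1. Qed.

(** The corners of a staircase from [u] to [v]: consecutive corners differ along one axis, so that
    only partial derivatives are needed to compare values at [u] and [v]. *)
Definition partsum (u v : V) (k : nat) : V := \row_i (if (i < k)%N then v 0 i else u 0 i).

Lemma partsum0 u v : partsum u v 0 = u.
Proof. by apply/rowP => i; rewrite mxE. Qed.

Lemma partsum_all u v : partsum u v m = v.
Proof. by apply/rowP => i; rewrite mxE ltn_ord. Qed.

Lemma partsumS u v (k : 'I_m) :
 partsum u v k.+1 = partsum u v k + (v 0 k - u 0 k) *: e_ k.
Proof.
apply/rowP => i; rewrite !mxE eqxx /= ltnS leq_eqVlt.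
have [->|ik] := eqVneq i k; first by rewrite eqxx ltnn /= mulr1 addrC subrK.
have -> : (i == k :> nat) = false by apply/negbTE.
by rewrite mulr0 addr0.
Qed.

Definition box (c : V) (r : R) : set V := [set u | forall i, `|u 0 i - c 0 i| <= r].

Lemma box_ball c r u : 0 <= r -> box c r u <-> `|u - c| <= r.
Proof.
move=> r0; split=> [H|/normrv_le H i].
 by apply/normrv_le => // i; have := H i; rewrite !mxE.
by have := H r0 i; rewrite !mxE.
Qed.

Lemma box_convex c r u v t : box c r u -> box c r v -> 0 <= t <= 1 ->
 box c r (u + t *: (v - u)).
Proof.
move=> Hu Hv /andP[t0 t1] i; rewrite !mxE.
have -> : u 0 i + t * (v 0 i - u 0 i) - c 0 i =
 (1 - t) * (u 0 i - c 0 i) + t * (v 0 i - c 0 i) by ring.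
apply: le_trans (ler_normD _ _) _; rewrite !normrM (ger0_norm t0).
rewrite (@ger0_norm _ (1 - t)) ?subr_ge0//.
have -> : r = (1 - t) * r + t * r by ring.
by apply: lerD; apply: ler_wpM2l => //; rewrite subr_ge0.
Qed.

Lemma box_partsum c r u v k t : box c r u -> box c r v -> 0 <= t <= 1 ->
 (k < m)%N -> box c r (partsum u v k + t *: (partsum u v k.+1 - partsum u v k)).
Proof.
move=> Hu Hv t01 km; apply: box_convex => // i; rewrite !mxE; case: ifP => _; exact: Hu || exact: Hv.
Qed.

(** The mean value theorem is applied on each edge of the staircase [partsum]; the edges stay in the
    box because a box is a convex product. *)
Lemma partial_bound (K : R) c r f u v : box c r u -> box c r v ->
 (forall w i, box c r w -> derivable f w (e_ i)) ->
 (forall w i, box c r w -> `|'D_(e_ i) f w| <= K) ->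
 `|f v - f u| <= K * \sum_i `|v 0 i - u 0 i|.
Proof.
move=> Hu Hv fd fK.
suff H k : (k <= m)%N -> `|f (partsum u v k) - f u| <=
  K * \sum_(i < m | (i < k)%N) `|v 0 i - u 0 i|.
 rewrite -{1}(partsum_all u v); apply: le_trans (H m (leqnn m)) _.
 by rewrite le_eqVlt; apply/orP; left; apply/eqP; congr (_ * _); apply: eq_bigl => i; rewrite ltn_ord.
elim: k => [_|k IH km].
 by rewrite partsum0 subrr normr0 big1 ?mulr0.
pose k' := Ordinal km; pose w := partsum u v k; pose a := v 0 k' - u 0 k'.
have Sw : partsum u v k.+1 = w + a *: e_ k' by exact: (partsumS u v k').
have inb (s : R) : 0 <= s <= 1 -> box c r (w + (s * a) *: e_ k').
 move=> s01; have := box_partsum Hu Hv s01 km.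
 by rewrite Sw -/w [w + a *: _]addrC addrK scalerA.
pose g s := f (w + (s * a) *: e_ k').
have gE : g = (fun s => f (w + s *: (a *: e_ k'))).
 by apply/funext => s; rewrite /g scalerA.
have dg (s : R) : 0 <= s <= 1 -> is_derive s 1 g (a * 'D_(e_ k') f (w + (s * a) *: e_ k')).
 move=> s01; have d1 := is_derive_line (fd _ k' (inb s s01)).
 have -> : g = (fun t => f (w + t *: e_ k')) \o (fun s => s * a) by [].
 have d2 : is_derive s 1 (fun s => s * a) a.
  by apply: is_derive_eq; rewrite scaler0 add0r [_%:A]mulr1.
 rewrite [a * _]mulrC.
 exact: (@is_derive1_comp R (fun t : R => f (w + t *: e_ k')) (fun s : R => s * a) s _ _ d1 d2).
have [t t01 Et] : exists2 t, t \in `[0, 1]%R & g 1 - g 0 =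
  (a * 'D_(e_ k') f (w + (t * a) *: e_ k')) * (1 - 0).
 apply: (@MVT_segment R g (fun t => a * 'D_(e_ k') f (w + (t * a) *: e_ k'))) => // [x|].
  rewrite in_itv /= => /andP[x0 x1]; apply: dg; by rewrite !ltW.
 apply: derivable_within_continuous => x; rewrite in_itv /= => x01.
 by have [] := dg x x01.
have Eg : f (partsum u v k.+1) - f w = a * 'D_(e_ k') f (w + (t * a) *: e_ k').
 by rewrite subr0 mulr1 in Et; rewrite -Et /g mul1r mul0r scale0r addr0 Sw.
have -> : \sum_(i < m | (i < k.+1)%N) `|v 0 i - u 0 i| =
  `|a| + \sum_(i < m | (i < k)%N) `|v 0 i - u 0 i|.
 rewrite (bigD1 k') //=; congr (_ + _); apply: eq_bigl => i.
 by rewrite ltnS ltn_neqAle -(inj_eq val_inj) andbC.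
rewrite mulrDr -(subrK (f w) (f (partsum u v k.+1))) -addrA.
apply: le_trans (ler_normD _ _) (lerD _ (IH (ltnW km))).
rewrite Eg normrM mulrC; apply: ler_wpM2r => //; apply: fK; apply: inb.
by move: t01; rewrite in_itv.
Qed.

Lemma partial_lip (K : R) c r f u v : 0 <= K -> box c r u -> box c r v ->
 (forall w i, box c r w -> derivable f w (e_ i)) ->
 (forall w i, box c r w -> `|'D_(e_ i) f w| <= K) ->
 `|f v - f u| <= (K * m%:R) * `|v - u|.
Proof.
move=> K0 Hu Hv fd fK; apply: le_trans (partial_bound Hu Hv fd fK) _.
rewrite -mulrA; apply: ler_wpM2l => //.
rewrite mulr_natl -[X in _ *+ X]card_ord -sumr_const; apply: ler_sum => i _.
by have := coord_le (v - u) i; rewrite !mxE.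
Qed.

Lemma nbhs_box (U : set V) u : nbhs u U -> exists2 r : R, 0 < r & box u r `<=` U.
Proof.
move=> /nbhs_ballP[e /= e0 He]; exists (e / 2); first by rewrite divr_gt0.
move=> v /box_ball; rewrite ltW ?divr_gt0// => /(_ isT) Hv; apply: He.
rewrite -ball_normE /= distrC (le_lt_trans Hv)// ltr_pdivrMr// ltr_pMr// ltr1n//.
Qed.

Lemma box_nbhs u (r : R) : 0 < r -> nbhs u (box u r).
Proof.
move=> r0; apply/nbhs_ballP; exists r => //= v; rewrite -ball_normE /= distrC => /ltW H.
by apply/box_ball => //; exact: ltW.
Qed.

Lemma box_compact c r : compact (box c r).
Proof.
have -> : box c r = [set u : V | forall i, `[c 0 i - r, c 0 i + r]%classic (u 0 i)].
 apply/seteqP; split=> u H i; have := H i; rewrite /= in_itv /= ler_distlC.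
  by rewrite -ler_distlC distrC ler_distlC.
 by rewrite -ler_distlC distrC ler_distlC.
by apply: (@rV_compact _ _ (fun i => `[c 0 i - r, c 0 i + r]%classic)) => i; exact: segment_compact.
Qed.

End Cube.

(** * Differentiability from continuous partial derivatives *)

Section C1.
Variable m : nat.
Notation V := 'rV[R]_m.
Implicit Types (f g : V -> R) (u v w : V).

Lemma row_sum_delta' u : u = \sum_i u 0 i *: e_ i.
Proof. by rewrite [LHS]row_sum_delta. Qed.

(** Subtracting the candidate differential [L] leaves a function whose partial derivatives are small
    on a small box around [u]; [partial_lip] then bounds its increment by a small multiple of the
    displacement. *)
Lemma C1_differentiable (U : set V) f : open U ->
 (forall i u, U u -> derivable f u (e_ i)) ->
 (forall i u, U u -> {for u, continuous ('D_(e_ i) f)}) ->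
 forall u, U u -> differentiable f u.
Proof.
move=> oU fd fc u Uu.
pose L (v : V) : R := \sum_i v 0 i * 'D_(e_ i) f u.
have Llin : linear L.
 move=> k v w; rewrite /L scaler_sumr -big_split; apply: eq_bigr => i _ /=.
 by rewrite !mxE mulrDl -mulrA.
pose LL : {linear V -> R} := HB.pack L (GRing.isLinear.Build _ _ _ _ L Llin).
have Lc : continuous LL.
 move=> v; rewrite /= /L; apply: sum_continuous_at => i _; apply: (@continuousM _ _ (fun z : V => z 0 i) (cst _)).
  exact: coord_continuous.
 exact: cst_continuous.
have cubeU := nbhs_box (open_nbhs_nbhs (conj oU Uu)).
have Ho : (fun v => f (u + v) - f u - L v) =o_ (0 : V) id.
 apply/eqoP => e e0.
 have [r r0 Hr] : exists2 r : R, 0 < r & forall w i, box u r w ->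
   U w /\ `|'D_(e_ i) f w - 'D_(e_ i) f u| <= e / (m%:R + 1).
  have e1 : 0 < e / (m%:R + 1) by rewrite divr_gt0// ltr_wpDl.
  have : \forall w \near u, forall i, U w /\ `|'D_(e_ i) f w - 'D_(e_ i) f u| <= e / (m%:R + 1).
   apply: (@filter_forall V 'I_m (fun i w => U w /\ `|'D_(e_ i) f w - 'D_(e_ i) f u| <= e / (m%:R + 1)) (nbhs u) _) => i.
   apply: filterI; first exact: open_nbhs_nbhs.
   have /cvgrPdist_le/(_ _ e1) := fc i u Uu.
   by apply: filterS => w; rewrite distrC.
  by move=> /nbhs_box[r r0 Hr]; exists r => // w i wb; apply: Hr.
 near=> v.
 have vr : box u r (u + v).
  apply/box_ball; first exact: ltW.
  rewrite addrAC subrr add0r; near: v.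
  apply/nbhs_ballP; exists r => //= v; rewrite -ball_normE /= sub0r normrN; exact: ltW.
 have ur : box u r u by move=> i; rewrite subrr normr0 ltW.
 pose g (w : V) := f w - L w.
 have gd w i : box u r w -> is_derive w (e_ i) g ('D_(e_ i) f w - 'D_(e_ i) f u).
  move=> wr; have fdw := fd i w (Hr w i wr).1.
  have Ld : differentiable (L : V -> R) w by exact: (@linear_differentiable _ _ _ LL).
  have LD : is_derive w (e_ i) L ('D_(e_ i) f u).
   split; first exact: diff_derivable.
   rewrite deriveE// (diff_lin w (f := LL))//= /L (bigD1 i)//= mxE !eqxx mul1r big1 ?addr0// => j ji.
   by rewrite mxE eqxx (negbTE ji) mul0r.
  by apply: is_deriveB.
 have := @partial_lip m (e / (m%:R + 1)) u r g u (u + v).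
 have K0 : 0 <= e / (m%:R + 1) by rewrite divr_ge0// ltW.
 move=> /(_ K0 ur vr) H.
 have {H} : `|g (u + v) - g u| <= e / (m%:R + 1) * m%:R * `|(u + v) - u|.
  apply: H => w i wr; first by have [] := gd w i wr.
  by have [_ ->] := gd w i wr; exact: (Hr w i wr).2.
 have -> : g (u + v) - g u = f (u + v) - f u - L v.
  rewrite /g; have -> : L (u + v) = L u + L v by exact: (raddfD LL).
  ring.
 rewrite [u + v]addrC addrK => /le_trans; apply; apply: ler_wpM2r => //.
 rewrite mulrAC ler_pdivrMr ?ltr_wpDl//; apply: ler_wpM2l; first exact: ltW.
 by rewrite lerDl.
have Eo : f \o shift u = cst (f u) + LL +o_ (0 : V) id.
 apply/eqaddoP => e e0; move/eqoP: Ho => /(_ e e0); apply: filterS => v /=.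
 by rewrite !fctE /= opprD addrA (addrC v).
have E := diff_unique Lc Eo.
by apply/diff_locallyP; rewrite E.
Unshelve. all: by end_near. Qed.

Lemma derive_sum_partial f u v : differentiable f u ->
 'D_v f u = \sum_i v 0 i * 'D_(e_ i) f u.
Proof.
move=> fd; rewrite deriveE// {1}(row_sum_delta' v) linear_sum; apply: eq_bigr => i _.
by rewrite linearZ /= deriveE.
Qed.

Lemma is_derive_chain (W : normedModType R) (G : W -> V) f (x : W) (y : W) :
 (forall i, derivable (fun z : W => G z 0 i) x y) -> differentiable G x ->
 differentiable f (G x) ->
 is_derive x y (f \o G) (\sum_i 'D_y (fun z : W => G z 0 i) x * 'D_(e_ i) f (G x)).
Proof.
move=> Gi Gd fd; have cd : differentiable (f \o G) x by exact: differentiable_comp.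
split; first exact: diff_derivable.
rewrite deriveE// diff_comp//= -deriveE// -deriveE// derive_sum_partial//.
apply: eq_bigr => i _; congr (_ * _).
have dG : derivable G x y by exact: diff_derivable.
by rewrite derive_mx// mxE.
Qed.

End C1.

End Calculus.
Arguments e_ {R m} i : simpl never.

Lemma mvt0 (R : realType) (f df : R -> R) (t : R) : 0 <= t ->
 (forall x : R, 0 <= x <= t -> is_derive x (1 : R) f (df x)) ->
 exists2 x : R, 0 <= x <= t & f t - f 0 = df x * t.
Proof.
move=> t0 fd; have [x||x] := @MVT_segment R f df 0 t t0.
- by rewrite in_itv /= => /andP[x0 xt]; apply: fd; rewrite !ltW.
- apply: derivable_within_continuous => x; rewrite in_itv /= => x01.
 by have [] := fd x x01.
- by rewrite in_itv /= subr0 => xt E; exists x.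
Qed.

(** * Functions of class C^k and symmetry of second derivatives *)

Section Smooth.
Variables (R : realType) (m : nat).
Notation V := 'rV[R]_m.
Implicit Types (f g : V -> R) (u v : V) (U : set V).

Lemma is_derive_lineP (W W' : normedModType R) (f : W -> W') (u v : W) a :
 is_derive u v f a <-> is_derive (0 : R) (1 : R) (fun h : R => f (u + h *: v)) a.
Proof.
have E : (fun h : R => h^-1 *: (((fun s : R => f (u + s *: v)) \o shift 0) (h *: 1)
  - f (u + (0 : R) *: v))) = (fun h => h^-1 *: ((f \o shift u) (h *: v) - f u)).
 rewrite funeqE => h /=; rewrite addr0 scale0r addr0 [h%:A]mulr1.
 by rewrite [u + _]addrC.
by split=> -[D Da]; split; move: D Da; rewrite /derivable /derive E.
Qed.

Lemma is_derive_comp1 (W : normedModType R) (f : W -> R) (h : R -> R) (u v : W) a b :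
 is_derive u v f a -> is_derive (f u) 1 h b -> is_derive u v (h \o f) (b * a).
Proof.
move=> /is_derive_lineP fa hb; apply/is_derive_lineP.
have hb' : is_derive (f (u + (0 : R) *: v)) 1 h b by rewrite scale0r addr0.
exact: (@is_derive1_comp R h (fun s : R => f (u + s *: v)) 0 b a hb' fa).
Qed.

(** The scalar counterpart of [Ck], for which the closure properties under ring operations are
    proved; [Ck_Sk] and [Sk_Ck] translate coordinate by coordinate. *)
Fixpoint Sk (k : nat) (U : set V) (f : V -> R) : Prop :=
 (forall u, U u -> {for u, continuous f}) /\
 match k with
 | 0 => True
 | k'.+1 => forall i : 'I_m,
   (forall u, U u -> derivable f u (e_ i)) /\ Sk k' U ('D_(e_ i) f)
 end.

Lemma Sk_cont k U f u : Sk k U f -> U u -> {for u, continuous f}.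
Proof. by case: k => [|k] [H _] Uu; exact: H. Qed.

Lemma Sk_der k U f u i : Sk k.+1 U f -> U u -> derivable f u (e_ i).
Proof. by move=> [_ H] Uu; exact: (H i).1. Qed.

Lemma Sk_partial k U f i : Sk k.+1 U f -> Sk k U ('D_(e_ i) f).
Proof. by move=> [_ H]; exact: (H i).2. Qed.

#[local] Arguments Sk_der {k U f u} i _ _.
#[local] Arguments Sk_partial {k U f} i _.

Lemma SkW k U f : Sk k.+1 U f -> Sk k U f.
Proof.
elim: k f => [|k IH] f; first by case.
move=> [fc fd]; split => // i; split; first exact: (fd i).1.
by apply: IH; exact: (fd i).2.
Qed.

Lemma Sk_le k l U f : (l <= k)%N -> Sk k U f -> Sk l U f.
Proof.
move=> /subnKC <-; elim: (k - l)%N => [|j IH]; first by rewrite addn0.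
by rewrite addnS => /SkW.
Qed.

Lemma continuous_at_eq (T T' : topologicalType) (U : set T) (f g : T -> T') (u : T) : open U -> U u ->
 {in U, f =1 g} -> {for u, continuous f} -> {for u, continuous g}.
Proof.
move=> oU Uu fg fc; suff : g x @[x --> u] --> g u by [].
rewrite -fg ?inE//; have fc' : f x @[x --> u] --> f u := fc.
apply: cvg_trans fc'; apply: near_eq_cvg; near=> w.
apply: fg; rewrite inE; near: w; exact: open_nbhs_nbhs.
Unshelve. all: by end_near. Qed.

Lemma continuous_near (T : topologicalType) (f : T -> R) (u : T) (e : R) :
 {for u, continuous f} -> 0 < e -> \forall w \near u, `|f u - f w| <= e.
Proof. by move=> /cvgrPdist_le; exact. Qed.

Lemma Sk_eq k U f g : open U -> {in U, f =1 g} -> Sk k U f -> Sk k U g.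
Proof.
move=> oU; elim: k f g => [|k IH] f g fg [fc fd]; split => //.
- by move=> u Uu; apply: (continuous_at_eq oU Uu fg); exact: fc.
- by move=> u Uu; apply: (continuous_at_eq oU Uu fg); exact: fc.
move=> i; split=> [u Uu|].
 by apply: (derive_nbhs_eq (e_ i) oU Uu fg).1; exact: (fd i).1.
apply: IH (fd i).2 => u; rewrite inE => Uu.
exact: (derive_nbhs_eq (e_ i) oU Uu fg).2.
Qed.

Lemma SkS k U f : (forall u, U u -> {for u, continuous f}) ->
 (forall i u, U u -> derivable f u (e_ i)) ->
 (forall i, Sk k U ('D_(e_ i) f)) -> Sk k.+1 U f.
Proof. by move=> fc fd fD; split => // i; split=> // u; exact: fd. Qed.

Lemma Sk_differentiable U f u : open U -> Sk 1 U f -> U u -> differentiable f u.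
Proof.
move=> oU fS; apply: C1_differentiable => // i v Uv; first exact: (Sk_der i fS).
exact: (Sk_cont (Sk_partial i fS)).
Qed.

Lemma Sk_cst k U (a : R) : Sk k U (cst a).
Proof.
elim: k a => [|k IH] a; first by split=> // u _; exact: cst_continuous.
apply: SkS => [u _|i u _|i]; [exact: cst_continuous|exact: derivable_cst|].
by rewrite (_ : 'D_(e_ i) (cst a) = cst 0)//; apply/funext => u; exact: derive_cst.
Qed.

Lemma SkN k U f : open U -> Sk k U f -> Sk k U (fun u => - f u).
Proof.
move=> oU; elim: k f => [|k IH] f fS.
 by split=> // u Uu; apply: continuousN; exact: (Sk_cont fS).
apply: SkS => [u Uu|i u Uu|i].
- by apply: continuousN; exact: (Sk_cont fS).
- by apply: derivableN; exact: (Sk_der i fS).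
apply: (Sk_eq oU _ (IH _ (Sk_partial i fS))) => u; rewrite inE => Uu.
by rewrite (deriveN (Sk_der i fS Uu)).
Qed.

Lemma SkD k U f g : open U -> Sk k U f -> Sk k U g -> Sk k U (fun u => f u + g u).
Proof.
move=> oU; elim: k f g => [|k IH] f g fS gS.
 by split=> // u Uu; apply: continuousD; [exact: (Sk_cont fS)|exact: (Sk_cont gS)].
apply: SkS => [u Uu|i u Uu|i].
- by apply: continuousD; [exact: (Sk_cont fS)|exact: (Sk_cont gS)].
- by apply: derivableD; [exact: (Sk_der i fS)|exact: (Sk_der i gS)].
apply: (Sk_eq oU _ (IH _ _ (Sk_partial i fS) (Sk_partial i gS))) => u; rewrite inE => Uu.
by rewrite (deriveD (Sk_der i fS Uu) (Sk_der i gS Uu)).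
Qed.

Lemma SkM k U f g : open U -> Sk k U f -> Sk k U g -> Sk k U (fun u => f u * g u).
Proof.
move=> oU; elim: k f g => [|k IH] f g fS gS.
 by split=> // u Uu; apply: continuousM; [exact: (Sk_cont fS)|exact: (Sk_cont gS)].
apply: SkS => [u Uu|i u Uu|i].
- by apply: continuousM; [exact: (Sk_cont fS)|exact: (Sk_cont gS)].
- by apply: derivableM; [exact: (Sk_der i fS)|exact: (Sk_der i gS)].
have H := SkD oU (IH _ _ (SkW fS) (Sk_partial i gS)) (IH _ _ (SkW gS) (Sk_partial i fS)).
apply: (Sk_eq oU _ H) => u; rewrite inE => Uu.
by rewrite (deriveM (Sk_der i fS Uu) (Sk_der i gS Uu)).
Qed.

Lemma Sk_sum (I : Type) (r : seq I) (P : pred I) k U (F : I -> V -> R) : open U ->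
 (forall i, P i -> Sk k U (F i)) -> Sk k U (fun u => \sum_(i <- r | P i) F i u).
Proof.
move=> oU FS; elim: r => [|i r IH].
 by under eq_fun do rewrite big_nil; exact: Sk_cst.
under eq_fun do rewrite big_cons.
by case Pi: (P i) => //; apply: SkD => //; exact: FS.
Qed.

Lemma Sk_prod (I : Type) (r : seq I) (P : pred I) k U (F : I -> V -> R) : open U ->
 (forall i, P i -> Sk k U (F i)) -> Sk k U (fun u => \prod_(i <- r | P i) F i u).
Proof.
move=> oU FS; elim: r => [|i r IH].
 by under eq_fun do rewrite big_nil; exact: Sk_cst.
under eq_fun do rewrite big_cons.
by case Pi: (P i) => //; apply: SkM => //; exact: FS.
Qed.

Lemma Sk_det k U n (A : V -> 'M[R]_n) : open U ->
 (forall i j, Sk k U (fun u => A u i j)) -> Sk k U (fun u => \det (A u)).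
Proof.
move=> oU AS; rewrite /determinant; apply: Sk_sum => // s _.
by apply: SkM => //; [exact: Sk_cst|apply: Sk_prod].
Qed.

(** The regularity of the derivative is requested only after composition with [f], and may use that
    of [h \o f] at lower order. The inverse and the exponential, whose derivatives are expressed
    through themselves, are thus handled by one induction on [k]. *)
Lemma Sk_comp1 k U f (h h' : R -> R) (I : set R) : open U ->
 (forall u, U u -> I (f u)) -> (forall t, I t -> is_derive t 1 h (h' t)) ->
 (forall l, (l < k)%N -> Sk l U f -> Sk l U (h \o f) -> Sk l U (h' \o f)) ->
 Sk k U f -> Sk k U (h \o f).
Proof.
move=> oU fI hd; elim: k => [|k IH] step fS.
 split=> // u Uu; apply: continuous_comp; first exact: (Sk_cont fS).
 apply: differentiable_continuous; apply/derivable1_diffP.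
 by have [] := hd _ (fI u Uu).
have fu u i (Uu : U u) := is_derive_comp1 (derivableP (Sk_der i fS Uu)) (hd _ (fI u Uu)).
have hS : Sk k U (h \o f).
 by apply: IH (SkW fS) => l lk; apply: step; exact: ltnW.
apply: SkS => [u Uu|i u Uu|i]; first exact: (Sk_cont hS).
 by have [] := fu u i Uu.
have H := SkM oU (step k (ltnSn k) (SkW fS) hS) (Sk_partial i fS).
apply: (Sk_eq oU _ H) => u; rewrite inE => Uu.
by have [_ ->] := fu u i Uu.
Qed.

Lemma SkV k U f : open U -> (forall u, U u -> f u != 0) -> Sk k U f ->
 Sk k U (fun u => (f u)^-1).
Proof.
move=> oU f0; apply: (@Sk_comp1 k U f GRing.inv (fun t => - (t^-1 * t^-1)) [set t | t != 0]) => //.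
 move=> t t0; have := is_deriveV t0 (is_derive_id t (1 : R)).
 by rewrite [_%:A]mulr1 -exprVn expr2.
by move=> l _ _ S; apply: SkN => //; apply: SkM.
Qed.

Lemma Sk_exp k U f : open U -> Sk k U f -> Sk k U (fun u => expR (f u)).
Proof.
move=> oU; apply: (@Sk_comp1 k U f expR expR [set: R]) => // t _.
Qed.

Lemma Sk_ln k U f : open U -> (forall u, U u -> 0 < f u) -> Sk k U f ->
 Sk k U (fun u => ln (f u)).
Proof.
move=> oU f0; apply: (@Sk_comp1 k U f (@ln R) (fun t => t^-1) [set t | 0 < t]) => //.
move=> l _ S _; apply: SkV => // u Uu; exact/lt0r_neq0/f0.
Qed.

Lemma Sk_powR k U f (q : R) : open U -> (forall u, U u -> 0 < f u) -> Sk k U f ->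
 Sk k U (fun u => f u `^ q).
Proof.
move=> oU f0 fS.
have H : Sk k U (fun u => expR (q * ln (f u))).
 by apply: Sk_exp => //; apply: SkM => //; [exact: Sk_cst|exact: Sk_ln].
apply: (Sk_eq oU _ H) => u; rewrite inE => Uu.
by rewrite /powR gt_eqF ?f0.
Qed.

Lemma Sk_coord k U i : open U -> Sk k U (fun u => u 0 i).
Proof.
move=> oU; case: k => [|k]; first by split=> // u _; exact: coord_continuous.
have dc u (j : 'I_m) : is_derive u (e_ j) (fun u : V => u 0 i) ((i == j)%:R).
 apply/is_derive_lineP.
 have -> : (fun h : R => (u + h *: e_ j) 0 i) = cst (u 0 i) + (fun h : R => h * (i == j)%:R).
  by apply/funext => h; rewrite !mxE eqxx.
 rewrite -[X in is_derive _ _ _ X]add0r; apply: is_deriveD.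
 by apply: is_derive_eq; rewrite scaler0 add0r [_%:A]mulr1.
apply: SkS => [u _|j u _|j]; first exact: coord_continuous.
 by have [] := dc u j.
suff -> : 'D_(e_ j) (fun u : V => u 0 i) = cst ((i == j)%:R : R) by exact: Sk_cst.
by apply/funext => u; have [_ ->] := dc u j.
Qed.

#[local] Opaque derive.

(** The second difference is the increment over [[0, t]] in direction [e_ i] of the function [phi],
    itself a difference in direction [e_ j]; the mean value theorem is used once in each
    direction. *)
Lemma mean_value_2 U f u (r t : R) i j : open U -> box u r `<=` U -> Sk 2 U f ->
 0 < t -> t + t <= r ->
 exists2 w, box u (t + t) w &
 f (u + t *: e_ i + t *: e_ j) - f (u + t *: e_ i) - f (u + t *: e_ j) + f u
 = t * t * 'D_(e_ j) ('D_(e_ i) f) w.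
Proof.
move=> oU bU fS t0 tr.
have inb (x y : R) : 0 <= x <= t -> 0 <= y <= t -> box u (t + t) (u + x *: e_ i + y *: e_ j).
 move=> /andP[x0 xt] /andP[y0 yt] l; rewrite !mxE eqxx /=.
 rewrite -[_ + _ + _]addrA [u 0 l + _]addrC addrK.
 apply: le_trans (ler_normD _ _) _; apply: lerD; rewrite normrM ger0_norm//.
  by case: (l == i); rewrite ?normr1 ?normr0 ?mulr1 ?mulr0// ltW.
 by case: (l == j); rewrite ?normr1 ?normr0 ?mulr1 ?mulr0// ltW.
have inU (x y : R) : 0 <= x <= t -> 0 <= y <= t -> U (u + x *: e_ i + y *: e_ j).
 by move=> xt yt; apply: bU => l; apply: le_trans (inb x y xt yt l) tr.
have t00 : 0 <= (0 : R) <= t by apply/andP; split => //; exact: ltW.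
have tt : 0 <= t <= t by apply/andP; split => //; exact: ltW.
pose phi (x : R) := f (u + x *: e_ i + t *: e_ j) - f (u + x *: e_ i).
pose dphi (x : R) := 'D_(e_ i) f (u + x *: e_ i + t *: e_ j) - 'D_(e_ i) f (u + x *: e_ i).
have phid (x : R) : 0 <= x <= t -> is_derive x 1 phi (dphi x).
 move=> x0t.
 have d1 : is_derive x 1 (fun x : R => f (u + t *: e_ j + x *: e_ i)) ('D_(e_ i) f (u + t *: e_ j + x *: e_ i)).
  by apply: is_derive_line; apply: (Sk_der i fS); rewrite addrAC; exact: inU.
 have d2 : is_derive x 1 (fun x : R => f (u + x *: e_ i)) ('D_(e_ i) f (u + x *: e_ i)).
  apply: is_derive_line; apply: (Sk_der i fS).
  by have := inU x 0 x0t t00; rewrite scale0r addr0.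
 rewrite /phi /dphi; have -> : (fun x0 : R => f (u + x0 *: e_ i + t *: e_ j) - f (u + x0 *: e_ i)) =
  (fun x0 : R => f (u + t *: e_ j + x0 *: e_ i) - f (u + x0 *: e_ i)).
  by apply/funext => y; rewrite addrAC.
 by rewrite [u + x *: e_ i + _]addrAC; exact: is_deriveB.
have [x x0t Ephi] := mvt0 (ltW t0) phid.
have d3 (y : R) : 0 <= y <= t -> is_derive y 1 (fun y : R => 'D_(e_ i) f (u + x *: e_ i + y *: e_ j))
  ('D_(e_ j) ('D_(e_ i) f) (u + x *: e_ i + y *: e_ j)).
 move=> yt; apply: is_derive_line; apply: (Sk_der j (Sk_partial i fS)); exact: inU.
have [y y0t] := mvt0 (ltW t0) d3.
rewrite scale0r addr0 => Ey.
exists (u + x *: e_ i + y *: e_ j); first exact: inb.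
rewrite mulrC mulrA -Ey -/(dphi x).
rewrite -Ephi.
by rewrite /phi scale0r addr0; ring.
Qed.

Lemma continuous_near2 U (A B : V -> R) u (e : R) : open U -> U u ->
 {for u, continuous A} -> {for u, continuous B} -> 0 < e ->
 exists2 r : R, 0 < r & forall w, box u r w ->
  [/\ U w, `|A u - A w| <= e & `|B u - B w| <= e].
Proof.
move=> oU Uu c1 c2 e0.
suff : \forall w \near u, [/\ U w, `|A u - A w| <= e & `|B u - B w| <= e].
 by move=> /nbhs_box[r r0 H]; exists r => // w /H.
by apply: filterS3 (open_nbhs_nbhs (conj oU Uu)) (continuous_near c1 e0) (continuous_near c2 e0).
Qed.

Lemma eq_of_close U (A B : V -> R) u : open U -> U u ->
 {for u, continuous A} -> {for u, continuous B} ->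
 (forall r : R, 0 < r -> box u r `<=` U ->
  exists w1 w2, [/\ box u r w1, box u r w2 & B w1 = A w2]) -> A u = B u.
Proof.
move=> oU Uu c1 c2 H; apply/eqP; rewrite -subr_eq0 -normr_le0.
apply/ler_addgt0Pl => e e0; rewrite addr0.
have e2 : 0 < e / 2 by rewrite divr_gt0.
have [r r0 Hr] := continuous_near2 oU Uu c1 c2 e2.
have [w1 [w2 [b1 b2 E]]] := H r r0 (fun w bw => let: And3 h _ _ := Hr w bw in h).
have [_ H1 _] := Hr w2 b2; have [_ _ H2] := Hr w1 b1.
rewrite (splitr e) -[_ - _](subrKA (A w2)).
apply: le_trans (ler_normD _ _) _; apply: lerD => //.
by rewrite -E distrC.
Qed.

(** The second difference is symmetric in [i] and [j], so the two mixed derivatives take equal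
    values at two points as close to [u] as desired, and continuity concludes. *)
Lemma partial_sym U f u i j : open U -> Sk 2 U f -> U u ->
 'D_(e_ i) ('D_(e_ j) f) u = 'D_(e_ j) ('D_(e_ i) f) u.
Proof.
move=> oU fS Uu; apply: (@eq_of_close U ('D_(e_ i) ('D_(e_ j) f)) ('D_(e_ j) ('D_(e_ i) f)) u oU Uu).
- exact: (Sk_cont (Sk_partial i (Sk_partial j fS)) Uu).
- exact: (Sk_cont (Sk_partial j (Sk_partial i fS)) Uu).
move=> r r0 bU.
have t0 : 0 < r / 2 by rewrite divr_gt0.
have tr : r / 2 + r / 2 <= r by rewrite -splitr.
have [w1 b1 E1] := mean_value_2 i j oU bU fS t0 tr.
have [w2 b2 E2] := mean_value_2 j i oU bU fS t0 tr.
rewrite -splitr in b1 b2; exists w1, w2; split; [exact: b1|exact: b2|].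
have tt : r / 2 * (r / 2) != 0 by rewrite mulf_neq0// gt_eqF.
have E : f (u + (r / 2) *: e_ i + (r / 2) *: e_ j) - f (u + (r / 2) *: e_ i) -
  f (u + (r / 2) *: e_ j) + f u = f (u + (r / 2) *: e_ j + (r / 2) *: e_ i) -
  f (u + (r / 2) *: e_ j) - f (u + (r / 2) *: e_ i) + f u.
 rewrite [u + _ *: e_ j + _]addrAC.
 move: (f _) (f _) (f _) (f _) => x1 x2 x3 x4; ring.
exact: (mulfI tt (etrans (esym E1) (etrans E E2))).
Qed.

Section Vector.
Variable n : nat.

Lemma continuous_coord_at (T : topologicalType) (F : T -> 'rV[R]_n) x j :
 {for x, continuous F} -> {for x, continuous (fun y => F y 0 j)}.
Proof.
move=> Fc; apply: (@continuous_comp _ _ _ F (fun v : 'rV[R]_n => v 0 j) x Fc).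
exact: coord_continuous.
Qed.

Lemma Ck_Sk k U (F : V -> 'rV[R]_n) j : open U -> Ck k U F -> Sk k U (fun u => F u 0 j).
Proof.
move=> oU; elim: k F => [|k IH] F [Fc Fd].
 split=> // u Uu; by apply: continuous_coord_at; exact: Fc.
apply: SkS => [u Uu|i u Uu|i].
- by apply: continuous_coord_at; exact: Fc.
- by have /derivable_mxP := (Fd i).1 u Uu; exact.
apply: (Sk_eq oU _ (IH _ (Fd i).2)) => u; rewrite inE => Uu.
by rewrite /partial derive_mx ?mxE//; exact: (Fd i).1.
Qed.

Lemma continuous_row (T : topologicalType) (F : T -> 'rV[R]_n) x :
 (forall j, {for x, continuous (fun y => F y 0 j)}) -> {for x, continuous F}.
Proof.
move=> Fj; apply/cvgrPdist_le => e e0.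
have : \forall y \near x, forall j, `|F x 0 j - F y 0 j| <= e.
 apply: (@filter_forall T 'I_n (fun j y => `|F x 0 j - F y 0 j| <= e) (nbhs x) _) => j.
 by move/cvgrPdist_le : (Fj j); exact.
apply: filterS => y Hy; apply/normrv_le; first exact: ltW.
by move=> j; rewrite !mxE.
Qed.

Lemma Sk_Ck k U (F : V -> 'rV[R]_n) : open U -> (forall j, Sk k U (fun u => F u 0 j)) -> Ck k U F.
Proof.
move=> oU; elim: k F => [|k IH] F FS.
 by split=> // u Uu; apply: continuous_row => j; exact: (Sk_cont (FS j)).
split=> [u Uu|i]; first by apply: continuous_row => j; exact: (Sk_cont (FS j)).
have Fd u : U u -> derivable F u (e_ i).
 by move=> Uu; apply/derivable_mxP => a j; rewrite ord1; exact: (Sk_der i (FS j)).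
split=> //; apply: IH => j.
apply: (Sk_eq oU _ (Sk_partial i (FS j))) => u; rewrite inE => Uu.
by rewrite /partial derive_mx ?mxE//; exact: Fd.
Qed.

End Vector.

End Smooth.

Global Opaque Sk.

#[local] Opaque derive.

(** * The Simons-type identity *)

Section Simons.
(** An algebraic model of a hypersurface: [A] is the ring of smooth functions, [x] the position, [N]
    the normal, [d i] the ambient components of the gradient, and [S] the derivative of the normal,
    that is, minus the Weingarten operator extended by zero on the normal. The hypothesis on the
    commutator of [d i] and [d j] holds because ambient components of tangential derivatives do not
    commute. *)
Variables (A : comPzRingType) (n : nat) (d : 'I_n -> A -> A) (x N : 'I_n -> A) (c : A).
Hypothesis dD : forall i f g, d i (f + g) = d i f + d i g.
Hypothesis dM : forall i f g, d i (f * g) = f * d i g + g * d i f.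
Hypothesis dc : forall i, d i c = 0.
Hypothesis NN : \sum_i N i * N i = 1.
Hypothesis Nd : forall f, \sum_i N i * d i f = 0.
Hypothesis dx : forall i j, d i (x j) = (i == j)%:R - N i * N j.
Let S i j := d i (N j).
Hypothesis S_sym : forall i j, S i j = S j i.
Hypothesis d_comm : forall i j f, d i (d j f) =
 d j (d i f) + \sum_k (N i * S j k - N j * S i k) * d k f.
Let s := \sum_i x i * N i.
Let tau := \sum_i S i i.
Hypothesis soliton : tau = - (c * s).

Lemma d0 i : d i 0 = 0.
Proof. by have := dD i 0 0; rewrite addr0 => /eqP; rewrite -subr_eq0 opprD addrA subrr sub0r oppr_eq0 => /eqP. Qed.

Lemma d1 i : d i 1 = 0.
Proof. by have := dM i 1 1; rewrite !mul1r => /eqP; rewrite -subr_eq0 opprD addrA subrr sub0r oppr_eq0 => /eqP. Qed.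

Lemma dN i f : d i (- f) = - d i f.
Proof. by apply/eqP; rewrite -addr_eq0 -dD addNr d0. Qed.

Lemma dB i f g : d i (f - g) = d i f - d i g.
Proof. by rewrite dD dN. Qed.

Lemma dnat i k : d i k%:R = 0.
Proof. by elim: k => [|k IH]; rewrite ?d0// -natr1 dD IH d1 addr0. Qed.

Lemma d_sum (I : Type) (r : seq I) (P : pred I) F i :
 d i (\sum_(j <- r | P j) F j) = \sum_(j <- r | P j) d i (F j).
Proof.
by elim: r => [|j r IH]; rewrite ?big_nil ?d0// !big_cons; case: ifP => // _; rewrite dD IH.
Qed.

Lemma delta_sum (F : 'I_n -> A) (k : 'I_n) : \sum_i (k == i)%:R * F i = F k.
Proof.
rewrite (bigD1 k) //= eqxx mul1r big1 ?addr0// => i ik.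
by rewrite eq_sym (negbTE ik) mul0r.
Qed.

Lemma NS j : \sum_i N i * S i j = 0.
Proof. exact: Nd. Qed.

Let Q := \sum_i \sum_j S i j * S i j.

Lemma ds k : d k s = \sum_l x l * S k l.
Proof.
rewrite d_sum; under eq_bigr do rewrite dM dx mulrBr.
rewrite big_split /= sumrB.
under [X in X - _]eq_bigr do rewrite mulrC.
rewrite delta_sum; under [X in _ - X]eq_bigr do rewrite mulrCA.
by rewrite -mulr_sumr NN mulr1 subrr addr0.
Qed.

Lemma dtau k : d k tau = - (c * \sum_l x l * S k l).
Proof. by rewrite soliton dN dM dc mulr0 addr0 ds. Qed.

(** The first sum is the Laplace-Beltrami operator in ambient components. In the second only the
    tangential part of [b] counts, as gradients are orthogonal to [N]. *)
Definition drift (b : 'I_n -> A) f := \sum_i d i (d i f) + \sum_i b i * d i f.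

Lemma driftM b f g : drift b (f * g) =
 f * drift b g + g * drift b f + (\sum_i d i f * d i g) *+ 2.
Proof.
transitivity (\sum_i (f * d i (d i g) + g * d i (d i f) + 2%:R * (d i f * d i g)) +
  \sum_i (f * (b i * d i g) + g * (b i * d i f))).
 by congr (_ + _); apply: eq_bigr => i _; rewrite !dM ?dD ?dM; ring.
rewrite !big_split /= -!mulr_sumr /drift; ring.
Qed.

Lemma drift_sum (I : Type) (r : seq I) (P : pred I) F b :
 drift b (\sum_(j <- r | P j) F j) = \sum_(j <- r | P j) drift b (F j).
Proof.
rewrite /drift big_split /= exchange_big /=; congr (_ + _).
 by apply: eq_bigr => i _; rewrite !d_sum.
by rewrite exchange_big /=; apply: eq_bigr => i _; rewrite d_sum mulr_sumr.
Qed.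

Let cx i := c * x i.
Let L := drift cx.

(** Symmetry of [S] and one commutation turn the Laplacian of the normal into the gradient of the
    trace minus [Q N]; the soliton equation makes that gradient cancel against the drift term. *)
Lemma LN k : L (N k) = - (Q * N k).
Proof.
rewrite /L /drift.
have -> : \sum_i d i (d i (N k)) = d k tau - N k * Q.
 transitivity (\sum_i (d k (S i i) + (S i i * 0 + \sum_l (N i * S k l - N k * S i l) * S l i))).
  by apply: eq_bigr => i _; rewrite mulr0 add0r -/(S i k) S_sym /S d_comm.
 under eq_bigr do rewrite mulr0 add0r.
 rewrite big_split /= -d_sum -/tau; congr (_ + _).
 under eq_bigr do under eq_bigr do rewrite mulrBl.
 under eq_bigr do rewrite sumrB.
 rewrite sumrB exchange_big /= big1 ?sub0r.
  congr (- _); rewrite mulr_sumr; apply: eq_bigr => i _.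
  by rewrite mulr_sumr; apply: eq_bigr => l _; rewrite -mulrA [S l i]S_sym.
 move=> l _; transitivity (S k l * \sum_i N i * S i l); last by rewrite NS mulr0.
 by rewrite mulr_sumr; apply: eq_bigr => i _; rewrite [S l i]S_sym; ring.
rewrite dtau /cx; under [\sum_i c * _ * _]eq_bigr do rewrite -mulrA -/(S _ _) S_sym.
by rewrite -mulr_sumr; ring.
Qed.

(** The Laplacian of the position is normal, and the soliton equation makes it cancel the normal
    part lost in the drift term. *)
Lemma Lx k : L (x k) = c * x k.
Proof.
rewrite /L /drift.
have -> : \sum_i d i (d i (x k)) = - (tau * N k).
 under eq_bigr do rewrite dx dB dnat dM sub0r opprD.
 rewrite sumrB sumrN -/(S _ _) NS oppr0 add0r.
 by rewrite mulr_suml; congr (- _); apply: eq_bigr => i _; rewrite mulrC.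
under eq_bigr do rewrite dx mulrBr.
rewrite sumrB; under eq_bigr do rewrite mulrC [_ == k]eq_sym.
rewrite delta_sum; under [X in _ + (_ - X)]eq_bigr do rewrite mulrA.
rewrite -mulr_suml; under [X in _ + (_ - X * _)]eq_bigr do rewrite -mulrA.
by rewrite -mulr_sumr -/s soliton /cx; ring.
Qed.

(** The product rule for [<x, N>] gives [- Q s] from [LN], [c s] from [Lx], and twice the cross
    term, which is the trace [tau = - c s]. *)
Lemma Ls : L s = - ((Q + c) * s).
Proof.
rewrite [LHS]/L [in LHS]/s drift_sum; under eq_bigr do rewrite driftM -/L LN Lx -mulr_natl.
rewrite !big_split /= -[\sum_i 2%:R * _]mulr_sumr.
have -> : \sum_k \sum_i d i (x k) * d i (N k) = tau.
 transitivity (\sum_k (S k k - N k * \sum_i N i * S i k)).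
  apply: eq_bigr => k _; under eq_bigr do rewrite dx mulrBl -/(S _ _) [_ == k]eq_sym.
  rewrite sumrB delta_sum; congr (_ - _); rewrite mulr_sumr.
  by apply: eq_bigr => i _; rewrite mulrA [N k * _]mulrC.
 by rewrite -/tau; apply: eq_bigr => k _; rewrite NS mulr0 subr0.
have -> : \sum_i x i * - (Q * N i) = - (Q * s).
 by rewrite mulr_sumr -sumrN; apply: eq_bigr => i _; ring.
have -> : \sum_i N i * (c * x i) = c * s.
 by rewrite mulr_sumr; apply: eq_bigr => i _; ring.
by rewrite soliton; ring.
Qed.

Let S2 i j := \sum_l S i l * S l j.
Let S3 i j := \sum_l S i l * S2 l j.

Lemma S2_sym i j : S2 i j = S2 j i.
Proof. by apply: eq_bigr => l _; rewrite mulrC [S l j]S_sym [S i l]S_sym. Qed.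

Let C i j f := \sum_k (N i * S j k - N j * S i k) * d k f.

Lemma C_N i j k : C i j (N k) = N i * S2 j k - N j * S2 i k.
Proof.
rewrite /C; under eq_bigr do rewrite mulrBl -!mulrA.
by rewrite sumrB -!mulr_sumr.
Qed.

Lemma NdS m k : \sum_i N i * d m (S i k) = - S2 m k.
Proof.
have := d0 m; rewrite -{1}(NS k) d_sum; under eq_bigr do rewrite dM.
rewrite big_split /= => /eqP; rewrite addr_eq0 => /eqP ->; congr (- _).
by apply: eq_bigr => i _; rewrite mulrC.
Qed.

Let Y k := - (\sum_i d i (S2 i k)) - (\sum_i \sum_l S i l * d l (S i k)) - c * \sum_l x l * S2 l k.

(** Terms with a factor [N j] or [N k] are collected because they die on contraction with a
    tangential tensor. The term [S3] has no intrinsic meaning: it arises from differentiating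
    ambient components, and is compensated in [sum_E2]. *)
Lemma LS j k : L (S j k) =
 - ((Q + c) * S j k) - S3 j k *+ 2 - d j Q * N k + N j * Y k.
Proof.
(* [S j k] is [d j (N k)]; moving [d j] to the front costs a commutator [C] at each swap, and [d j]
   acting on the drift coefficient gives [- c * S j k]. *)
have E1 : L (S j k) = d j (L (N k)) - c * S j k + \sum_i C i j (S i k) +
  \sum_i d i (C i j (N k)) + c * \sum_l x l * C l j (N k).
 rewrite /L /drift dD !d_sum.
 have -> : \sum_i d i (d i (S j k)) = \sum_i d j (d i (d i (N k))) +
  \sum_i C i j (S i k) + \sum_i d i (C i j (N k)).
  rewrite -!big_split /=; apply: eq_bigr => i _.
  have -> : d i (S j k) = d j (d i (N k)) + C i j (N k) by rewrite /S d_comm.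
  by rewrite dD (d_comm i j (d i (N k))).
 have -> : \sum_i cx i * d i (S j k) = \sum_i cx i * d j (d i (N k)) + c * \sum_l x l * C l j (N k).
  rewrite mulr_sumr -big_split /=; apply: eq_bigr => l _.
  by rewrite /S d_comm -/(C l j (N k)) /cx; ring.
 have -> : \sum_i d j (cx i * d i (N k)) = \sum_i cx i * d j (d i (N k)) + c * S j k.
  under eq_bigr do rewrite dM; rewrite big_split /=; congr (_ + _).
  under eq_bigr do rewrite /cx dM dc mulr0 addr0 dx.
  transitivity (c * (\sum_i (j == i)%:R * S i k - N j * \sum_i N i * S i k)).
   rewrite mulr_sumr -sumrB mulr_sumr; apply: eq_bigr => i _; rewrite /S; ring.
  by rewrite delta_sum NS mulr0 subr0.
 by ring.
have E2 : \sum_i C i j (S i k) = - S3 j k - N j * \sum_i \sum_l S i l * d l (S i k).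
 rewrite /C; under eq_bigr do under eq_bigr do rewrite mulrBl.
 under eq_bigr do rewrite sumrB.
 rewrite sumrB; congr (_ - _).
  rewrite exchange_big /= -sumrN; apply: eq_bigr => l _.
  under eq_bigr do rewrite mulrAC mulrC.
  by rewrite -mulr_sumr NdS mulrN.
 rewrite mulr_sumr; apply: eq_bigr => i _; rewrite mulr_sumr.
 by apply: eq_bigr => l _; rewrite mulrA.
have E3 : \sum_i d i (C i j (N k)) = tau * S2 j k - S3 j k - N j * \sum_i d i (S2 i k).
 under eq_bigr do rewrite C_N dB !dM.
 rewrite sumrB !big_split /= Nd add0r opprD addrA.
 have -> : \sum_i S2 j k * d i (N i) = tau * S2 j k by rewrite -mulr_sumr mulrC.
 have -> : \sum_i N j * d i (S2 i k) = N j * \sum_i d i (S2 i k) by rewrite mulr_sumr.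
 have -> : \sum_i S2 i k * d i (N j) = S3 j k.
  by apply: eq_bigr => i _; rewrite mulrC -/(S _ _) S_sym.
 by ring.
have E4 : \sum_l x l * C l j (N k) = s * S2 j k - N j * \sum_l x l * S2 l k.
 under eq_bigr do rewrite C_N mulrBr.
 rewrite sumrB; congr (_ - _).
  by rewrite mulr_suml; apply: eq_bigr => l _; rewrite mulrA.
 by rewrite mulr_sumr; apply: eq_bigr => l _; rewrite mulrCA.
rewrite E1 E2 E3 E4 LN dN dM -/(S j k) soliton /Y.
ring.
Qed.

Variable r : A.
Hypothesis rs : r * s = 1.
Let B i j := r * S i j.
Let w := \sum_i \sum_j B i j * B i j.
Let SB i j := \sum_l S i l * B l j.
(** The covariant derivative of [B]: by [NdB], the last two terms remove the normal components that
    [d i (B j k)] has in the indices [j] and [k]. *)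
Let E i j k := d i (B j k) + N k * SB i j + N j * SB i k.

Lemma NB j : \sum_i N i * B i j = 0.
Proof. by under eq_bigr do rewrite mulrCA; rewrite -mulr_sumr NS mulr0. Qed.

Lemma B_sym i j : B i j = B j i.
Proof. by rewrite /B S_sym. Qed.

Lemma SB_sym i j : SB i j = SB j i.
Proof. by apply: eq_bigr => l _; rewrite /B [S l j]S_sym [S i l]S_sym; ring. Qed.

Lemma NSB j : \sum_i N i * SB i j = 0.
Proof.
rewrite /SB; under eq_bigr do rewrite mulr_sumr.
rewrite exchange_big big1 //= => l _; under eq_bigr do rewrite mulrA.
by rewrite -mulr_suml NS mul0r.
Qed.

Lemma NdB i j : \sum_k N k * d i (B j k) = - SB i j.
Proof.
have := d0 i; rewrite -{1}(NB j) d_sum; under eq_bigr do rewrite dM B_sym.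
rewrite big_split /= => /eqP; rewrite addr_eq0 => /eqP ->; congr (- _).
by apply: eq_bigr => l _; rewrite mulrC [B j l]B_sym.
Qed.

Lemma sB i j : s * B i j = S i j.
Proof. by rewrite /B mulrA [s * r]mulrC rs mul1r. Qed.

(** The gradient of the logarithm of the weight [s^2 e^(c eta)], up to a normal part: [r * d i s] is
    the gradient of [log |s|]. *)
Let bw i := c * x i + (r * d i s) *+ 2.

Lemma drift_bw f : drift bw f = L f + (r * \sum_i d i s * d i f) *+ 2.
Proof.
rewrite /L /drift -addrA; congr (_ + _); under eq_bigr do rewrite mulrDl.
rewrite big_split /=; congr (_ + _).
rewrite mulr_sumr -sumrMnl; apply: eq_bigr => i _; ring.
Qed.

(** Expanding [L (s * B)] produces the cross term [2 <grad s, grad B>], which is exactly what the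
    additional drift in [bw] absorbs, while [Ls] supplies the zeroth-order term. *)
Lemma drift_B j k : drift bw (B j k) = r * (L (S j k) + (Q + c) * S j k).
Proof.
have H X : s * (r * X) = X by rewrite mulrA [s * r]mulrC rs mul1r.
have E0 : L (s * B j k) = s * drift bw (B j k) - B j k * ((Q + c) * s).
 rewrite [LHS]/L driftM -/L Ls drift_bw; move: (\sum_i _) => X.
 have -> : s * (L (B j k) + r * X *+ 2) = s * L (B j k) + (s * (r * X)) *+ 2 by ring.
 by rewrite H; ring.
rewrite sB in E0.
rewrite E0 -(sB j k).
have -> : s * drift bw (B j k) - B j k * ((Q + c) * s) + (Q + c) * (s * B j k) = s * drift bw (B j k) by ring.
by rewrite mulrA rs mul1r.
Qed.

Lemma sum_B_LS : \sum_j \sum_k B j k * (L (S j k) + (Q + c) * S j k) =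
 - (\sum_j \sum_k B j k * S3 j k) *+ 2.
Proof.
have E2 : \sum_j \sum_k d j Q * (N k * B k j) = 0.
 by rewrite big1// => j _; rewrite -mulr_sumr NB mulr0.
have E3 : \sum_j \sum_k Y k * (N j * B j k) = 0.
 by rewrite exchange_big big1//= => k _; rewrite -mulr_sumr NB mulr0.
transitivity (\sum_j \sum_k (- 2%:R * (B j k * S3 j k) + -1 * (d j Q * (N k * B k j)) + Y k * (N j * B j k))).
 by apply: eq_bigr => j _; apply: eq_bigr => k _; rewrite LS [B k j]B_sym; ring.
under eq_bigr do rewrite !big_split /= -!mulr_sumr.
rewrite !big_split /= E3 addr0 -!mulr_sumr; under [X in _ + -1 * X]eq_bigr do rewrite mulr_sumr.
by rewrite E2; ring.
Qed.

Lemma r_sum_B_S3 : r * (\sum_j \sum_k B j k * S3 j k) = \sum_i \sum_j SB i j * SB i j.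
Proof.
have rS2 l k : r * S2 l k = SB l k.
 by rewrite mulr_sumr; apply: eq_bigr => i _; rewrite mulrCA.
transitivity (\sum_j \sum_k \sum_l S l j * B j k * SB l k).
 rewrite mulr_sumr; apply: eq_bigr => j _; rewrite mulr_sumr; apply: eq_bigr => k _.
 rewrite /S3 !mulr_sumr; apply: eq_bigr => l _; rewrite -rS2 [S l j]S_sym; ring.
under eq_bigr do rewrite exchange_big /=.
rewrite exchange_big /=; apply: eq_bigr => l _; rewrite exchange_big /=.
by apply: eq_bigr => k _; rewrite -mulr_suml.
Qed.

(** Removing the normal components of [d B] in either of two slots costs [|SB|^2] each time; this
    defect cancels the cubic term of [LS] in [drift_normB]. *)
Lemma sum_E2 : \sum_i \sum_j \sum_k E i j k * E i j k =
 \sum_i \sum_j \sum_k d i (B j k) * d i (B j k) - (\sum_i \sum_j SB i j * SB i j) *+ 2.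
Proof.
rewrite -sumrMnl -sumrB; apply: eq_bigr => i _.
pose P := \sum_j SB i j * SB i j.
have F1 : \sum_j \sum_k SB i j * (N k * d i (B j k)) = - P.
 by rewrite -sumrN; apply: eq_bigr => j _; rewrite -mulr_sumr NdB mulrN.
have F2 : \sum_j \sum_k SB i k * (N j * d i (B j k)) = - P.
 rewrite exchange_big -F1 /=; apply: eq_bigr => j _; apply: eq_bigr => k _.
 by rewrite B_sym.
have F3 : \sum_j \sum_k SB i j * SB i j * (N k * N k) = P.
 by apply: eq_bigr => j _; rewrite -mulr_sumr NN mulr1.
have F4 : \sum_j \sum_k SB i k * SB i k * (N j * N j) = P by rewrite exchange_big.
have F5 : \sum_j \sum_k (N j * SB i j) * (N k * SB i k) = 0.
 rewrite big1// => j _; rewrite -mulr_sumr; suff -> : \sum_k N k * SB i k = 0 by rewrite mulr0.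
 by transitivity (\sum_k N k * SB k i); [apply: eq_bigr => k _; rewrite SB_sym|exact: NSB].
transitivity (\sum_j \sum_k (d i (B j k) * d i (B j k) + 2%:R * (SB i j * (N k * d i (B j k)))
 + 2%:R * (SB i k * (N j * d i (B j k))) + SB i j * SB i j * (N k * N k)
 + SB i k * SB i k * (N j * N j) + 2%:R * ((N j * SB i j) * (N k * SB i k)))).
 by apply: eq_bigr => j _; apply: eq_bigr => k _; rewrite /E; ring.
under eq_bigr do rewrite !big_split /= -![\sum_k 2%:R * _]mulr_sumr.
by rewrite !big_split /= -![\sum_j 2%:R * _]mulr_sumr F1 F2 F3 F4 F5 -/P; ring.
Qed.

Theorem drift_normB : drift bw w = (\sum_i \sum_j \sum_k E i j k * E i j k) *+ 2.
Proof.
rewrite /w drift_sum; under eq_bigr do rewrite drift_sum.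
transitivity (\sum_j \sum_k (r * (B j k * (L (S j k) + (Q + c) * S j k))) *+ 2 +
 \sum_j \sum_k (\sum_i d i (B j k) * d i (B j k)) *+ 2).
 rewrite -big_split; apply: eq_bigr => j _; rewrite -big_split; apply: eq_bigr => k _ /=.
 by rewrite driftM drift_B; ring.
have Ex : \sum_j \sum_k \sum_i d i (B j k) * d i (B j k) =
  \sum_i \sum_j \sum_k d i (B j k) * d i (B j k).
 by under eq_bigr do rewrite exchange_big /=; rewrite exchange_big.
under eq_bigr do rewrite sumrMnl -mulr_sumr.
under [X in _ + X]eq_bigr do rewrite sumrMnl.
by rewrite !sumrMnl -mulr_sumr sum_B_LS Ex sum_E2 -r_sum_B_S3; ring.
Qed.

Lemma d_normB i : d i w = (\sum_j \sum_k B j k * E i j k) *+ 2.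
Proof.
rewrite /w d_sum -sumrMnl.
have F1 : \sum_j \sum_k SB i j * (N k * B k j) = 0.
 by rewrite big1// => j _; rewrite -mulr_sumr NB mulr0.
have F2 : \sum_j \sum_k SB i k * (N j * B j k) = 0.
 by rewrite exchange_big big1//= => k _; rewrite -mulr_sumr NB mulr0.
transitivity (\sum_j (\sum_k d i (B j k * B j k)) + (\sum_j \sum_k SB i j * (N k * B k j)) *+ 2
 + (\sum_j \sum_k SB i k * (N j * B j k)) *+ 2).
 by rewrite F1 F2 mul0rn !addr0; apply: eq_bigr => j _; rewrite d_sum.
rewrite -!sumrMnl -!big_split /=; apply: eq_bigr => j _.
rewrite -!sumrMnl -!big_split /=; apply: eq_bigr => k _.
by rewrite dM /E [B k j]B_sym; ring.
Qed.

(** Both sides are the covariant derivative of [s B = S]; exchanging [i] and [j] in the second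
    derivative of [N] leaves a commutator that matches the normal corrections hidden in [E]. *)
Lemma codazzi i j k : d i s * B j k + s * E i j k = d j s * B i k + s * E j i k.
Proof.
have sSB a b : s * SB a b = S2 a b.
 by rewrite mulr_sumr; apply: eq_bigr => l _; rewrite mulrCA sB.
have H a b e : d a s * B b e + s * E a b e = d a (S b e) + N e * S2 a b + N b * S2 a e.
 by rewrite -(sB b e) dM -!sSB /E; ring.
rewrite !H [S2 j i]S2_sym; have -> : d i (S j k) = d j (S i k) + C i j (N k) by rewrite /S d_comm.
by rewrite C_N; ring.
Qed.

End Simons.

(** * Calculus on an immersed manifold *)

Arguments Sk_der {R m k U f u} i _ _.
Arguments Sk_partial {R m k U f} i _.

(** * Gram matrices and pseudo-inverses of Jacobians *)

Section LinearAlgebra.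
Variable R : realType.

Lemma dotE n (u v : 'rV[R]_n) : dot u v = \sum_i u 0 i * v 0 i.
Proof. by rewrite /dot mxE; apply: eq_bigr => i _; rewrite mxE. Qed.

Lemma dotC n (u v : 'rV[R]_n) : dot u v = dot v u.
Proof. by rewrite !dotE; apply: eq_bigr => i _; rewrite mulrC. Qed.

Lemma dot_ge0 n (u : 'rV[R]_n) : 0 <= dot u u.
Proof. by rewrite dotE; apply: sumr_ge0 => i _; rewrite -expr2 sqr_ge0. Qed.

Lemma dot_eq0 n (u : 'rV[R]_n) : dot u u = 0 -> u = 0.
Proof.
rewrite dotE => /eqP; rewrite psumr_eq0; last by move=> i _; rewrite -expr2 sqr_ge0.
by move=> /allP H; apply/rowP => i; have := H i (mem_index_enum _); rewrite mxE /= mulf_eq0 orbb => /eqP.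
Qed.

Lemma row_free_kernel k n (A : 'M[R]_(k, n)) :
 (forall v : 'rV_k, v *m A = 0 -> v = 0) -> row_free A.
Proof.
move=> H; rewrite -kermx_eq0; apply/eqP/row_matrixP => i; rewrite row0.
by apply: H; rewrite -row_mul mulmx_ker row0.
Qed.

Lemma row_free_eq0 k n (A : 'M[R]_(k, n)) (v : 'rV_k) : row_free A -> v *m A = 0 -> v = 0.
Proof. by move=> fA E; apply: (row_free_inj fA); rewrite E mul0mx. Qed.

Lemma gram_unit k n (J : 'M[R]_(k, n)) : row_free J -> J *m J^T \in unitmx.
Proof.
move=> fJ; rewrite -row_free_unit; apply: row_free_kernel => v E.
apply: (row_free_eq0 fJ); apply: dot_eq0.
by rewrite /dot trmx_mul mulmxA -(mulmxA v) E mul0mx mxE.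
Qed.

(** On the segment from the identity to [A] all matrices are positive definite, hence invertible;
    the determinant is a polynomial in the parameter with value 1 at the identity, so it cannot
    change sign. *)
Lemma posdef_det_gt0 k (A : 'M[R]_k) :
 (forall v : 'rV_k, v != 0 -> 0 < (v *m A *m v^T) 0 0) -> 0 < \det A.
Proof.
move=> Apos; pose B (t : R) : 'M[R]_k := (1 - t)%:M + t *: A.
have Bdet t : 0 <= t <= 1 -> \det (B t) != 0.
 move=> /andP[t0 t1]; rewrite -unitfE -unitmxE -row_free_unit.
 apply: row_free_kernel => v E; apply/eqP; apply: contraT => v0.
 have := Apos v v0; have : (v *m B t *m v^T) 0 0 = 0 by rewrite E mul0mx mxE.
 rewrite mulmxDr mul_mx_scalar -scalemxAr mulmxDl -!scalemxAl => E1.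
 set a := (v *m A *m v^T) 0 0 => a0.
 have E0 : (1 - t) * dot v v + t * a = 0 by rewrite -E1 /a /dot !mxE.
 have vv : 0 < dot v v.
  by rewrite lt_neqAle dot_ge0 andbT eq_sym; apply: contra v0 => /eqP/dot_eq0 ->.
 have : 0 < (1 - t) * dot v v + t * a; last by rewrite E0 ltxx.
 have [->|tn0] := eqVneq t 0; first by rewrite subr0 mul1r mul0r addr0.
 apply: ltr_wpDl; first by rewrite mulr_ge0 ?subr_ge0 ?dot_ge0.
 by rewrite mulr_gt0// lt_neqAle eq_sym tn0.
pose P : {poly R} := \det (\matrix_(i, j) ((1 - 'X) *+ (i == j) + 'X * (A i j)%:P)).
have PE t : P.[t] = \det (B t).
 rewrite /P -horner_evalE -det_map_mx; congr (\det _); apply/matrixP => i j.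
 rewrite /B !mxE /= /horner_eval; case: (i == j); rewrite ?mulr1n ?mulr0n;
  by rewrite !(hornerD, hornerM, hornerN, hornerC, hornerX).
have P0 : P.[0] = 1.
 by rewrite PE /B subr0 scale0r addr0 det1.
have P1 : P.[1] = \det A.
 by rewrite PE /B subrr scale1r -scalemx1 scale0r add0r.
rewrite ltNge; apply/negP => dA.
have [||t t01 /rootP Pt] := @poly_ivt R (- P) 0 1; rewrite ?ler01//.
 by rewrite !hornerN P0 P1 oppr_le0 ler01 oppr_ge0.
by have := Bdet t t01; rewrite -PE -oppr_eq0 -hornerN Pt eqxx.
Qed.

Lemma gram_det_gt0 k n (J : 'M[R]_(k, n)) : row_free J -> 0 < \det (J *m J^T).
Proof.
move=> fJ; apply: posdef_det_gt0 => v v0.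
have -> : (v *m (J *m J^T) *m v^T) 0 0 = dot (v *m J) (v *m J).
 by rewrite /dot trmx_mul !mulmxA.
rewrite lt_neqAle dot_ge0 andbT eq_sym; apply: contra v0 => /eqP/dot_eq0 E.
by rewrite (row_free_eq0 fJ E).
Qed.

(** The Moore-Penrose right inverse. When the rows of [J] are the coordinate vectors, it raises the
    index of a coordinate gradient and reads the result in ambient components. *)
Definition pinv k n (J : 'M[R]_(k, n)) : 'M[R]_(n, k) := J^T *m invmx (J *m J^T).

Lemma mul_pinv k n (J : 'M[R]_(k, n)) : row_free J -> J *m pinv J = 1%:M.
Proof. by move=> fJ; rewrite /pinv mulmxA mulmxV// gram_unit. Qed.

Lemma invmx_sym k (A : 'M[R]_k) : A^T = A -> (invmx A)^T = invmx A.
Proof. by move=> sA; rewrite trmx_inv sA. Qed.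

Lemma pinvT k n (J : 'M[R]_(k, n)) : (pinv J)^T = invmx (J *m J^T) *m J.
Proof. by rewrite /pinv trmx_mul trmxK invmx_sym// trmx_mul trmxK. Qed.

Lemma frame_change k n (T : 'M[R]_k) (J1 J2 : 'M[R]_(k, n)) : row_free J1 ->
 J1 = T *m J2 -> T \in unitmx /\ row_free J2.
Proof.
move=> fJ E; have r1 : \rank J1 = k by apply/eqP.
split.
 rewrite -row_full_unit -col_leq_rank -{1}r1 E; exact: mxrankM_maxl.
rewrite /row_free eqn_leq rank_leq_row -{1}r1 E; exact: mxrankM_maxr.
Qed.

(** A change of chart multiplies the Jacobian and the coordinate gradient by the same invertible
    [T]; the cancellation of [T] is the chart independence of the gradient. *)
Lemma pinv_change k n l (T : 'M[R]_k) (J1 J2 : 'M[R]_(k, n)) (g1 g2 : 'M[R]_(k, l)) :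
 row_free J1 -> J1 = T *m J2 -> g1 = T *m g2 -> pinv J1 *m g1 = pinv J2 *m g2.
Proof.
move=> fJ EJ Eg; have [uT fJ2] := frame_change fJ EJ.
rewrite /pinv -!mulmxA; set y1 := invmx _ *m g1; set y2 := invmx _ *m g2.
rewrite {1}EJ trmx_mul -mulmxA; congr (_ *m _).
have E2 : J2 *m J2^T *m y2 = g2 by rewrite /y2 mulKVmx ?gram_unit.
have E1 : J1 *m J1^T *m y1 = g1 by rewrite /y1 mulKVmx ?gram_unit.
rewrite -[LHS](mulKmx (gram_unit fJ2)) -[RHS](mulKmx (gram_unit fJ2)); congr (_ *m _).
rewrite E2 -[LHS](mulKmx uT) -[RHS](mulKmx uT) -Eg -E1 EJ trmx_mul.
by rewrite !mulmxA.
Qed.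

(** The difference [P] of the two sides is annihilated on the left by the rows of [J] and by [nu],
    and these form a basis. *)
Lemma pinv_proj k (J : 'M[R]_(k, k.+1)) (nu : 'rV[R]_k.+1) : row_free J ->
 J *m nu^T = 0 -> dot nu nu = 1 -> pinv J *m J = 1%:M - nu^T *m nu.
Proof.
move=> fJ Jnu nn.
have nn' : nu *m nu^T = 1%:M by apply/matrixP => i j; rewrite !ord1 -/(dot nu nu) nn mxE eqxx.
have nuJ : nu *m J^T = 0 by rewrite -[LHS]trmxK trmx_mul trmxK Jnu trmx0.
pose P := 1%:M - nu^T *m nu - pinv J *m J.
suff P0 : P = 0 by apply/eqP; rewrite eq_sym -subr_eq0 -/P P0.
have JP : J *m P = 0.
 by rewrite /P !mulmxBr mulmx1 mulmxA Jnu mul0mx subr0 mulmxA mul_pinv// mul1mx subrr.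
have nuP : nu *m P = 0.
 by rewrite /P !mulmxBr mulmx1 mulmxA nn' mul1mx subrr sub0r /pinv !mulmxA nuJ !mul0mx oppr0.
have KP : col_mx J nu *m P = 0 by rewrite mul_col_mx JP nuP col_mx0.
have fK : row_free (col_mx J nu).
 apply: row_free_kernel => v; rewrite -[v]hsubmxK mul_row_col.
 set a := lsubmx v; set b := rsubmx v => E.
 have b0 : b = 0.
  have : (a *m J + b *m nu) *m nu^T = 0 by rewrite E mul0mx.
  by rewrite mulmxDl -!mulmxA Jnu nn' mulmx0 add0r mulmx1.
 move: E; rewrite b0 mul0mx addr0 => /(row_free_eq0 fJ) ->; exact: row_mx0.
have fullK : row_full (col_mx J nu).
 by move/eqP: fK => fK; rewrite /row_full fK addn1.
by have /row_fullP[B BK] := fullK; rewrite -[P]mul1mx -BK -mulmxA KP mulmx0.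
Qed.

End LinearAlgebra.

(** * Charts and the tangential gradient *)

Section ManifoldCalculus.
Variables (R : realType) (m : nat) (M : manifold R m).
Notation V := 'rV[R]_m.
Implicit Types (f g : M -> R) (phi : chart R m M) (p : M).

Lemma crange_cmap phi p : cdom phi p -> crange phi (cmap phi p).
Proof. by exists p. Qed.

Lemma cmapK' phi p : cdom phi p -> cinv phi (cmap phi p) = p.
Proof. by move=> Dp; apply: cmapK; rewrite inE. Qed.

Lemma cinv_dom phi u : crange phi u -> cdom phi (cinv phi u).
Proof. by move=> [q Dq <-]; rewrite cmapK'. Qed.

Lemma cinvK phi u : crange phi u -> cmap phi (cinv phi u) = u.
Proof. by move=> [q Dq <-]; rewrite cmapK'. Qed.

Lemma open_crange phi : open (crange phi).
Proof. exact: crange_open. Qed.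

Arguments open_crange : clear implicits.

Lemma open_image phi (O : set M) : open O -> open (cmap phi @` (cdom phi `&` O)).
Proof.
move=> oO; rewrite openE => u [q [Dq Oq] <-].
have cu := @cinv_continuous _ _ _ phi _ (crange_cmap Dq).
have nO : nbhs (cinv phi (cmap phi q)) O by rewrite cmapK'//; apply: open_nbhs_nbhs.
have n1 : \forall x \near cmap phi q, O (cinv phi x) by exact: cu _ nO.
have n2 := open_nbhs_nbhs (conj (open_crange phi) (crange_cmap Dq)).
suff : nbhs (cmap phi q) (cmap phi @` (cdom phi `&` O)) by [].
apply: filterS2 n1 n2 => w Ow rw; exists (cinv phi w); last exact: cinvK.
by split => //; exact: cinv_dom.
Qed.

Definition CM k f := forall phi, atlas phi -> Sk k (crange phi) (f \o cinv phi).

Lemma CMW k f : CM k.+1 f -> CM k f.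
Proof. by move=> H phi /H /SkW. Qed.

Lemma CM_le k l f : (l <= k)%N -> CM k f -> CM l f.
Proof. by move=> lk H phi /H; exact: Sk_le. Qed.

Lemma CM_cst k (a : R) : CM k (cst a).
Proof. by move=> phi _; exact: Sk_cst. Qed.

Lemma CMN k f : CM k f -> CM k (- f).
Proof. by move=> H phi a; apply: (SkN (open_crange phi)); exact: H. Qed.

Lemma CMD k f g : CM k f -> CM k g -> CM k (f + g).
Proof. by move=> H1 H2 phi a; apply: (SkD (open_crange phi)); [exact: H1|exact: H2]. Qed.

Lemma CMM k f g : CM k f -> CM k g -> CM k (f * g).
Proof. by move=> H1 H2 phi a; apply: (SkM (open_crange phi)); [exact: H1|exact: H2]. Qed.

Lemma CMV k f : (forall p, f p != 0) -> CM k f -> CM k (fun p => (f p)^-1).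
Proof. by move=> f0 H phi a; apply: (SkV (open_crange phi)) => //; exact: H. Qed.

Lemma CM_exp k f : CM k f -> CM k (fun p => expR (f p)).
Proof. by move=> H phi a; apply: (Sk_exp (open_crange phi)); exact: H. Qed.

Lemma CM_powR k f (q : R) : (forall p, 0 < f p) -> CM k f -> CM k (fun p => f p `^ q).
Proof. by move=> f0 H phi a; apply: (Sk_powR q (open_crange phi)) => //; exact: H. Qed.

Lemma CM_continuous f : CM 0 f -> continuous f.
Proof.
move=> H p; have Dp := chart_at_dom p; have A := chart_at_atlas p.
set phi := chart_at p in Dp A.
have c1 : {for cmap phi p, continuous (f \o cinv phi)}.
 exact: (Sk_cont (H _ A) (crange_cmap Dp)).
have c2 : {for p, continuous ((f \o cinv phi) \o cmap phi)}.
 by apply: continuous_comp; [exact: (cmap_continuous Dp)|exact: c1].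
apply: (continuous_at_eq (cdom_open phi) Dp _ c2) => q; rewrite inE => Dq /=.
by rewrite cmapK'.
Qed.

Lemma overlap_open phi1 phi2 : open (overlap phi1 phi2).
Proof. exact: open_image (cdom_open phi2). Qed.

Arguments overlap_open : clear implicits.

Lemma transition_smooth phi1 phi2 j k : atlas phi1 -> atlas phi2 ->
 Sk k (overlap phi1 phi2) (fun u => transition phi1 phi2 u 0 j).
Proof.
move=> a1 a2; have [H _] := atlas_compatible a1 a2.
exact: (Ck_Sk j (overlap_open phi1 phi2) (H k)).
Qed.

Lemma row_differentiable (W : normedModType R) n (F : V -> 'rV[R]_n) u :
 (forall j, differentiable (fun u => F u 0 j) u) -> differentiable F u.
Proof.
move=> H.
have -> : F = (fun u => \sum_j F u 0 j *: (e_ j : 'rV[R]_n)).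
 by apply/funext => w; rewrite -row_sum_delta'.
have -> : (fun u => \sum_j F u 0 j *: (e_ j : 'rV[R]_n)) =
 \sum_j (fun u => F u 0 j *: (e_ j : 'rV[R]_n)) by apply/funext => w; rewrite fct_sumE.
by apply: differentiable_sum => j; apply: differentiableZl.
Qed.

Lemma transition_differentiable phi1 phi2 u : atlas phi1 -> atlas phi2 ->
 overlap phi1 phi2 u -> differentiable (transition phi1 phi2) u.
Proof.
move=> a1 a2 ou; apply: (@row_differentiable 'rV[R]_m) => j.
exact: (Sk_differentiable (overlap_open phi1 phi2) (transition_smooth j 1 a1 a2) ou).
Qed.

Definition tmat phi1 phi2 u : 'M[R]_m :=
 \matrix_(a, b) 'D_(e_ a) (fun u => transition phi1 phi2 u 0 b) u.

Lemma chart_change phi1 phi2 f p a : atlas phi1 -> atlas phi2 ->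
 cdom phi1 p -> cdom phi2 p -> CM 1 f ->
 'D_(e_ a) (f \o cinv phi1) (cmap phi1 p) =
 \sum_b tmat phi1 phi2 (cmap phi1 p) a b * 'D_(e_ b) (f \o cinv phi2) (cmap phi2 p).
Proof.
move=> a1 a2 D1 D2 fS.
have oO := overlap_open phi1 phi2.
have ou : overlap phi1 phi2 (cmap phi1 p) by exists p.
have tu : transition phi1 phi2 (cmap phi1 p) = cmap phi2 p by rewrite /transition /= cmapK'.
have E : {in overlap phi1 phi2, (f \o cinv phi1) =1 (f \o cinv phi2) \o transition phi1 phi2}.
 move=> w; rewrite inE => -[q [q1 q2] <-]; rewrite /transition /= !cmapK'//.
rewrite (derive_nbhs_eq (e_ a) oO ou E).2.
have td := transition_differentiable a1 a2 ou.
have fd : differentiable (f \o cinv phi2) (transition phi1 phi2 (cmap phi1 p)).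
 rewrite tu; apply: (Sk_differentiable (open_crange phi2) (fS _ a2)); exact: crange_cmap.
have [|_ ->] := @is_derive_chain R m V (transition phi1 phi2) (f \o cinv phi2) (cmap phi1 p) (e_ a) _ td fd.
 by move=> i; apply: (Sk_der a (transition_smooth i 1 a1 a2) ou).
by apply: eq_bigr => b _; rewrite tu mxE.
Qed.

Section Immersion.
Variables (n : nat) (psi : M -> 'rV[R]_n).
Hypothesis imm : immersion psi.

Definition xx (j : 'I_n) : M -> R := fun p => psi p 0 j.

Lemma xx_smooth k j : CM k (xx j).
Proof.
move=> phi a; have [H _] := imm.
exact: (Ck_Sk j (open_crange phi) (H phi a k)).
Qed.

Lemma jacE phi u a j : atlas phi -> crange phi u ->
 jac (psi \o cinv phi) u a j = 'D_(e_ a) (xx j \o cinv phi) u.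
Proof.
move=> at_ ru; rewrite mxE /partial derive_mx ?mxE//.
have [H _] := imm; have [_ H1] := H phi at_ 1%N; exact: ((H1 a).1 u ru).
Qed.

Lemma jac_free phi u : atlas phi -> crange phi u -> row_free (jac (psi \o cinv phi) u).
Proof. by move=> a ru; exact: (imm.2 phi a u ru). Qed.

Lemma jac_change phi1 phi2 p : atlas phi1 -> atlas phi2 -> cdom phi1 p -> cdom phi2 p ->
 jac (psi \o cinv phi1) (cmap phi1 p) =
 tmat phi1 phi2 (cmap phi1 p) *m jac (psi \o cinv phi2) (cmap phi2 p).
Proof.
move=> a1 a2 D1 D2; apply/matrixP => a j.
rewrite jacE//; last exact: crange_cmap.
rewrite (chart_change a a1 a2 D1 D2 (@xx_smooth 1 j)) mxE; apply: eq_bigr => b _.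
by rewrite jacE//; exact: crange_cmap.
Qed.

Definition grd phi f u : 'cV[R]_m := \col_a 'D_(e_ a) (f \o cinv phi) u.

Definition Emx phi u : 'M[R]_(n, m) := pinv (jac (psi \o cinv phi) u).

(* The [i]-th component in R^n of the intrinsic gradient of [f]. *)
Definition dl (i : 'I_n) f : M -> R := fun p =>
 \sum_a Emx (chart_at p) (cmap (chart_at p) p) i a *
  'D_(e_ a) (f \o cinv (chart_at p)) (cmap (chart_at p) p).

Lemma dl_chart phi i f p : atlas phi -> cdom phi p -> CM 1 f ->
 dl i f p = \sum_a Emx phi (cmap phi p) i a * 'D_(e_ a) (f \o cinv phi) (cmap phi p).
Proof.
move=> a2 D2 fS; have a1 := chart_at_atlas p; have D1 := chart_at_dom p.
set phi1 := chart_at p in a1 D1.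
have H := pinv_change (g1 := grd phi1 f (cmap phi1 p)) (g2 := grd phi f (cmap phi p))
 (jac_free a1 (crange_cmap D1)) (jac_change a1 a2 D1 D2).
have Eg : grd phi1 f (cmap phi1 p) = tmat phi1 phi (cmap phi1 p) *m grd phi f (cmap phi p).
 apply/matrixP => a b; rewrite mxE (chart_change a a1 a2 D1 D2 fS) mxE.
 by apply: eq_bigr => l _; rewrite [grd _ _ _ _ _]mxE.
have /matrixP/(_ i 0) := H Eg; rewrite !mxE => E.
rewrite /dl -/phi1; transitivity (\sum_j pinv (jac (psi \o cinv phi1) (cmap phi1 p)) i j * grd phi1 f (cmap phi1 p) j 0).
 by apply: eq_bigr => a _; rewrite [grd _ _ _ _ _]mxE.
by rewrite E; apply: eq_bigr => a _; rewrite [grd _ _ _ _ _]mxE.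
Qed.

Lemma dl_cinv phi i f u : atlas phi -> crange phi u -> CM 1 f ->
 dl i f (cinv phi u) = \sum_a Emx phi u i a * 'D_(e_ a) (f \o cinv phi) u.
Proof. by move=> a ru fS; rewrite (dl_chart i a (cinv_dom ru) fS) cinvK. Qed.

Lemma gram_smooth phi k a b : atlas phi -> Sk k (crange phi) (fun u => gram (psi \o cinv phi) u a b).
Proof.
move=> at_; have oU := open_crange phi.
have H : Sk k (crange phi) (fun u => \sum_j 'D_(e_ a) (xx j \o cinv phi) u * 'D_(e_ b) (xx j \o cinv phi) u).
 by apply: Sk_sum => // j _; apply: SkM => //; apply: Sk_partial; exact: xx_smooth.
apply: (Sk_eq oU _ H) => u; rewrite inE => ru; rewrite /gram mxE; apply: eq_bigr => j _.
by rewrite [(jac _ _)^T _ _]mxE !jacE.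
Qed.

Lemma gram_det_smooth phi k : atlas phi -> Sk k (crange phi) (fun u => \det (gram (psi \o cinv phi) u)).
Proof. by move=> at_; apply: (Sk_det (open_crange phi)) => a b; exact: gram_smooth. Qed.

Lemma gram_det_pos phi u : atlas phi -> crange phi u -> 0 < \det (gram (psi \o cinv phi) u).
Proof. by move=> at_ ru; apply: gram_det_gt0; exact: jac_free. Qed.

Lemma invgram_smooth phi k a b : atlas phi ->
 Sk k (crange phi) (fun u => invmx (gram (psi \o cinv phi) u) a b).
Proof.
move=> at_; have oU := open_crange phi.
have H : Sk k (crange phi) (fun u => (\det (gram (psi \o cinv phi) u))^-1 *
 ((-1) ^+ (b + a) * \det (row' b (col' a (gram (psi \o cinv phi) u))))).
 apply: SkM => //.
  by apply: SkV => //; [move=> u ru; rewrite gt_eqF// gram_det_pos|exact: gram_det_smooth].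
 apply: SkM => //; first exact: Sk_cst.
 apply: Sk_det => // i j.
 have -> : (fun u => row' b (col' a (gram (psi \o cinv phi) u)) i j) =
  (fun u => gram (psi \o cinv phi) u (lift b i) (lift a j)).
  by apply/funext => u; rewrite mxE mxE.
 exact: gram_smooth.
apply: (Sk_eq oU _ H) => u; rewrite inE => ru.
rewrite /invmx ifT; last exact: (gram_unit (jac_free at_ ru)).
by rewrite [RHS]mxE [(\adj _) _ _]mxE.
Qed.

Lemma Emx_smooth phi k i a : atlas phi -> Sk k (crange phi) (fun u => Emx phi u i a).
Proof.
move=> at_; have oU := open_crange phi.
have H : Sk k (crange phi) (fun u => \sum_b 'D_(e_ b) (xx i \o cinv phi) u * invmx (gram (psi \o cinv phi) u) b a).
 apply: Sk_sum => // b _; apply: SkM => //; last exact: invgram_smooth.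
 by apply: Sk_partial; exact: xx_smooth.
apply: (Sk_eq oU _ H) => u; rewrite inE => ru; rewrite /Emx /pinv mxE; apply: eq_bigr => b _.
by rewrite [(jac _ _)^T _ _]mxE jacE.
Qed.

Lemma dl_smooth k i f : CM k.+1 f -> CM k (dl i f).
Proof.
move=> fS phi at_; have oU := open_crange phi.
have H : Sk k (crange phi) (fun u => \sum_a Emx phi u i a * 'D_(e_ a) (f \o cinv phi) u).
 apply: Sk_sum => // a _; apply: SkM => //; first exact: Emx_smooth.
 by apply: Sk_partial; exact: fS.
apply: (Sk_eq oU _ H) => u; rewrite inE => ru /=; rewrite dl_cinv//.
by apply: CM_le fS.
Qed.

Lemma dlD i f g : CM 1 f -> CM 1 g -> dl i (f + g) = dl i f + dl i g.
Proof.
move=> fS gS; apply/funext => p; have a1 := chart_at_atlas p.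
have ru := crange_cmap (chart_at_dom p).
rewrite /dl !fctE -big_split; apply: eq_bigr => a _ /=; rewrite -mulrDr; congr (_ * _).
by rewrite -(deriveD (Sk_der a (fS _ a1) ru) (Sk_der a (gS _ a1) ru)).
Qed.

Lemma dlM i f g : CM 1 f -> CM 1 g -> dl i (f * g) = f * dl i g + g * dl i f.
Proof.
move=> fS gS; apply/funext => p; have a1 := chart_at_atlas p.
have Dp := chart_at_dom p; have ru := crange_cmap Dp.
rewrite /dl !fctE !mulr_sumr -big_split; apply: eq_bigr => a _ /=.
have := deriveM (Sk_der a (fS _ a1) ru) (Sk_der a (gS _ a1) ru).
rewrite !fctE /= cmapK'// => ->; rewrite /GRing.scale /=; ring.
Qed.

Lemma dl_eq i f g (O : set M) p : open O -> O p -> {in O, f =1 g} -> dl i f p = dl i g p.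
Proof.
move=> oO Op E; rewrite /dl; apply: eq_bigr => a _; congr (_ * _).
have Dp := chart_at_dom p; set phi := chart_at p in Dp *.
apply: (derive_nbhs_eq (e_ a) (open_image (phi := phi) oO) _ _).2; first by exists p.
by move=> u; rewrite inE => -[q [Dq Oq] <-] /=; rewrite cmapK'//; apply: E; rewrite inE.
Qed.

Lemma dl_comp i f (h : R -> R) (h' : R) p : CM 1 f -> is_derive (f p) 1 h h' ->
 dl i (h \o f) p = h' * dl i f p.
Proof.
move=> fS hd; rewrite /dl mulr_sumr; apply: eq_bigr => a _.
have a1 := chart_at_atlas p; have Dp := chart_at_dom p; have ru := crange_cmap Dp.
have fp : (f \o cinv (chart_at p)) (cmap (chart_at p) p) = f p by rewrite /= cmapK'.
rewrite -fp in hd.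
have [_ ->] := is_derive_comp1 (derivableP (Sk_der a (fS _ a1) ru)) hd.
by rewrite mulrCA.
Qed.

Lemma dl_cst i (a : R) : dl i (cst a) = 0.
Proof.
apply/funext => p; rewrite /dl big1// => b _.
by rewrite (_ : _ \o _ = cst a)// derive_cst mulr0.
Qed.

End Immersion.
End ManifoldCalculus.

Arguments open_crange {R m M} phi.
Arguments overlap_open {R m M} phi1 phi2.

(** * The ring of smooth functions and its derivations *)

Section SmoothRing.
Variables (R : realType) (m : nat) (M : manifold R m).

Definition smoothf : {pred (M -> R)} := fun f => `[< forall k, CM k f >].

Lemma smoothfP f : reflect (forall k, CM k f) (f \in smoothf).
Proof. exact: asboolP. Qed.

Lemma smoothf_subring : subring_closed smoothf.
Proof.
split=> [|f g /smoothfP F /smoothfP G|f g /smoothfP F /smoothfP G]; apply/smoothfP => k.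
- exact: CM_cst.
- by apply: CMD => //; apply: CMN.
- exact: CMM.
Qed.

HB.instance Definition _ := GRing.isSubringClosed.Build (M -> R) smoothf smoothf_subring.

(** Bundled as a commutative ring so that the identities proved over an abstract ring with operators
    [d i] apply directly. *)
Record sfun := Sfun { sf :> M -> R ; sf_smooth : sf \in smoothf }.
HB.instance Definition _ := [isSub for sf].
HB.instance Definition _ := [Choice of sfun by <:].
HB.instance Definition _ := GRing.SubChoice_isSubComPzRing.Build (M -> R) smoothf sfun smoothf_subring.

Lemma sfP (f : sfun) k : CM k f.
Proof. exact: (smoothfP f (sf_smooth f)). Qed.

Definition mksf f (H : forall k, CM k f) : sfun := Sfun (introT (smoothfP f) H).

Lemma sf_inj (f g : sfun) : (forall p, f p = g p) -> f = g.
Proof. by move=> E; apply: val_inj; apply/funext. Qed.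

Lemma sfD (f g : sfun) p : (f + g) p = f p + g p. Proof. by []. Qed.
Lemma sfN (f : sfun) p : (- f) p = - f p. Proof. by []. Qed.
Lemma sfB (f g : sfun) p : (f - g) p = f p - g p. Proof. by []. Qed.
Lemma sfM (f g : sfun) p : (f * g) p = f p * g p. Proof. by []. Qed.
Lemma sf0 p : (0 : sfun) p = 0. Proof. by []. Qed.
Lemma sf1 p : (1 : sfun) p = 1. Proof. by []. Qed.

Lemma sf_sum (I : Type) (r : seq I) (P : pred I) (F : I -> sfun) p :
 (\sum_(i <- r | P i) F i) p = \sum_(i <- r | P i) F i p.
Proof. by elim/big_rec2 : _ => // i y1 y2 Pi <-. Qed.

Lemma sf_natr k p : (k%:R : sfun) p = k%:R.
Proof. by elim: k => // k IH; rewrite -!natr1 sfD IH. Qed.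

Lemma sfMn (f : sfun) k p : (f *+ k) p = f p *+ k.
Proof. by rewrite -mulr_natr sfM sf_natr mulr_natr. Qed.

Section Derivations.
Variables (n : nat) (psi : M -> 'rV[R]_n).
Hypothesis imm : immersion psi.

Definition dsf (i : 'I_n) (f : sfun) : sfun :=
 mksf (fun k => dl_smooth imm i (sfP f k.+1)).

Lemma dsfE i f p : dsf i f p = dl psi i f p.
Proof. by []. Qed.

Lemma dsfD i f g : dsf i (f + g) = dsf i f + dsf i g.
Proof. by apply: val_inj; apply: dlD; exact: sfP. Qed.

Lemma dsfM i f g : dsf i (f * g) = f * dsf i g + g * dsf i f.
Proof. by apply: val_inj; apply: dlM; exact: sfP. Qed.

Lemma dsf_cst i a : dsf i (mksf (fun k => CM_cst k a)) = 0.
Proof. by apply: val_inj; exact: dl_cst. Qed.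

(** Inverse to the definition of [dl]: a coordinate derivative is the pairing of the ambient
    gradient with a coordinate vector, because [pinv] is a right inverse. *)
Lemma partial_dl phi a (f : M -> R) p : atlas phi -> cdom phi p -> CM 1 f ->
 'D_(e_ a) (f \o cinv phi) (cmap phi p) =
 \sum_k jac (psi \o cinv phi) (cmap phi p) a k * dl psi k f p.
Proof.
move=> at_ Dp fS; have ru := crange_cmap Dp.
set J := jac _ _; have fJ : row_free J by exact: jac_free.
have E : J *m (pinv J *m grd phi f (cmap phi p)) = grd phi f (cmap phi p).
 by rewrite mulmxA mul_pinv// mul1mx.
have -> : 'D_(e_ a) (f \o cinv phi) (cmap phi p) = grd phi f (cmap phi p) a 0 by rewrite mxE.
rewrite -E mxE; apply: eq_bigr => k _; congr (_ * _).
rewrite (dl_chart imm k at_ Dp fS) mxE; apply: eq_bigr => b _.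
by rewrite [grd _ _ _ _ _]mxE.
Qed.

(* A tangential derivation is determined by its values on the coordinates. *)
Lemma dl_comm_coord i j (f : sfun) p :
 dsf i (dsf j f) p - dsf j (dsf i f) p =
 \sum_k (dsf i (dsf j (mksf (fun l => @xx_smooth _ _ _ _ _ imm l k))) p -
     dsf j (dsf i (mksf (fun l => @xx_smooth _ _ _ _ _ imm l k))) p) * dl psi k f p.
Proof.
have at_ := chart_at_atlas p; have Dp := chart_at_dom p.
have oU := open_crange (chart_at p).
set phi := chart_at p in at_ Dp oU; set u := cmap phi p.
have ru : crange phi u by exact: crange_cmap.
pose E i a := fun u => Emx psi phi u i a.
pose H i j b := \sum_a E i a u * 'D_(e_ a) (E j b) u.
have ES k i' a : Sk k (crange phi) (E i' a) by exact: Emx_smooth.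
have key i' j' (g : sfun) : dsf i' (dsf j' g) p = \sum_b H i' j' b * 'D_(e_ b) (g \o cinv phi) u +
 \sum_a \sum_b E i' a u * E j' b u * 'D_(e_ a) ('D_(e_ b) (g \o cinv phi)) u.
 have gS k := sfP g k at_.
 rewrite dsfE (dl_chart imm i' at_ Dp (sfP (dsf j' g) 1)).
 transitivity (\sum_a E i' a u * \sum_b ('D_(e_ a) (E j' b) u * 'D_(e_ b) (g \o cinv phi) u
   + E j' b u * 'D_(e_ a) ('D_(e_ b) (g \o cinv phi)) u)).
  apply: eq_bigr => a _; congr (_ * _).
  pose G b := fun u => E j' b u * 'D_(e_ b) (g \o cinv phi) u.
  have EG : {in crange phi, dsf j' g \o cinv phi =1 \sum_b G b}.
   by move=> w; rewrite inE => rw; rewrite fct_sumE; exact: (dl_cinv imm j' at_ rw (sfP g 1)).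
  rewrite (derive_nbhs_eq (e_ a) oU ru EG).2.
  have dG b : derivable (G b) u (e_ a).
   apply: derivableM; first exact: (Sk_der a (ES 1%N j' b) ru).
   exact: (Sk_der a (Sk_partial b (gS 2%N)) ru).
  rewrite derive_sum//; apply: eq_bigr => b _.
  rewrite /G (deriveM (Sk_der a (ES 1%N j' b) ru) (Sk_der a (Sk_partial b (gS 2%N)) ru)).
  by rewrite addrC /GRing.scale /= [X in X + _]mulrC.
 under eq_bigr do rewrite big_split /= mulrDr !mulr_sumr.
 rewrite big_split /=; congr (_ + _).
  rewrite exchange_big; apply: eq_bigr => b _ /=; rewrite /H mulr_suml.
  by apply: eq_bigr => a _; rewrite mulrA.
 by apply: eq_bigr => a _; apply: eq_bigr => b _; rewrite mulrA.
have key2 (g : sfun) : dsf i (dsf j g) p - dsf j (dsf i g) p =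
  \sum_b (H i j b - H j i b) * 'D_(e_ b) (g \o cinv phi) u.
 rewrite !key.
 have -> : \sum_a \sum_b E j a u * E i b u * 'D_(e_ a) ('D_(e_ b) (g \o cinv phi)) u =
  \sum_a \sum_b E i a u * E j b u * 'D_(e_ a) ('D_(e_ b) (g \o cinv phi)) u.
  rewrite exchange_big; apply: eq_bigr => a _; apply: eq_bigr => b _ /=.
  by rewrite (partial_sym b a oU (sfP g 2 at_) ru) [E j b u * _]mulrC.
 rewrite opprD addrACA subrr addr0 -sumrB.
 by apply: eq_bigr => b _; rewrite mulrBl.
apply: (etrans (key2 f)); pose X k := mksf (fun l => @xx_smooth _ _ _ _ _ imm l k).
transitivity (\sum_k (\sum_b (H i j b - H j i b) * 'D_(e_ b) (X k \o cinv phi) u) * dl psi k f p);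
 last by apply: eq_bigr => k _; exact: (congr1 (fun z => z * dl psi k f p) (esym (key2 (X k)))).
under [RHS]eq_bigr do rewrite mulr_suml.
rewrite exchange_big; apply: eq_bigr => b _ /=.
rewrite (partial_dl b at_ Dp (sfP f 1)) mulr_sumr; apply: eq_bigr => k _.
by rewrite mulrA (jacE imm b k at_ ru).
Qed.

End Derivations.
End SmoothRing.

(** * Geometry of an immersed hypersurface *)

Section Hypersurface.
Variables (R : realType) (m : nat) (M : manifold R m) (psi N : M -> 'rV[R]_m.+1).
Hypothesis imm : immersion psi.
Hypothesis N_normal : unit_normal psi N.

Definition xs j : sfun M := mksf (fun k => @xx_smooth _ _ _ _ _ imm k j).

Lemma nn_smooth k j : CM k (fun p => N p 0 j).
Proof.
move=> phi a; have [H _] := N_normal.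
exact: (Ck_Sk j (open_crange phi) (H phi a k)).
Qed.

Definition ns j : sfun M := mksf (fun k => nn_smooth k j).
Notation d := (dsf imm).

Lemma dotNN p : dot (N p) (N p) = 1.
Proof.
have [H _] := N_normal.2 p; have := sqr_sqrtr (dot_ge0 (N p)).
by rewrite -/(enorm (N p)) H expr1n.
Qed.

Lemma normal_chart phi p : atlas phi -> cdom phi p ->
 jac (psi \o cinv phi) (cmap phi p) *m (N p)^T = 0.
Proof.
move=> a2 D2; have a1 := chart_at_atlas p; have D1 := chart_at_dom p.
have EJ := jac_change imm a1 a2 D1 D2.
have [uT _] := frame_change (jac_free imm a1 (crange_cmap D1)) EJ.
have [_ E] := N_normal.2 p; rewrite /par_at /crd_at EJ -mulmxA in E.
by rewrite -[LHS](mulKmx uT) E mulmx0.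
Qed.

Lemma sum_NN : \sum_i ns i * ns i = 1.
Proof. by apply: sf_inj => p; rewrite sf_sum sf1 -(dotNN p) dotE. Qed.

Lemma chart_proj phi p : atlas phi -> cdom phi p ->
 Emx psi phi (cmap phi p) *m jac (psi \o cinv phi) (cmap phi p) = 1%:M - (N p)^T *m N p.
Proof.
move=> a Dp; apply: pinv_proj; [exact: (jac_free imm a (crange_cmap Dp))|exact: normal_chart|exact: dotNN].
Qed.

Lemma N_Emx phi p : atlas phi -> cdom phi p -> N p *m Emx psi phi (cmap phi p) = 0.
Proof.
move=> a Dp; rewrite /Emx /pinv mulmxA.
have -> : N p *m (jac (psi \o cinv phi) (cmap phi p))^T = 0.
 by rewrite -[LHS]trmxK trmx_mul trmxK normal_chart// trmx0.
by rewrite mul0mx.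
Qed.

Lemma Nd0 (f : sfun M) : \sum_i ns i * d i f = 0.
Proof.
apply: sf_inj => p; rewrite sf_sum.
have at_ := chart_at_atlas p; have Dp := chart_at_dom p.
under eq_bigr do rewrite sfM dsfE (dl_chart imm _ at_ Dp (sfP f 1)) mulr_sumr.
rewrite exchange_big big1//= => a _.
under eq_bigr do rewrite mulrA; rewrite -mulr_suml.
have /matrixP/(_ 0 a) := N_Emx at_ Dp; rewrite mxE [RHS]mxE => E.
by rewrite E mul0r.
Qed.

Lemma dx_proj i j : d i (xs j) = (i == j)%:R - ns i * ns j.
Proof.
apply: sf_inj => p; have at_ := chart_at_atlas p; have Dp := chart_at_dom p.
rewrite dsfE (dl_chart imm _ at_ Dp (sfP (xs j) 1)).
have E : (Emx psi (chart_at p) (cmap (chart_at p) p) *m jac (psi \o cinv (chart_at p)) (cmap (chart_at p) p)) i j = (i == j)%:R - N p 0 i * N p 0 j.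
 by rewrite chart_proj// !mxE big_ord1 !mxE.
rewrite sfB sfM sf_natr -E mxE; apply: eq_bigr => a _.
by rewrite (jacE imm a j at_ (crange_cmap Dp)).
Qed.

(* The second fundamental form in a chart, up to sign. *)
Definition hmx phi p : 'M[R]_m :=
 jac (N \o cinv phi) (cmap phi p) *m (jac (psi \o cinv phi) (cmap phi p))^T.

Lemma jacN phi u a j : atlas phi -> crange phi u ->
 jac (N \o cinv phi) u a j = 'D_(e_ a) (ns j \o cinv phi) u.
Proof.
move=> at_ ru; rewrite mxE /partial derive_mx ?mxE//.
have [H _] := N_normal; have [_ H1] := H phi at_ 1%N; exact: ((H1 a).1 u ru).
Qed.

(** Obtained by differentiating the orthogonality of the coordinate vectors to [N], which holds on
    the whole chart range. *)
Lemma hmx_sff phi p a b : atlas phi -> cdom phi p ->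
 hmx phi p b a = - \sum_j 'D_(e_ b) ('D_(e_ a) (xs j \o cinv phi)) (cmap phi p) * N p 0 j.
Proof.
move=> at_ Dp; have oU := open_crange phi; have ru := crange_cmap Dp.
pose G (j : 'I_m.+1) := fun u => 'D_(e_ a) (xs j \o cinv phi) u * (ns j \o cinv phi) u.
have G0 : {in crange phi, \sum_j G j =1 cst 0}.
 move=> u; rewrite inE => ru'; rewrite fct_sumE /G /=.
 have /matrixP/(_ a 0) := normal_chart at_ (cinv_dom ru'); rewrite mxE [RHS]mxE => H1.
 apply: etrans H1; apply: eq_bigr => j _.
 by rewrite cinvK// (jacE imm a j at_ ru') mxE.
have dxd j := Sk_der b (Sk_partial a (sfP (xs j) 2 at_)) ru.
have dnd j := Sk_der b (sfP (ns j) 1 at_) ru.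
have Gd j : derivable (G j) (cmap phi p) (e_ b) by apply: derivableM; [exact: dxd|exact: dnd].
have := (derive_nbhs_eq (e_ b) oU ru G0).2; rewrite derive_cst derive_sum//.
have -> : \sum_j 'D_(e_ b) (G j) (cmap phi p) = hmx phi p b a +
  \sum_j 'D_(e_ b) ('D_(e_ a) (xs j \o cinv phi)) (cmap phi p) * N p 0 j.
 rewrite mxE -big_split; apply: eq_bigr => j _ /=; rewrite /G (deriveM (dxd j) (dnd j)).
 rewrite [(jac (psi \o _) _)^T _ _]mxE (jacN _ _ at_ ru) (jacE imm a j at_ ru) /= cmapK'//.
 rewrite /GRing.scale /=.
 by congr (_ + _); rewrite mulrC.
by move=> /eqP; rewrite addr_eq0 => /eqP.
Qed.

Lemma hmx_sym phi p : atlas phi -> cdom phi p -> (hmx phi p)^T = hmx phi p.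
Proof.
move=> at_ Dp; apply/matrixP => a b; rewrite [LHS]mxE.
rewrite (@hmx_sff phi p a b at_ Dp) (@hmx_sff phi p b a at_ Dp).
apply: (congr1 (fun z => - z)); apply: eq_bigr => j _.
exact: (congr1 (fun z => z * N p 0 j)
 (partial_sym b a (open_crange phi) (sfP (xs j) 2 at_) (crange_cmap Dp))).
Qed.

Lemma Emx_gram phi p : atlas phi -> cdom phi p ->
 (Emx psi phi (cmap phi p))^T *m Emx psi phi (cmap phi p) = invmx (gram (psi \o cinv phi) (cmap phi p)).
Proof.
move=> at_ Dp; rewrite /Emx pinvT -mulmxA mul_pinv ?mulmx1//.
exact: (jac_free imm at_ (crange_cmap Dp)).
Qed.

Lemma tr_conj k l (A : 'M[R]_(k, l)) (h G : 'M[R]_l) : A^T *m A = G ->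
 \tr (A *m h *m A^T *m (A *m h *m A^T)) = \tr (G *m - h *m (G *m - h)).
Proof.
move=> E; have -> : A *m h *m A^T *m (A *m h *m A^T) = A *m (h *m (A^T *m A) *m h *m A^T).
 by rewrite !mulmxA.
rewrite mxtrace_mulC.
have -> : h *m (A^T *m A) *m h *m A^T *m A = h *m (A^T *m A) *m h *m (A^T *m A) by rewrite !mulmxA.
by rewrite E !mulmxN !mulNmx opprK mxtrace_mulC !mulmxA.
Qed.

Definition Smx p : 'M[R]_m.+1 := \matrix_(i, j) d i (ns j) p.

(** [N] has unit length, so [S] kills it on the right and may be multiplied there by the tangential
    projection. This makes the symmetry of [S] visible from that of [hmx]. *)
Lemma Smx_chart phi p : atlas phi -> cdom phi p ->
 Smx p = Emx psi phi (cmap phi p) *m hmx phi p *m (Emx psi phi (cmap phi p))^T.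
Proof.
move=> at_ Dp; have ru := crange_cmap Dp.
have S1 : Smx p = Emx psi phi (cmap phi p) *m jac (N \o cinv phi) (cmap phi p).
 apply/matrixP => i j; rewrite !mxE dsfE (dl_chart imm _ at_ Dp (sfP (ns j) 1)).
 by apply: eq_bigr => a _; rewrite (jacN _ _ at_ ru).
have SN : Smx p *m (N p)^T = 0.
 apply/matrixP => i j; rewrite ord1 mxE [RHS]mxE.
 have E := d1 (dsfM imm) i; rewrite -sum_NN (d_sum (dsfD imm)) in E.
 have E2 : (\sum_(j < m.+1) ns j * d i (ns j)) *+ 2 = 0.
  by apply: etrans E; rewrite mulr2n -big_split; apply: eq_bigr => l _ /=; rewrite dsfM.
 have := congr1 (fun f : sfun M => f p) E2; rewrite sfMn sf_sum sf0 => /eqP.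
 rewrite mulrn_eq0 /= => /eqP E3; rewrite -[RHS]E3; apply: eq_bigr => l _.
 by rewrite !mxE mulrC.
rewrite /hmx mulmxA -S1 -mulmxA -trmx_mul chart_proj//.
by rewrite linearB /= trmx1 trmx_mul trmxK mulmxBr mulmx1 mulmxA SN mul0mx subr0.
Qed.

Lemma S_symm i j : d i (ns j) = d j (ns i).
Proof.
apply: sf_inj => p; have at_ := chart_at_atlas p; have Dp := chart_at_dom p.
have H : (Smx p)^T = Smx p.
 by rewrite (Smx_chart at_ Dp) trmx_mul trmxK trmx_mul (hmx_sym at_ Dp) mulmxA.
by have /matrixP/(_ j i) := H; rewrite !mxE.
Qed.

(** By [dl_comm_coord] it suffices to know the commutator on the coordinate functions, where
    [dx_proj] makes it explicit. *)
Lemma d_commutator i j (f : sfun M) : d i (d j f) =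
 d j (d i f) + \sum_k (ns i * d j (ns k) - ns j * d i (ns k)) * d k f.
Proof.
apply: sf_inj => p; apply/eqP; rewrite sfD addrC -subr_eq; apply/eqP.
rewrite (dl_comm_coord imm) sf_sum; apply: eq_bigr => k _; rewrite sfM; congr (_ * _).
have dN' := dN (dsfD imm).
have dnat' := dnat (dsfD imm) (dsfM imm).
have E a b : d a (d b (xs k)) = - (ns b * d a (ns k) + ns k * d a (ns b)).
 by rewrite dx_proj dsfD dnat' dN' dsfM add0r.
rewrite -/(xs k) !E [d j (ns i)]S_symm; rewrite !(sfN, sfD, sfM, sfB); ring.
Qed.

Section Soliton.
Variable c : R.
Hypothesis soliton : soliton_for c psi.

Definition cs : sfun M := mksf (fun k => CM_cst k c).
Definition support_fn : sfun M := \sum_i xs i * ns i.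

Lemma support_fnE p : support_fn p = dot (psi p) (N p).
Proof. by rewrite sf_sum dotE; apply: eq_bigr. Qed.

Lemma normal_partE p v : normal_part (par_at psi p) (crd_at p) v = dot v (N p) *: N p.
Proof.
have at_ := chart_at_atlas p; have Dp := chart_at_dom p.
have E : (jac (par_at psi p) (crd_at p))^T *m invmx (gram (par_at psi p) (crd_at p)) *m
 jac (par_at psi p) (crd_at p) = 1%:M - (N p)^T *m N p := chart_proj at_ Dp.
rewrite /normal_part -!mulmxA; rewrite -mulmxA in E.
rewrite E mulmxBr mulmx1 opprB addrC subrK mulmxA.
apply/matrixP => i j; rewrite [i]ord1 mxE big_ord1 [RHS]mxE; congr (_ * _).
Qed.

Lemma sff_hmx p a b : sff (par_at psi p) (crd_at p) (N p) a b = - hmx (chart_at p) p a b.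
Proof.
have at_ := chart_at_atlas p; have Dp := chart_at_dom p; have ru := crange_cmap Dp.
rewrite hmx_sff// opprK mxE dotE; apply: eq_bigr => j _; congr (_ * _).
have oU := open_crange (chart_at p).
have [H _] := imm; have [_ H2] := H _ at_ 2%N.
have [_ H3] := (H2 b).2.
rewrite {1}/partial derive_mx; last exact: ((H3 a).1 _ ru).
rewrite mxE; apply: (derive_nbhs_eq (e_ a) oU ru _).2 => u; rewrite inE => ru'.
by rewrite /partial derive_mx ?mxE//; exact: ((H2 b).1 u ru').
Qed.

Lemma mean_curvature_vectorE p : mean_curvature_vector psi p = - (\sum_i d i (ns i)) p *: N p.
Proof.
have at_ := chart_at_atlas p; have Dp := chart_at_dom p; have ru := crange_cmap Dp.
rewrite /mean_curvature_vector /mean_curvature_local.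
set gi := invmx _.
transitivity (\sum_a \sum_b (gi a b * sff (par_at psi p) (crd_at p) (N p) a b) *: N p).
 apply: eq_bigr => a _; apply: eq_bigr => b _; rewrite normal_partE scalerA; congr (_ * _ *: _).
 by rewrite mxE.
under eq_bigr do rewrite -scaler_suml.
rewrite -scaler_suml; congr (_ *: _); rewrite sf_sum.
have -> : \sum_i d i (ns i) p = \tr (Smx p) by apply: eq_bigr => i _; rewrite mxE.
rewrite (Smx_chart at_ Dp) mxtrace_mulC; have h_sym := hmx_sym at_ Dp.
have sffh := @sff_hmx p; move: h_sym sffh; set h := hmx _ _ => h_sym sffh.
rewrite mulmxA (Emx_gram at_ Dp) -/gi.
rewrite /mxtrace -sumrN; apply: eq_bigr => a _; rewrite mxE -sumrN.
apply: eq_bigr => b _; rewrite sffh mulrN.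
by have /matrixP/(_ b a) := h_sym; rewrite mxE => ->.
Qed.

Lemma soliton_trace : \sum_i d i (ns i) = - (cs * support_fn).
Proof.
apply: sf_inj => p; have := soliton p; rewrite normal_partE mean_curvature_vectorE scalerA => E.
have E2 := congr1 (fun v => dot v (N p)) E; rewrite /= in E2.
have dZ (a : R) v : dot (a *: v) (N p) = a * dot v (N p).
 by rewrite !dotE mulr_sumr; apply: eq_bigr => i _; rewrite mxE mulrA.
rewrite !dZ dotNN !mulr1 in E2.
by rewrite sfN sfM support_fnE E2 opprK.
Qed.

Lemma mean_curvatureE p : mean_curvature psi N p = c * support_fn p.
Proof.
rewrite /mean_curvature mean_curvature_vectorE soliton_trace sfN sfM opprK.
by rewrite dotE -[RHS]mulr1 -(dotNN p) dotE mulr_sumr; apply: eq_bigr => i _; rewrite mxE mulrA.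
Qed.

Lemma norm_AE p : norm_A psi N p = Num.sqrt ((\sum_i \sum_j d i (ns j) * d i (ns j)) p).
Proof.
have at_ := chart_at_atlas p; have Dp := chart_at_dom p; have ru := crange_cmap Dp.
rewrite /norm_A; congr Num.sqrt; apply: esym.
have -> : (\sum_i \sum_j d i (ns j) * d i (ns j)) p = \tr (Smx p *m Smx p).
 rewrite sf_sum /mxtrace; apply: eq_bigr => i _; rewrite mxE sf_sum; apply: eq_bigr => j _.
 by rewrite !mxE sfM [d j (ns i)]S_symm.
have Es : sff (par_at psi p) (crd_at p) (N p) = - hmx (chart_at p) p.
 by apply/matrixP => a b; rewrite sff_hmx [RHS]mxE.
rewrite /weingarten Es; have JE := Emx_gram at_ Dp.
have -> : \tr (Smx p *m Smx p) = \tr (invmx (gram (par_at psi p) (crd_at p)) *m - hmx (chart_at p) p *m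
 (invmx (gram (par_at psi p) (crd_at p)) *m - hmx (chart_at p) p)).
 rewrite (Smx_chart at_ Dp); move: JE; set Em := Emx _ _ _; set h := hmx _ _ => JE.
 exact: tr_conj JE.
by [].
Qed.

End Soliton.
End Hypersurface.

(** * The strong maximum principle *)

Section OneVariable.
Variable R : realType.
Implicit Types f g : R -> R.

Lemma is_derive_mull (k s : R) : is_derive s (1 : R) (fun t : R => k * t) k.
Proof.
have := @is_deriveZ R R R id k s 1 _ (is_derive_id s (1 : R)).
by rewrite [k *: 1]mulr1.
Qed.

Lemma is_derive_near (W : normedModType R) (f g : R -> W) (x d : R) a : 0 < d ->
 (forall t : R, `|t - x| < d -> f t = g t) -> is_derive x (1 : R) f a -> is_derive x (1 : R) g a.
Proof.
move=> d0 fg; apply: near_eq_is_derive.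
by apply/nbhs_ballP; exists d => //= t; rewrite /ball /= distrC; exact: fg.
Qed.

Lemma small_pos (d r : R) : 0 < d -> 0 < r -> exists t : R, [/\ 0 < t, t < d & t <= r].
Proof.
move=> d0 r0; exists (Num.min (d / 2) r); split.
- by rewrite lt_min divr_gt0.
- have : Num.min (d / 2) r <= d / 2 by rewrite ge_min lexx.
 by move/le_lt_trans; apply; rewrite ltr_pdivrMr// ltr_pMr// ltr1n.
- by rewrite ge_min lexx orbT.
Qed.

(** The product of [y] with the integrating factor [expR (- K * t)] has nonpositive derivative. *)
Lemma gronwall0 (y dy : R -> R) (K T : R) : 0 <= T ->
 (forall t : R, 0 <= t <= T -> is_derive t (1 : R) y (dy t)) ->
 (forall t : R, 0 <= t <= T -> dy t <= K * y t) -> y 0 <= 0 ->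
 forall t : R, 0 <= t <= T -> y t <= 0.
Proof.
move=> T0 yd yK y0 t /andP[t0 tT].
pose z s := y s * expR (- K * s).
pose dz s := (dy s - K * y s) * expR (- K * s).
have zd (s : R) : 0 <= s <= t -> is_derive s (1 : R) z (dz s).
 move=> /andP[s0 st]; have sT : 0 <= s <= T by rewrite s0 (le_trans st tT).
 have d1 : is_derive s (1 : R) (fun s : R => - K * s) (- K).
  exact: is_derive_mull.
 have d2 : is_derive s (1 : R) (fun s : R => expR (- K * s)) (expR (- K * s) * - K).
  exact: (@is_derive1_comp R expR (fun s : R => - K * s) s _ _ _ d1).
 have d3 := is_deriveM (yd s sT) d2.
 apply: is_derive_eq d3 _; rewrite /dz /GRing.scale /=; ring.
have [x /andP[x0 xt] E] := mvt0 t0 zd.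
have xT : 0 <= x <= T by rewrite x0 (le_trans xt tT).
have : z t - z 0 <= 0.
 rewrite E mulr_le0_ge0// /dz mulr_le0_ge0 ?expR_ge0// subr_le0; exact: yK.
rewrite /z mulr0 expR0 mulr1 subr_le0 => H.
by rewrite -(pmulr_lle0 _ (expR_gt0 (- K * t))) (le_trans H).
Qed.

Lemma deriv_eps f (x a e : R) : is_derive x (1 : R) f a -> 0 < e ->
 exists2 r : R, 0 < r & forall h : R, `|h| < r -> `|f (x + h) - f x - a * h| <= e * `|h|.
Proof.
move=> [fd fa] e0.
have : h^-1 *: ((f \o shift x) (h *: (1 : R)) - f x) @[h --> 0^'] --> 'D_1 f x by exact: fd.
rewrite fa => /cvgrPdist_le/(_ _ e0)/nbhs_ballP[r /= r0 Hr]; exists r => // h hr.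
have [->|h0] := eqVneq h 0; first by rewrite addr0 subrr mulr0 subr0 normr0 mulr0.
have := Hr h; rewrite /ball /= sub0r normrN => /(_ hr h0).
rewrite [h%:A]mulr1 [h + x]addrC /GRing.scale /= => H.
have -> : f (x + h) - f x - a * h = - (a - h^-1 * (f (x + h) - f x)) * h.
 by rewrite opprB mulrBl mulrAC mulVf// mul1r.
by rewrite normrM normrN ler_wpM2r.
Qed.

Lemma right_deriv_ge0 f (a r : R) : 0 < r -> is_derive (0 : R) (1 : R) f a ->
 f 0 = 0 -> (forall t : R, 0 <= t <= r -> 0 <= f t) -> 0 <= a.
Proof.
move=> r0 fd f0 fp; rewrite leNgt; apply/negP => a0.
have e0 : 0 < - a / 2 by rewrite divr_gt0// oppr_gt0.
have [d d0 Hd] := deriv_eps fd e0.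
have [t [t0 td' tr]] := small_pos d0 r0.
have td : `|t| < d by rewrite gtr0_norm.
have := Hd t td; rewrite add0r f0 subr0 (gtr0_norm t0) => /(le_trans (ler_norm _)) H.
have := fp t; rewrite ltW// tr => /(_ isT) ft.
have : f t <= (a / 2) * t by lra.
by apply/negP; rewrite -ltNge (lt_le_trans _ ft)// pmulr_llt0// ltr_pdivrMr// mul0r.
Qed.

Lemma min_deriv0 f (a r : R) : 0 < r -> is_derive (0 : R) (1 : R) f a ->
 (forall t : R, `|t| <= r -> f 0 <= f t) -> a = 0.
Proof.
move=> r0 fd fmin; apply/eqP; rewrite eq_le; apply/andP; split; last first.
 have d1 : is_derive (0 : R) (1 : R) (fun t => f t - f 0) a.
  by rewrite -[X in is_derive _ _ _ X]subr0; apply: is_deriveB.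
 apply: (right_deriv_ge0 r0 d1); first by rewrite subrr.
 by move=> t /andP[t0 tr]; rewrite subr_ge0 fmin// ger0_norm.
have d2 : is_derive (0 : R) (1 : R) (fun t => f (- t) - f 0) (- a).
 rewrite -[X in is_derive _ _ _ X]subr0; apply: is_deriveB.
 have dN : is_derive (0 : R) (1 : R) (fun t : R => - t) (-1 : R) by apply: is_derive_eq.
 have fd' : is_derive (- (0 : R)) (1 : R) f a by rewrite oppr0.
 have := @is_derive1_comp R f (fun t : R => - t) 0 _ _ fd' dN.
 by rewrite mulrN1.
rewrite -oppr_ge0; apply: (right_deriv_ge0 r0 d2); first by rewrite oppr0 subrr.
by move=> t /andP[t0 tr]; rewrite subr_ge0 fmin// normrN ger0_norm.
Qed.

(** A negative second derivative would make the first derivative negative just after 0, and the mean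
    value theorem would give a smaller value there. *)
Lemma min_second_deriv f g (a r : R) : 0 < r ->
 (forall t : R, `|t| <= r -> is_derive t (1 : R) f (g t)) ->
 is_derive (0 : R) (1 : R) g a -> (forall t : R, `|t| <= r -> f 0 <= f t) -> 0 <= a.
Proof.
move=> r0 fd gd fmin.
have g0 : g 0 = 0 by apply: (min_deriv0 r0 _ fmin); apply: fd; rewrite normr0 ltW.
rewrite leNgt; apply/negP => a0.
have e0 : 0 < - a / 2 by rewrite divr_gt0// oppr_gt0.
have [d d0 Hd] := deriv_eps gd e0.
have [t [t0 td tr]] := small_pos d0 r0.
have inr (x : R) : 0 <= x <= t -> `|x| <= r.
 by move=> /andP[x0 xt]; rewrite ger0_norm// (le_trans xt tr).
have [||x] := @MVT R f g 0 t t0.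
- move=> x; rewrite in_itv /= => /andP[x0 xt]; apply: fd; apply: inr; by rewrite !ltW.
- apply: derivable_within_continuous => x; rewrite in_itv /= => x0t.
 by have [] := fd x (inr x x0t).
rewrite in_itv /= subr0 => /andP[x0 xt] E.
have xd : `|x| < d by rewrite gtr0_norm// (lt_trans xt td).
have := Hd x xd; rewrite add0r g0 subr0 (gtr0_norm x0) => /(le_trans (ler_norm _)) H.
have gx : g x < 0.
 have : g x <= (a / 2) * x by lra.
 by move/le_lt_trans; apply; rewrite pmulr_llt0// ltr_pdivrMr// mul0r.
have := fmin t; rewrite gtr0_norm// => /(_ tr); rewrite -subr_ge0 E.
by apply/negP; rewrite -ltNge pmulr_llt0.
Qed.

End OneVariable.

(** * Hopf's lemma in an open subset of R^m *)

Section MaximumPrinciple.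
Variables (R : realType) (m n : nat).
Notation V := 'rV[R]_m.
Variables (U : set V) (E : 'I_n -> 'I_m -> V -> R) (b : 'I_n -> V -> R).
Hypothesis oU : open U.
Hypothesis ES : forall i a, Sk 1 U (E i a).
Hypothesis bS : forall i, Sk 0 U (b i).
Hypothesis E_nondeg : forall u (xi : V), U u ->
 (forall i, \sum_a E i a u * xi 0 a = 0) -> xi = 0.
Implicit Types (f g h : V -> R) (u w : V).

Definition Dl i g u := \sum_a E i a u * 'D_(e_ a) g u.
(** A second-order operator written with a possibly overcomplete family of vector fields [Dl i], as
    the drift Laplacian is in ambient components; ellipticity is the assumption [E_nondeg], and the
    metric is never expanded. *)
Definition Lop g u := \sum_i Dl i (Dl i g) u + \sum_i b i u * Dl i g u.

Lemma DlE i g u : Dl i g u = \sum_a E i a u * 'D_(e_ a) g u. Proof. by []. Qed.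

Lemma Dl_smooth i g k : (k <= 1)%N -> Sk k.+1 U g -> Sk k U (Dl i g).
Proof.
move=> k1 gS; apply: Sk_sum => // a _; apply: SkM => //; last exact: Sk_partial.
exact: Sk_le k1 (ES i a).
Qed.

Lemma Lop_cont g : Sk 2 U g -> Sk 0 U (Lop g).
Proof.
move=> gS; have S1 i := Dl_smooth i (leqnn 1) gS.
apply: SkD => //; apply: Sk_sum => // i _; first exact: (Dl_smooth i (leq0n 1)).
by apply: SkM => //; apply: SkW.
Qed.

Lemma Dl_eq i f g u : U u -> {in U, f =1 g} -> Dl i f u = Dl i g u.
Proof.
move=> Uu fg; apply: eq_bigr => a _; congr (_ * _).
exact: (derive_nbhs_eq (e_ a) oU Uu fg).2.
Qed.

Lemma DlD i f g u : Sk 1 U f -> Sk 1 U g -> U u -> Dl i (fun w => f w + g w) u = Dl i f u + Dl i g u.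
Proof.
move=> fS gS Uu; rewrite /Dl -big_split; apply: eq_bigr => a _ /=; rewrite -mulrDr; congr (_ * _).
exact: (deriveD (Sk_der a fS Uu) (Sk_der a gS Uu)).
Qed.

Lemma DlM i f g u : Sk 1 U f -> Sk 1 U g -> U u ->
 Dl i (fun w => f w * g w) u = f u * Dl i g u + g u * Dl i f u.
Proof.
move=> fS gS Uu; rewrite /Dl !mulr_sumr -big_split; apply: eq_bigr => a _ /=.
have := deriveM (Sk_der a fS Uu) (Sk_der a gS Uu); rewrite /GRing.scale /= => H.
by rewrite [X in _ * X]H; ring.
Qed.

Lemma Dl_cst i (a : R) u : Dl i (cst a) u = 0.
Proof. by rewrite /Dl big1// => c _; rewrite derive_cst mulr0. Qed.

Lemma DlZ i f (k : R) u : Sk 1 U f -> U u -> Dl i (fun w => k * f w) u = k * Dl i f u.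
Proof.
move=> fS Uu; have := DlM i (Sk_cst 1 U k) fS Uu.
by rewrite Dl_cst mulr0 addr0.
Qed.

#[local] Opaque Dl.

Lemma LopD f g u : Sk 2 U f -> Sk 2 U g -> U u -> Lop (fun w => f w + g w) u = Lop f u + Lop g u.
Proof.
move=> fS gS Uu; have f1 := SkW fS; have g1 := SkW gS.
have E1 i : Dl i (Dl i (fun w => f w + g w)) u = Dl i (Dl i f) u + Dl i (Dl i g) u.
 apply: etrans (DlD i (Dl_smooth i (leqnn 1) fS) (Dl_smooth i (leqnn 1) gS) Uu).
 by apply: (Dl_eq i Uu) => w; rewrite inE => Uw; exact: (DlD i f1 g1 Uw).
have E2 i : b i u * Dl i (fun w => f w + g w) u = b i u * Dl i f u + b i u * Dl i g u.
 by rewrite (DlD i f1 g1 Uu) mulrDr.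
apply: (etrans (congr2 +%R (eq_bigr _ (fun i _ => E1 i)) (eq_bigr _ (fun i _ => E2 i)))).
by rewrite !big_split addrACA.
Qed.

Lemma LopZ f (k : R) u : Sk 2 U f -> U u -> Lop (fun w => k * f w) u = k * Lop f u.
Proof.
move=> fS Uu; have f1 := SkW fS.
have E1 i : Dl i (Dl i (fun w => k * f w)) u = k * Dl i (Dl i f) u.
 apply: etrans (DlZ i k (Dl_smooth i (leqnn 1) fS) Uu).
 by apply: (Dl_eq i Uu) => w; rewrite inE => Uw; exact: (DlZ i k f1 Uw).
have E2 i : b i u * Dl i (fun w => k * f w) u = k * (b i u * Dl i f u).
 by rewrite (DlZ i k f1 Uu) mulrCA.
apply: (etrans (congr2 +%R (eq_bigr _ (fun i _ => E1 i)) (eq_bigr _ (fun i _ => E2 i)))).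
by rewrite -!mulr_sumr -mulrDr.
Qed.

Lemma Lop_cst (k : R) u : U u -> Lop (cst k) u = 0.
Proof.
move=> Uu; rewrite /Lop.
have E1 i : Dl i (Dl i (cst k)) u = 0.
 by rewrite (@Dl_eq i _ (cst 0)) ?Dl_cst// => w _; rewrite Dl_cst.
rewrite (eq_bigr _ (fun i _ => E1 i)) big1// add0r big1// => i _.
by rewrite Dl_cst mulr0.
Qed.

Lemma Lop_exp f (al : R) u : Sk 2 U f -> U u ->
 Lop (fun w => expR (- al * f w)) u =
 expR (- al * f u) * (al ^+ 2 * (\sum_i (Dl i f u) ^+ 2) - al * Lop f u).
Proof.
move=> fS Uu; have f1 := SkW fS.
have eS k : Sk k U f -> Sk k U (fun w => expR (- al * f w)).
 by move=> S; apply: Sk_exp => //; apply: SkM => //; exact: Sk_cst.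
have De i w : U w -> Dl i (fun w => expR (- al * f w)) w = - al * (expR (- al * f w) * Dl i f w).
 move=> Uw; rewrite !DlE !mulr_sumr; apply: eq_bigr => a _.
 have d1 : is_derive w (e_ a) (fun w => - al * f w) (- al * 'D_(e_ a) f w).
  have dc : is_derive w (e_ a) (cst (- al) : V -> R) 0 by exact: is_derive_cst.
  by have := is_deriveM dc (derivableP (Sk_der a f1 Uw)); rewrite scaler0 addr0.
 have [_ ->] := is_derive_comp1 d1 (@is_derive_expR R (- al * f w)).
 ring.
have D1 i : Sk 1 U (Dl i f) by exact: Dl_smooth.
have E1 i : Dl i (Dl i (fun w => expR (- al * f w))) u =
  expR (- al * f u) * (al ^+ 2 * (Dl i f u) ^+ 2) - expR (- al * f u) * (al * Dl i (Dl i f) u).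
 apply: (@etrans _ _ (Dl i (fun w => - al * (expR (- al * f w) * Dl i f w)) u)).
  by apply: (Dl_eq i Uu) => w; rewrite inE => Uw; exact: (De i w Uw).
 rewrite (DlZ i (- al) (SkM oU (eS 1%N f1) (D1 i)) Uu) (DlM i (eS 1%N f1) (D1 i) Uu) (De i u Uu).
 by ring.
have E2 i : b i u * Dl i (fun w => expR (- al * f w)) u =
  - (expR (- al * f u) * (al * (b i u * Dl i f u))) by rewrite (De i u Uu); ring.
apply: (etrans (congr2 +%R (eq_bigr _ (fun i _ => E1 i)) (eq_bigr _ (fun i _ => E2 i)))).
rewrite sumrB sumrN -!mulr_sumr /Lop.
move: (\sum_i Dl i f u ^+ 2) (\sum_i Dl i (Dl i f) u) (\sum_i b i u * Dl i f u) => X Y Z.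
ring.
Qed.

(** All first derivatives vanish at the minimum, so each term [Dl i (Dl i h) u] reduces to the
    second derivative along the straight line with direction frozen at [u]. *)
Lemma Lop_min h u r : Sk 2 U h -> 0 < r -> box u r `<=` U ->
 (forall w, box u r w -> h u <= h w) -> 0 <= Lop h u.
Proof.
move=> hS r0 rU hmin; have Uu : U u by apply: rU => i; rewrite subrr normr0 ltW.
have lin (v : V) : exists2 d : R, 0 < d & forall t : R, `|t| <= d -> box u r (u + t *: v).
 exists (r / (`|v| + 1)); first by rewrite divr_gt0// ltr_wpDl.
 move=> t td i; rewrite !mxE [u 0 i + _]addrC addrK normrM.
 have v1 : 0 < `|v| + 1 by rewrite ltr_wpDl.
 apply: le_trans (ler_pM _ _ td (coord_le v i)) _ => //.
 rewrite mulrAC ler_pdivrMr// ler_wpM2l//; first exact: ltW.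
 by rewrite lerDl.
have h1 := SkW hS.
have dline (g : V -> R) (v : V) (t : R) : Sk 1 U g -> U (u + t *: v) ->
  is_derive t (1 : R) (fun s : R => g (u + s *: v)) ('D_v g (u + t *: v)).
 by move=> gS Ut; apply: is_derive_line; apply: diff_derivable; exact: (Sk_differentiable oU gS).
have D0 (v : V) : 'D_v h u = 0.
 have [d d0 Hd] := lin v.
 apply: (@min_deriv0 R (fun s : R => h (u + s *: v)) _ d d0).
  by have := dline h v 0 h1; rewrite scale0r addr0; apply.
 by move=> t td; rewrite scale0r addr0; apply: hmin; exact: Hd.
have Dl0 i : Dl i h u = 0 by rewrite DlE big1// => a _; rewrite D0 mulr0.
rewrite /Lop [X in _ + X]big1 ?addr0; last by move=> i _; rewrite Dl0 mulr0.
apply: sumr_ge0 => i _.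
pose v : V := \row_a E i a u.
have [d d0 Hd] := lin v.
have h2 a : Sk 1 U ('D_(e_ a) h) by exact: Sk_partial.
have gd : is_derive (0 : R) (1 : R) (fun t : R => 'D_v h (u + t *: v)) (Dl i (Dl i h) u).
 have d2 : is_derive (0 : R) (1 : R) (\sum_a (fun t : R => v 0 a * 'D_(e_ a) h (u + t *: v)))
   (\sum_a v 0 a * 'D_v ('D_(e_ a) h) u).
  apply: is_derive_sum => a.
  have := dline ('D_(e_ a) h) v 0 (h2 a); rewrite scale0r addr0 => /(_ Uu) H.
  have dc : is_derive (0 : R) (1 : R) (cst (v 0 a) : R -> R) 0 by exact: is_derive_cst.
  by have := is_deriveM dc H; rewrite scaler0 addr0.
 have -> : Dl i (Dl i h) u = \sum_a v 0 a * 'D_v ('D_(e_ a) h) u.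
  rewrite DlE.
  transitivity (\sum_a \sum_c E i a u * E i c u * 'D_(e_ a) ('D_(e_ c) h) u).
   apply: eq_bigr => a _.
   pose G c := fun w => E i c w * 'D_(e_ c) h w.
   have -> : Dl i h = \sum_c G c by apply/funext => w; rewrite fct_sumE DlE.
   have dG c : derivable (G c) u (e_ a).
    by apply: derivableM; [exact: (Sk_der a (ES i c) Uu)|exact: (Sk_der a (h2 c) Uu)].
   rewrite derive_sum// mulr_sumr; apply: eq_bigr => c _.
   rewrite /G (deriveM (Sk_der a (ES i c) Uu) (Sk_der a (h2 c) Uu)) D0 scale0r addr0.
   by rewrite mulrA.
  rewrite exchange_big; apply: eq_bigr => c _ /=.
  rewrite (derive_sum_partial v (Sk_differentiable oU (h2 c) Uu)) mulr_sumr mxE.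
  by apply: eq_bigr => a _; rewrite !mxE mulrCA mulrA.
 apply: (is_derive_near d0 _ d2) => t; rewrite subr0 => td.
 rewrite fct_sumE; apply/esym/derive_sum_partial.
 by apply: (Sk_differentiable oU h1); apply: rU; apply: Hd; exact: ltW.
apply: (@min_second_deriv R (fun s : R => h (u + s *: v)) (fun t : R => 'D_v h (u + t *: v)) _ d d0 _ gd).
 by move=> t td; apply: dline => //; apply: rU; exact: Hd.
by move=> t td; rewrite scale0r addr0; apply: hmin; exact: Hd.
Qed.

Lemma coord_sq_le (u w : V) (a : 'I_m) : (u 0 a - w 0 a) ^+ 2 <= \sum_i (u 0 i - w 0 i) ^+ 2.
Proof. by rewrite (bigD1 a)//= lerDl sumr_ge0// => i _; exact: sqr_ge0. Qed.

Definition dist2 (c u : V) : R := \sum_i (u 0 i - c 0 i) ^+ 2.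

Lemma dist2_smooth c k U' : open U' -> Sk k U' (dist2 c).
Proof.
move=> oU'; apply: Sk_sum => // i _; under eq_fun do rewrite expr2.
have H : Sk k U' (fun u => u 0 i - c 0 i) by apply: SkD => //; [exact: Sk_coord|exact: Sk_cst].
exact: SkM.
Qed.

Lemma dist2_ge0 c u : 0 <= dist2 c u.
Proof. by apply: sumr_ge0 => i _; exact: sqr_ge0. Qed.

Lemma dist2_gt0 c u : u <> c -> 0 < dist2 c u.
Proof.
move=> uc; rewrite lt_neqAle dist2_ge0 andbT eq_sym; apply/eqP => EQ; apply: uc.
apply/rowP => i; apply/eqP; rewrite -subr_eq0 -sqrf_eq0 eq_le sqr_ge0 andbT.
by apply: le_trans (coord_sq_le u c i) _; rewrite -/(dist2 c u) EQ.
Qed.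

Lemma partial_dist2 c u a : 'D_(e_ a) (dist2 c) u = 2 * (u 0 a - c 0 a).
Proof.
have d1 i : is_derive u (e_ a) (fun u : V => u 0 i - c 0 i) (i == a)%:R.
 apply/is_derive_lineP.
 have -> : (fun h : R => (u + h *: e_ a) 0 i - c 0 i) = cst (u 0 i - c 0 i) + (fun h : R => (i == a)%:R * h).
  by apply/funext => h; rewrite !mxE eqxx /= !fctE; ring.
 by rewrite -[X in is_derive _ _ _ X]add0r; apply: is_deriveD; exact: is_derive_mull.
have d2 i : is_derive u (e_ a) (fun u : V => (u 0 i - c 0 i) ^+ 2) ((i == a)%:R * (2 * (u 0 i - c 0 i))).
 have := is_deriveM (d1 i) (d1 i).
 have -> : (fun u : V => (u 0 i - c 0 i) ^+ 2) = (fun u : V => u 0 i - c 0 i) * (fun u : V => u 0 i - c 0 i).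
  by apply/funext => w; rewrite expr2.
 move=> H; apply: is_derive_eq H _; rewrite /GRing.scale /=; ring.
have -> : dist2 c = \sum_i (fun u : V => (u 0 i - c 0 i) ^+ 2) by apply/funext => w; rewrite fct_sumE.
have [_ ->] := is_derive_sum d2.
rewrite (bigD1 a)//= eqxx mul1r big1 ?addr0// => i ia.
by rewrite (negbTE ia) mul0r.
Qed.

Lemma compact_subset_box c r (P : V -> Prop) : (forall u, box c r u -> closure [set w | box c r w /\ P w] u -> P u) ->
 compact [set w | box c r w /\ P w].
Proof.
move=> H; have cb := @box_compact R m c r.
have clb : closed (box c r) by apply: compact_closed => //; exact: norm_hausdorff.
apply: (subclosed_compact _ cb) => [u Hu|w []//].
have bu : box c r u by apply: clb; move=> B nB; have [w [[bw _] Bw]] := Hu B nB; exists w.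
by split => //; exact: H.
Qed.

Lemma closure_le (f : V -> R) (A : set V) (u : V) (k : R) : {for u, continuous f} ->
 (forall w, A w -> f w <= k) -> closure A u -> f u <= k.
Proof.
move=> fc Ak cu; apply/ler_addgt0Pr => e e0.
have [w [Aw /= H]] := cu _ (continuous_near fc e0).
have := Ak w Aw; move: H => /(le_trans (ler_norm _)); lra.
Qed.

Lemma within_continuous_at (T T' : topologicalType) (f : T -> T') (A : set T) :
 (forall u : T, A u -> {for u, continuous f}) -> {within A, continuous f}.
Proof. by move=> H; apply: continuous_in_subspaceT => u; rewrite inE => /H. Qed.

Hypothesis m_gt0 : (0 < m)%N.

(** If [f] is positive at a nearby point [u1], a ball around [u1] touches the zero set of [f] at
    some [u2]. An exponential barrier on an annulus forces [f] to have nonzero slope at [u2],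
    although [u2] is an interior minimum of [f]. *)
Lemma hopf_local (f : V -> R) (K : R) u0 : 0 <= K -> Sk 2 U f ->
 (forall u, U u -> 0 <= f u) -> (forall u, U u -> Lop f u <= K * f u) ->
 U u0 -> f u0 = 0 -> exists2 d : R, 0 < d & forall u, box u0 d u -> f u = 0.
Proof.
move=> K0 fS fge Lf Uu0 fu0.
have [r r0 rU] := nbhs_box (open_nbhs_nbhs (conj oU Uu0)).
have m1 : 0 < (m%:R + 1 : R) by rewrite ltr_wpDl.
(* The Euclidean ball around [u1] reaching [u0] has radius at most [m * d] when [u1] is in the box
   of size [d]; so it lies in the box around [u0] of size [(m + 1) * d = r]. *)
pose d := r / (m%:R + 1); have d0 : 0 < d by rewrite divr_gt0.
exists d => // u1 bu1; apply/eqP; apply: contraT => fu1.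
have drle : d <= r by rewrite ler_pdivrMr// ler_peMr ?ler_wpDl// ltW.
have Uu1 : U u1 by apply: rU => i; apply: le_trans (bu1 i) drle.
have f1 : 0 < f u1 by rewrite lt_neqAle eq_sym fu1 fge.
pose ps := dist2 u1; have psS k : Sk k U ps by exact: dist2_smooth.
have psc w : {for w, continuous ps}.
 by apply: (@Sk_cont R m 0 setT) => //; apply: dist2_smooth; exact: openT.
have ps0 : ps u0 <= m%:R * d ^+ 2.
 rewrite /ps /dist2; apply: le_trans (ler_sum _ (_ : forall i, true -> _ <= d ^+ 2)) _.
  move=> i _; have bi := bu1 i; rewrite distrC in bi.
  by rewrite -[X in X <= _]real_normK ?num_real// ler_pXn2r ?nnegrE// ltW.
 by rewrite sumr_const card_ord mulr_natl.
have inbox w : ps w <= ps u0 -> box u0 r w.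
 move=> Hw i; have md : ps w <= (m%:R * d) ^+ 2.
  apply: le_trans Hw (le_trans ps0 _); rewrite [(m%:R * d) ^+ 2]exprMn.
  by apply: ler_wpM2r; [exact: sqr_ge0|rewrite -natrX ler_nat expnS expn1 leq_pmull].
 have : `|w 0 i - u1 0 i| <= m%:R * d.
  have md0 : 0 <= m%:R * d by rewrite mulr_ge0// ltW.
  rewrite -(@ler_pXn2r _ 2) ?nnegrE// real_normK ?num_real//.
  exact: le_trans (coord_sq_le w u1 i) md.
 move=> H1; rewrite -(subrKA (u1 0 i)); apply: le_trans (ler_normD _ _) _.
 apply: le_trans (lerD H1 (bu1 i)) _; rewrite /d -[X in _ + X]mul1r -mulrDl.
 by rewrite mulrCA divff ?mulr1// gt_eqF.
have fc w : U w -> {for w, continuous f} by move=> Uw; exact: (Sk_cont fS).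
pose Z := [set w | box u0 r w /\ f w = 0].
have bu0 : box u0 r u0 by move=> i; rewrite subrr normr0 ltW.
have cZ : compact Z.
 apply: compact_subset_box => w bw cw; have Uw := rU w bw.
 apply/eqP; rewrite eq_le fge// andbT; apply: (closure_le (fc w Uw) _ cw).
 by move=> z [_ ->].
(* [u2] is a zero of [f] nearest to [u1]; hence [f] is positive on the open ball of squared radius
   [R2]. *)
have [u2] := compact_EVT_min (ex_intro _ u0 (conj bu0 fu0) : Z !=set0) cZ (within_continuous_at (fun w _ => psc w)).
rewrite inE => -[bu2 fu2] u2min; have Uu2 := rU u2 bu2.
pose R2 := ps u2.
have R2le : R2 <= ps u0 by apply: u2min; rewrite inE.
have R2pos : 0 < R2.
 by apply: dist2_gt0 => EQ; move: f1; rewrite -EQ fu2 ltxx.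
have fpos w : ps w < R2 -> 0 < f w.
 move=> Hw; have bw : box u0 r w by apply: inbox; apply: le_trans (ltW Hw) R2le.
 rewrite lt_neqAle fge ?andbT; last exact: rU.
 apply/eqP => EQ; have : R2 <= ps w by apply: u2min; rewrite inE.
 by rewrite leNgt Hw.
(* The inner ball is removed because the barrier needs [ps] to have nonzero gradient, which fails at
   the centre. *)
pose A := [set w | box u0 r w /\ R2 / 4 <= ps w <= R2].
have AU w : A w -> U w by move=> [bw _]; exact: rU.
have cA : compact A.
 apply: compact_subset_box => w bw cw; apply/andP; split; last first.
  by apply: (closure_le (psc w) _ cw) => z [_ /andP[]].
 rewrite -lerN2; apply: (closure_le (f := fun z => - ps z) _ _ cw); first by apply: continuousN; exact: psc.
 by move=> z [_ /andP[H _]]; rewrite lerN2.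
have A2 : A u2.
 by split=> //; apply/andP; split; rewrite -/R2; lra.
pose g2 w := \sum_i (Dl i ps w) ^+ 2.
have g2S : Sk 0 U g2.
 apply: Sk_sum => // i _; under eq_fun do rewrite expr2.
 have H : Sk 0 U (Dl i ps) by exact: (Dl_smooth i (leq0n 1)).
 exact: SkM.
have g2pos w : A w -> 0 < g2 w.
 move=> Aw; rewrite lt_neqAle sumr_ge0 ?andbT; last by move=> i _; exact: sqr_ge0.
 apply/eqP => /esym/eqP; rewrite psumr_eq0; last by move=> i _; exact: sqr_ge0.
 move=> /allP H; have xi0 := @E_nondeg w (\row_a (2 * (w 0 a - u1 0 a))) (AU w Aw).
 have {}xi0 : \row_a (2 * (w 0 a - u1 0 a)) = 0 :> V.
  apply: xi0 => i; have := H i (mem_index_enum _); rewrite /= sqrf_eq0 => /eqP D0.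
  apply: etrans D0; rewrite DlE; apply: eq_bigr => a _; rewrite mxE; congr (_ * _).
  by rewrite partial_dist2.
 have EQ : w = u1.
  apply/rowP => a; have /rowP/(_ a) := xi0; rewrite !mxE => /eqP.
  by rewrite mulf_eq0 pnatr_eq0 /= subr_eq0 => /eqP.
 have [_ /andP[+ _]] := Aw; rewrite EQ /ps /dist2 big1; last by move=> i _; rewrite subrr expr0n.
 by rewrite leNgt divr_gt0.
have [w1] := compact_EVT_min (ex_intro _ u2 A2 : A !=set0) cA
 (within_continuous_at (fun w Aw => Sk_cont g2S (AU w Aw))).
rewrite inE => Aw1 g2min; pose m0 := g2 w1; have m0pos : 0 < m0 by exact: g2pos.
have [w2] := compact_EVT_max (ex_intro _ u2 A2 : A !=set0) cA
 (within_continuous_at (fun w Aw => Sk_cont (Lop_cont (psS 2%N)) (AU w Aw))).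
rewrite inE => Aw2 Lmax; pose C1 := `|Lop ps w2|.
(* By [Lop_exp], [Lop v] is at least [v * (al ^+ 2 * m0 - al * C1)]; since [al * m0 = C1 + K + m0]
   and [al >= 1], this exceeds [K * v]. *)
pose al := (C1 + K) / m0 + 1.
have al1 : 1 <= al.
 by rewrite /al lerDr; apply: divr_ge0; [apply: addr_ge0; [exact: normr_ge0|]|exact: ltW].
have alm : al * m0 = C1 + K + m0 by rewrite mulrDl divfK ?gt_eqF// mul1r.
pose v w := expR (- al * ps w).
have vS : Sk 2 U v := Sk_exp oU (SkM oU (Sk_cst 2 U (- al)) (psS 2%N)).
have Lv w : A w -> K * v w < Lop v w.
 move=> Aw; rewrite /v (Lop_exp al (psS 2%N) (AU w Aw)) mulrC ltr_pM2l ?expR_gt0//.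
 have h1 : m0 <= \sum_i Dl i ps w ^+ 2 by apply: g2min; rewrite inE.
 have h2 : Lop ps w <= C1 by apply: le_trans (Lmax w _) (ler_norm _); rewrite inE.
 have h3 : al ^+ 2 * m0 <= al ^+ 2 * \sum_i Dl i ps w ^+ 2 by rewrite ler_wpM2l// sqr_ge0.
 have h4 : al * Lop ps w <= al * C1 by rewrite ler_wpM2l// (le_trans ler01).
 have h5 : al ^+ 2 * m0 = al * (C1 + K + m0) by rewrite expr2 -mulrA alm.
 have h6 : K <= al * K by rewrite ler_peMl.
 have h7 : 0 < al * m0 by rewrite mulr_gt0// (lt_le_trans ltr01).
 have h8 : al * (C1 + K + m0) = al * C1 + al * K + al * m0 by ring.
 lra.
pose Ain := [set w | box u0 r w /\ ps w = R2 / 4].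
have [mu mu0 Hmu] : exists2 mu : R, 0 < mu & forall w, Ain w -> mu <= f w.
 have [Ain0|] := pselect (Ain !=set0); last first.
  by move=> H; exists 1 => // w Aw; case: H; exists w.
 have cAin : compact Ain.
  apply: compact_subset_box => w bw cw; apply/eqP; rewrite eq_le; apply/andP; split.
   by apply: (closure_le (psc w) _ cw) => z [_ ->].
  rewrite -lerN2; apply: (closure_le (f := fun z => - ps z) _ _ cw); first by apply: continuousN; exact: psc.
  by move=> z [_ ->].
 have [w3] := compact_EVT_min Ain0 cAin (within_continuous_at (fun w (Aw : Ain w) => fc w (rU w (proj1 Aw)))).
 rewrite inE => -[bw3 pw3] w3min; exists (f w3); last by move=> w Aw; apply: w3min; rewrite inE.
 by apply: fpos; rewrite pw3 ltr_pdivrMr// ltr_pMr// ltr1n.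
pose Cc := expR (- al * R2).
(* That is, [f - mu * (v - Cc)]. It is nonnegative on the outer sphere, where [v = Cc], and on the
   inner one, where [f >= mu >= mu * v]; a negative interior minimum would contradict [Lop_min]. *)
pose h w := f w + (- mu * v w + mu * Cc).
have hS : Sk 2 U h.
 exact: (SkD oU fS (SkD oU (SkM oU (Sk_cst 2 U (- mu)) vS) (Sk_cst 2 U (mu * Cc)))).
have v1 w : v w <= 1.
 by rewrite /v -expR0 ler_expR mulNr oppr_le0 mulr_ge0 ?dist2_ge0// (le_trans ler01).
have [us] := compact_EVT_min (ex_intro _ u2 A2 : A !=set0) cA
 (within_continuous_at (fun w Aw => Sk_cont hS (AU w Aw))).
rewrite inE => Aus hmin; have Uus := AU us Aus.
have hpos w : A w -> 0 <= h w.
 move=> Aw; suff : 0 <= h us by move/le_trans; apply; apply: hmin; rewrite inE.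
 rewrite leNgt; apply/negP => hneg.
 have [bus /andP[p1 p2]] := Aus.
 have Cc0 : 0 <= Cc by exact: expR_ge0.
 have psne2 : ps us != R2.
  apply/eqP => EQ; move: hneg; rewrite /h /v EQ -/Cc mulNr addNr addr0.
  by rewrite ltNge fge.
 have psne1 : ps us != R2 / 4.
  apply/eqP => EQ; have := Hmu us (conj bus EQ); move: hneg; rewrite /h => hneg Hf.
  have : mu * v us <= mu by rewrite ler_piMr// ltW.
  have : 0 <= mu * Cc by rewrite mulr_ge0// ltW.
  lra.
 have q1 : R2 / 4 < ps us by rewrite lt_neqAle eq_sym psne1.
 have q2 : ps us < R2 by rewrite lt_neqAle psne2.
 have [rr rr0 Hrr] : exists2 rr : R, 0 < rr & box us rr `<=` A.
  apply: nbhs_box.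
  have e1 : 0 < (ps us - R2 / 4) by rewrite subr_gt0.
  have e2 : 0 < (R2 - ps us) by rewrite subr_gt0.
  apply: filterS2 (continuous_near (psc us) e1) (continuous_near (psc us) e2) => z H1 H2.
  move: H1 H2; rewrite !ler_norml => /andP[H1 H2] /andP[H3 H4].
  have q3 : ps z <= R2 by lra.
  have q4 : R2 / 4 <= ps z by lra.
  by split; [apply: inbox; exact: le_trans q3 R2le|rewrite q4 q3].
 have := @Lop_min h us rr hS rr0 (fun z bz => AU z (Hrr z bz))
  (fun z bz => hmin z (mem_set (Hrr z bz))).
 have kvS : Sk 2 U (fun w => - mu * v w) := SkM oU (Sk_cst 2 U (- mu)) vS.
 have kS : Sk 2 U (cst (mu * Cc)) by exact: Sk_cst.
 have -> : Lop h us = Lop f us + (- mu * Lop v us + 0).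
  rewrite -(Lop_cst (mu * Cc) Uus) -(LopZ (- mu) vS Uus) -(LopD kvS kS Uus).
  exact: (LopD fS (SkD oU kvS kS) Uus).
 rewrite addr0 leNgt => /negP; apply.
 have l1 := Lf us Uus.
 have l2 : mu * (K * v us) < mu * Lop v us by rewrite ltr_pM2l// Lv.
 have l3 : f us <= h us + mu * v us.
  have : 0 <= mu * Cc by rewrite mulr_ge0// ltW.
  by rewrite /h; lra.
 have l4 : K * f us <= K * (h us + mu * v us) by rewrite ler_wpM2l.
 have l5 : K * h us <= 0 by rewrite mulr_ge0_le0// ltW.
 have l6 : K * (h us + mu * v us) = K * h us + mu * (K * v us) by ring.
 lra.
(* Towards the centre [ps] equals [(1 - t) ^+ 2 * R2], so the segment stays in the annulus for
   [t <= 1/2]. There [h >= 0] vanishes at [t = 0], while its slope is strictly negative: [f]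
   contributes 0 and the barrier [- mu * (2 * al * R2 * Cc)]. *)
pose ze : V := u1 - u2.
have psline (t : R) : ps (u2 + t *: ze) = (1 - t) ^+ 2 * R2.
 rewrite /R2 /ps /dist2 mulr_sumr; apply: eq_bigr => i _; rewrite !mxE; ring.
have f1S := SkW fS.
have dfline : is_derive (0 : R) (1 : R) (fun t : R => f (u2 + t *: ze)) 0.
 have dl0 : is_derive (0 : R) (1 : R) (fun t : R => f (u2 + t *: ze)) ('D_ze f u2).
  have := @is_derive_line R V R f u2 ze 0; rewrite scale0r addr0; apply.
  by apply: diff_derivable; exact: (Sk_differentiable oU f1S).
 suff DZ : 'D_ze f u2 = 0 by rewrite DZ in dl0.
 have [r2 r20 Hr2] := nbhs_box (open_nbhs_nbhs (conj oU Uu2)).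
 have dd0 : 0 < r2 / (`|ze| + 1) by rewrite divr_gt0// ltr_wpDl.
 apply: (min_deriv0 dd0 dl0) => t td; rewrite scale0r addr0 fu2; apply: fge; apply: Hr2 => i.
 rewrite !mxE [u2 0 i + _]addrC addrK normrM.
 have z1 : 0 < `|ze| + 1 by rewrite ltr_wpDl.
 have ci := coord_le ze i; rewrite !mxE in ci.
 apply: le_trans (ler_pM _ _ td ci) _ => //.
 rewrite mulrAC ler_pdivrMr//; apply: ler_wpM2l; first exact: ltW.
 by rewrite lerDl.
pose G t := f (u2 + t *: ze) + - mu * (expR (- al * ((1 - t) ^+ 2 * R2)) - Cc).
have dq : is_derive (0 : R) (1 : R) (fun t : R => - al * ((1 - t) ^+ 2 * R2)) (2 * al * R2).
 have -> : (fun t : R => - al * ((1 - t) ^+ 2 * R2)) =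
  cst (- al * R2) + ((fun t : R => (2 * al * R2) * t) + (fun t : R => (- al * R2) * (t * t))).
  by apply/funext => t; rewrite !fctE; ring.
 have dd := is_deriveM (is_derive_id (0 : R) (1 : R)) (is_derive_id (0 : R) (1 : R)).
 have db : is_derive (0 : R) (1 : R) (fun t : R => (- al * R2) * (t * t)) ((- al * R2) * 0).
  have := @is_deriveZ R R R _ (- al * R2) 0 1 _ dd.
  by rewrite !scale0r addr0 scaler0 mulr0.
 have := is_deriveD (is_derive_cst (- al * R2 : R) (0 : R) (1 : R)) (is_deriveD (is_derive_mull (2 * al * R2) 0) db).
 by move=> H; apply: is_derive_eq H _; rewrite mulr0 addr0 add0r.
have dE : is_derive (0 : R) (1 : R) (fun t : R => expR (- al * ((1 - t) ^+ 2 * R2))) (Cc * (2 * al * R2)).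
 have E0 : - al * ((1 - 0) ^+ 2 * R2) = - al * R2 by rewrite subr0 expr1n mul1r.
 have dx : is_derive (- al * ((1 - 0) ^+ 2 * R2)) (1 : R) expR Cc by rewrite E0; exact: is_derive_expR.
 exact: (@is_derive1_comp R expR (fun t : R => - al * ((1 - t) ^+ 2 * R2)) 0 _ _ dx dq).
have dd : is_derive (0 : R) (1 : R) ((fun t : R => expR (- al * ((1 - t) ^+ 2 * R2))) - cst Cc) (Cc * (2 * al * R2) - 0).
 by apply: is_deriveB.
have dZ := @is_deriveZ R R R _ (- mu) 0 1 _ dd.
have dG : is_derive (0 : R) (1 : R) G (0 + - mu * (Cc * (2 * al * R2) - 0)).
 have -> : G = (fun t : R => f (u2 + t *: ze)) + (- mu *: ((fun t : R => expR (- al * ((1 - t) ^+ 2 * R2))) - cst Cc)).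
  by apply/funext => t.
 exact: (is_deriveD dfline dZ).
have half0 : 0 < 2^-1 :> R by rewrite invr_gt0.
have G0 : G 0 = 0.
 by rewrite /G scale0r addr0 fu2 subr0 expr1n mul1r subrr mulr0 addr0.
have Gpos (t : R) : 0 <= t <= 2^-1 -> 0 <= G t.
 move=> /andP[t0 t2]; have At : A (u2 + t *: ze).
  have b0 : 0 <= (1 - t) * (1 - t) <= 1 by apply/andP; split; nra.
  have b1 : (1 - t) ^+ 2 * R2 <= R2.
   by move: b0 => /andP[_ b0]; rewrite expr2 ler_piMl// ltW.
  split; first by apply: inbox; rewrite psline; apply: le_trans R2le.
  rewrite psline b1 andbT mulrC ler_pM2r//.
  have -> : 4^-1 = 2^-1 ^+ 2 :> R by field.
  by rewrite !expr2; nra.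
 have := hpos _ At; rewrite /h /v psline /G -/Cc; lra.
have := right_deriv_ge0 half0 dG G0 Gpos; rewrite add0r subr0 => HH.
suff : - mu * (Cc * (2 * al * R2)) < 0 by rewrite ltNge HH.
rewrite mulNr oppr_lt0 mulr_gt0// mulr_gt0 ?expR_gt0// mulr_gt0// mulr_gt0//.
exact: lt_le_trans ltr01 al1.
Qed.

End MaximumPrinciple.

Section Connected.
Variables (T : topologicalType).
Hypothesis T_conn : connected [set: T].

Lemma connected_all (A : set T) o : A o -> (forall p, A p -> nbhs p A) ->
 (forall p, ~ A p -> nbhs p (~` A)) -> forall p, A p.
Proof.
move=> Ao Aop Acl p.
suff -> : A = [set: T] by [].
apply: T_conn; first by exists o.
- exists A; last by rewrite setTI.
 by rewrite openE => q /Aop.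
- exists A; last by rewrite setTI.
 rewrite -openC openE => q Aq; exact: Acl.
Qed.

Lemma connected_propagate (A : set T) o : A o ->
 (forall p : T, exists2 W : set T, nbhs p W & forall q q', W q -> W q' -> A q -> A q') -> forall p, A p.
Proof.
move=> Ao H; apply: (connected_all Ao) => p Ap; have [W Wp HW] := H p.
 by apply: filterS (Wp) => q Wq; apply: (HW p q _ Wq Ap); exact: nbhs_singleton.
by apply: filterS (Wp) => q Wq Aq; apply: Ap; apply: (HW q p Wq _ Aq); exact: nbhs_singleton.
Qed.
End Connected.

Lemma near_neq0 (R : realType) (T : topologicalType) (f : T -> R) p :
 {for p, continuous f} -> f p != 0 -> \forall q \near p, f q != 0.
Proof. by move=> fc f0; apply: (@cvgr_neq0 R R T (nbhs p) _ f (f p)). Qed.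

(** * Absence of zeros of the support function *)

Section Positivity.
Variables (R : realType) (m : nat) (M : manifold R m) (psi N : M -> 'rV[R]_m.+1).
Hypothesis imm : immersion psi.
Hypothesis N_normal : unit_normal psi N.
Hypothesis m_gt0 : (0 < m)%N.
Hypothesis M_conn : connected [set: M].
Variable c : R.
Hypothesis soliton : soliton_for c psi.
Hypothesis c_lt0 : c < 0.
Notation d := (dsf imm).
Notation x := (xs imm).
Notation nn := (ns N_normal).
Notation s := (support_fn imm N_normal).

Lemma cmap_nbhs (phi : chart R m M) p (P : set 'rV[R]_m) : cdom phi p -> nbhs (cmap phi p) P ->
 nbhs p (cdom phi `&` (cmap phi @^-1` P)).
Proof.
move=> Dp HP; apply: filterI; first exact: open_nbhs_nbhs (conj (cdom_open phi) Dp).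
exact: (cmap_continuous Dp).
Qed.

(** Read in a chart, [Ls] gives [L (e s) = - (Q + c) e s <= - c e s] for the sign [e] making [e s]
    nonnegative; Hopf's lemma applies with [K = - c]. *)
Lemma soliton_hopf (e : R) p : (e = 1 \/ e = -1) -> (forall q, 0 <= e * s q) -> s p = 0 ->
 nbhs p [set q | s q = 0].
Proof.
move=> e1 es0 sp; pose phi := chart_at p.
have at_ : atlas phi := chart_at_atlas p; have Dp : cdom phi p := chart_at_dom p.
have oU := open_crange phi.
pose E i a u := Emx psi phi u i a.
pose b i u := c * (x i \o cinv phi) u.
pose f u := e * (s \o cinv phi) u.
have sS k : Sk k (crange phi) (s \o cinv phi) := sfP s k at_.
have fS : Sk 2 (crange phi) f by exact: (SkM oU (Sk_cst 2 _ e) (sS 2%N)).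
have ES i a : Sk 1 (crange phi) (E i a) := @Emx_smooth _ _ _ _ _ imm phi 1 i a at_.
have bS i : Sk 0 (crange phi) (b i) := SkM oU (Sk_cst 0 _ c) (sfP (x i) 0 at_).
have nd u (xi : 'rV_m) : crange phi u -> (forall i, \sum_a E i a u * xi 0 a = 0) -> xi = 0.
 move=> Uu H; have := mul_pinv (jac_free imm at_ Uu); rewrite -/(Emx psi phi u) => J1.
 have E0 : Emx psi phi u *m xi^T = 0.
  apply/matrixP => i j; rewrite ord1 mxE [RHS]mxE; apply: etrans (H i).
  by apply: eq_bigr => a _; rewrite [xi^T _ _]mxE.
 by apply: trmx_inj; rewrite -[LHS]mul1mx -J1 -mulmxA E0 mulmx0 trmx0.
have DlE' i (g : sfun M) u : crange phi u -> Dl E i (g \o cinv phi) u = (d i g \o cinv phi) u.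
 by move=> Uu; exact: (esym (dl_cinv imm i at_ Uu (sfP g 1))).
have LopE u : crange phi u -> Lop E b (s \o cinv phi) u = drift d (fun i => cs M c * x i) s (cinv phi u).
 move=> Uu; rewrite /drift sfD.
  apply: (@f_equal2 _ _ _ +%R); rewrite sf_sum; apply: eq_bigr => i _.
  have H := @Dl_eq _ _ _ _ E oU i (Dl E i (s \o cinv phi)) (d i s \o cinv phi) u Uu.
  rewrite H; first by rewrite DlE'.
  by move=> w; rewrite inE => Uw; exact: DlE'.
 by rewrite sfM sfM; congr (_ * _); exact: DlE'.
have Ls' := Ls (dsfD imm) (dsfM imm) (fun i => dsf_cst imm i c) (sum_NN N_normal) (Nd0 imm N_normal)
 (dx_proj imm N_normal) (S_symm imm N_normal) (d_commutator imm N_normal) (soliton_trace imm N_normal soliton).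
have f0 u : crange phi u -> 0 <= f u by move=> _; exact: es0.
have Lf u : crange phi u -> Lop E b f u <= - c * f u.
 move=> Uu; rewrite (@LopZ _ _ _ _ E b oU ES _ e _ (sS 2%N) Uu) LopE// Ls' sfN sfM sfD /f /=.
 have Q0 : 0 <= (\sum_i \sum_j d i (nn j) * d i (nn j)) (cinv phi u).
  rewrite sf_sum sumr_ge0// => i _; rewrite sf_sum sumr_ge0// => j _; rewrite sfM.
  by rewrite -expr2 sqr_ge0.
 have es := es0 (cinv phi u).
 have P0 := mulr_ge0 Q0 es.
 suff : e * - (((\sum_i \sum_j d i (nn j) * d i (nn j) : sfun M) (cinv phi u) + c) * s (cinv phi u)) <=
  - c * (e * s (cinv phi u)) by [].
 lra.
have fp : f (cmap phi p) = 0 by rewrite /f /= cmapK'// sp mulr0.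
have [|dd dd0 Hd] := hopf_local oU ES bS nd m_gt0 _ fS f0 Lf (crange_cmap Dp) fp.
 by rewrite oppr_ge0 ltW.
have := cmap_nbhs Dp (box_nbhs (cmap phi p) dd0); apply: filterS => q [Dq bq].
have := Hd _ bq; rewrite /f /= cmapK'// => /eqP; rewrite mulf_eq0 => /orP[/eqP e0|/eqP//].
by case: e1; rewrite e0; lra.
Qed.

Hypothesis H_neq0 : exists p, mean_curvature psi N p != 0.
Hypothesis H_sign : (forall p, 0 <= mean_curvature psi N p) \/
      (forall p, mean_curvature psi N p <= 0).

Lemma support_neq0 p : s p != 0.
Proof.
have [e e1 es] : exists2 e : R, e = 1 \/ e = -1 & forall q, 0 <= e * s q.
 case: H_sign => H; [exists (-1); first by right|exists 1; first by left]; move=> q;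
  have := H q; rewrite (mean_curvatureE imm N_normal soliton) => H1.
  by rewrite mulN1r oppr_ge0; rewrite nmulr_rge0 // in H1.
 by rewrite mul1r; rewrite nmulr_rle0 // in H1.
apply/eqP => sp; have [q] := H_neq0; rewrite (mean_curvatureE imm N_normal soliton) => /eqP; apply.
suff -> : s q = 0 by rewrite mulr0.
apply: (connected_all M_conn (A := [set q | s q = 0]) sp) => {}q /= sq.
 exact: soliton_hopf e1 es sq.
have sc : continuous s := CM_continuous (sfP s 0).
have sq0 : s q != 0 by exact/eqP.
have H : \forall w \near q, s w != 0 by exact: (@near_neq0 R M (sf s) q (sc q)).
by apply: filterS H => w /eqP.
Qed.

Definition sinv : sfun M := mksf (fun k => CMV support_neq0 (sfP s k)).

Lemma sinvK : sinv * s = 1.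
Proof. by apply: sf_inj => p; rewrite sfM sf1 mulVf// support_neq0. Qed.

End Positivity.

(** * C^1 curves and transition functions *)

Section CurveCalculus.
Variable R : realType.

Lemma is_derive_quad (f : R -> R) (t a C : R) :
 (forall h : R, `|f (t + h) - f t - h * a| <= C * h ^+ 2) -> is_derive t (1 : R) f a.
Proof.
move=> H; have C0 : 0 <= C by have := H 1; rewrite expr1n mulr1; apply: le_trans; exact: normr_ge0.
have cv : h^-1 *: ((f \o shift t) (h *: (1 : R)) - f t) @[h --> 0^'] --> a.
 apply/cvgrPdist_le => e e0; near=> h.
 have h0 : h != 0 by near: h; exact: nbhs_dnbhs_neq.
 have hs : `|h| <= e / (C + 1).
  by near: h; apply: dnbhs0_le; rewrite divr_gt0// ltr_wpDl.
 rewrite /= [h *: 1]mulr1 [h + t]addrC.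
 have -> : a - h^-1 *: (f (t + h) - f t) = - (h^-1 * (f (t + h) - f t - h * a)).
  by rewrite /GRing.scale /=; field.
 rewrite normrN normrM normfV ler_pdivrMl ?normr_gt0//.
 apply: le_trans (H h) _; rewrite -(real_normK (num_real h)) expr2.
 have h1 : 0 <= `|h| by [].
 have : C * `|h| <= e.
  rewrite ler_pdivlMr ?ltr_wpDl// in hs; apply: le_trans hs.
  by rewrite mulrC ler_wpM2l// lerDl.
 nra.
by split; [apply/cvg_ex; exists a|exact: cvg_lim].
Unshelve. all: by end_near. Qed.

Definition ramp (t : R) : R := Num.max 0 t ^+ 2.

Lemma is_derive_ramp (t : R) : is_derive t (1 : R) ramp (2 * Num.max 0 t).
Proof.
apply: (@is_derive_quad _ _ _ 1) => h; rewrite mul1r /ramp !/Num.max /Order.max.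
by case: ifP => th; case: ifP => t0; rewrite ler_norml; apply/andP; split; nra.
Qed.

(** A piecewise quadratic C^1 step from 0 for [t <= 0] to 1 for [t >= 1], with slope between 0 and
    2. Class C^1 suffices for reparametrizing curves and for bump functions. *)
Definition smoothstep (t : R) : R := 2 * ramp t - 4 * ramp (t - 2^-1) + 2 * ramp (t - 1).
Definition dsmoothstep (t : R) : R :=
 4 * Num.max 0 t - 8 * Num.max 0 (t - 2^-1) + 4 * Num.max 0 (t - 1).

Lemma is_derive_smoothstep (t : R) : is_derive t (1 : R) smoothstep (dsmoothstep t).
Proof.
have D (k a s : R) : is_derive s (1 : R) (fun u : R => k * ramp (u - a)) (2 * k * Num.max 0 (s - a)).
 have h1 : is_derive s (1 : R) (fun u : R => u - a) 1.
  have := is_deriveB (is_derive_id s (1 : R)) (is_derive_cst a s (1 : R)).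
  by rewrite subr0.
 have h2 := @is_derive1_comp R ramp (fun u : R => u - a) s _ _ (is_derive_ramp (s - a)) h1.
 have := @is_deriveZ R R R _ k s 1 _ h2.
 by move=> h3; apply: is_derive_eq h3 _; rewrite /GRing.scale /=; ring.
have := is_deriveD (is_deriveD (D 2 0 t) (D (- 4) 2^-1 t)) (D 2 1 t).
have -> : (fun u : R => 2 * ramp (u - 0)) + (fun u : R => - 4 * ramp (u - 2^-1)) + (fun u : R => 2 * ramp (u - 1)) = smoothstep.
 by apply/funext => u; rewrite !fctE /smoothstep subr0; ring.
by move=> h; apply: is_derive_eq h _; rewrite /dsmoothstep subr0; ring.
Qed.

Lemma smoothstep_le0 (t : R) : t <= 0 -> smoothstep t = 0.
Proof.
move=> t0; rewrite /smoothstep /ramp !(max_idPl _) ?expr0n ?mulr0 ?subr0 ?addr0//; lra.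
Qed.

Lemma smoothstep_ge1 (t : R) : 1 <= t -> smoothstep t = 1.
Proof. by move=> t1; rewrite /smoothstep /ramp !(max_idPr _); [field|lra|lra|lra]. Qed.

Lemma smoothstep01 (t : R) : 0 <= smoothstep t <= 1.
Proof.
have [t0|t0] := leP t 0; first by rewrite smoothstep_le0// lexx ler01.
have [t1|t1] := leP 1 t; first by rewrite smoothstep_ge1// lexx ler01.
rewrite /smoothstep /ramp [Num.max 0 (t - 1)](max_idPl _); last lra.
rewrite [Num.max 0 t](max_idPr _); last lra.
have [h|h] := leP t 2^-1.
 rewrite (max_idPl _); last lra.
 by apply/andP; split; nra.
rewrite (max_idPr _); last lra.
by apply/andP; split; nra.
Qed.

Lemma dsmoothstep_bound (t : R) : 0 <= dsmoothstep t <= 2.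
Proof.
rewrite /dsmoothstep !/Num.max /Order.max.
by case: ifP => ?; case: ifP => ?; case: ifP => ?; apply/andP; split; lra.
Qed.

Lemma dsmoothstep_out (t : R) : t <= 0 \/ 1 <= t -> dsmoothstep t = 0.
Proof.
rewrite /dsmoothstep !/Num.max /Order.max.
by case=> ?; case: ifP => ?; case: ifP => ?; case: ifP => ?; lra.
Qed.

Lemma dsmoothstep_continuous : continuous dsmoothstep.
Proof.
have mc (a : R) : continuous (fun t : R => Num.max 0 (t - a)).
 have -> : (fun t : R => Num.max 0 (t - a)) = (fun t : R => 2^-1 * ((t - a) + `|t - a|)).
  apply/funext => t; have [h|h] := leP 0 (t - a).
   by rewrite ger0_norm//; field.
  by rewrite ltr0_norm//; field.
 have sc : continuous (fun t : R => t - a).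
  by move=> t; apply: continuousB; [exact: cvg_id|exact: cvg_cst].
 move=> t; apply: (@continuousM _ _ (fun=> 2^-1) (fun t : R => (t - a) + `|t - a|) t); first exact: cvg_cst.
 apply: continuousD; first exact: sc.
 apply: (@continuous_comp _ _ _ (fun t : R => t - a) Num.norm); first exact: sc.
 exact: norm_continuous.
have -> : dsmoothstep = (fun t : R => 4 * Num.max 0 (t - 0) - 8 * Num.max 0 (t - 2^-1) + 4 * Num.max 0 (t - 1)).
 by apply/funext => t; rewrite /dsmoothstep subr0.
by move=> t; apply: cvgD; [apply: cvgB|]; (apply: cvgM; [exact: cvg_cst|exact: mc]).
Qed.

Lemma int_primitive (f F : R -> R) (a b : R) : a <= b -> continuous f ->
 (forall t, is_derive t (1 : R) F (f t)) ->
 (\int[lebesgue_measure]_(t in `[a, b]) (f t)%:E = (F b - F a)%:E)%E.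
Proof.
rewrite le_eqVlt => /predU1P[<-|ab] fc Fd.
 by rewrite set_itv1 integral_set1 subrr.
have Fc : continuous F.
 by move=> t; apply/differentiable_continuous/derivable1_diffP; have [] := Fd t.
rewrite (continuous_FTC2 ab (F := F)) ?EFinB//.
- by apply: continuous_subspaceT.
- split=> [t _||]; first by have [] := Fd t.
  by apply: cvg_at_right_filter; exact: Fc.
 by apply: cvg_at_left_filter; exact: Fc.
- by move=> t _; rewrite derive1E; have [_ ->] := Fd t.
Qed.

Lemma primitive_from (f : R -> R) (a : R) : continuous f ->
 exists F : R -> R, forall t, a < t -> is_derive t (1 : R) F (f t).
Proof.
move=> fc; exists (fun x => (\int[lebesgue_measure]_(t in `[a, x]) (f t))%R) => t at_.
have ut : t < t + 1 by rewrite ltrDl.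
have [|dF dE] := @continuous_FTC1_closed R f a t (t + 1) ut _ at_ (fc t).
 apply: continuous_compact_integrable; first exact: segment_compact.
 exact: continuous_subspaceT.
by rewrite -dE derive1E; exact: derivableP.
Qed.

Lemma is_derive0_cst (f : R -> R) (a : R) : (forall t, a < t -> is_derive t (1 : R) f 0) ->
 forall s t, a < s -> a < t -> f s = f t.
Proof.
move=> fd; suff H s t : a < s -> s <= t -> f s = f t.
 by move=> s t as_ at_; have [/H ->//|/ltW /H ->//] := leP s t.
move=> as_ st; have [x||c _ E] := @MVT_segment R f (fun=> 0) s t st.
- by rewrite in_itv /= => /andP[sx _]; apply: fd; exact: lt_trans sx.
- apply: derivable_within_continuous => x; rewrite in_itv /= => /andP[sx _].
 by have [] := fd x (lt_le_trans as_ sx).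
by apply/eqP; rewrite eq_sym -subr_eq0 E mul0r.
Qed.

(** An integral from a base point is a primitive only to the right of it. The base point [- |t| - 1]
    therefore moves with [t]; after normalization at 0 the various primitives agree where they
    overlap. *)
Lemma primitive (f : R -> R) : continuous f ->
 exists2 F : R -> R, F 0 = 0 & forall t, is_derive t (1 : R) F (f t).
Proof.
move=> fc; pose P a := projT1 (cid (primitive_from a fc)).
have PP (a t : R) : a < t -> is_derive t (1 : R) (P a) (f t) := projT2 (cid (primitive_from a fc)) t.
pose b (t : R) := - `|t| - 1.
have b0 t : b t < 0 by rewrite /b; have := normr_ge0 t; lra.
have bt t : b t < t by rewrite /b; have := ler_norm (- t); rewrite normrN; lra.
have PE a t : a < 0 -> a < t -> P (b t) t - P (b t) 0 = P a t - P a 0.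
 move=> a0 at_; pose e := Num.max a (b t).
 have := @is_derive0_cst (P (b t) - P a) e _ t 0.
 rewrite !fctE => H; suff : P (b t) t - P a t = P (b t) 0 - P a 0 by lra.
 apply: H; rewrite ?gt_max ?a0 ?at_ ?b0 ?bt//.
 move=> x; rewrite gt_max => /andP[ax bx].
 have := is_deriveB (PP (b t) x bx) (PP a x ax); by rewrite subrr.
exists (fun t => P (b t) t - P (b t) 0); first by rewrite subrr.
move=> t; pose a := b t - 1.
have E : is_derive t (1 : R) (fun s : R => P a s - P a 0) (f t).
 have at_ : a < t by rewrite /a; have := bt t; lra.
 have := is_deriveB (PP a t at_) (is_derive_cst (P a 0) t (1 : R)); by rewrite subr0.
apply: is_derive_near ltr01 _ E => s st; apply/esym/PE; first by rewrite /a; have := b0 t; lra.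
move: st; rewrite ltr_norml => /andP[h1 h2]; rewrite /a /b.
by have := ler_norm (- t); rewrite normrN; lra.
Qed.

Section C1at.
Variable (W : normedModType R).
Implicit Types (f g : R -> W) (t : R).

Definition C1at f t := (\forall s \near t, derivable f s 1) /\ {for t, continuous ('D_1 f)}.

Lemma C1at_der f t : C1at f t -> derivable f t 1.
Proof. by case=> H _; exact: nbhs_singleton H. Qed.

Lemma C1atI f df t : (\forall s \near t, is_derive s (1 : R) f (df s)) -> {for t, continuous df} -> C1at f t.
Proof.
move=> H dc; split; first by apply: filterS H => s [].
have E : {near t, df =1 'D_1 f} by apply: filterS H => s [_ ->].
suff : 'D_1 f @ t --> 'D_1 f t by [].
have E0 : 'D_1 f t = df t by apply/esym; exact: nbhs_singleton E.
rewrite E0.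
have dc' : df @ t --> df t := dc.
by apply: cvg_trans dc'; apply: near_eq_cvg.
Qed.

Lemma C1at_eq f g t : {near t, f =1 g} -> C1at f t -> C1at g t.
Proof.
move=> E [fd fc]; have E2 := (near_join E).
apply: (@C1atI g ('D_1 f)) fc.
apply: filterS2 E2 fd => s Es fs; apply: near_eq_is_derive Es _.
exact: derivableP.
Qed.

Lemma C1at_continuous f t : C1at f t -> {for t, continuous f}.
Proof. by move/C1at_der/derivable1_diffP/differentiable_continuous. Qed.

End C1at.

Lemma C1at_scal_comp (f h : R -> R) t : C1at h t -> C1at f (h t) -> C1at (f \o h) t.
Proof.
move=> hC fC; have hc := C1at_continuous hC.
have n1 : \forall s \near t, derivable f (h s) 1 by have [fd _] := fC; have := hc _ fd.
apply: (@C1atI _ _ (fun s => 'D_1 f (h s) * 'D_1 h s)).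
 apply: filterS2 n1 hC.1 => s d1 d2.
 exact: (@is_derive1_comp R f h s _ _ (derivableP d1) (derivableP d2)).
apply: continuousM hC.2; apply: (@continuous_comp _ _ _ h ('D_1 f)) => //; exact: fC.2.
Qed.

Lemma C1at_smoothstep t : C1at smoothstep t.
Proof.
apply: (@C1atI _ _ dsmoothstep); last exact: dsmoothstep_continuous.
by apply: (@filterS _ (nbhs t) _ setT) filterT => s _; exact: is_derive_smoothstep.
Qed.

Section Row.
Variable m : nat.
Notation V := 'rV[R]_m.
Implicit Types (G : R -> V).

Lemma C1at_coord G t j : C1at G t -> C1at (fun s => G s 0 j) t.
Proof.
move=> [Gd Gc]; apply: (@C1atI _ _ (fun s => 'D_1 G s 0 j)).
 apply: filterS Gd => s ds; have /derivable_mxP/(_ 0 j) dj := ds.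
 by rewrite derive_mx// mxE; exact: derivableP.
exact: continuous_coord_at.
Qed.

Lemma derivable_row G t : (forall j, derivable (fun s => G s 0 j) t 1) -> derivable G t 1.
Proof. by move=> H; apply/derivable_mxP => a j; rewrite ord1. Qed.

Lemma derive_row G t j : derivable G t 1 -> 'D_1 G t 0 j = 'D_1 (fun s => G s 0 j) t.
Proof. by move=> d; rewrite derive_mx// mxE. Qed.

Lemma C1at_row G t : (forall j, C1at (fun s => G s 0 j) t) -> C1at G t.
Proof.
move=> H; have Gd : \forall s \near t, forall j, derivable (fun s => G s 0 j) s 1.
 by apply: (@filter_forall R 'I_m (fun j s => derivable (fun s => G s 0 j) s 1) (nbhs t) _) => j; exact: (H j).1.
apply: (@C1atI _ _ (fun s => \row_j 'D_1 (fun s => G s 0 j) s)).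
 apply: filterS Gd => s ds; have d := derivable_row ds.
 have -> : (\row_j 'D_1 (fun s => G s 0 j) s) = 'D_1 G s.
  by apply/rowP => j; rewrite mxE derive_row.
 exact: derivableP.
apply: continuous_row => j.
have -> : (fun y : R => (\row_j 'D_1 (fun s => G s 0 j) y) 0 j) = 'D_1 (fun s => G s 0 j).
 by apply/funext => y; rewrite mxE.
exact: (H j).2.
Qed.

Lemma is_derive_curve G (f : V -> R) (U : set V) t : open U -> Sk 1 U f -> U (G t) ->
 derivable G t 1 -> is_derive t (1 : R) (f \o G) (\sum_i 'D_1 G t 0 i * 'D_(e_ i) f (G t)).
Proof.
move=> oU fS Ut Gd; have Gc : derivable G t 1 := Gd.
have := @is_derive_chain R m R G f t 1 _ _ _.
move=> H; apply: is_derive_eq (H _ _ _) _.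
- by move=> i; have /derivable_mxP/(_ 0 i) := Gd.
- by apply/derivable1_diffP.
- exact: Sk_differentiable fS Ut.
- by apply: eq_bigr => i _; rewrite derive_row.
Qed.

Lemma C1at_comp G (f : V -> R) (U : set V) t : open U -> Sk 1 U f -> U (G t) ->
 C1at G t -> C1at (f \o G) t.
Proof.
move=> oU fS Ut GC; have Gc := C1at_continuous GC.
have nU : \forall s \near t, U (G s) by apply: (Gc); exact: open_nbhs_nbhs.
apply: (@C1atI _ _ (fun s => \sum_i 'D_1 G s 0 i * 'D_(e_ i) f (G s))).
 by apply: filterS2 nU GC.1 => s Us ds; exact: (is_derive_curve oU fS Us ds).
apply: sum_continuous_at => i _; apply: continuousM.
 by apply: continuous_coord_at; exact: GC.2.
apply: (@continuous_comp _ _ _ G ('D_(e_ i) f)) => //.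
exact: (Sk_cont (Sk_partial i fS) Ut).
Qed.

End Row.
End CurveCalculus.

Lemma Sk_local (R : realType) m k (U : set 'rV[R]_m) (f : 'rV[R]_m -> R) :
 (forall u, U u -> exists O : set 'rV[R]_m, [/\ open O, O u & Sk k O f]) -> Sk k U f.
Proof.
elim: k f => [|k IH] f H.
 split; last by [].
 by move=> u Uu; have [W [_ Ou fO]] := H u Uu; exact: (Sk_cont fO).
apply: SkS => [u /H [W [_ Ou fO]]|i u /H [W [_ Ou fO]]|i].
- exact: (Sk_cont fO).
- exact: (Sk_der i fO).
apply: IH => u /H [W [oO Ou fO]]; exists W; split => //; exact: (Sk_partial i fO).
Qed.

Lemma within_compact (T T' : topologicalType) (f : T -> T') (A : set T) :
 (forall u : T, A u -> {for u, continuous f}) -> compact A -> compact (f @` A).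
Proof. by move=> H; apply: continuous_compact; exact: within_continuous_at. Qed.

(** * Bump functions in charts *)

Section Bump.
Variables (R : realType) (m : nat) (M : manifold R m).
Notation V := 'rV[R]_m.

(** The numbers [3] and [4 / r] put the transition of each factor between distances [r / 2] and
    [3 / 4 * r] from the centre, leaving a margin inside the box of size [r]. *)
Definition profile (c : V) (r : R) (u : V) : R :=
 \prod_a (smoothstep (3 + 4 / r * (u 0 a - c 0 a)) * smoothstep (3 - 4 / r * (u 0 a - c 0 a))).

Lemma profile01 c r u : 0 <= profile c r u <= 1.
Proof.
have H (a : 'I_m) : 0 <= smoothstep (3 + 4 / r * (u 0 a - c 0 a)) * smoothstep (3 - 4 / r * (u 0 a - c 0 a)) <= 1.
 have /andP[p1 p2] := smoothstep01 (3 + 4 / r * (u 0 a - c 0 a)).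
 have /andP[q1 q2] := smoothstep01 (3 - 4 / r * (u 0 a - c 0 a)).
 by rewrite mulr_ge0// mulr_ile1.
apply/andP; split; first by apply: prodr_ge0 => a _; case/andP: (H a).
by apply: prodr_ile1 => a _; exact: H.
Qed.

Lemma profile1 c r u : 0 < r -> box c (r / 2) u -> profile c r u = 1.
Proof.
move=> r0 H; rewrite /profile big1// => a _; have := H a; rewrite ler_norml => /andP[h1 h2].
have e1 : 4 / r * (r / 2) = 2 by field; rewrite gt_eqF.
have k0 : 0 <= 4 / r by rewrite divr_ge0// ltW.
have g1 := ler_wpM2l k0 h1; have g2 := ler_wpM2l k0 h2.
rewrite mulrN e1 in g1; rewrite e1 in g2.
by rewrite !smoothstep_ge1 ?mulr1//; lra.
Qed.

Lemma profile_supp c r u : 0 < r -> profile c r u != 0 -> box c (3 / 4 * r) u.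
Proof.
move=> r0 H a; move/prodf_neq0/(_ a isT) : H; rewrite mulf_eq0 negb_or => /andP[h1 h2].
have g1 : 0 < 3 + 4 / r * (u 0 a - c 0 a).
 by rewrite ltNge; apply: contraNN h1 => /smoothstep_le0 ->.
have g2 : 0 < 3 - 4 / r * (u 0 a - c 0 a).
 by rewrite ltNge; apply: contraNN h2 => /smoothstep_le0 ->.
have E : u 0 a - c 0 a = r / 4 * (4 / r * (u 0 a - c 0 a)) by field; rewrite gt_eqF.
move: g1 g2; set y := 4 / r * _ => g1 g2.
have r4 : 0 <= r / 4 by rewrite divr_ge0// ltW.
have p1 : 0 <= r / 4 * (y + 3) by rewrite mulr_ge0//; lra.
have p2 : 0 <= r / 4 * (3 - y) by rewrite mulr_ge0//; lra.
by rewrite E -/y ler_norml; apply/andP; split; lra.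
Qed.

Lemma profile_smooth (k : nat) (O : set 'rV[R]_k) (T : 'rV[R]_k -> V) c r : open O ->
 (forall a, Sk 1 O (fun u => T u 0 a)) -> Sk 1 O (fun u => profile c r (T u)).
Proof.
move=> oO TS; apply: Sk_prod => // a _.
have S (y : 'rV[R]_k -> R) : Sk 1 O y -> Sk 1 O (fun u => smoothstep (y u)).
 move=> yS; apply: (@Sk_comp1 _ _ 1 O y (@smoothstep R) (@dsmoothstep R) [set: R]) => //.
  by move=> t _; exact: is_derive_smoothstep.
 case=> // _ y0 _; split => // u Ou; apply: (@continuous_comp _ _ _ y (@dsmoothstep R)).
  exact: (Sk_cont y0).
 exact: dsmoothstep_continuous.
have yS : Sk 1 O (fun u => 4 / r * (T u 0 a - c 0 a)).
 apply: SkM => //; first exact: Sk_cst.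
 by apply: SkD => //; exact: Sk_cst.
exact: (SkM oO (S _ (SkD oO (Sk_cst 1 O 3) yS)) (S _ (SkD oO (Sk_cst 1 O 3) (SkN oO yS)))).
Qed.

Variables (phi : chart R m M) (c : V) (r : R).
Hypotheses (at_ : atlas phi) (r0 : 0 < r) (sub : box c r `<=` crange phi).

Definition bump (p : M) : R := if `[< cdom phi p >] then profile c r (cmap phi p) else 0.

Lemma bump01 p : 0 <= bump p <= 1.
Proof. by rewrite /bump; case: ifP => _; rewrite ?lexx ?ler01// profile01. Qed.

Lemma bumpE p : cdom phi p -> bump p = profile c r (cmap phi p).
Proof. by move=> Dp; rewrite /bump asboolT. Qed.

Lemma bump1 p : cdom phi p -> box c (r / 2) (cmap phi p) -> bump p = 1.
Proof. by move=> Dp H; rewrite bumpE// profile1. Qed.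

Lemma bump_supp p : bump p != 0 -> cdom phi p /\ box c (3 / 4 * r) (cmap phi p).
Proof.
rewrite /bump; case: ifP; rewrite ?eqxx// => /asboolP Dp H; split=> //; exact: profile_supp.
Qed.

Lemma box34 : box c (3 / 4 * r) `<=` crange phi.
Proof. by move=> u H; apply: sub => a; apply: (le_trans (H a)); have := r0; lra. Qed.

Lemma box_image_compact s : box c s `<=` crange phi -> compact (cinv phi @` box c s).
Proof.
move=> H; apply: within_compact; last exact: box_compact.
by move=> u /H ru; exact: (@cinv_continuous _ _ _ phi).
Qed.

Lemma bump_out p : ~ (cinv phi @` box c (3 / 4 * r)) p -> bump p = 0.
Proof.
move=> H; apply/eqP/negP => /negP/bump_supp[Dp bp]; apply: H.
by exists (cmap phi p) => //; exact: cmapK'.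
Qed.

(** Locally there are two cases: inside the chart domain the bump is a profile composed with a
    transition map; outside it the point avoids the compact support, which is closed because the
    manifold is Hausdorff. *)
Lemma bump_smooth : CM 1 bump.
Proof.
move=> phi2 at2; apply: Sk_local => u ru.
have Kc := compact_closed (@carrier_hausdorff _ _ M) (box_image_compact box34).
have [Du|nDu] := pselect (cdom phi (cinv phi2 u)).
 exists (overlap phi2 phi); split; first exact: overlap_open.
  by exists (cinv phi2 u); [split => //; exact: cinv_dom|exact: cinvK].
 apply: (Sk_eq (overlap_open phi2 phi) _ (profile_smooth c r (overlap_open phi2 phi)
  (fun a => transition_smooth a 1 at2 at_))) => w; rewrite inE => -[q [q2 q1] <-].
 by rewrite /transition /= cmapK'// bumpE.
exists (cmap phi2 @` (cdom phi2 `&` ~` (cinv phi @` box c (3 / 4 * r)))); split.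
- by apply: open_image; exact: closed_openC.
- exists (cinv phi2 u); last exact: cinvK.
 split; first exact: cinv_dom.
 by move=> [w bw E]; apply: nDu; rewrite -E; apply: cinv_dom; exact: box34.
have oO := open_image (phi := phi2) (closed_openC Kc).
apply: (Sk_eq oO _ (Sk_cst 1 _ 0)) => w; rewrite inE => -[q [q2 q1] <-].
by rewrite /= cmapK'// bump_out.
Qed.

End Bump.

(** * Riemannian distance and completeness *)

Section Enorm.
Variables (R : realType) (n : nat).
Implicit Types (u v : 'rV[R]_n) (a : R).

Lemma dotDl u v w : dot (u + v) w = dot u w + dot v w.
Proof. by rewrite /dot mulmxDl mxE. Qed.

Lemma dotDr u v w : dot w (u + v) = dot w u + dot w v.
Proof. by rewrite dotC dotDl !(dotC w). Qed.

Lemma dotZl a u v : dot (a *: u) v = a * dot u v.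
Proof. by rewrite /dot -scalemxAl mxE. Qed.

Lemma dotZr a u v : dot u (a *: v) = a * dot u v.
Proof. by rewrite dotC dotZl dotC. Qed.

Lemma dotNl u v : dot (- u) v = - dot u v.
Proof. by rewrite -scaleN1r dotZl mulN1r. Qed.

Lemma dotNr u v : dot u (- v) = - dot u v.
Proof. by rewrite dotC dotNl dotC. Qed.

Lemma enorm_ge0 u : 0 <= enorm u.
Proof. exact: sqrtr_ge0. Qed.

Lemma sqr_enorm u : enorm u ^+ 2 = dot u u.
Proof. by rewrite sqr_sqrtr// dot_ge0. Qed.

Lemma enorm_eq0 u : enorm u = 0 -> u = 0.
Proof. by move=> E; apply: dot_eq0; rewrite -sqr_enorm E expr0n. Qed.

Lemma enorm0 : enorm (0 : 'rV[R]_n) = 0.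
Proof. by rewrite /enorm /dot mul0mx mxE sqrtr0. Qed.

Lemma enormZ a u : enorm (a *: u) = `|a| * enorm u.
Proof. by rewrite /enorm dotZl dotZr mulrA -expr2 sqrtrM ?sqr_ge0// sqrtr_sqr. Qed.

Lemma enormN u : enorm (- u) = enorm u.
Proof. by rewrite -scaleN1r enormZ normrN1 mul1r. Qed.

Lemma dot_CS u v : `|dot u v| <= enorm u * enorm v.
Proof.
rewrite -(ler_pXn2r (n := 2))// ?nnegrE ?mulr_ge0 ?enorm_ge0//.
rewrite real_normK ?num_real// exprMn !sqr_enorm.
have H (t : R) : 0 <= dot u u - 2 * t * dot u v + t ^+ 2 * dot v v.
 have := dot_ge0 (u - t *: v).
 rewrite dotDl !dotDr !dotNl !dotNr !dotZl !dotZr (dotC v u) => h.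
 by rewrite expr2; lra.
have v0 := dot_ge0 v; have [E|ne] := eqVneq (dot v v) 0.
 suff -> : dot u v = 0 by rewrite expr0n E mulr0.
 by rewrite (dot_eq0 E) /dot trmx0 mulmx0 mxE.
have vp : 0 < dot v v by rewrite lt_neqAle eq_sym ne v0.
have := H (dot u v / dot v v); rewrite -(pmulr_lge0 _ vp).
suff -> : (dot u u - 2 * (dot u v / dot v v) * dot u v + (dot u v / dot v v) ^+ 2 * dot v v) * dot v v =
 dot u u * dot v v - dot u v ^+ 2 by rewrite subr_ge0.
by field.
Qed.

Lemma enormD u v : enorm (u + v) <= enorm u + enorm v.
Proof.
rewrite -(ler_pXn2r (n := 2))// ?nnegrE ?addr_ge0 ?enorm_ge0//.
rewrite sqr_enorm dotDl !dotDr sqrrD !sqr_enorm (dotC v u).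
have := le_trans (ler_norm _) (dot_CS u v); rewrite -mulr_natl; lra.
Qed.

Lemma coord_le_enorm u k : `|u 0 k| <= enorm u.
Proof.
rewrite -(ler_pXn2r (n := 2))// ?nnegrE ?enorm_ge0// real_normK ?num_real// sqr_enorm dotE.
rewrite (bigD1 k)//= expr2 lerDl sumr_ge0// => i _.
by rewrite -expr2 sqr_ge0.
Qed.

Lemma enorm_le_sum u : enorm u <= \sum_k `|u 0 k|.
Proof.
rewrite -(ler_pXn2r (n := 2))// ?nnegrE ?enorm_ge0 ?sumr_ge0// sqr_enorm dotE.
rewrite expr2 mulr_suml; apply: ler_sum => i _.
apply: le_trans (ler_norm _) _; rewrite normrM ler_wpM2l//.
by rewrite (bigD1 i)//= lerDl sumr_ge0.
Qed.

Lemma enorm_alternate u v a b : 0 <= a -> 0 <= b -> a = 0 \/ b = 0 ->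
 enorm u * (a * 2) + enorm v * (b * 2) = enorm ((a * 2) *: u + (b * 2) *: v).
Proof.
move=> a0 b0 [->|->]; rewrite mul0r scale0r mulr0 ?add0r ?addr0 enormZ ger0_norm 1?mulrC//.
 by rewrite mulr_ge0.
by rewrite mulr_ge0.
Qed.

Lemma dot_continuous (T : topologicalType) (f g : T -> 'rV[R]_n) x :
 {for x, continuous f} -> {for x, continuous g} -> {for x, continuous (fun y => dot (f y) (g y))}.
Proof.
move=> fc gc; have -> : (fun y => dot (f y) (g y)) = (fun y => \sum_i f y 0 i * g y 0 i).
 by apply/funext => y; rewrite dotE.
by apply: sum_continuous_at => i _; apply: continuousM; exact: continuous_coord_at.
Qed.

Lemma enorm_continuous (T : topologicalType) (f : T -> 'rV[R]_n) x :
 {for x, continuous f} -> {for x, continuous (fun y => enorm (f y))}.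
Proof.
move=> fc; apply: (@continuous_comp _ _ _ (fun y => dot (f y) (f y)) (@Num.sqrt R)).
 exact: dot_continuous.
exact: sqrt_continuous.
Qed.

End Enorm.

Section C1atExtra.
Variables (R : realType) (W : normedModType R).

Lemma C1atD (f g : R -> W) (t : R) : C1at f t -> C1at g t -> C1at (fun s => f s + g s) t.
Proof.
move=> [fd fc] [gd gc]; apply: (@C1atI _ _ _ (fun s => 'D_1 f s + 'D_1 g s)).
 by apply: filterS2 fd gd => s ds es; apply: is_deriveD; exact: derivableP.
exact: continuousD.
Qed.

Lemma C1at_cst (a : W) (t : R) : C1at (cst a) t.
Proof.
apply: (@C1atI _ _ _ (fun=> 0)); last exact: cst_continuous.
by apply: (@filterS _ (nbhs t) _ setT) filterT => s _; exact: is_derive_cst.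
Qed.
End C1atExtra.

(** * Length of curves and Riemannian distance *)

Section Curves.
Variables (R : realType) (m : nat) (M : manifold R m).
Notation V := 'rV[R]_m.
Implicit Types (g : R -> M) (f : M -> R) (t : R) (p q : M).

Lemma C1_curve_at g phi t : C1_curve g -> atlas phi -> cdom phi (g t) -> C1at (cmap phi \o g) t.
Proof.
move=> [gc gd] at_ Dt.
have nD : \forall s \near t, cdom phi (g s) by apply: gc; exact: open_nbhs_nbhs (conj (cdom_open phi) Dt).
split; first by apply: filterS nD => s Ds; exact: (gd _ at_ _ Ds).1.
have [_] := gd _ at_ _ Dt.
by have -> : (cmap phi \o g)^`()%classic = 'D_1 (cmap phi \o g) by apply/funext => s; rewrite derive1E.
Qed.

Lemma C1_curve_intro g : continuous g ->
 (forall t, exists phi, [/\ atlas phi, cdom phi (g t) & C1at (cmap phi \o g) t]) -> C1_curve g.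
Proof.
move=> gc H; split=> // phi2 at2 t D2; have [phi [at1 D1 C1]] := H t.
suff [C2 C3] : C1at (cmap phi2 \o g) t.
 split; first exact: nbhs_singleton C2.
 by have -> : (cmap phi2 \o g)^`()%classic = 'D_1 (cmap phi2 \o g) by apply/funext => s; rewrite derive1E.
have nD : \forall s \near t, cdom phi (g s) by apply: gc; exact: open_nbhs_nbhs (conj (cdom_open phi) D1).
have E : {near t, transition phi phi2 \o (cmap phi \o g) =1 cmap phi2 \o g}.
 by apply: filterS nD => s Ds; rewrite /transition /= cmapK'.
apply: C1at_eq E _; apply: C1at_row => j.
have oU := overlap_open phi phi2.
have S1 := transition_smooth j 1 at1 at2.
apply: (C1at_comp oU S1) C1; by exists (g t).
Qed.

Lemma C1_curve_comp g (h : R -> R) : C1_curve g -> (forall t, C1at h t) -> C1_curve (g \o h).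
Proof.
move=> gC hC; apply: C1_curve_intro.
 move=> t; apply: continuous_comp; first exact: C1at_continuous (hC t).
 exact: gC.1.
move=> t; exists (chart_at (g (h t))); split; [exact: chart_at_atlas|exact: chart_at_dom|].
apply: C1at_row => j.
have := C1_curve_at gC (chart_at_atlas _) (chart_at_dom (g (h t))) => /(C1at_coord j) H.
exact: (C1at_scal_comp (hC t) H).
Qed.

Variables (n : nat) (psi : M -> 'rV[R]_n).
Hypothesis imm : immersion psi.

Definition vel g t : 'rV[R]_n := 'D_1 (psi \o g) t.
Definition speed g t : R := enorm (vel g t).

Lemma curve_chart g f phi t : C1_curve g -> CM 1 f -> atlas phi -> cdom phi (g t) ->
 C1at (f \o g) t /\
 'D_1 (f \o g) t = \sum_a 'D_1 (cmap phi \o g) t 0 a * 'D_(e_ a) (f \o cinv phi) (cmap phi (g t)).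
Proof.
move=> gC fS at_ Dt; have CA := C1_curve_at gC at_ Dt.
have nD : \forall s \near t, cdom phi (g s) by apply: gC.1; exact: open_nbhs_nbhs (conj (cdom_open phi) Dt).
have E : {near t, (f \o cinv phi) \o (cmap phi \o g) =1 f \o g}.
 by apply: filterS nD => s Ds; rewrite /= cmapK'.
have oU := open_crange phi; have Ut := crange_cmap Dt.
split; first by apply: C1at_eq E _; exact: (C1at_comp oU (fS _ at_)).
have := is_derive_curve oU (fS _ at_) Ut (C1at_der CA) => H.
by have [_ ->] := near_eq_is_derive E H.
Qed.

Lemma curve_psi g : C1_curve g -> forall t, C1at (psi \o g) t.
Proof.
move=> gC t; apply: C1at_row => j.
exact: (curve_chart gC (xx_smooth imm 1 j) (chart_at_atlas _) (chart_at_dom (g t))).1.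
Qed.

Lemma vel_chart g phi t k : C1_curve g -> atlas phi -> cdom phi (g t) ->
 vel g t 0 k = ('D_1 (cmap phi \o g) t *m jac (psi \o cinv phi) (cmap phi (g t))) 0 k.
Proof.
move=> gC at_ Dt; rewrite /vel (derive_row _ (C1at_der (curve_psi gC t))).
rewrite (curve_chart gC (xx_smooth imm 1 k) at_ Dt).2 mxE; apply: eq_bigr => a _.
by rewrite (jacE imm a k at_ (crange_cmap Dt)).
Qed.

Lemma curve_fun g f t : C1_curve g -> CM 1 f ->
 is_derive t (1 : R) (f \o g) (\sum_k vel g t 0 k * dl psi k f (g t)).
Proof.
move=> gC fS; have at_ := chart_at_atlas (g t); have Dt := chart_at_dom (g t).
have [C1 C2] := curve_chart gC fS at_ Dt.
apply: is_derive_eq (derivableP (C1at_der C1)) _; rewrite C2.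
under eq_bigr do rewrite (partial_dl imm _ at_ Dt fS) mulr_sumr.
rewrite exchange_big; apply: eq_bigr => k _.
rewrite (vel_chart k gC at_ Dt) mxE mulr_suml; apply: eq_bigr => a _.
by rewrite mulrA.
Qed.

Lemma speed_continuous g : C1_curve g -> continuous (speed g).
Proof. by move=> gC t; apply: enorm_continuous; exact: (curve_psi gC t).2. Qed.

Lemma curve_lengthE g L : C1_curve g -> (forall t, is_derive t (1 : R) L (speed g t)) ->
 curve_length psi g = (L 1 - L 0)%:E.
Proof.
move=> gC Ld; rewrite -(int_primitive ler01 (speed_continuous gC) Ld) /curve_length.
by apply: eq_integral => t _; rewrite derive1E.
Qed.

Lemma vel_comp g (h : R -> R) t : C1_curve g -> C1at h t -> vel (g \o h) t = 'D_1 h t *: vel g (h t).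
Proof.
move=> gC hC; have P := C1at_der (curve_psi gC (h t)).
have dj j : is_derive t (1 : R) (fun s => (psi \o (g \o h)) s 0 j) ('D_1 (fun s => (psi \o g) s 0 j) (h t) * 'D_1 h t).
 have /derivable_mxP/(_ 0 j) d := P.
 exact: (@is_derive1_comp R (fun s => (psi \o g) s 0 j) h t _ _ (derivableP d) (derivableP (C1at_der hC))).
have D : derivable (psi \o (g \o h)) t 1 by apply: derivable_row => j; have [] := dj j.
apply/rowP => j; rewrite /vel (derive_row j D) mxE (derive_row j P) mulrC.
by have [_ ->] := dj j.
Qed.

Lemma curve_length_ge0 g : (0 <= curve_length psi g)%E.
Proof. by apply: integral_ge0 => t _; rewrite lee_fin enorm_ge0. Qed.

Lemma rdist_ge0 p q : (0 <= rdist psi p q)%E.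
Proof. by apply: le_ereal_inf_tmp => _ [g _ <-]; exact: curve_length_ge0. Qed.

Lemma rdist_le g p q : C1_curve g -> g 0 = p -> g 1 = q -> (rdist psi p q <= curve_length psi g)%E.
Proof. by move=> gC g0 g1; apply: ereal_inf_lbound; exists g. Qed.

Lemma rdist_lt p q (a : \bar R) : (rdist psi p q < a)%E ->
 exists g, [/\ C1_curve g, g 0 = p, g 1 = q & (curve_length psi g < a)%E].
Proof. by move=> /ereal_inf_lt[_ [g [gC g0 g1] <-] H]; exists g. Qed.

Lemma C1at_affine (a b t : R) : C1at (fun s : R => a + b * s) t.
Proof.
apply: (@C1atI _ _ _ (fun=> b)); last exact: cst_continuous.
apply: (@filterS _ (nbhs t) _ setT) filterT => s _.
by have := is_deriveD (is_derive_cst a s (1 : R)) (is_derive_mull b s); rewrite add0r.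
Qed.

Lemma derive_affine (a b t : R) : 'D_1 (fun s : R => a + b * s) t = b.
Proof.
have := is_deriveD (is_derive_cst a t (1 : R)) (is_derive_mull b t).
by rewrite add0r => -[_ H].
Qed.

(** The arc from [a] to [b] is reparametrized affinely on [[0, 1]]; the sign [e] covers the case
    [b < a]. *)
Lemma rdist_sub_curve g L (a b : R) : C1_curve g -> (forall t, is_derive t (1 : R) L (speed g t)) ->
 (rdist psi (g a) (g b) <= `|L b - L a|%:E)%E.
Proof.
move=> gC Ld; pose h (s : R) := a + (b - a) * s.
have hC t : C1at h t := C1at_affine a (b - a) t.
have ghC := C1_curve_comp gC hC.
have h0 : (g \o h) 0 = g a by rewrite /= /h mulr0 addr0.
have h1 : (g \o h) 1 = g b by rewrite /= /h mulr1 addrC subrK.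
apply: le_trans (rdist_le ghC h0 h1) _.
pose e : R := if a <= b then 1 else -1.
have eb : e * (b - a) = `|b - a|.
 rewrite /e; have [ab|ab] := leP a b; first by rewrite mul1r ger0_norm ?subr_ge0.
 by rewrite mulN1r ltr0_norm ?subr_lt0.
have Ld' t : is_derive t (1 : R) (fun s => e * L (h s)) (speed (g \o h) t).
 have dh : is_derive t (1 : R) h (b - a) by apply: is_derive_eq (derivableP (C1at_der (hC t))) _; exact: derive_affine.
 have := @is_deriveZ R R R _ e t 1 _ (@is_derive1_comp R L h t _ _ (Ld (h t)) dh).
 move=> H; apply: is_derive_eq H _.
 rewrite /speed (vel_comp gC (hC t)) derive_affine enormZ -eb /GRing.scale /=; ring.
rewrite (curve_lengthE ghC Ld') lee_fin /h mulr1 mulr0 addr0 [a + (b - a)]addrC subrK -mulrBr.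
rewrite /e; case: ifP => _; first by rewrite mul1r ler_norm.
by rewrite mulN1r -normrN ler_norm.
Qed.

Lemma speed_primitive g : C1_curve g -> exists L, forall t, is_derive t (1 : R) L (speed g t).
Proof. by move=> gC; have [L _ H] := primitive (speed_continuous gC); exists L. Qed.

Lemma primitive_mono (L l : R -> R) : (forall t, is_derive t (1 : R) L (l t)) -> (forall t, 0 <= l t) -> L 0 <= L 1.
Proof.
move=> Ld l0; have [x _ E] := mvt0 ler01 (fun x (_ : 0 <= x <= 1) => Ld x).
by rewrite -subr_ge0 E mulr1.
Qed.

Lemma rdist_sym_lt p q (a : R) : (rdist psi p q < a%:E)%E -> (rdist psi q p < a%:E)%E.
Proof.
move=> /rdist_lt[g [gC <- <-]]; have [L Ld] := speed_primitive gC.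
rewrite (curve_lengthE gC Ld); apply: le_lt_trans; apply: le_trans (rdist_sub_curve 1 0 gC Ld) _.
rewrite lee_fin distrC ger0_norm// subr_ge0; apply: (primitive_mono Ld) => t; exact: enorm_ge0.
Qed.

(** The two curves are run through [smoothstep], so that the speed vanishes at the junction and the
    concatenation is again a C^1 curve on the whole line. *)
Lemma rdist_tri_lt p q r (a b : R) : (rdist psi p q < a%:E)%E -> (rdist psi q r < b%:E)%E ->
 (rdist psi p r < (a + b)%:E)%E.
Proof.
move=> /rdist_lt[g1 [C1 g10 g11]] + /rdist_lt[g2 [C2 g20 g21]].
have [L1 d1] := speed_primitive C1; have [L2 d2] := speed_primitive C2.
rewrite (curve_lengthE C1 d1) (curve_lengthE C2 d2) !lte_fin => la lb.
pose h1 (t : R) := smoothstep (0 + 2 * t); pose h2 (t : R) := smoothstep (-1 + 2 * t).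
have hC1 t : C1at h1 t by exact: (C1at_scal_comp (C1at_affine 0 2 t) (C1at_smoothstep _)).
have hC2 t : C1at h2 t by exact: (C1at_scal_comp (C1at_affine (-1) 2 t) (C1at_smoothstep _)).
have dh a0 t : is_derive t (1 : R) (fun s : R => smoothstep (a0 + 2 * s)) (dsmoothstep (a0 + 2 * t) * 2).
 have da : is_derive t (1 : R) (fun s : R => a0 + 2 * s) 2.
  by apply: is_derive_eq (derivableP (C1at_der (C1at_affine a0 2 t))) _; exact: derive_affine.
 exact: (@is_derive1_comp R (@smoothstep R) _ t _ _ (is_derive_smoothstep _) da).
have h1r (t : R) : 2^-1 <= t -> h1 t = 1 by move=> ?; apply: smoothstep_ge1; lra.
have h2l (t : R) : t <= 2^-1 -> h2 t = 0 by move=> ?; apply: smoothstep_le0; lra.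
pose g (t : R) := if t <= 2^-1 then g1 (h1 t) else g2 (h2 t).
have gl (t : R) : t <= 2^-1 -> g t = g1 (h1 t) by rewrite /g => ->.
have gr (t : R) : 2^-1 <= t -> g t = g2 (h2 t).
 rewrite /g le_eqVlt => /predU1P[<-|]; last by move=> h; rewrite leNgt h.
 by rewrite lexx h1r// h2l// g11 g20.
have G1 := C1_curve_comp C1 hC1; have G2 := C1_curve_comp C2 hC2.
pose k1 := g1 \o h1; pose k2 := g2 \o h2.
have nl (t : R) : t < 2^-1 -> {near t, k1 =1 g}.
 by move=> th; apply: filterS (lt_nbhsl th) => s sh; rewrite gl// ltW.
have nr (t : R) : 2^-1 < t -> {near t, k2 =1 g}.
 by move=> th; apply: filterS (lt_nbhsr th) => s sh; rewrite gr// ltW.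
have g12 : g 2^-1 = q by rewrite gl// h1r.
have G12 : k1 2^-1 = q by rewrite /k1 /= h1r.
have G22 : k2 2^-1 = q by rewrite /k2 /= h2l// g20.
have gC : C1_curve g.
 apply: C1_curve_intro => t.
  have [th|th|->] := ltgtP t 2^-1.
  - suff : g x @[x --> t] --> g t by [].
   rewrite -(nbhs_singleton (nl t th)).
   have c1 : k1 x @[x --> t] --> k1 t := G1.1 t.
   by apply: cvg_trans c1; apply: near_eq_cvg; exact: nl.
  - suff : g x @[x --> t] --> g t by [].
   rewrite -(nbhs_singleton (nr t th)).
   have c1 : k2 x @[x --> t] --> k2 t := G2.1 t.
   by apply: cvg_trans c1; apply: near_eq_cvg; exact: nr.
  suff : g x @[x --> (2^-1 : R)] --> g 2^-1 by [].
  rewrite g12 => A Aq; have c1 : nbhs (k1 2^-1) A -> nbhs (2^-1 : R) (k1 @^-1` A) := G1.1 (2^-1 : R) A.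
  have c2 : nbhs (k2 2^-1) A -> nbhs (2^-1 : R) (k2 @^-1` A) := G2.1 (2^-1 : R) A.
  rewrite G12 in c1; rewrite G22 in c2.
  apply: filterS2 (c1 Aq) (c2 Aq) => s; rewrite /= /g; by case: ifP.
 exists (chart_at (g t)); split; [exact: chart_at_atlas|exact: chart_at_dom|].
 have [th|th|E2] := ltgtP t 2^-1.
 - rewrite -(nbhs_singleton (nl t th)).
  apply: (C1at_eq _ (C1_curve_at G1 (chart_at_atlas _) (chart_at_dom (k1 t)))).
  by apply: filterS (nl t th) => s E; rewrite /= -E.
 - rewrite -(nbhs_singleton (nr t th)).
  apply: (C1at_eq _ (C1_curve_at G2 (chart_at_atlas _) (chart_at_dom (k2 t)))).
  by apply: filterS (nr t th) => s E; rewrite /= -E.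
 rewrite E2 g12; set phi := chart_at q; have at_ : atlas phi := chart_at_atlas q.
 have Dq : cdom phi q := chart_at_dom q.
 have j1 : C1at (cmap phi \o k1) 2^-1 by apply: C1_curve_at => //; rewrite G12.
 have j2 : C1at (cmap phi \o k2) 2^-1 by apply: C1_curve_at => //; rewrite G22.
 (* On each side of the junction one of the two pieces sits still at [q]; hence the chart expression
    is the sum of both pieces minus a constant, and no case analysis on derivatives is needed. *)
 have -> : cmap phi \o g = (fun s => (cmap phi \o k1) s + (cmap phi \o k2) s + cst (- cmap phi q) s).
  apply/funext => s; rewrite /k1 /k2 /=.
  have [sh|/ltW sh] := leP s 2^-1; first by rewrite gl// h2l// g20 addrK.
  by rewrite gr// h1r// g11 addrAC subrr add0r.
 exact: C1atD (C1atD j1 j2) (C1at_cst (- cmap phi q) 2^-1).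
have velE t : vel g t = 'D_1 h1 t *: vel g1 (h1 t) + 'D_1 h2 t *: vel g2 (h2 t).
 rewrite -(vel_comp C1 (hC1 t)) -(vel_comp C2 (hC2 t)) /vel.
 have -> : psi \o g = (psi \o (g1 \o h1)) + (psi \o (g2 \o h2)) + cst (- psi q).
  apply/funext => s; rewrite !fctE /=.
  have [sh|/ltW sh] := leP s 2^-1; first by rewrite gl// h2l// g20 addrK.
  by rewrite gr// h1r// g11 addrAC subrr add0r.
 have e1 := derivableP (C1at_der (curve_psi G1 t)); have e2 := derivableP (C1at_der (curve_psi G2 t)).
 have := is_deriveD (is_deriveD e1 e2) (is_derive_cst (- psi q) t (1 : R)).
 by rewrite addr0 => -[_ H].
have Dh1 t : 'D_1 h1 t = dsmoothstep (0 + 2 * t) * 2 by have [_ H] := dh 0 t.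
have Dh2 t : 'D_1 h2 t = dsmoothstep (-1 + 2 * t) * 2 by have [_ H] := dh (-1) t.
have Ld t : is_derive t (1 : R) (fun s => L1 (h1 s) + L2 (h2 s)) (speed g t).
 have j1 := @is_derive1_comp R L1 h1 t _ _ (d1 (h1 t)) (dh 0 t).
 have j2 := @is_derive1_comp R L2 h2 t _ _ (d2 (h2 t)) (dh (-1) t).
 apply: is_derive_eq (is_deriveD j1 j2) _; rewrite /speed velE Dh1 Dh2.
 have /andP[b1 _] := dsmoothstep_bound (0 + 2 * t); have /andP[b2 _] := dsmoothstep_bound (-1 + 2 * t).
 apply: enorm_alternate => //; have [th|th] := leP t 2^-1.
  by right; apply: dsmoothstep_out; left; lra.
 by left; apply: dsmoothstep_out; right; lra.
have g0 : g 0 = p by rewrite gl ?invr_ge0// /h1 mulr0 addr0 smoothstep_le0.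
have g1' : g 1 = r.
 rewrite gr; last by rewrite invf_le1// ler1n.
 by rewrite /h2 smoothstep_ge1//; lra.
apply: le_lt_trans (rdist_le gC g0 g1') _.
rewrite (curve_lengthE gC Ld) lte_fin.
have -> : h1 1 = 1 by rewrite /h1 smoothstep_ge1//; lra.
have -> : h1 0 = 0 by rewrite /h1 smoothstep_le0//; lra.
have -> : h2 1 = 1 by rewrite /h2 smoothstep_ge1//; lra.
have -> : h2 0 = 0 by rewrite /h2 smoothstep_le0//; lra.
lra.
Qed.

Lemma lip_rdist (f : M -> R) (C : R) : 0 <= C ->
 (forall g t, C1_curve g -> derivable (f \o g) t 1 /\ `|'D_1 (f \o g) t| <= C * speed g t) ->
 forall p q (a : R), (rdist psi p q < a%:E)%E -> `|f q - f p| <= C * a.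
Proof.
move=> C0 H p q a /rdist_lt[g [gC <- <-]]; have [L Ld] := speed_primitive gC.
rewrite (curve_lengthE gC Ld) lte_fin => /ltW la.
apply: le_trans (ler_wpM2l C0 la).
have CL t : is_derive t (1 : R) (fun s => C * L s) (C * speed g t).
 by have := @is_deriveZ R R R _ C t 1 _ (Ld t).
have D t := (H g t gC).1; have B t := (H g t gC).2.
have n1 t : 0 <= C * speed g t - 'D_1 (f \o g) t.
 by rewrite subr_ge0; apply: le_trans (B t); exact: ler_norm.
have n2 t : 0 <= C * speed g t + 'D_1 (f \o g) t.
 by move: (B t); rewrite ler_norml => /andP[b1 _]; lra.
have m1 := primitive_mono (fun t => is_deriveB (CL t) (derivableP (D t))) n1.
have m2 := primitive_mono (fun t => is_deriveD (CL t) (derivableP (D t))) n2.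
rewrite !fctE /= in m1 m2.
by rewrite ler_norml; apply/andP; split; lra.
Qed.

(** The linear function [<psi, v>] with [v] the displacement itself is Lipschitz along curves; this
    avoids differentiating a norm. *)
Lemma psi_lip p q (a : R) : (rdist psi p q < a%:E)%E -> enorm (psi q - psi p) <= a.
Proof.
move=> pq; set v := psi q - psi p; have [E|ne] := eqVneq (enorm v) 0.
 rewrite E; have : (0%:E < a%:E)%E := le_lt_trans (rdist_ge0 p q) pq.
 by rewrite lte_fin => /ltW.
have vp : 0 < enorm v by rewrite lt_neqAle eq_sym ne enorm_ge0.
have := @lip_rdist (fun w => dot (psi w) v) (enorm v) (ltW vp) _ p q a pq.
rewrite -dotNl -dotDl -/v -sqr_enorm.
have -> : `|enorm v ^+ 2| = enorm v * enorm v by rewrite ger0_norm ?sqr_ge0// expr2.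
rewrite ler_pM2l//; apply => g t gC; have P := C1at_der (curve_psi gC t).
have dd : is_derive t (1 : R) ((fun w => dot (psi w) v) \o g) (dot (vel g t) v).
 have -> : (fun w => dot (psi w) v) \o g = \sum_j (fun s => v 0 j * (psi \o g) s 0 j).
  by apply/funext => s; rewrite /= dotE fct_sumE; apply: eq_bigr => j _; rewrite mulrC.
 have H j : is_derive t (1 : R) (fun s => v 0 j * (psi \o g) s 0 j) (v 0 j * vel g t 0 j).
  have /derivable_mxP/(_ 0 j) d := P.
  have := @is_deriveZ R R R _ (v 0 j) t 1 _ (derivableP d).
  by rewrite -(derive_row j P).
 have := is_derive_sum (fun j => H j).
 by move=> HH; apply: is_derive_eq HH _; rewrite dotE; apply: eq_bigr => j _; rewrite mulrC.
split; first by have [] := dd.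
have [_ ->] := dd; rewrite mulrC; exact: dot_CS.
Qed.

(** The coordinate segment is traversed with [smoothstep], which is constant outside [[0, 1]] and
    keeps the curve in the box for all times; its slope bound accounts for the factor 2. *)
Lemma rdist_segment phi c r u v (K : R) : atlas phi -> 0 <= K -> box c r `<=` crange phi ->
 box c r u -> box c r v ->
 (forall w, box c r w -> enorm ((v - u) *m jac (psi \o cinv phi) w) <= K) ->
 (rdist psi (cinv phi u) (cinv phi v) <= (2 * K)%:E)%E.
Proof.
move=> at_ K0 sub bu bv HK; pose l (t : R) := u + smoothstep t *: (v - u).
have bl t : box c r (l t) by apply: box_convex => //; exact: smoothstep01.
have dl_ t : is_derive t (1 : R) l (dsmoothstep t *: (v - u)).
 have dj j : is_derive t (1 : R) (fun s => l s 0 j) (dsmoothstep t * (v - u) 0 j).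
  have := is_deriveD (is_derive_cst (u 0 j) t (1 : R)) (@is_deriveZ R R R _ ((v - u) 0 j) t 1 _ (is_derive_smoothstep t)).
  rewrite add0r /GRing.scale /= mulrC; congr (is_derive _ _ _ _).
  by apply/funext => s; rewrite !fctE /l !mxE mulrC.
 have d : derivable l t 1 by apply: derivable_row => j; have [] := dj j.
 apply: is_derive_eq (derivableP d) _; apply/rowP => j; rewrite derive_row// mxE.
 by have [_ ->] := dj j.
have lC t : C1at l t.
 apply: (@C1atI _ _ _ (fun s => dsmoothstep s *: (v - u))).
  by apply: (@filterS _ (nbhs t) _ setT) filterT.
 by apply: cvgZr_tmp; exact: dsmoothstep_continuous.
pose g := cinv phi \o l.
have gD t : cdom phi (g t) by apply: cinv_dom; apply: sub.
have cg : cmap phi \o g = l by apply/funext => t; rewrite /= cinvK//; exact: sub.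
have gC : C1_curve g.
 apply: C1_curve_intro; last by move=> t; exists phi; rewrite cg.
 move=> t; apply: continuous_comp; first exact: C1at_continuous (lC t).
 by apply: cinv_continuous; exact: sub.
have [L Ld] := speed_primitive gC.
have g0 : g 0 = cinv phi u by rewrite /g /= /l smoothstep_le0// scale0r addr0.
have g1 : g 1 = cinv phi v by rewrite /g /= /l smoothstep_ge1// scale1r addrC subrK.
rewrite -g0 -g1; apply: le_trans (rdist_le gC erefl erefl) _.
rewrite (curve_lengthE gC Ld) lee_fin.
have [x _ ->] := mvt0 ler01 (fun x (_ : 0 <= x <= 1) => Ld x); rewrite mulr1.
have -> : speed g x = enorm (dsmoothstep x *: ((v - u) *m jac (psi \o cinv phi) (l x))).
 congr enorm; apply/rowP => k; rewrite (vel_chart k gC at_ (gD x)) cg.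
 by have [_ ->] := dl_ x; rewrite -scalemxAl [cmap phi _]cinvK//; exact: sub.
have /andP[s0 s2] := dsmoothstep_bound x; rewrite enormZ ger0_norm//.
by apply: ler_pM => //; [exact: enorm_ge0|exact: HK].
Qed.

Lemma near_rdist p (e : R) : 0 < e ->
 exists2 W : set M, nbhs p W & forall q q', W q -> W q' -> (rdist psi q q' < e%:E)%E.
Proof.
move=> e0; pose phi := chart_at p; have at_ : atlas phi := chart_at_atlas p.
have Dp : cdom phi p := chart_at_dom p; pose c := cmap phi p.
pose J := jac (psi \o cinv phi).
have ex (a : 'I_m) (k : 'I_n) : \forall w \near c, `|J c a k - J w a k| <= 1.
 apply: continuous_near ltr01.
 have S0 := Sk_partial a (xx_smooth imm 1 k at_).
 have := Sk_cont S0 (crange_cmap Dp); apply: continuous_at_eq (open_crange phi) (crange_cmap Dp) _.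
 by move=> w; rewrite inE => rw; rewrite /J (jacE imm).
have /nbhs_box[r r0 Hr] : nbhs c (crange phi `&` [set w | forall a k, `|J c a k - J w a k| <= 1]).
 apply: filterI; first exact: open_nbhs_nbhs (conj (open_crange phi) (crange_cmap Dp)).
 apply: (@filter_forall V 'I_m (fun a w => forall k, `|J c a k - J w a k| <= 1) (nbhs c) _) => a.
 by apply: (@filter_forall V 'I_n (fun k w => `|J c a k - J w a k| <= 1) (nbhs c) _) => k; exact: ex.
pose B := \sum_k \sum_a (`|J c a k| + 1).
have B0 : 0 <= B by apply: sumr_ge0 => k _; apply: sumr_ge0 => a _; rewrite addr_ge0.
(* Two points of the box of size [s] differ by at most [2 * s] in each coordinate; [rdist_segment]
   then bounds their distance by [4 * s * B], which is less than [e]. *)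
pose s := Num.min r (e / (8 * (B + 1))).
have B1 : 0 < 8 * (B + 1) by rewrite mulr_gt0// ltr_wpDl.
have s0 : 0 < s by rewrite lt_min r0 divr_gt0.
have sr : s <= r by rewrite ge_min lexx.
have se : s * (8 * (B + 1)) <= e by rewrite -ler_pdivlMr// ge_min lexx orbT.
have sB : box c s `<=` box c r by move=> w H a; apply: le_trans (H a) sr.
exists (cdom phi `&` cmap phi @^-1` box c s).
 by apply: cmap_nbhs => //; exact: box_nbhs.
move=> q q' [Dq bq] [Dq' bq'].
rewrite -(cmapK' Dq) -(cmapK' Dq'); apply: le_lt_trans (rdist_segment (c := c) (r := s) (K := 2 * s * B) at_ _ _ bq bq' _) _.
- by rewrite mulr_ge0// mulr_ge0// ltW.
- by move=> w /sB/Hr[].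
- move=> w /sB/Hr[_ Hw]; apply: le_trans (enorm_le_sum _) _.
 rewrite mulr_sumr; apply: ler_sum => k _; rewrite mxE; apply: le_trans (ler_norm_sum _ _ _) _.
 rewrite mulr_sumr; apply: ler_sum => a _; rewrite normrM; apply: ler_pM => //.
  rewrite !mxE; have := bq a; have := bq' a; rewrite /= !ler_norml => /andP[? ?] /andP[? ?].
  by apply/andP; split; lra.
 have := Hw a k; rewrite distrC => h; rewrite -/J -[J w a k](subrK (J c a k)).
 by apply: le_trans (ler_normD _ _) _; rewrite addrC lerD2l.
- rewrite lte_fin; apply: lt_le_trans se; nra.
Qed.

Lemma continuous_compact_bounded (T : topologicalType) (f : T -> R) (K : set T) : continuous f -> compact K ->
 exists2 C : R, 0 <= C & forall x, K x -> `|f x| <= C.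
Proof.
move=> fc Kc; have [C [_ H]] := compact_bounded (within_compact (fun u _ => fc u) Kc).
exists (`|C| + 1); first by rewrite addr_ge0.
move=> x Kx; apply: (H (`|C| + 1)); last by exists x.
by apply: le_lt_trans (ler_norm C) _; rewrite ltrDl.
Qed.

Lemma grad_bounded (f : M -> R) (K : set M) : CM 1 f -> compact K -> (forall p, ~ K p -> f p = 0) ->
 exists2 C : R, 0 <= C & forall k p, `|dl psi k f p| <= C.
Proof.
move=> fS Kc f0; have Kcl := compact_closed (@carrier_hausdorff _ _ M) Kc.
have H k : exists2 C : R, 0 <= C & forall p, K p -> `|dl psi k f p| <= C.
 exact: continuous_compact_bounded (CM_continuous (dl_smooth imm k fS)) Kc.
have Hx k : {C : R | 0 <= C /\ forall p, K p -> `|dl psi k f p| <= C}.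
 by apply: cid; have [C C0 HC] := H k; exists C.
exists (\sum_k projT1 (Hx k)); first by apply: sumr_ge0 => k _; exact: (projT2 (Hx k)).1.
move=> k p; have [Kp|nKp] := pselect (K p).
 apply: le_trans ((projT2 (Hx k)).2 p Kp) _.
 by rewrite (bigD1 k)//= lerDl sumr_ge0// => i _; exact: (projT2 (Hx i)).1.
have -> : dl psi k f p = dl psi k (cst 0) p.
 apply: (@dl_eq _ _ _ _ psi k f (cst 0) (~` K) p (closed_openC Kcl) nKp) => q.
 by rewrite inE => /f0.
by rewrite dl_cst normr0; apply: sumr_ge0 => i _; exact: (projT2 (Hx i)).1.
Qed.

Lemma lip_grad (f : M -> R) (C : R) : CM 1 f -> 0 <= C -> (forall k p, `|dl psi k f p| <= C) ->
 forall p q (a : R), (rdist psi p q < a%:E)%E -> `|f q - f p| <= n%:R * C * a.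
Proof.
move=> fS C0 H; apply: lip_rdist => [|g t gC]; first by rewrite mulr_ge0.
have := curve_fun t gC fS => -[fd fD]; split=> //; rewrite fD.
apply: le_trans (ler_norm_sum _ _ _) _.
have -> : n%:R * C * speed g t = \sum_(k < n) C * speed g t.
 by rewrite sumr_const card_ord -[RHS]mulr_natl mulrA.
apply: ler_sum => k _; rewrite normrM mulrC; apply: ler_pM => //.
exact: coord_le_enorm.
Qed.

(** A bump function with value 1 at [p] and support in the coordinate image of [W] has bounded
    gradient, hence is Lipschitz for the distance; points close to [p] in distance cannot have left
    its support. *)
Lemma rdist_ball p (W : set M) : nbhs p W -> exists2 e : R, 0 < e & forall q, (rdist psi p q < e%:E)%E -> W q.
Proof.
move=> Wp; pose phi := chart_at p; have at_ : atlas phi := chart_at_atlas p.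
have Dp : cdom phi p := chart_at_dom p; pose c := cmap phi p.
have Wc : nbhs c [set u | W (cinv phi u)].
 have := @cinv_continuous _ _ _ phi c (crange_cmap Dp); apply; by rewrite /c cmapK'.
have /nbhs_box[r r0 Hr] : nbhs c (crange phi `&` [set u | W (cinv phi u)]).
 apply: filterI => //; exact: open_nbhs_nbhs (conj (open_crange phi) (crange_cmap Dp)).
have sub : box c r `<=` crange phi by move=> u /Hr[].
pose b := bump phi c r; have bS : CM 1 b := bump_smooth at_ r0 sub.
have [C C0 HC] := grad_bounded bS (box_image_compact (box34 r0 sub)) (fun p => @bump_out _ _ _ phi c r r0 p).
have C1 : 0 < n%:R * C + 1 by rewrite ltr_wpDl// mulr_ge0.
exists (n%:R * C + 1)^-1; first by rewrite invr_gt0.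
move=> q /(lip_grad bS C0 HC) H.
have bp : b p = 1.
 apply: bump1 => // a; rewrite /c subrr normr0 divr_ge0//; exact: ltW.
have bq : b q != 0.
 apply/eqP => bq; move: H; rewrite bq bp sub0r normrN1 leNgt => /negP; apply.
 by rewrite ltr_pdivrMr// mul1r ltrDl.
have [Dq Hq] := bump_supp r0 bq; rewrite -(cmapK' Dq).
by apply: (Hr _ _).2 => a; apply: le_trans (Hq a) _; lra.
Qed.

End Curves.

Lemma dep_choice (T : Type) (Q : nat -> T -> Prop) (S : nat -> T -> T -> Prop) x0 : Q 0%N x0 ->
 (forall k y, Q k y -> exists y', S k y y' /\ Q k.+1 y') ->
 exists x : nat -> T, x 0%N = x0 /\ forall k, Q k (x k) /\ S k (x k) (x k.+1).
Proof.
move=> Q0 H.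
pose step k y := if pselect (exists y', S k y y' /\ Q k.+1 y') is left h then projT1 (cid h) else y.
pose x := fix x k := if k is k'.+1 then step k' (x k') else x0.
have Sx k : Q k (x k) -> S k (x k) (x k.+1) /\ Q k.+1 (x k.+1).
 move=> /H h; rewrite /= /step; case: pselect => // h'; exact: (projT2 (cid h')).
have Qx k : Q k (x k) by elim: k => // k /Sx[].
by exists x; split=> // k; split; [exact: Qx|exact: (Sx k (Qx k)).1].
Qed.

(** If [P] failed for [K], the complements in [K] of the sets satisfying [P] would generate a proper
    filter, and a cluster point would contradict the local assumption. *)
Lemma compact_induction (T : topologicalType) (K : set T) (P : set T -> Prop) : compact K -> P set0 ->
 (forall A B : set T, A `<=` B -> P B -> P A) -> (forall A B, P A -> P B -> P (A `|` B)) ->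
 (forall p, K p -> exists2 W, nbhs p W & P W) -> P K.
Proof.
move=> Kc P0 Psub PU Ploc; apply: contrapT => nPK.
pose F : set_system T := [set B | exists2 A, P A & K `\` A `<=` B].
have FF : ProperFilter F.
 split.
  move=> [A PA KA]; apply: nPK; apply: Psub PA => p Kp; apply: contrapT => nA.
  exact: (KA p (conj Kp nA)).
 split.
 - by exists set0.
 - move=> B C [A1 P1 H1] [A2 P2 H2]; exists (A1 `|` A2); first exact: PU.
  by move=> p [Kp nA]; split; [apply: H1|apply: H2]; split=> // h; apply: nA; [left|right].
 - by move=> B C BC [A PA H]; exists A => // p /H/BC.
have [|p [Kp pF]] := Kc F FF; first by exists set0 => // p [].
have [W Wp PW] := Ploc p Kp.
by have [|q [[_ nW] Wq]] := pF (K `\` W) W _ Wp; first by exists W.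
Qed.

(** * Descent in a complete space by Ekeland's principle *)

Section Descent.
Variables (R : realType) (T : Type) (S : T -> Prop) (f : T -> R) (nr : T -> T -> R -> Prop).
Variables (C K : R).
Hypothesis C0 : 0 <= C.
Hypothesis K0 : 0 <= K.
Hypothesis f0 : forall x, S x -> 0 <= f x.
Hypothesis nr_refl : forall x a, 0 < a -> nr x x a.
Hypothesis nr_tri : forall x y z a b, nr x y a -> nr y z b -> nr x z (a + b).
Hypothesis nr_sym : forall x y a, nr x y a -> nr y x a.
Hypothesis nr_le : forall x y a b, nr x y a -> a <= b -> nr x y b.
Hypothesis f_lip : forall x y a, nr x y a -> `|f x - f y| <= C * a.
Hypothesis compl : forall x : nat -> T, (forall k, S (x k)) ->
 (forall e, 0 < e -> exists k, forall i j, (k <= i)%N -> (k <= j)%N -> nr (x i) (x j) e) ->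
 exists2 p, S p & forall e, 0 < e -> exists k, forall i, (k <= i)%N -> nr (x i) p e.
Hypothesis step : forall x, S x -> 0 < f x ->
 exists y, [/\ S y, f y < f x & nr x y (K * (f x - f y))].

(** Points reachable from [x] at cost at most [K] times the decrease of [f] form a transitive
    relation. A sequence that at each step nearly minimizes [f] among reachable points is Cauchy,
    and from its limit no further step of the assumed kind is possible. *)
Lemma descent x0 : S x0 -> exists2 x, S x & f x = 0.
Proof.
move=> S0.
(* The slack [e] makes the relation reflexive although [nr] stands for a strict bound on the
   distance. *)
pose Rel x y := [/\ S y, f y <= f x & forall e, 0 < e -> nr x y (K * (f x - f y) + e)].
have Rrefl x : S x -> Rel x x.
 by split=> // e e0; rewrite subrr mulr0 add0r; exact: nr_refl.
have Rtr x y z : Rel x y -> Rel y z -> Rel x z.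
 move=> [Sy xy H1] [Sz yz H2]; split=> //; first exact: le_trans yz xy.
 move=> e e0; have e20 : 0 < e / 2 by rewrite divr_gt0.
 by apply: (nr_le (nr_tri (H1 _ e20) (H2 _ e20))); lra.
(* The next point closes at least half of the gap between [f x] and the infimum over reachable
   points. *)
pose Next x y := Rel x y /\ forall z, Rel x z -> f y <= (f x + f z) / 2.
have ex x : S x -> exists y, Next x y.
 move=> Sx; pose E := [set f z | z in Rel x].
 have hE : has_inf E.
  split; first by exists (f x); exists x => //; exact: Rrefl.
  by exists 0 => _ [z [Sz _ _] <-]; exact: f0.
 have Ele z : Rel x z -> inf E <= f z by move=> Rz; apply: (ge_inf hE.2); exists z.
 have [le|lt] := leP (f x) (inf E).
  exists x; split; first exact: Rrefl.
  by move=> z /Ele h; have := le_trans le h; lra.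
 have e0 : 0 < (f x - inf E) / 2 by rewrite divr_gt0// subr_gt0.
 have [_ [y Ry <-] ylt] := inf_adherent e0 hE.
 by exists y; split=> // z /Ele h; lra.
have [|x [x0E Hx]] := @dep_choice T (fun _ => S) (fun _ => Next) x0 S0.
 by move=> k y /ex[y' [h1 h2]]; exists y'; split=> //; have [] := h1.
have Sx k := (Hx k).1.
have Rij i j : Rel (x i) (x (i + j)%N).
 elim: j => [|j IH]; first by rewrite addn0; exact: Rrefl.
 rewrite addnS; exact: Rtr IH (Hx _).2.1.
have Rle i j : (i <= j)%N -> Rel (x i) (x j) by move=> /subnKC <-.
pose E := [set f (x k) | k in [set: nat]].
have hE : has_inf E.
 by split; [exists (f (x 0%N)); exists 0%N|exists 0 => _ [k _ <-]; exact: f0].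
pose l := inf E.
have lle k : l <= f (x k) by apply: (ge_inf hE.2); exists k.
have lnear (e : R) : 0 < e -> exists k, forall i, (k <= i)%N -> f (x i) < l + e.
 move=> e0; have [_ [k _ <-] h] := inf_adherent e0 hE; exists k => i ki.
 by have [_ h2 _] := Rle _ _ ki; exact: le_lt_trans h2 h.
have cau (e : R) : 0 < e -> exists k, forall i j, (k <= i)%N -> (k <= j)%N -> nr (x i) (x j) e.
 move=> e0; have d0 : 0 < e / 2 / (K + 1) by rewrite !divr_gt0// ltr_wpDl.
 have [k Hk] := lnear _ d0; exists k.
 have H i j : (k <= i)%N -> (i <= j)%N -> nr (x i) (x j) e.
  move=> ki ij; have [_ _ h] := Rle _ _ ij; have e20 : 0 < e / 2 by rewrite divr_gt0.
  apply: (nr_le (h _ e20)); have h1 := Hk _ ki; have h2 := lle j.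
  have h3 : f (x i) - f (x j) <= e / 2 / (K + 1) by lra.
  have h4 := ler_wpM2l K0 h3.
  have h5 : K * (e / 2 / (K + 1)) <= e / 2.
   rewrite mulrA ler_pdivrMr ?ltr_wpDl// mulrC ler_pM2l//; lra.
  lra.
 move=> i j ki kj; have [ij|/ltnW ji] := leqP i j; first exact: H.
 by apply: nr_sym; exact: H.
have [p Sp Hp] := compl Sx cau.
have fp : f p = l.
 have key (e : R) : 0 < e -> `|f p - l| <= (C + 1) * e.
  move=> e0; have [k1 h1] := Hp _ e0; have [k2 h2] := lnear _ e0.
  have := f_lip (h1 _ (leq_maxl k1 k2)); have := h2 _ (leq_maxr k1 k2); have := lle (maxn k1 k2).
  move: (f (x (maxn k1 k2))) => y; rewrite !ler_norml => h3 h4 /andP[h5 h6].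
  by apply/andP; split; lra.
 apply/eqP; rewrite -subr_eq0 -normr_le0; apply/ler_addgt0Pl => e e0; rewrite addr0.
 have C1 : 0 < C + 1 by rewrite ltr_wpDl.
 have := key (e / (C + 1)); rewrite divr_gt0// => /(_ isT).
 by rewrite mulrC divfK// gt_eqF.
have Rp k : Rel (x k) p.
 split=> //; first by rewrite fp; exact: lle.
 move=> e e0; have e20 : 0 < e / 2 by rewrite divr_gt0.
 have [k1 h1] := Hp _ e20; have km := leq_maxl k k1.
 have [_ _ h2] := Rle _ _ km.
 apply: (nr_le (nr_tri (h2 _ e20) (h1 _ (leq_maxr k k1)))).
 have h3 : f p <= f (x (maxn k k1)) by rewrite fp.
 have h4 : K * (f (x k) - f (x (maxn k k1))) <= K * (f (x k) - f p) by apply: ler_wpM2l => //; lra.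
 lra.
exists p => //; apply/eqP; apply: contrapT => /negP fp0.
have fpp : 0 < f p.
 by rewrite lt_neqAle f0// andbT eq_sym.
have [y [Sy yp ny]] := step Sp fpp.
have Rpy : Rel p y.
 by split=> //; [exact: ltW|move=> e e0; apply: (nr_le ny); rewrite lerDl ltW].
(* [y] is reachable from every [x k] through [p], so halving gives
   [2 * f (x k.+1) <= f (x k) + f y]. With [l <= f (x k.+1)] the values stay above [l] by the fixed
   amount [l - f y]. *)
have key k : 2 * l - f y <= f (x k).
 have := (Hx k).2.2 _ (Rtr _ _ _ (Rp k) Rpy); have := lle k.+1; lra.
have e0 : 0 < l - f y by rewrite subr_gt0 -fp.
have [k /(_ k (leqnn k)) h] := lnear _ e0.
by have := key k; lra.
Qed.
End Descent.

(** * Precompactness of balls and Lipschitz cutoffs *)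

Section HopfRinow.
Variables (R : realType) (m n : nat) (M : manifold R m) (psi : M -> 'rV[R]_n).
Hypothesis imm : immersion psi.
Implicit Types (p q o : M) (r : R).
Notation rd := (rdist psi).

Definition dball p r : set M := [set q | (rd p q < r%:E)%E].
Definition precompact (B : set M) := exists2 K, compact K & B `<=` K.

Lemma rdist_refl p r : 0 < r -> (rd p p < r%:E)%E.
Proof.
by move=> /(near_rdist imm p)[W Wp]; apply; exact: nbhs_singleton.
Qed.

Lemma rdist_le_lt p q r s : (rd p q < r%:E)%E -> r <= s -> (rd p q < s%:E)%E.
Proof. by move=> h rs; apply: lt_le_trans h _; rewrite lee_fin. Qed.

Lemma precompact0 : precompact set0.
Proof. by exists set0 => //; exact: compact0. Qed.

Lemma precompact_sub A B : A `<=` B -> precompact B -> precompact A.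
Proof. by move=> AB [K Kc BK]; exists K => // p /AB/BK. Qed.

Lemma precompactU A B : precompact A -> precompact B -> precompact (A `|` B).
Proof. by move=> [K Kc AK] [L Lc BL]; exists (K `|` L); [exact: compactU|exact: setUSS]. Qed.

Lemma near_precompact p : exists2 W, nbhs p W & precompact W.
Proof.
pose phi := chart_at p; have Dp : cdom phi p := chart_at_dom p.
have [r r0 Hr] := nbhs_box (open_nbhs_nbhs (conj (open_crange phi) (crange_cmap Dp))).
exists (cdom phi `&` (cmap phi @^-1` box (cmap phi p) r)).
 by apply: cmap_nbhs => //; exact: box_nbhs.
exists (cinv phi @` box (cmap phi p) r); first exact: box_image_compact.
by move=> q [Dq bq]; exists (cmap phi q) => //; exact: cmapK'.
Qed.

(** On a nearly shortest curve the intermediate point is taken at arc length [t - d / 8]; less than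
    [5 / 8 * d] then remains to be covered. *)
Lemma rdist_split x z (t d : R) : 0 < d -> (rd x z < (t + d / 2)%:E)%E ->
 exists2 y, y = x \/ (rd x y < t%:E)%E & (rd y z < (3 / 4 * d)%:E)%E.
Proof.
move=> d0 xz; have [td|td] := leP t (d / 8).
 by exists x; [left|apply: rdist_le_lt xz _; lra].
have [xzt|xzt] := ltP (rd x z) t%:E.
 by exists z; [right|apply: rdist_refl; lra].
have [g [gC g0 g1]] := rdist_lt xz; have [L Ld] := speed_primitive imm gC.
rewrite (curve_lengthE imm gC Ld) lte_fin => Llt.
have Lge : t <= L 1 - L 0.
 rewrite -lee_fin; apply: le_trans xzt _; rewrite -(curve_lengthE imm gC Ld); exact: rdist_le.
have Lc : {within `[0, 1], continuous L}.
 apply: continuous_subspaceT => s; apply/differentiable_continuous/derivable1_diffP.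
 by have [] := Ld s.
have v : Num.min (L 0) (L 1) <= L 0 + t - d / 8 <= Num.max (L 0) (L 1).
 by rewrite min_l ?max_r; [apply/andP; split; lra|lra|lra].
have [s s01 Es] := IVT ler01 Lc v.
exists (g s).
 right; rewrite -g0; apply: le_lt_trans (rdist_sub_curve imm 0 s gC Ld) _.
 rewrite lte_fin Es; have -> : L 0 + t - d / 8 - L 0 = t - d / 8 by ring.
 by rewrite ger0_norm; lra.
rewrite -g1; apply: le_lt_trans (rdist_sub_curve imm s 1 gC Ld) _.
by rewrite lte_fin Es ger0_norm; lra.
Qed.

Lemma dball_le0 x r : r <= 0 -> dball x r = set0.
Proof.
move=> r0; apply/seteqP; split=> // y; rewrite /dball /= => h.
have := le_lt_trans (rdist_ge0 psi x y) h; rewrite lte_fin; lra.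
Qed.

(** Otherwise every point of the ball has a precompact ball of radius [d], and a precompact ball of
    radius [t <= r] around [x] could be enlarged by [d / 2]; the supremum of such [t] would then
    pass [r]. *)
Lemma dball_split x r (d : R) : 0 < d -> ~ precompact (dball x r) ->
 exists2 y, (rd x y < r%:E)%E & ~ precompact (dball y d).
Proof.
move=> d0 npre; apply: contrapT => H.
have r0 : 0 < r.
 by rewrite ltNge; apply/negP => r0; apply: npre; rewrite dball_le0//; exact: precompact0.
have pre y : (rd x y < r%:E)%E -> precompact (dball y d).
 by move=> xy; apply: contrapT => h; apply: H; exists y.
have grow (t : R) : t <= r -> precompact (dball x t) -> precompact (dball x (t + d / 2)).
 move=> tr [K Kc HK].
 pose P (A : set M) := precompact [set z | exists y, [/\ A y, (rd x y < t%:E)%E & (rd y z < (3 / 4 * d)%:E)%E]].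
 have PK : P K.
  apply: compact_induction Kc _ _ _ _.
  - by apply: precompact_sub precompact0 => z [y []].
  - by move=> A B AB; apply: precompact_sub => z [y [/AB Ay h1 h2]]; exists y.
  - move=> A B PA PB; apply: precompact_sub (precompactU PA PB) => z [y [[Ay|By] h1 h2]].
    by left; exists y.
   by right; exists y.
  (* As [d / 4 + 3 / 4 * d = d], the balls around all relevant points of one small set lie in a
     single ball of radius [d], which is precompact. *)
  - move=> p Kp; have d4 : 0 < d / 4 by rewrite divr_gt0.
   have [W Wp HW] := near_rdist imm p d4; exists W => //.
   have [[y0 [Wy xy]]|nex] := pselect (exists y, W y /\ (rd x y < t%:E)%E).
    have := pre _ (rdist_le_lt xy tr); apply: precompact_sub => z [y [Wy' _ yz]].
    by apply: rdist_le_lt (rdist_tri_lt imm (HW _ _ Wy Wy') yz) _; lra.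
   by apply: precompact_sub precompact0 => z [y [Wy xy _]]; apply: nex; exists y.
 have xx := pre x (rdist_refl x r0).
 apply: precompact_sub (precompactU xx PK) => z /(rdist_split d0)[y [->|xy] yz].
  by left; apply: rdist_le_lt yz _; lra.
 by right; exists y; split=> //; exact: HK.
pose E := [set t : R | t <= r /\ precompact (dball x t)].
have hE : has_sup E.
 split; last by exists r => t [].
 by exists 0; split; [exact: ltW|rewrite dball_le0//; exact: precompact0].
have d4 : 0 < d / 4 by rewrite divr_gt0.
have [t [tr pt] lt] := sup_adherent d4 hE.
have pt' := grow t tr pt; have [tr'|tr'] := leP (t + d / 2) r.
 have : E (t + d / 2) by [].
 move=> /(ub_le_sup hE.2); lra.
apply: npre; apply: precompact_sub pt' => z xz; apply: rdist_le_lt xz _; exact: ltW.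
Qed.

Hypothesis M_complete : complete_immersion psi.

Lemma half_pow_small (a e : R) : 0 < e -> exists k, forall i, (k <= i)%N -> a / 2 ^+ i < e.
Proof.
move=> e0; exists (Num.bound `|a / e|) => i ki.
have h1 : a / e < (Num.bound `|a / e|)%:R.
 by apply: le_lt_trans (ler_norm _) _; exact: archi_boundP (normr_ge0 _).
have h2 : (Num.bound `|a / e|)%:R <= 2 ^+ i :> R.
 by rewrite -natrX ler_nat (leq_trans ki)// ltnW// ltn_expl.
rewrite ltr_pdivrMr ?exprn_gt0// mulrC -ltr_pdivrMr//; exact: lt_le_trans h1 h2.
Qed.

(** Repeated use of [dball_split] with halved radii gives a Cauchy sequence of centres of balls that
    are not precompact; near its limit these small balls enter a precompact neighbourhood. *)
Lemma dball_precompact o r : precompact (dball o r).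
Proof.
apply: contrapT => npre.
have r0 : 0 < r.
 by rewrite ltNge; apply/negP => r0; apply: npre; rewrite dball_le0//; exact: precompact0.
pose rk k := r / 2 ^+ k.
have rk0 k : 0 < rk k by rewrite divr_gt0// exprn_gt0.
have rkS k : rk k.+1 = rk k / 2 by rewrite /rk exprS; field; rewrite expf_neq0// pnatr_eq0.
have [||x [xo Hx]] := @dep_choice M (fun k y => ~ precompact (dball y (rk k)))
 (fun k y y' => (rd y y' < (rk k)%:E)%E) o.
- by rewrite /rk expr0 divr1.
- by move=> k y /(dball_split (rk0 k.+1))[y' h1 h2]; exists y'.
(* A telescoped geometric sum: subtracting [2 * rk (i + j)] is what makes the induction on [j]
   close. *)
have dij i j : (rd (x i) (x (i + j)%N) < (3 * rk i - 2 * rk (i + j)%N)%:E)%E.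
 elim: j => [|j IH].
  by rewrite addn0; apply: rdist_refl; have := rk0 i; lra.
 rewrite addnS; have := rdist_tri_lt imm IH (Hx (i + j)%N).2.
 by move=> h; apply: rdist_le_lt h _; rewrite rkS; have := rk0 (i + j)%N; lra.
have dle i j : (i <= j)%N -> (rd (x i) (x j) < (3 * rk i)%:E)%E.
 move=> /subnKC <-; apply: rdist_le_lt (dij i _) _; have := rk0 (i + (j - i))%N; lra.
have [p Hp] : exists p, forall e : R, 0 < e -> exists k : nat, forall i : nat,
   (k <= i)%N -> (rd (x i) p < e%:E)%E.
 apply: M_complete => e e0; have e30 : 0 < e / 3 by rewrite divr_gt0.
 have [k Hk] := half_pow_small r e30; exists k.
 have H i j : (k <= i)%N -> (i <= j)%N -> (rd (x i) (x j) < e%:E)%E.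
  by move=> ki ij; apply: rdist_le_lt (dle _ _ ij) _; have := Hk _ ki; rewrite -/(rk i); lra.
 move=> i j ki kj; have [ij|/ltnW ji] := leqP i j; first exact: H.
 by apply: (rdist_sym_lt imm); exact: H.
have [W Wp preW] := near_precompact p.
have [e e0 He] := rdist_ball imm Wp.
have e20 : 0 < e / 2 by rewrite divr_gt0.
have [k1 h1] := Hp _ e20; have [k2 h2] := half_pow_small r e20.
have l1 := h1 _ (leq_maxl k1 k2); have l2 := h2 _ (leq_maxr k1 k2).
apply: (Hx (maxn k1 k2)).1; apply: precompact_sub preW => q xq; apply: He.
have := rdist_tri_lt imm (rdist_sym_lt imm l1) xq.
by move=> h; apply: rdist_le_lt h _; rewrite /rk; lra.
Qed.

Section Cutoff.
Variables (o : M) (T : R).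
Hypothesis T0 : 0 < T.

(** Truncation at [T] makes the extended-real distance finite, so that [fine] loses nothing here. *)
Definition dcut p : R := fine (Order.min (rd o p) T%:E).
Definition cutoff p : R := 1 - dcut p / T.

Lemma dcutE p : ((dcut p)%:E = Order.min (rd o p) T%:E)%E.
Proof.
rewrite fineK// ge0_fin_numE.
 by rewrite gt_min ltry orbT.
by rewrite le_min rdist_ge0 lee_fin ltW.
Qed.

Lemma dcut0T p : 0 <= dcut p <= T.
Proof.
rewrite -!lee_fin dcutE le_min rdist_ge0 lee_fin ltW//=.
by rewrite ge_min lexx orbT.
Qed.

Lemma dcut_le p a : (rd o p < a%:E)%E -> dcut p <= a.
Proof. by move=> /ltW h; rewrite -lee_fin dcutE ge_min h. Qed.

Lemma dcut_lt p a : dcut p < a -> a <= T -> (rd o p < a%:E)%E.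
Proof.
rewrite -lte_fin dcutE gt_min => /orP[//|]; rewrite lte_fin => h1 h2.
by have := lt_le_trans h1 h2; rewrite ltxx.
Qed.

Lemma dcut_lip p q a : (rd p q < a%:E)%E -> dcut q <= dcut p + a.
Proof.
move=> pq; apply/ler_addgt0Pr => e e0.
have a0 : 0 < a.
 by have := le_lt_trans (rdist_ge0 psi p q) pq; rewrite lte_fin.
have [h|h] := leP (dcut p + e) T.
 have pe : (rd o p < (dcut p + e)%:E)%E by apply: dcut_lt => //; rewrite ltrDl.
 by have := dcut_le (rdist_tri_lt imm pe pq); lra.
by have /andP[_] := dcut0T q; lra.
Qed.

Lemma cutoff01 p : 0 <= cutoff p <= 1.
Proof.
have /andP[h1 h2] := dcut0T p.
rewrite /cutoff subr_ge0 ler_pdivrMr// mul1r h2 lerBlDr lerDl.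
by rewrite divr_ge0// ltW.
Qed.

Lemma cutoff_supp p : cutoff p != 0 -> dball o T p.
Proof.
move=> h; apply: dcut_lt => //; rewrite lt_neqAle (andP (dcut0T p)).2 andbT.
by apply: contraNneq h; rewrite /cutoff => ->; rewrite divff ?subrr// gt_eqF.
Qed.

Lemma cutoff_lip p q a : (rd p q < a%:E)%E -> `|cutoff p - cutoff q| <= a / T.
Proof.
move=> pq; have h1 := dcut_lip pq; have h2 := dcut_lip (rdist_sym_lt imm pq).
have -> : cutoff p - cutoff q = (dcut q - dcut p) / T by rewrite /cutoff; ring.
rewrite normrM normfV (gtr0_norm T0) ler_pM2r ?invr_gt0// ler_norml.
by apply/andP; split; lra.
Qed.

Lemma cutoff_half p : (rd o p < (T / 2)%:E)%E -> 2^-1 <= cutoff p.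
Proof.
move=> /dcut_le h; rewrite /cutoff; suff : dcut p / T <= 2^-1 by lra.
by rewrite ler_pdivrMr//; lra.
Qed.

Lemma cutoff_continuous : continuous cutoff.
Proof.
move=> p; apply/cvgrPdist_le => e e0.
have [W Wp HW] := near_rdist imm p (mulr_gt0 e0 T0).
apply: filterS (Wp) => q Wq; have := cutoff_lip (HW _ _ (nbhs_singleton Wp) Wq).
by rewrite mulfK// gt_eqF.
Qed.
End Cutoff.
End HopfRinow.

(** * Integration and the Liouville theorem *)

Section Measurability.
Variable R : realType.

Lemma count_bigcup_measurable d (T : measurableType d) (I : countType) (D : set I) (F : I -> set T) :
 (forall i, D i -> measurable (F i)) -> measurable (\bigcup_(i in D) F i).
Proof.
move=> H; pose G (k : nat) := if unpickle k is Some i then (if `[< D i >] then F i else set0) else set0.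
have -> : \bigcup_(i in D) F i = \bigcup_k G k.
 apply/seteqP; split=> [x [i Di Fx]|x [k _]].
  by exists (pickle i) => //; rewrite /G pickleK asboolT.
 by rewrite /G; case: (unpickle k) => // i; case: ifP => // /asboolP Di Fx; exists i.
apply: bigcup_measurable => k _; rewrite /G; case: (unpickle k) => // i.
by case: ifP => // /asboolP; exact: H.
Qed.

Lemma measurable_into_borel d (T : measurableType d) (T' : ptopologicalType) (F : T -> T') :
 (forall U : set T', open U -> measurable (F @^-1` U)) ->
 measurable_fun setT (F : T -> g_sigma_algebraType (@open T')).
Proof.
move=> H; apply: (@measurability _ _ T (g_sigma_algebraType (@open T')) setT F (@open T') erefl).
by move=> _ [U oU <-]; rewrite setTI; exact: H.
Qed.

Lemma continuous_borel (T : ptopologicalType) (f : T -> R) : continuous f ->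
 measurable_fun setT (f : g_sigma_algebraType (@open T) -> R).
Proof.
move=> fc; apply: (@measurability _ _ (g_sigma_algebraType (@open T)) _ setT f _ (RGenOpens.measurableE R)).
move=> _ [_ [x [y ->]] <-]; rewrite setTI; apply: sub_sigma_algebra.
apply: open_comp; last exact: interval_open.
by move=> z _; exact: fc.
Qed.

Lemma rat_near (x e : R) : 0 < e -> exists q : rat, `|x - ratr q| <= e.
Proof.
move=> e0; have xe : x < x + e by rewrite ltrDl.
have [q] := rat_in_itvoo xe; rewrite in_itv /= => /andP[h1 h2]; exists q.
by rewrite ler_norml; apply/andP; split; lra.
Qed.

End Measurability.

(** * Lebesgue integration on R^m *)

Section BorelRow.
Variable R : realType.
Notation mu := (@lebesgue_measure R).

Definition brow (m : nat) : Type := g_sigma_algebraType (@open 'rV[R]_m).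
HB.instance Definition _ m := Measurable.on (brow m).

Lemma measurable_open_brow m (U : set 'rV[R]_m) : open U -> measurable (U : set (brow m)).
Proof. by move=> oU; apply: sub_sigma_algebra. Qed.

Lemma measurable_closed_brow m (U : set 'rV[R]_m) : closed U -> measurable (U : set (brow m)).
Proof. by move=> cU; rewrite -[U]setCK; apply: measurableC; apply: measurable_open_brow; exact: closed_openC. Qed.

Definition rvec m (q : 'rV[rat]_m) : 'rV[R]_m := map_mx ratr q.
Definition rbox m (z : 'rV[rat]_m * nat) : set 'rV[R]_m := box (rvec z.1) (z.2.+1%:R^-1).

(** There are countably many boxes with rational centre and inverse-integer size; so a map into R^m
    is Borel as soon as its coordinates are. *)
Lemma open_rbox m (U : set 'rV[R]_m) : open U ->
 U = \bigcup_(z in [set z : 'rV[rat]_m * nat | rbox z `<=` U]) rbox z.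
Proof.
move=> oU; apply/seteqP; split=> [u Uu|u [z zU]]; last exact: zU.
have [r r0 Hr] := nbhs_box (open_nbhs_nbhs (conj oU Uu)).
have [k Hk] : exists k : nat, k.+1%:R^-1 <= r / 2.
 exists (Num.bound (2 / r)); rewrite -[leRHS]invrK lef_pV2 ?posrE ?invr_gt0 ?divr_gt0//.
 have h0 : 0 <= 2 / r by rewrite divr_ge0// ltW.
 have := archi_boundP h0; rewrite invf_div => /ltW h; apply: le_trans h _; by rewrite ler_nat.
have k0 : 0 < k.+1%:R^-1 :> R by rewrite invr_gt0.
pose q : 'rV[rat]_m := \row_a projT1 (cid (rat_near (u 0 a) k0)).
have Hq a : `|u 0 a - rvec q 0 a| <= k.+1%:R^-1.
 rewrite !mxE; exact: (projT2 (cid (rat_near (u 0 a) k0))).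
exists (q, k) => //=.
move=> w bw; apply: Hr => a; have h1 : `|w 0 a - rvec q 0 a| <= k.+1%:R^-1 := bw a.
have h2 := Hq a.
have -> : w 0 a - u 0 a = (w 0 a - rvec q 0 a) - (u 0 a - rvec q 0 a) by ring.
apply: le_trans (ler_normB _ _) (le_trans (lerD h1 h2) _).
by rewrite [leRHS]splitr; exact: lerD.
Qed.

Lemma measurable_coord_brow d (T : measurableType d) m (F : T -> 'rV[R]_m) :
 (forall a, measurable_fun setT (fun x => F x 0 a)) -> measurable_fun setT (F : T -> brow m).
Proof.
move=> H; apply: measurable_into_borel => U /open_rbox ->.
rewrite preimage_bigcup; apply: count_bigcup_measurable => z _.
have -> : F @^-1` rbox z = \bigcap_(a in [set: 'I_m]) ((fun x => F x 0 a) @^-1` `[rvec z.1 0 a - z.2.+1%:R^-1, rvec z.1 0 a + z.2.+1%:R^-1]%classic).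
 apply/seteqP; split=> x.
  by move=> h a _ /=; have := h a; rewrite in_itv /= ler_distl.
 by move=> h a; have := h a I; rewrite /= in_itv /= -ler_distl.
apply: fin_bigcap_measurable; first exact: finite_finset.
by move=> a _; rewrite -[X in measurable X]setTI; apply: H.
Qed.

Lemma measurable_brow_coord m a : measurable_fun setT (fun u : brow m => (u : 'rV[R]_m) 0 a).
Proof.
by apply: continuous_borel => u; exact: coord_continuous.
Qed.

Lemma lebesgue_translate (f : R -> \bar R) (s : R) : measurable_fun [set: R] f -> (forall t, (0 <= f t)%E) ->
 (\int[mu]_t f (t + s)%R = \int[mu]_t f t)%E.
Proof.
move=> mf f0.
have ms : measurable_fun [set: measurableTypeR R] (fun t : measurableTypeR R => t + s : measurableTypeR R).
 by apply: measurable_funD => //; exact: measurable_cst.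
have E A : measurable A -> mu A = pushforward mu (fun t : measurableTypeR R => t + s : measurableTypeR R) A.
 apply: lebesgue_measure_unique => _ [[a b]] _ <-.
 have P : (fun t : R => t + s) @^-1` `]a, b]%classic = `]a - s, b - s]%classic.
  by apply/seteqP; split=> t /=; rewrite !in_itv /= => /andP[h1 h2]; apply/andP; split; lra.
 rewrite [RHS](_ : _ = mu `]a - s, b - s]%classic); last by rewrite -P.
 by rewrite !lebesgue_measure_itv /= !lte_fin ltrD2r -!EFinD; case: ifP => // _; congr (_%:E); ring.
rewrite -[LHS](ge0_integral_pushforward ms mu measurableT mf)//.
by apply: eq_measure_integral => A mA _; exact: esym (E A mA).
Qed.

Section ProdMeasure.
Context d1 d2 (T1 : measurableType d1) (T2 : measurableType d2).
Variables (m1 : {sigma_finite_measure set T1 -> \bar R}) (m2 : {sigma_finite_measure set T2 -> \bar R}).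

(* The library's instance for sub-probabilities masks its instance for
   sigma-finite measures on [\x]; the alias makes the latter available. *)
Definition prod_measure := (m1 \x m2)%E.

Lemma prod_measure_sigma_finite : sigma_finite setT prod_measure.
Proof. by have [] := lebesgue_integral_fubini.measure_function_Measure_isSigmaFinite__to__measure_function_isSigmaFinite m1 m2. Qed.

HB.instance Definition _ := Measure.on prod_measure.
HB.instance Definition _ := Measure_isSigmaFinite.Build _ _ _ prod_measure prod_measure_sigma_finite.
End ProdMeasure.

(** The iterated integral is realized on an auxiliary measure space mapped to R^m, since row vectors
    are not an iterated product type. Translation invariance belongs to the statement so that both
    properties pass through one induction, by Tonelli. *)
Definition leb_model (m : nat) : Prop :=
 exists (d : measure_display) (T : measurableType d) (lam : {sigma_finite_measure set T -> \bar R})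
  (iota : T -> 'rV[R]_m), measurable_fun setT (iota : T -> brow m) /\
 forall f : 'rV[R]_m -> \bar R, measurable_fun setT (f : brow m -> \bar R) -> (forall u, (0 <= f u)%E) ->
  lebesgue_rV f = (\int[lam]_x f (iota x))%E /\
  forall v, lebesgue_rV (fun u => f (u + v)) = lebesgue_rV f.

Lemma rv0 (u : 'rV[R]_0) : u = 0.
Proof. by apply/rowP => -[]. Qed.

Lemma row1l m (t : R) (y : 'rV[R]_m) : (row_mx (t%:M : 'rV[R]_1) y : 'rV[R]_m.+1) 0 ord0 = t.
Proof.
have -> : (ord0 : 'I_m.+1) = lshift m (ord0 : 'I_1) by exact/val_inj.
by rewrite (@row_mxEl _ 1 1 m) mxE eqxx mulr1n.
Qed.

Lemma row1r m (t : R) (y : 'rV[R]_m) b : (row_mx (t%:M : 'rV[R]_1) y : 'rV[R]_m.+1) 0 (lift ord0 b) = y 0 b.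
Proof.
have -> : (lift ord0 b : 'I_m.+1) = rshift 1 b by exact/val_inj.
exact: (@row_mxEr _ 1 1 m).
Qed.

Lemma measurable_row_mx d (T : measurableType d) m (t : T -> R) (F : T -> 'rV[R]_m) :
 measurable_fun setT t -> measurable_fun setT (F : T -> brow m) ->
 measurable_fun setT ((fun x => row_mx ((t x)%:M : 'rV[R]_1) (F x)) : T -> brow m.+1).
Proof.
move=> mt mF; apply: measurable_coord_brow => a.
case: (unliftP ord0 a) => [b|] ->; last first.
 have -> : (fun x => (row_mx ((t x)%:M : 'rV[R]_1) (F x) : 'rV[R]_m.+1) 0 ord0) = t by apply/funext => x; exact: row1l.
 exact: mt.
have -> : (fun x => (row_mx ((t x)%:M : 'rV[R]_1) (F x) : 'rV[R]_m.+1) 0 (lift ord0 b)) = (fun u : brow m => (u : 'rV[R]_m) 0 b) \o F.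
 by apply/funext => x; exact: row1r.
exact: measurableT_comp (measurable_brow_coord b) mF.
Qed.

Lemma leb_modelP m : leb_model m.
Proof.
elim: m => [|m [d [T [lam [iota [mi H]]]]]].
 exists _, unit, (dirac tt), (fun=> 0); split.
  by apply: measurable_into_borel => U _.
 move=> f mf f0; split.
  by rewrite integral_dirac//= diracT mul1e.
 by move=> v; rewrite /= (rv0 (0 + v)).
pose io (z : R * T) : 'rV[R]_m.+1 := row_mx (z.1%:M : 'rV[R]_1) (iota z.2).
have mio : measurable_fun setT (io : R * T -> brow m.+1).
 by apply: measurable_row_mx => //; exact: measurableT_comp mi _.
pose m0 : {sigma_finite_measure set (measurableTypeR R) -> \bar R} := mu.
pose ml : {sigma_finite_measure set (measurableTypeR R * T)%type -> \bar R} := prod_measure m0 lam.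
exists _, (measurableTypeR R * T)%type, ml, io; split; first exact: mio.
move=> f mf f0; pose ft (t : R) (y : 'rV[R]_m) := f (row_mx (t%:M : 'rV[R]_1) y).
have mft t : measurable_fun setT (ft t : brow m -> \bar R).
 apply: (measurableT_comp mf); apply: (measurable_row_mx (measurable_cst t)).
 exact: measurable_id.
have ft0 t y : (0 <= ft t y)%E by exact: f0.
have mfio : measurable_fun setT (f \o io) by exact: measurableT_comp mf mio.
have E : lebesgue_rV f = (\int[mu]_t \int[lam]_x f (io (t, x)))%E.
 by apply: eq_integral => t _; exact: (H _ (mft t) (ft0 t)).1.
split.
 by rewrite E; exact: esym (fubini_tonelli1 (m1 := m0) (m2 := lam) (f \o io) mfio (fun z => f0 (io z))).
move=> v; have -> : lebesgue_rV (fun u => f (u + v)) =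
  (\int[mu]_t (fun t => lebesgue_rV (ft t)) (t + v 0 ord0)%R)%E.
 apply: eq_integral => t _; rewrite -[RHS]((H _ (mft _) (ft0 _)).2 (\row_b v 0 (lift ord0 b))).
 congr lebesgue_rV; apply/funext => y; rewrite /ft; congr f; apply/rowP => a.
 by case: (unliftP ord0 a) => [b|] ->; rewrite [LHS]mxE ?row1l// !row1r !mxE.
have G0 t : (0 <= lebesgue_rV (ft t))%E.
 by rewrite (H _ (mft t) (ft0 t)).1; apply: integral_ge0 => x _; exact: ft0.
apply: (@lebesgue_translate (fun t => lebesgue_rV (ft t)) _ _ G0).
have -> : (fun t => lebesgue_rV (ft t)) = fubini_F lam (f \o io).
 by apply/funext => t; rewrite (H _ (mft t) (ft0 t)).1.
exact: (@measurable_fun_fubini_tonelli_F _ _ _ _ _ lam (f \o io) mfio (fun z => f0 (io z))).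
Qed.

Lemma lebesgue_rV_eq m (f g : 'rV[R]_m -> \bar R) : f =1 g -> lebesgue_rV f = lebesgue_rV g.
Proof. by move=> /funext ->. Qed.

Lemma lebesgue_rV0 m : lebesgue_rV (fun _ : 'rV[R]_m => 0%E) = 0%E.
Proof. by elim: m => //= m IH; under eq_integral do rewrite IH; rewrite integral0. Qed.

Lemma lebesgue_rV_box m (c : 'rV[R]_m) r : 0 <= r ->
 lebesgue_rV (fun u => (\1_(box c r) u)%:E) = ((2 * r) ^+ m)%:E.
Proof.
move=> r0; elim: m c => [|m IH] c.
 by rewrite /= indicE mem_set ?expr0// => -[].
pose c' : 'rV[R]_m := \row_b c 0 (lift ord0 b).
pose A := `[c 0 ord0 - r, c 0 ord0 + r]%classic.
have E (t : R) y : \1_(box c r) (row_mx (t%:M : 'rV[R]_1) y) = \1_A t * \1_(box c' r) y :> R.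
 rewrite !indicE -natrM mulnb; congr (nat_of_bool _)%:R.
 apply/idP/andP => [|[]]; rewrite !inE.
  move=> h; split.
   by have := h ord0; rewrite row1l /A /= in_itv /= ler_distl.
  by move=> b; have := h (lift ord0 b); rewrite row1r mxE.
 move=> h1 h2 a; case: (unliftP ord0 a) => [b|] ->.
  by rewrite row1r; have := h2 b; rewrite mxE.
 by rewrite row1l; move: h1; rewrite /A /= in_itv /= -ler_distl.
transitivity (\int[mu]_t (((2 * r) ^+ m)%:E * (\1_A t)%:E))%E.
 apply: eq_integral => t _; have [tA|tA] := pselect (A t).
  apply: etrans (lebesgue_rV_eq (g := fun y => (\1_(box c' r) y)%:E) _) _.
   by move=> y; rewrite E indicE mem_set// mul1r.
  by rewrite IH indicE mem_set// mule1.
 apply: etrans (lebesgue_rV_eq (g := fun y => 0%E) _) _.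
  by move=> y; rewrite E indicE memNset// mul0r.
 by rewrite lebesgue_rV0 indicE memNset// mule0.
have IA : (\int[mu]_t (\1_A t)%:E = mu A)%E.
 have mA : measurable (A : set (measurableTypeR R)) by exact: measurable_itv.
 apply: etrans (integral_indic _ _ mA) _; first exact: measurableT.
 by congr (mu _); exact: setIT.
rewrite ge0_integralZl//.
- rewrite IA lebesgue_measure_itv /= lte_fin.
 have [rr|rr] := ltP; first by rewrite -EFinD -EFinM exprS; congr (_%:E); ring.
 by have -> : r = 0 by [lra]; rewrite mulr0 expr0n mule0 expr0n.
- by apply/measurable_EFinP; apply: measurable_indic; exact: measurable_itv.
- by rewrite lee_fin exprn_ge0// mulr_ge0.
Qed.

End BorelRow.

(** * Bounded functions supported on sets of finite measure *)

Section BoundedFiniteSupport.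
Context d (T : measurableType d) (R : realType) (mu : {measure set T -> \bar R}).
Implicit Types (f g : T -> R).

(** A class of integrable functions stable under sums and under multiplication by bounded measurable
    functions, which makes the integral linear without integrability side conditions. *)
Definition bfs f := measurable_fun setT f /\
 exists A C, [/\ measurable A, (mu A < +oo)%E, 0 <= C & forall x, `|f x| <= C * \1_A x].

Local Notation J f := (\int[mu]_x f x)%R.

Lemma bfs_bounded f : bfs f -> exists2 C, 0 <= C & forall x, `|f x| <= C.
Proof.
move=> [_ [A [C [_ _ C0 H]]]]; exists C => // x; apply: le_trans (H x) _.
by rewrite indicE ler_piMr//; case: (_ \in _); rewrite ?ler01.
Qed.

Lemma bfs_integrable f : bfs f -> mu.-integrable setT (EFin \o f).
Proof.
move=> [mf [A [C [mA fA C0 H]]]].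
apply: (@le_integrable _ T R mu setT measurableT (EFin \o f) (fun x => C%:E * (\1_A x)%:E)%E).
- exact/measurable_EFinP.
- move=> x _; have := H x; rewrite -lee_fin => h; apply: le_trans h _.
 by rewrite -EFinM /= lee_fin; exact: ler_norm.
- apply: integrableZl => //; apply/integrableP; split.
  by apply/measurable_EFinP; exact: measurable_indic.
 under eq_integral do rewrite gee0_abs//.
 by rewrite integral_indic// setIT.
Qed.

Lemma bfs_eq f g : f =1 g -> bfs f -> bfs g.
Proof. by move=> /funext ->. Qed.

Lemma bfs_le f g : measurable_fun setT f -> (forall x, `|f x| <= `|g x|) -> bfs g -> bfs f.
Proof.
move=> mf fg [_ [A [C [mA fA C0 H]]]]; split=> //; exists A, C; split=> // x.
exact: le_trans (fg x) (H x).
Qed.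

Lemma bfs_mull f g C : measurable_fun setT f -> (forall x, `|f x| <= C) -> bfs g ->
 bfs (fun x => f x * g x).
Proof.
move=> mf fC [mg [A [D [mA fA D0 H]]]]; split; first exact: measurable_funM.
have C0 : 0 <= `|C| by [].
exists A, (`|C| * D); split=> //; first exact: mulr_ge0.
move=> x; rewrite normrM -mulrA; apply: ler_pM => //.
by apply: le_trans (fC x) _; exact: ler_norm.
Qed.

Lemma bfsZ k f : bfs f -> bfs (fun x => k * f x).
Proof. by apply: (@bfs_mull (fun=> k) f `|k|) => //; exact: measurable_cst. Qed.

Lemma bfsD f g : bfs f -> bfs g -> bfs (fun x => f x + g x).
Proof.
move=> [mf [A [C [mA fA C0 H1]]]] [mg [B [D [mB fB D0 H2]]]].
split; first exact: measurable_funD.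
exists (A `|` B), (C + D); split.
- exact: measurableU.
- by apply: le_lt_trans (measureU2 mu mA mB) _; exact: lte_add_pinfty.
- exact: addr_ge0.
move=> x; apply: le_trans (ler_normD _ _) _; rewrite mulrDl; apply: lerD.
 apply: le_trans (H1 x) _; rewrite ler_wpM2l// !indicE ler_nat in_setU.
 by case: (x \in A).
apply: le_trans (H2 x) _; rewrite ler_wpM2l// !indicE ler_nat in_setU.
by case: (x \in A); case: (x \in B).
Qed.

Lemma bfsN f : bfs f -> bfs (fun x => - f x).
Proof. by move=> bf; apply: bfs_eq (bfsZ (- 1) bf) => x; rewrite mulN1r. Qed.

Lemma bfsB f g : bfs f -> bfs g -> bfs (fun x => f x - g x).
Proof. by move=> bf bg; apply: bfsD => //; exact: bfsN. Qed.

Lemma bfs_norm f : bfs f -> bfs (fun x => `|f x|).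
Proof.
move=> bf; apply: bfs_le (bf); first exact: measurableT_comp bf.1.
by move=> x; rewrite normr_id.
Qed.

Lemma bfs_sum (I : Type) (r : seq I) (F : I -> T -> R) : (forall i, bfs (F i)) ->
 bfs (fun x => \sum_(i <- r) F i x).
Proof.
move=> H; elim: r => [|i r IH].
 apply: (@bfs_eq (fun=> 0)); first by move=> x; rewrite big_nil.
 split; first exact: measurable_cst.
 by exists set0, 0; split=> //; [rewrite measure0 ltry|move=> x; rewrite normr0 mul0r].
by apply: bfs_eq (bfsD (H i) IH) => x; rewrite big_cons.
Qed.

Lemma JD f g : bfs f -> bfs g -> J (fun x => f x + g x) = J f + J g.
Proof. by move=> bf bg; rewrite RintegralD//; exact: bfs_integrable. Qed.

Lemma JB f g : bfs f -> bfs g -> J (fun x => f x - g x) = J f - J g.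
Proof. by move=> bf bg; rewrite RintegralB//; exact: bfs_integrable. Qed.

Lemma JZ k f : bfs f -> J (fun x => k * f x) = k * J f.
Proof. by move=> bf; rewrite RintegralZl//; exact: bfs_integrable. Qed.

Lemma J_sum (I : Type) (r : seq I) (F : I -> T -> R) : (forall i, bfs (F i)) ->
 J (fun x => \sum_(i <- r) F i x) = \sum_(i <- r) J (F i).
Proof.
move=> H; elim: r => [|i r IH].
 under eq_Rintegral do rewrite big_nil.
 by rewrite big_nil Rintegral_cst// mul0r.
under eq_Rintegral do rewrite big_cons.
by rewrite big_cons -IH; apply: JD => //; exact: bfs_sum.
Qed.

Lemma J_le f g : bfs f -> bfs g -> (forall x, f x <= g x) -> J f <= J g.
Proof.
by move=> bf bg fg; apply: le_Rintegral => // ; exact: bfs_integrable.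
Qed.

Lemma J_ge0 f : (forall x, 0 <= f x) -> 0 <= J f.
Proof. by move=> f0; apply: Rintegral_ge0. Qed.

Lemma J_norm f : bfs f -> `|J f| <= J (fun x => `|f x|).
Proof. by move=> bf; apply: le_normr_Rintegral => //; exact: bfs_integrable. Qed.

Lemma bfs_indic A : measurable A -> (mu A < +oo)%E -> bfs \1_A.
Proof.
move=> mA fA; split; first exact: measurable_indic.
by exists A, 1; split=> // x; rewrite mul1r ger0_norm.
Qed.

Lemma J_indic A : measurable A -> J (\1_A) = fine (mu A).
Proof. by move=> mA; rewrite /Rintegral integral_indic// setIT. Qed.

End BoundedFiniteSupport.

(** * Lebesgue measure on R^m and difference quotients *)

Section LebRow.
Variables (R : realType) (m : nat).
Notation V := 'rV[R]_m.

(** The measure of the model is pushed forward to R^m along [iota]. *)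
Lemma leb_exists : exists mu : {measure set (brow R m) -> \bar R},
 forall f : V -> \bar R, measurable_fun setT (f : brow R m -> \bar R) -> (forall u, (0 <= f u)%E) ->
  lebesgue_rV f = (\int[mu]_u f u)%E /\ forall v, (\int[mu]_u f (u + v)%R = \int[mu]_u f u)%E.
Proof.
have [d [T [lam [iota [mi H]]]]] := leb_modelP R m.
pose nu0 := (pushforward lam (iota : T -> brow R m) : {measure set (brow R m) -> \bar R}).
pose nu := nu0 mi.
have E (f : V -> \bar R) : measurable_fun setT (f : brow R m -> \bar R) -> (forall u, (0 <= f u)%E) ->
 lebesgue_rV f = (\int[nu]_u f u)%E.
 move=> mf f0; rewrite (H f mf f0).1.
 by rewrite (ge0_integral_pushforward mi lam measurableT mf (fun u _ => f0 u)) preimage_setT.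
exists nu => f mf f0; split; first exact: E.
move=> v; have mfv : measurable_fun setT ((fun u => f (u + v)) : brow R m -> \bar R).
 apply: (measurableT_comp mf); apply: measurable_into_borel => U oU.
 apply: measurable_open_brow; apply: open_comp => // u _.
 by apply: (@cvgD _ _ _ (nbhs u) _ id (cst v)); [exact: cvg_id|exact: cvg_cst].
by rewrite -(E _ mf f0) -(E _ mfv (fun u => f0 _)); exact: (H f mf f0).2.
Qed.

Definition leb : {measure set (brow R m) -> \bar R} := projT1 (cid leb_exists).

Lemma lebE (f : V -> \bar R) : measurable_fun setT (f : brow R m -> \bar R) -> (forall u, (0 <= f u)%E) ->
 lebesgue_rV f = (\int[leb]_u f u)%E.
Proof. by move=> mf f0; exact: (projT2 (cid leb_exists) f mf f0).1. Qed.

Lemma leb_translate (f : V -> \bar R) v : measurable_fun setT (f : brow R m -> \bar R) -> (forall u, (0 <= f u)%E) ->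
 (\int[leb]_u f (u + v)%R = \int[leb]_u f u)%E.
Proof. by move=> mf f0; exact: (projT2 (cid leb_exists) f mf f0).2. Qed.

Lemma box_closed (c : V) r : closed (box c r).
Proof. by apply: compact_closed; [exact: norm_hausdorff|exact: box_compact]. Qed.

Lemma measurable_box c r : measurable (box c r : set (brow R m)).
Proof. by apply: measurable_closed_brow; exact: box_closed. Qed.

Lemma leb_box c r : 0 <= r -> leb (box c r) = ((2 * r) ^+ m)%:E.
Proof.
move=> r0; rewrite -(lebesgue_rV_box c r0) lebE.
- by rewrite integral_indic// ?setIT//; exact: measurable_box.
- by apply/measurable_EFinP; apply: measurable_indic; exact: measurable_box.
- by move=> u; rewrite lee_fin.
Qed.

Lemma leb_box_fin c r : (leb (box c r) < +oo)%E.
Proof.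
have [r0|r0] := leP 0 r; first by rewrite leb_box// ltry.
apply: (@le_lt_trans _ _ ((2 * `|r|) ^+ m)%:E); last exact: ltry.
rewrite -(leb_box c (normr_ge0 r)); apply: le_measure.
- by rewrite inE; exact: measurable_box.
- by rewrite inE; exact: measurable_box.
- by move=> u H a; apply: le_trans (H a) (ler_norm _).
Qed.

Notation J f := (\int[leb]_u f u)%R.

Lemma measurable_translate (f : V -> R) v : measurable_fun setT (f : brow R m -> R) ->
 measurable_fun setT ((fun u => f (u + v)) : brow R m -> R).
Proof.
move=> mf; apply: (measurableT_comp mf); apply: measurable_into_borel => U oU.
apply: measurable_open_brow; apply: open_comp => // u _.
by apply: (@cvgD _ _ _ (nbhs u) _ id (cst v)); [exact: cvg_id|exact: cvg_cst].
Qed.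

Lemma J_translate (f : V -> R) v : measurable_fun setT (f : brow R m -> R) ->
 J (fun u => f (u + v)) = J f.
Proof.
move=> mf; rewrite /Rintegral; congr fine.
have mE : measurable_fun setT (EFin \o (f : brow R m -> R)) by exact/measurable_EFinP.
rewrite [LHS]integralE [RHS]integralE; congr (_ - _)%E.
 have Z := (@leb_translate ((EFin \o f)^\+)%E v (measurable_funepos mE) (fun u => funepos_ge0 _ u)).
 by apply: etrans Z; apply: eq_integral => u _; rewrite !funeposE.
have Z := (@leb_translate ((EFin \o f)^\-)%E v (measurable_funeneg mE) (fun u => funeneg_ge0 _ u)).
by apply: etrans Z; apply: eq_integral => u _; rewrite !funenegE.
Qed.

Lemma continuous_bfs (f : V -> R) c r : continuous f -> (forall u, ~ box c r u -> f u = 0) ->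
 bfs leb (f : brow R m -> R).
Proof.
move=> fc f0; split; first exact: continuous_borel.
have [C C0 H] := continuous_compact_bounded fc (@box_compact R m c r).
exists (box c r), C; split=> //; [exact: measurable_box|exact: leb_box_fin|].
move=> u; rewrite indicE; have [bu|bu] := pselect (box c r u).
 by rewrite mem_set// mulr1 H.
by rewrite memNset// mulr0 f0// normr0.
Qed.

Lemma uniform_continuity (f : V -> R) c r (e : R) : continuous f -> 0 < e ->
 exists2 del, 0 < del & forall u w, box c r u -> `|w - u| <= del -> `|f w - f u| <= e.
Proof.
move=> fc e0.
pose P (A : set V) := exists2 del, 0 < del & forall u w, A u -> `|w - u| <= del -> `|f w - f u| <= e.
suff : P (box c r) by [].
apply: compact_induction (@box_compact R m c r) _ _ _ _.
- by exists 1.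
- by move=> A B AB [del d0 H]; exists del => // u w /AB; exact: H.
- move=> A B [d1 d10 H1] [d2 d20 H2]; exists (Num.min d1 d2); first by rewrite lt_min d10.
 move=> u w [Au|Bu]; rewrite le_min => /andP[h1 h2]; [exact: H1|exact: H2].
move=> p _; have e20 : 0 < e / 2 by rewrite divr_gt0.
have [s s0 Hs] := nbhs_box (continuous_near (fc p) e20).
have s20 : 0 < s / 2 by rewrite divr_gt0.
exists (box p (s / 2)); first exact: box_nbhs.
exists (s / 2) => // u w bu wu.
have bw : box p s w.
 move=> a; have h1 := bu a; have h2 := le_trans (coord_le (w - u) a) wu.
 rewrite !mxE in h2; have -> : w 0 a - p 0 a = (w 0 a - u 0 a) + (u 0 a - p 0 a) by ring.
 by apply: le_trans (ler_normD _ _) _; rewrite [leRHS]splitr; exact: lerD.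
have bu' : box p s u by move=> a; apply: le_trans (bu a) _; lra.
have -> : f w - f u = (f p - f u) - (f p - f w) by ring.
apply: le_trans (ler_normB _ _) _; rewrite [leRHS]splitr; apply: lerD; exact: Hs.
Qed.

(* Summation by parts for difference quotients, by translation invariance. *)
Lemma weak_inequality (phi xi : V -> R) (v c : V) (rho L del : R) :
 measurable_fun setT (phi : brow R m -> R) -> (forall u, 0 <= phi u <= 1) ->
 continuous xi -> (forall u, derivable xi u v) -> continuous ('D_v xi) ->
 (forall u, ~ box c rho u -> xi u = 0) -> 0 <= rho -> 0 <= L -> 0 < del ->
 (forall h u, 0 < h -> h <= del -> box c rho u -> `|phi u - phi (u - h *: v)| <= L * h) ->
 `|J (fun u => phi u ^+ 2 * 'D_v xi u)| <= 2 * L * J (fun u => phi u * `|xi u|).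
Proof.
move=> mphi phi01 xc xd xdc x0 rho0 L0 del0 phil.
have mphi2 : measurable_fun setT ((fun u => phi u ^+ 2) : brow R m -> R) by exact: measurable_funX.
have phi1 u : `|phi u| <= 1 by case/andP: (phi01 u) => p0 p1; rewrite ger0_norm.
have phi21 u : `|phi u ^+ 2| <= 1.
 by case/andP: (phi01 u) => p0 p1; rewrite ger0_norm ?sqr_ge0// exprn_ile1.
pose B := box c (rho + `|v| + 1).
have Bout h u : 0 <= h <= 1 -> ~ B u -> ~ box c rho (u + h *: v).
 move=> /andP[h0 h1] nB H; apply: nB => a.
 have -> : u 0 a - c 0 a = ((u + h *: v) 0 a - c 0 a) - h * v 0 a by rewrite !mxE; ring.
 apply: le_trans (ler_normB _ _) _; rewrite -addrA; apply: lerD; first exact: H.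
 rewrite normrM ger0_norm//; have := coord_le v a; have := normr_ge0 (v 0 a); nra.
have Dx0 u : ~ box c rho u -> 'D_v xi u = 0.
 move=> nbu; have oB : open (~` box c rho) by apply: closed_openC; exact: box_closed.
 rewrite (derive_nbhs_eq (g := cst 0) v oB nbu _).2 ?derive_cst//.
 by move=> w; rewrite inE; exact: x0.
have xh0 h u : 0 <= h <= 1 -> ~ B u -> xi (u + h *: v) = 0 by move=> h01 /(Bout h _ h01)/x0.
have b_xi := continuous_bfs xc x0.
have b_dx := continuous_bfs xdc Dx0.
have volB : 0 <= fine (leb B) by exact: fine_ge0 (measure_ge0 _ _).
have b_B : bfs leb (\1_B : brow R m -> R) by apply: bfs_indic; [exact: measurable_box|exact: leb_box_fin].
have b_ax := bfs_norm b_xi.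
have b_pax := bfs_mull mphi phi1 b_ax.
have Jx0 : 0 <= J (fun u => `|xi u|) by exact: J_ge0.
apply/ler_addgt0Pr => e e0.
pose e1 := e / 2 / (fine (leb B) + 1).
have e10 : 0 < e1 by rewrite !divr_gt0// ltr_wpDl.
have [d1 d10 Hd1] := uniform_continuity c (rho + `|v| + 1) xdc e10.
pose K := L ^+ 2 * J (fun u => `|xi u|).
have K0 : 0 <= K by rewrite mulr_ge0// sqr_ge0.
(* The step is so small that the quadratic remainder [K * h] and the error of the difference
   quotient, governed by uniform continuity of the derivative, cost at most [e / 2] each. *)
have [h [h0 h1 hdel hK]] : exists h, [/\ 0 < h, h <= 1, h <= del & K * h <= e / 2 /\ h * `|v| <= d1].
 pose h := Num.min (Num.min 1 del) (Num.min (e / 2 / (K + 1)) (d1 / (`|v| + 1))).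
 have p1 : 0 < K + 1 by rewrite ltr_wpDl.
 have p2 : 0 < `|v| + 1 by rewrite ltr_wpDl.
 have h0 : 0 < h by rewrite !lt_min ltr01 del0 !divr_gt0.
 exists h; split=> //; rewrite ?ge_min ?lexx ?orbT//; split.
  have : h <= e / 2 / (K + 1) by rewrite !ge_min lexx !orbT.
  by rewrite ler_pdivlMr// => hh; lra.
 have : h <= d1 / (`|v| + 1) by rewrite !ge_min lexx !orbT.
 by rewrite ler_pdivlMr// => hh; lra.
have [hK1 hK2] := hK.
have h01 : 0 <= h <= 1 by rewrite ltW.
pose dq u := xi (u + h *: v) - xi u.
have mxih : measurable_fun setT ((fun u => xi (u + h *: v)) : brow R m -> R).
 by apply: measurable_translate; exact: b_xi.1.
have [Cx Cx0 HCx] := bfs_bounded b_xi.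
have b_xih : bfs leb ((fun u => xi (u + h *: v)) : brow R m -> R).
 split=> //; exists B, Cx; split=> //; [exact: measurable_box|exact: leb_box_fin|].
 move=> u; rewrite indicE; have [Bu|nBu] := pselect (B u).
  by rewrite mem_set// mulr1.
 by rewrite memNset// mulr0 xh0// normr0.
have b_dq : bfs leb (dq : brow R m -> R) by exact: bfsB b_xih b_xi.
have err u : `|h * 'D_v xi u - dq u| <= e1 * h * \1_B u.
 rewrite indicE; have [Bu|nBu] := pselect (B u); last first.
  have nr : ~ box c rho u by have := Bout 0 u; rewrite lexx ler01 scale0r addr0 => /(_ isT nBu).
  by rewrite memNset// mulr0 /dq Dx0// xh0// x0// subrr mulr0 subr0 normr0.
 rewrite mem_set// mulr1; have [s /andP[s0 sh] Es] := mvt0 (ltW h0) (fun s (_ : 0 <= s <= h) => is_derive_line (xd (u + s *: v))).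
 rewrite /dq; have -> : xi (u + h *: v) - xi u = 'D_v xi (u + s *: v) * h by rewrite -Es scale0r addr0.
 have -> : h * 'D_v xi u - 'D_v xi (u + s *: v) * h = - (('D_v xi (u + s *: v) - 'D_v xi u) * h) by ring.
 rewrite normrN normrM (gtr0_norm h0) ler_pM2r//; apply: Hd1 => //.
 by rewrite addrAC subrr add0r normrZ ger0_norm//; apply: le_trans hK2; exact: ler_wpM2r.
have b_1 := bfs_mull mphi2 phi21 b_dx.
have b_2 := bfs_mull mphi2 phi21 b_dq.
have step1 : h * J (fun u => phi u ^+ 2 * 'D_v xi u) =
  J (fun u => phi u ^+ 2 * (h * 'D_v xi u - dq u)) + J (fun u => phi u ^+ 2 * dq u).
 rewrite -JZ// -JD//; last by apply: bfs_mull mphi2 phi21 _; apply: bfsB => //; exact: bfsZ.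
 by apply: eq_Rintegral => u _; ring.
have b_3 : bfs leb ((fun u => phi u ^+ 2 * (h * 'D_v xi u - dq u)) : brow R m -> R).
 by apply: bfs_mull mphi2 phi21 _; apply: bfsB => //; exact: bfsZ.
have step2 : `|J (fun u => phi u ^+ 2 * (h * 'D_v xi u - dq u))| <= e1 * h * fine (leb B).
 apply: le_trans (J_norm b_3) _.
 rewrite -(J_indic _ (measurable_box _ _)) -JZ//; apply: J_le; [exact: bfs_norm|exact: bfsZ|].
 move=> u; rewrite normrM; apply: le_trans (err u).
 by rewrite ler_piMl.
pose psi u := phi (u - h *: v).
have mpsi : measurable_fun setT (psi : brow R m -> R) by exact: measurable_translate.
have mpsi2 : measurable_fun setT ((fun u => psi u ^+ 2) : brow R m -> R) by exact: measurable_funX.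
have psi21 u : `|psi u ^+ 2| <= 1 by exact: phi21.
have b_4 := bfs_mull mpsi2 psi21 b_xi.
have b_5 := bfs_mull mphi2 phi21 b_xi.
have b_6 := bfs_mull mphi2 phi21 b_xih.
(* Translating the variable by [h *: v] transfers the difference from [xi] to [phi ^+ 2], for which
   a Lipschitz bound is enough. *)
have step3 : J (fun u => phi u ^+ 2 * dq u) = J (fun u => (psi u ^+ 2 - phi u ^+ 2) * xi u).
 have -> : J (fun u => phi u ^+ 2 * dq u) = J (fun u => phi u ^+ 2 * xi (u + h *: v)) - J (fun u => phi u ^+ 2 * xi u).
  by rewrite -JB//; apply: eq_Rintegral => u _; rewrite mulrBr.
 have -> : J (fun u => phi u ^+ 2 * xi (u + h *: v)) = J (fun u => psi u ^+ 2 * xi u).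
  rewrite -(@J_translate (fun u => psi u ^+ 2 * xi u) (h *: v) b_4.1).
  by apply: eq_Rintegral => u _; rewrite /psi addrK.
 by rewrite -JB//; apply: eq_Rintegral => u _; rewrite mulrBl.
have b_7 : bfs leb ((fun u => (psi u ^+ 2 - phi u ^+ 2) * xi u) : brow R m -> R).
 by apply: bfs_eq (bfsB b_4 b_5) => u; rewrite mulrBl.
have b_8 := bfsZ (L * h * 2) b_pax.
have b_9 := bfsZ (L * h * (L * h)) b_ax.
have step4 : `|J (fun u => phi u ^+ 2 * dq u)| <= h * (2 * L * J (fun u => phi u * `|xi u|)) + h * (K * h).
 rewrite step3; apply: le_trans (J_norm b_7) _.
 have -> : h * (2 * L * J (fun u => phi u * `|xi u|)) + h * (K * h) =
  J (fun u => (L * h * 2) * (phi u * `|xi u|) + (L * h * (L * h)) * `|xi u|).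
  by rewrite JD// !JZ// /K expr2; ring.
 apply: J_le; [exact: bfs_norm|exact: bfsD|].
 move=> u; have [bu|nbu] := pselect (box c rho u); last by rewrite x0// normr0 !mulr0 normr0 addr0.
 have H := phil h u h0 hdel bu; rewrite normrM.
 have -> : L * h * 2 * (phi u * `|xi u|) + L * h * (L * h) * `|xi u| = ((L * h) * (2 * phi u + L * h)) * `|xi u| by ring.
 apply: ler_wpM2r => //.
 have -> : psi u ^+ 2 - phi u ^+ 2 = - ((phi u - psi u) * (phi u + psi u)) by ring.
 rewrite normrN normrM; apply: ler_pM => //.
 move: (H); rewrite ler_norml => /andP[H1 H2].
 have /andP[p0 _] := phi01 u; have /andP[q0 _] := phi01 (u - h *: v).
 by rewrite ger0_norm ?addr_ge0// /psi; lra.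
rewrite -(ler_pM2l h0) -{1}(gtr0_norm h0) -normrM step1.
apply: le_trans (ler_normD _ _) _; apply: le_trans (lerD step2 step4) _.
have e1e : e1 * fine (leb B) <= e / 2.
 have p1 : 0 < fine (leb B) + 1 by rewrite ltr_wpDl.
 rewrite /e1 mulrAC ler_pdivrMr// ler_pM2l ?divr_gt0//; lra.
have t1 : h * (e1 * fine (leb B)) <= h * (e / 2) by rewrite ler_pM2l.
have t2 : h * (K * h) <= h * (e / 2) by rewrite ler_pM2l.
lra.
Qed.

End LebRow.

(** * Change of variables from measures of sets *)

Section Transfer.
Context d1 d2 (X : measurableType d1) (Y : measurableType d2) (R : realType).
Variables (nu : {measure set X -> \bar R}) (mu : {measure set Y -> \bar R}).
Variables (D : set X) (t : Y -> X) (w : Y -> R).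
Hypothesis mD : measurable D.
Hypothesis mt : measurable_fun setT t.
Hypothesis mw : measurable_fun setT w.
Hypothesis w0 : forall y, 0 <= w y.
Hypothesis wD : forall y, w y != 0 -> D (t y).
Hypothesis nuE : forall B, measurable B -> B `<=` D -> (nu B = \int[mu]_y (\1_B (t y) * w y)%:E)%E.

Import HBNNSimple.

(** The identity for measures of subsets of [D] extends to simple functions by linearity and to
    nonnegative functions by monotone convergence. Values of [t] outside the preimage of [D] are
    harmless because [w] vanishes there. *)
Lemma ge0_integral_transfer (f : X -> \bar R) : measurable_fun D f -> (forall x, D x -> (0 <= f x)%E) ->
 (\int[nu]_(x in D) f x = \int[mu]_y (f (t y) * (w y)%:E))%E.
Proof.
move=> mf f0; pose f_ := nnsfun_approx mD mf.
have mft n : measurable_fun setT (fun y => (f_ n (t y) * w y)%:E).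
 apply/measurable_EFinP; apply: measurable_funM => //.
 exact: measurableT_comp.
transitivity (limn (fun n => \int[nu]_(x in D) (f_ n x)%:E))%E.
 rewrite -monotone_convergence//.
 - by apply: eq_integral => x /set_mem Dx; apply/esym/cvg_lim => //; apply: cvg_nnsfun_approx.
 - by move=> n; exact/measurable_EFinP/measurable_funTS.
 - by move=> n x _; rewrite lee_fin.
 - by move=> x _ n k nk; rewrite lee_fin; exact/lefP/nd_nnsfun_approx.
transitivity (limn (fun n => \int[mu]_y (f_ n (t y) * w y)%:E))%E; last first.
 rewrite -monotone_convergence//.
 - apply: eq_integral => y _; apply/cvg_lim => //.
  have [E|wy] := eqVneq (w y) 0.
   rewrite E mule0; under eq_fun do rewrite mulr0; exact: cvg_cst.
  under eq_fun do rewrite EFinM.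
  apply: cvgeZr; first by [].
  by apply: cvg_nnsfun_approx => //; exact: wD.
 - by move=> n y _; rewrite lee_fin mulr_ge0.
 - by move=> y _ n k nk; rewrite lee_fin ler_wpM2r//; exact/lefP/nd_nnsfun_approx.
congr (limn _); apply/funext => n.
have mP k : measurable (f_ n @^-1` [set k]) by exact: measurable_sfunP.
transitivity (\sum_(k \in range (f_ n)) k%:E * nu (f_ n @^-1` [set k] `&` D))%E.
 under eq_integral do rewrite fimfunE -fsumEFin//.
 rewrite ge0_integral_fsum//.
 - apply: eq_fsbigr => k _; rewrite integralZl_indic_nnsfun// integral_indic//.
 - by move=> k; exact/measurable_EFinP/measurable_funTS/measurable_funM.
 - by move=> k x _; rewrite nnfun_muleindic_ge0.
transitivity (\int[mu]_y \sum_(k \in range (f_ n)) (k * \1_(f_ n @^-1` [set k]) (t y) * w y)%:E)%E; last first.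
 apply: eq_integral => y _; rewrite fsumEFin//; congr (_%:E).
 by rewrite [in RHS]fimfunE !fsbig_finite//= mulr_suml.
rewrite ge0_integral_fsum//.
- apply: eq_fsbigr => k kf; have k0 : 0 <= k by have [x _ <-] := set_mem kf.
 have mB : measurable (f_ n @^-1` [set k] `&` D) by exact: measurableI.
 rewrite (nuE mB); last by move=> x [].
 rewrite -ge0_integralZl//.
 + apply: eq_integral => y _; rewrite -EFinM; congr (_%:E); rewrite -mulrA; congr (_ * _).
  have [->|wy] := eqVneq (w y) 0; first by rewrite !mulr0.
  by congr (_ * _); rewrite !indicE in_setI (mem_set (wD wy)) andbT.
 + apply/measurable_EFinP/measurable_funM => //.
  by apply: measurableT_comp => //; exact: measurable_indic.
 + by move=> y _; rewrite lee_fin mulr_ge0.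
- move=> k; apply/measurable_EFinP/measurable_funM => //; apply: measurable_funM => //.
 by apply: measurableT_comp => //; exact: measurable_indic.
- move=> k y _; rewrite lee_fin mulr_ge0//.
 have [/set_mem[x _ <-]|nk] := boolP (k \in range (f_ n)); first by rewrite mulr_ge0.
 rewrite indicE memNset ?mulr0// => E; move/negP: nk; apply; rewrite inE.
 by exists (t y).
Qed.

End Transfer.

(** * Orthonormalization of rows *)

Section GramSchmidt.
Variable R : realType.

Lemma mulmx_dot k n (A : 'M[R]_(k, n)) (B : 'M[R]_(k, n)) i j : (A *m B^T) i j = dot (row i A) (row j B).
Proof. by rewrite dotE mxE; apply: eq_bigr => l _; rewrite !mxE. Qed.

(** Gram-Schmidt by induction on the number of rows: the lower rows are orthonormalized, then the
    first row is projected off their span and normalized. The change of basis is kept explicitly. *)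
Lemma orthonormal_rows r n (A : 'M[R]_(r, n)) : row_free A ->
 exists2 P : 'M[R]_r, P \in unitmx & (P *m A) *m (P *m A)^T = 1%:M.
Proof.
elim: r A => [|r IH] A Af; first by exists 1%:M; [exact: unitmx1|apply/matrixP => -[]].
have cf (v : 'rV[R]_r.+1) : v *m A = 0 -> v = 0 by exact: row_free_eq0.
pose a := row ord0 A; pose B : 'M[R]_(r, n) := \matrix_i row (lift ord0 i) A.
have AE (v : 'rV[R]_r.+1) : v *m A = v 0 ord0 *: a + (\row_i v 0 (lift ord0 i)) *m B.
 apply/rowP => j; rewrite !mxE big_ord_recl; congr (_ + _).
 by apply: eq_bigr => i _; rewrite !mxE.
have Bf : row_free B.
 apply/row_free_kernel => v vB.
 have := cf (\row_i (if unlift ord0 i is Some k then v 0 k else 0)).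
 rewrite AE mxE unlift_none scale0r add0r.
 have -> : (\row_i (\row_i0 (if unlift ord0 i0 is Some k then v 0 k else 0)) 0 (lift ord0 i)) = v.
  by apply/rowP => i; rewrite !mxE liftK.
 by move=> /(_ vB)/rowP E; apply/rowP => i; have := E (lift ord0 i); rewrite !mxE liftK.
have [P Pu PP] := IH B Bf; pose Q := P *m B.
pose y := a - a *m Q^T *m Q.
have QQ1 : Q *m Q^T = 1%:M := PP.
have yQ : y *m Q^T = 0 by rewrite mulmxBl -[_ *m Q *m _]mulmxA QQ1 mulmx1 subrr.
have y0 : y != 0.
 apply/eqP => E; pose v : 'rV[R]_r.+1 := \row_i (if unlift ord0 i is Some k then (- (a *m Q^T *m P)) 0 k else 1).
 have : v *m A = 0.
  rewrite AE mxE unlift_none scale1r.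
  have -> : (\row_i v 0 (lift ord0 i)) = - (a *m Q^T *m P) by apply/rowP => i; rewrite !mxE liftK !mxE.
  by rewrite mulNmx -[_ *m P *m B]mulmxA -/Q.
 by move/cf/rowP/(_ ord0); rewrite !mxE unlift_none => /eqP; rewrite oner_eq0.
have ny : 0 < enorm y.
 by rewrite lt_neqAle enorm_ge0 andbT eq_sym; apply: contraNneq y0 => /enorm_eq0 ->.
pose z := (enorm y)^-1 *: y.
have zQ : z *m Q^T = 0 by rewrite -scalemxAl yQ scaler0.
have zz : dot z z = 1.
 rewrite dotZl dotZr -sqr_enorm expr2; field; exact: lt0r_neq0.
pose P1 : 'M[R]_r.+1 := \matrix_i (if unlift ord0 i is Some k then
 \row_j (if unlift ord0 j is Some l then P k l else 0)
 else \row_j (if unlift ord0 j is Some l then (- (enorm y)^-1 *: (a *m Q^T *m P)) 0 l else (enorm y)^-1)).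
have r0 : row ord0 (P1 *m A) = z.
 rewrite row_mul AE /z /y scalerBr !mxE unlift_none mxE unlift_none; congr (_ + _).
 have -> : \row_i (row ord0 P1) 0 (lift ord0 i) = - (enorm y)^-1 *: (a *m Q^T *m P).
  by apply/rowP => i; rewrite !mxE unlift_none mxE liftK !mxE.
 by rewrite -scalemxAl -[_ *m P *m B]mulmxA -/Q scaleNr.
have rS k : row (lift ord0 k) (P1 *m A) = row k Q.
 rewrite row_mul AE [(row (lift ord0 k) P1) 0 ord0]mxE [P1 _ _]mxE liftK mxE unlift_none scale0r add0r.
 rewrite /Q [RHS]row_mul; congr (_ *m _).
 by apply/rowP => i; rewrite !mxE liftK mxE liftK.
have PA : (P1 *m A) *m (P1 *m A)^T = 1%:M.
 apply/matrixP => i j; rewrite mulmx_dot mxE.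
 have QQ k l : dot (row k Q) (row l Q) = (k == l)%:R.
  by rewrite -mulmx_dot PP mxE.
 have zq k : dot z (row k Q) = 0.
  by have /rowP/(_ k) := zQ; rewrite !mxE dotE => E; rewrite -[RHS]E; apply: eq_bigr => l _; rewrite !mxE.
 case: (unliftP ord0 i) => [k|] ->; case: (unliftP ord0 j) => [l|] ->; rewrite ?r0 ?rS ?QQ ?zz ?eqxx//.
by rewrite dotC zq eq_sym (negbTE (neq_lift _ _)).
exists P1 => //.
by have := mulmx1_unit (etrans (mulmxA _ _ _) PA) => -[].
Qed.

End GramSchmidt.

(** * Derivative of a determinant *)

Section Jacobi.
Variable R : realType.

Lemma is_derive_prod (I : eqType) (r : seq I) (f df : I -> R -> R) (t : R) : uniq r ->
 (forall i, is_derive t (1 : R) (f i) (df i t)) ->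
 is_derive t (1 : R) (fun s => \prod_(i <- r) f i s)
  (\sum_(i <- r) df i t * \prod_(j <- r | j != i) f j t).
Proof.
move=> + fd; elim: r => [|i r IH] ur.
 rewrite big_nil; have -> : (fun s => \prod_(i <- [::]) f i s) = cst 1.
  by apply/funext => s; rewrite big_nil.
 exact: is_derive_cst.
have [ir ur'] : i \notin r /\ uniq r by move: ur => /= /andP[].
have -> : (fun s => \prod_(j <- i :: r) f j s) = f i * (fun s => \prod_(j <- r) f j s).
 by apply/funext => s; rewrite big_cons.
apply: is_derive_eq (is_deriveM (fd i) (IH ur')) _.
rewrite /GRing.scale /= big_cons addrC; congr (_ + _).
 rewrite mulrC big_cons eqxx /=; congr (_ * _).
 by rewrite big_seq [RHS]big_seq_cond; apply: eq_bigl => j; case: eqP => [->|]; rewrite ?(negbTE ir) ?andbF ?andbT.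
rewrite mulr_sumr; apply: eq_big_seq => j jr.
have ij : i != j by apply: contraNneq ir => ->.
by rewrite big_cons ij mulrCA.
Qed.

Lemma is_derive_prod_ord k (f df : 'I_k -> R -> R) (t : R) :
 (forall i, is_derive t (1 : R) (f i) (df i t)) ->
 is_derive t (1 : R) (fun s => \prod_i f i s) (\sum_i df i t * \prod_(j | j != i) f j t).
Proof. by move=> H; apply: is_derive_prod => //; exact: index_enum_uniq. Qed.

Lemma is_derive_bigsum (I : Type) (r : seq I) (f df : I -> R -> R) (t : R) :
 (forall i, is_derive t (1 : R) (f i) (df i t)) ->
 is_derive t (1 : R) (fun s => \sum_(i <- r) f i s) (\sum_(i <- r) df i t).
Proof.
move=> fd; elim: r => [|i r IH].
 rewrite big_nil; have -> : (fun s => \sum_(i <- [::]) f i s) = cst 0.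
  by apply/funext => s; rewrite big_nil.
 exact: is_derive_cst.
have -> : (fun s => \sum_(j <- i :: r) f j s) = f i + (fun s => \sum_(j <- r) f j s).
 by apply/funext => s; rewrite big_cons.
by rewrite big_cons; apply: is_deriveD.
Qed.

(** Jacobi's formula: the product rule yields a sum of determinants with one row differentiated, and
    each is expanded along that row. *)
Lemma is_derive_det k (A dA : R -> 'M[R]_k) (t : R) :
 (forall i j, is_derive t (1 : R) (fun s => A s i j) (dA t i j)) ->
 is_derive t (1 : R) (fun s => \det (A s)) (\tr (\adj (A t) *m dA t)).
Proof.
move=> Ad.
have D (s : 'S_k) : is_derive t (1 : R) (fun u => (-1) ^+ s * \prod_i A u i (s i))
 ((-1) ^+ s * \sum_i dA t i (s i) * \prod_(j | j != i) A t j (s j)).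
 have := @is_deriveZ R R R _ ((-1) ^+ s) t 1 _ (@is_derive_prod_ord k (fun i u => A u i (s i)) (fun i u => dA u i (s i)) t (fun i => Ad i (s i))).
 by [].
have := @is_derive_bigsum _ (index_enum {perm 'I_k}) (fun s u => (-1) ^+ s * \prod_i A u i (s i))
 (fun s u => (-1) ^+ s * \sum_i dA u i (s i) * \prod_(j | j != i) A u j (s j)) t D.
move=> H; apply: is_derive_eq H _.
transitivity (\sum_i \det (\matrix_(a, b) if a == i then dA t a b else A t a b)).
 under eq_bigr do rewrite mulr_sumr.
 rewrite exchange_big; apply: eq_bigr => i _; apply: eq_bigr => s _; congr (_ * _).
 rewrite [RHS](bigD1 i)//= mxE eqxx; congr (_ * _); apply: eq_bigr => j ji.
 by rewrite mxE (negbTE ji).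
rewrite mxtrace_mulC; apply: eq_bigr => i _; rewrite (expand_det_row _ i) mxE.
apply: eq_bigr => j _; rewrite !mxE eqxx; congr (_ * _); rewrite /cofactor; congr (_ * \det _).
by apply/matrixP => a b; rewrite !mxE eq_sym (negbTE (neq_lift _ _)).
Qed.

End Jacobi.

(** * The divergence in a chart *)

Section Divergence.
Variables (R : realType) (m n : nat) (M : manifold R m) (psi : M -> 'rV[R]_n).
Hypothesis imm : immersion psi.
Variable phi : chart R m M.
Hypothesis at_ : atlas phi.
Notation V := 'rV[R]_m.
Let U := crange phi.
Let oU : open U := open_crange phi.

Definition vdens (u : V) : R := Num.sqrt (\det (gram (psi \o cinv phi) u)).
Definition jd (a : 'I_m) (i : 'I_n) : V -> R := 'D_(e_ a) (xx psi i \o cinv phi).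
Notation E u := (Emx psi phi u).
Notation J u := (jac (psi \o cinv phi) u).

Lemma jd_smooth k a i : Sk k U (jd a i).
Proof. exact: Sk_partial a (xx_smooth imm k.+1 i at_). Qed.

Lemma jdE u a i : U u -> J u a i = jd a i u.
Proof. exact: jacE. Qed.

Lemma vdens_gt0 u : U u -> 0 < vdens u.
Proof. by move=> Uu; rewrite sqrtr_gt0; exact: gram_det_pos. Qed.

Lemma vdens_smooth k : Sk k U vdens.
Proof.
have H : Sk k U (fun u => \det (gram (psi \o cinv phi) u) `^ 2^-1).
 by apply: Sk_powR => //; [move=> u Uu; exact: gram_det_pos|exact: gram_det_smooth].
apply: (Sk_eq oU _ H) => u; rewrite inE => Uu; rewrite powR12_sqrt// ltW//; exact: gram_det_pos.
Qed.

Lemma Sk_is_derive k f u i : Sk k.+1 U f -> U u -> is_derive u (e_ i) f ('D_(e_ i) f u).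
Proof. by move=> fS Uu; apply: derivableP; exact: (Sk_der i fS). Qed.

Lemma is_derive_near_open (f g : V -> R) u v a : U u -> {in U, f =1 g} ->
 is_derive u v f a -> is_derive u v g a.
Proof.
move=> Uu fg [fd <-]; have [H1 H2] := derive_nbhs_eq v oU Uu fg.
by split; [exact: H1|rewrite H2].
Qed.

Lemma partial_gram u b a c : U u -> is_derive u (e_ b) (fun w => gram (psi \o cinv phi) w a c)
 (\sum_i ('D_(e_ b) (jd a i) u * jd c i u + jd a i u * 'D_(e_ b) (jd c i) u)).
Proof.
move=> Uu; apply: (@is_derive_near_open (\sum_i (jd a i * jd c i))) => //.
 move=> w; rewrite inE => Uw; rewrite fct_sumE /gram mxE; apply: eq_bigr => i _.
 by rewrite [(J w)^T _ _]mxE !jdE.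
have H i : is_derive u (e_ b) (jd a i * jd c i)
  ('D_(e_ b) (jd a i) u * jd c i u + jd a i u * 'D_(e_ b) (jd c i) u).
 have d1 := Sk_is_derive b (jd_smooth 1 a i) Uu; have d2 := Sk_is_derive b (jd_smooth 1 c i) Uu.
 apply: is_derive_eq (is_deriveM d1 d2) _; rewrite /GRing.scale /= addrC; congr (_ + _); exact: mulrC.
exact: is_derive_sum (fun i => H i).
Qed.

(** Differentiating [vdens * vdens = det g] by Jacobi's formula; the two halves of the derivative of
    the Gram matrix contribute equally because it is symmetric. *)
Lemma partial_vdens b u : U u ->
 'D_(e_ b) vdens u = vdens u * \sum_a \sum_i 'D_(e_ b) (jd a i) u * E u i a.
Proof.
move=> Uu; pose g := gram (psi \o cinv phi) u.
have gu : g \in unitmx by exact: gram_unit (jac_free imm at_ Uu).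
pose K : 'M[R]_(m, n) := \matrix_(a, i) 'D_(e_ b) (jd a i) u.
pose dg : 'M[R]_m := K *m (J u)^T + J u *m K^T.
have dgE a c : is_derive u (e_ b) (fun w => gram (psi \o cinv phi) w a c) (dg a c).
 apply: is_derive_eq (partial_gram b a c Uu) _; rewrite big_split !mxE; congr (_ + _);
  by apply: eq_bigr => i _; rewrite [(_)^T _ _]mxE [K _ _]mxE jdE.
have dD : is_derive u (e_ b) (fun w => \det (gram (psi \o cinv phi) w)) (\tr (\adj g *m dg)).
 apply/is_derive_lineP.
 have := @is_derive_det R m (fun s => gram (psi \o cinv phi) (u + s *: e_ b)) (fun=> dg) 0.
 rewrite scale0r addr0; apply => a c.
 exact: (@is_derive_lineP _ _ _ (fun w => gram (psi \o cinv phi) w a c) u (e_ b) _).1 (dgE a c).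
have adjE : \adj g = \det g *: invmx g.
 by rewrite /invmx gu scalerA divrr ?scale1r// -unitmxE.
have gT : g^T = g by rewrite /g /gram trmx_mul trmxK.
have trE : \tr (\adj g *m dg) = 2 * \det g * \tr (K *m E u).
 rewrite adjE -scalemxAl mxtraceZ mulrAC mulrC; congr (_ * _).
 rewrite mulmxDr mxtraceD.
 have -> : \tr (invmx g *m (K *m (J u)^T)) = \tr (K *m E u).
  by rewrite mxtrace_mulC -mulmxA.
 have -> : \tr (invmx g *m (J u *m K^T)) = \tr (K *m E u).
  rewrite -mxtrace_tr mulmxA trmx_mul trmxK trmx_mul (invmx_sym gT).
  by [].
 by ring.
have d1 := Sk_is_derive b (vdens_smooth 1) Uu.
have d2 := is_deriveM d1 d1.
have E2 : {in U, vdens * vdens =1 (fun w => \det (gram (psi \o cinv phi) w))}.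
 move=> w; rewrite inE => Uw; transitivity (vdens w ^+ 2); first by rewrite expr2.
 by rewrite /vdens sqr_sqrtr// ltW//; exact: gram_det_pos.
have [_ e1] := is_derive_near_open Uu E2 d2; have [_ e2] := dD.
have e3 := etrans (esym e1) e2; rewrite trE /GRing.scale /= in e3.
have v0 := vdens_gt0 Uu; have vv : vdens u * vdens u = \det g by apply: E2; rewrite inE.
have -> : \sum_a \sum_i 'D_(e_ b) (jd a i) u * E u i a = \tr (K *m E u).
 by apply: eq_bigr => a _; rewrite mxE; apply: eq_bigr => i _; rewrite [K _ _]mxE.
move: e3; rewrite -vv; set D := 'D_(e_ b) vdens u; set T := \tr _ => e3.
have h : 2 * vdens u * D = 2 * vdens u * (vdens u * T) by transitivity (vdens u * D + vdens u * D); [ring|rewrite e3; ring].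
by move/mulfI : h; apply; rewrite mulf_neq0 ?pnatr_eq0// gt_eqF.
Qed.

Variable Y : 'I_n -> M -> R.
Hypothesis YS : forall i, CM 1 (Y i).
Definition yrow p : 'rV[R]_n := \row_i Y i p.
Hypothesis Ytan : forall u, U u -> yrow (cinv phi u) *m E u *m J u = yrow (cinv phi u).

Definition ycomp (a : 'I_m) (u : V) : R := \sum_i Y i (cinv phi u) * E u i a.

Lemma ycomp_smooth a : Sk 1 U (ycomp a).
Proof.
apply: Sk_sum => // i _; apply: SkM => //; first exact: YS.
exact: (@Emx_smooth _ _ _ _ _ imm phi 1 i a at_).
Qed.

Lemma Y_ycomp u i : U u -> Y i (cinv phi u) = \sum_b ycomp b u * jd b i u.
Proof.
move=> Uu; have /rowP/(_ i) := Ytan Uu; rewrite mxE [RHS]mxE => <-.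
apply: eq_bigr => b _; rewrite jdE//; congr (_ * _).
by rewrite mxE; apply: eq_bigr => k _; rewrite [yrow _ _ _]mxE.
Qed.

(** The ambient sum of the derivatives of [Y] is the coordinate divergence plus terms in the second
    derivatives of the immersion; by symmetry of mixed derivatives these are exactly the logarithmic
    derivative of the density. *)
Lemma divergence_chart u : U u ->
 vdens u * \sum_i dl psi i (Y i) (cinv phi u) = \sum_a 'D_(e_ a) (fun w => vdens w * ycomp a w) u.
Proof.
move=> Uu.
have JE : J u *m E u = 1%:M by exact: mul_pinv (jac_free imm at_ Uu).
have dY a i : 'D_(e_ a) (Y i \o cinv phi) u = \sum_b ('D_(e_ a) (ycomp b) u * jd b i u + ycomp b u * 'D_(e_ a) (jd b i) u).
 have H b : is_derive u (e_ a) (ycomp b * jd b i) ('D_(e_ a) (ycomp b) u * jd b i u + ycomp b u * 'D_(e_ a) (jd b i) u).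
  have d1 := Sk_is_derive a (ycomp_smooth b) Uu; have d2 := Sk_is_derive a (jd_smooth 1 b i) Uu.
  apply: is_derive_eq (is_deriveM d1 d2) _; rewrite /GRing.scale /= addrC; congr (_ + _); exact: mulrC.
 have E1 : {in U, \sum_b ycomp b * jd b i =1 Y i \o cinv phi}.
  by move=> w; rewrite inE => Uw; rewrite fct_sumE /= (Y_ycomp i Uw).
 by have [_ ->] := is_derive_near_open Uu E1 (is_derive_sum (fun b => H b)).
have dv a : 'D_(e_ a) (fun w => vdens w * ycomp a w) u = vdens u * 'D_(e_ a) (ycomp a) u + ycomp a u * 'D_(e_ a) vdens u.
 have d1 := Sk_is_derive a (vdens_smooth 1) Uu; have d2 := Sk_is_derive a (ycomp_smooth a) Uu.
 by have [_] := is_deriveM d1 d2.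
under [RHS]eq_bigr do rewrite dv.
rewrite big_split /=.
have L1 i : dl psi i (Y i) (cinv phi u) = \sum_a E u i a * \sum_b ('D_(e_ a) (ycomp b) u * jd b i u + ycomp b u * 'D_(e_ a) (jd b i) u).
 by rewrite (dl_cinv imm i at_ Uu (YS i)); apply: eq_bigr => a _; rewrite dY.
have -> : \sum_i dl psi i (Y i) (cinv phi u) = \sum_a \sum_b 'D_(e_ a) (ycomp b) u * (\sum_i J u b i * E u i a) +
 \sum_b ycomp b u * \sum_a \sum_i 'D_(e_ a) (jd b i) u * E u i a.
 transitivity (\sum_i \sum_a \sum_b ('D_(e_ a) (ycomp b) u * (J u b i * E u i a) + ycomp b u * ('D_(e_ a) (jd b i) u * E u i a))).
  apply: eq_bigr => i _; rewrite L1; apply: eq_bigr => a _; rewrite mulr_sumr; apply: eq_bigr => b _.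
  by rewrite jdE//; ring.
 under eq_bigr do under eq_bigr do rewrite big_split.
 under eq_bigr do rewrite big_split; rewrite big_split /=; congr (_ + _).
  rewrite exchange_big; apply: eq_bigr => a _; rewrite exchange_big; apply: eq_bigr => b _.
  by rewrite mulr_sumr.
 under eq_bigr do rewrite exchange_big.
 rewrite exchange_big; apply: eq_bigr => b _; rewrite mulr_sumr exchange_big; apply: eq_bigr => a _.
 by rewrite mulr_sumr.
rewrite mulrDr; congr (_ + _).
 rewrite mulr_sumr; apply: eq_bigr => a _; congr (_ * _).
 have JEe b : \sum_i J u b i * E u i a = (b == a)%:R.
  by have /matrixP/(_ b a) := JE; rewrite mxE [RHS]mxE.
 rewrite (bigD1 a)//= JEe eqxx mulr1 big1 ?addr0// => b ba.
 by rewrite JEe (negbTE ba) mulr0.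
rewrite mulr_sumr; apply: eq_bigr => b _; apply: etrans (mulrCA _ _ _) _.
apply: (congr1 (fun z => ycomp b u * z)); apply: etrans _ (esym (partial_vdens b Uu)).
apply: (congr1 (fun z => vdens u * z)).
apply: eq_bigr => a _; apply: eq_bigr => i _; apply: (congr1 (fun z => z * E u i a)).
exact: (partial_sym a b oU (xx_smooth imm 2 i at_) Uu).
Qed.

End Divergence.

(** * The volume measure on coordinate boxes *)

Section ChartMeasure.
Variables (R : realType) (m n : nat) (M : manifold R m) (psi : M -> 'rV[R]_n).
Hypothesis imm : immersion psi.
Variable dM : {measure set (borel M) -> \bar R}.
Hypothesis dM_volume : is_volume psi dM.
Notation V := 'rV[R]_m.
Notation mu := (leb R m).

Section OneChart.
Variables (phi : chart R m M) (c : V) (r : R).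
Hypothesis at_ : atlas phi.
Hypothesis r0 : 0 <= r.
Hypothesis sub : box c r `<=` crange phi.
Let K : set M := cinv phi @` box c r.
Let oU : open (crange phi) := open_crange phi.

(** Both maps are made total and Borel by default values off the box. The default point is
    immaterial, since the weight is 0 there. *)
Definition chart_pt (u : V) : M := if `[< box c r u >] then cinv phi u else cinv phi c.
Definition chart_wt (u : V) : R := if `[< box c r u >] then vdens psi phi u else 0.

Lemma chart_ptE u : box c r u -> chart_pt u = cinv phi u.
Proof. by move=> bu; rewrite /chart_pt asboolT. Qed.

Lemma chart_wtE u : box c r u -> chart_wt u = vdens psi phi u.
Proof. by move=> bu; rewrite /chart_wt asboolT. Qed.

Lemma chart_wt_out u : ~ box c r u -> chart_wt u = 0.
Proof. by move=> bu; rewrite /chart_wt asboolF. Qed.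

Lemma chart_wt_ge0 u : 0 <= chart_wt u.
Proof. by rewrite /chart_wt; case: ifP => // _; rewrite sqrtr_ge0. Qed.

Lemma box_center : box c r c.
Proof. by move=> a; rewrite subrr normr0. Qed.

Lemma chart_pt_in u : K (chart_pt u).
Proof.
rewrite /chart_pt; case: ifP => [/asboolP bu|_]; first by exists u.
by exists c => //; exact: box_center.
Qed.

Lemma measurable_patch (T : topologicalType) (f : V -> T) (O : set T) : open O ->
 (forall u, crange phi u -> {for u, continuous f}) ->
 measurable (box c r `&` f @^-1` O : set (brow R m)).
Proof.
move=> oO fc.
have -> : box c r `&` f @^-1` O = box c r `&` (crange phi `&` f @^-1` O).
 by apply/seteqP; split=> u [bu]; [move=> fu; split=> //; split=> //; exact: sub|move=> [_ fu]].
apply: measurableI; first exact: measurable_box.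
apply: measurable_open_brow; rewrite openE => u [Uu Ou].
have n1 : nbhs u (crange phi) := open_nbhs_nbhs (conj oU Uu).
have n2 : nbhs u (f @^-1` O) by apply: (fc u Uu); exact: open_nbhs_nbhs.
suff : nbhs u (crange phi `&` f @^-1` O) by [].
exact: filterI.
Qed.

Lemma measurable_const_patch (P : Prop) : measurable ((~` box c r) `&` [set _ | P] : set (brow R m)).
Proof.
have mB : measurable (~` box c r : set (brow R m)) by apply: measurableC; exact: measurable_box.
have [p|np] := pselect P.
 by have -> : [set _ : V | P] = setT; [apply/seteqP; split|rewrite setIT].
by have -> : [set _ : V | P] = set0; [apply/seteqP; split|rewrite setI0].
Qed.

Lemma measurable_chart_pt : measurable_fun setT (chart_pt : brow R m -> borel M).
Proof.
apply: measurable_into_borel => O oO.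
have -> : chart_pt @^-1` O = (box c r `&` cinv phi @^-1` O) `|` ((~` box c r) `&` [set _ | O (cinv phi c)]).
 apply/seteqP; split=> u.
  by rewrite /chart_pt /=; case: ifP => [/asboolP bu|/asboolP bu] h; [left|right].
 move=> [[bu h]|[bu h]]; rewrite /chart_pt /=; first by rewrite asboolT.
 by rewrite asboolF.
apply: measurableU; last exact: measurable_const_patch.
by apply: measurable_patch => // u; exact: (@cinv_continuous _ _ _ phi).
Qed.

Lemma measurable_chart_wt : measurable_fun setT (chart_wt : brow R m -> R).
Proof.
apply: (@measurability _ _ (brow R m) _ setT chart_wt _ (RGenOpens.measurableE R)).
move=> _ [_ [x [y ->]] <-]; rewrite setTI.
have -> : chart_wt @^-1` `]x, y[ = (box c r `&` vdens psi phi @^-1` `]x, y[) `|` ((~` box c r) `&` [set _ | `]x, y[%classic (0 : R)]).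
 apply/seteqP; split=> u.
  by rewrite /chart_wt /=; case: ifP => [/asboolP bu|/asboolP bu] h; [left|right].
 move=> [[bu h]|[bu h]]; rewrite /chart_wt /=; first by rewrite asboolT.
 by rewrite asboolF.
apply: measurableU; last exact: measurable_const_patch.
apply: measurable_patch; first exact: interval_open.
by move=> u Uu; exact: (Sk_cont (vdens_smooth imm at_ 0) Uu).
Qed.

Lemma measurable_chart_box : measurable (K : set (borel M)).
Proof.
have Kc := compact_closed (@carrier_hausdorff _ _ M) (box_image_compact sub).
rewrite -[X in measurable X]setCK; apply: measurableC; apply: sub_sigma_algebra.
exact: closed_openC.
Qed.

Lemma volume_chart (B : set (borel M)) : measurable B -> B `<=` K ->
 (dM B = \int[mu]_u (\1_B (chart_pt u) * chart_wt u)%:E)%E.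
Proof.
move=> mB BK; have BD : B `<=` cdom phi by move=> q /BK[u bu <-]; apply: cinv_dom; exact: sub.
rewrite (dM_volume at_ mB BD) -lebE.
- congr lebesgue_rV; apply/funext => u; congr (_%:E).
 have [bu|nbu] := pselect (box c r u).
  rewrite chart_ptE// chart_wtE//; congr (_ * _); rewrite !indicE; congr (nat_of_bool _)%:R.
  apply/idP/idP; rewrite !inE.
   by move=> [q Bq <-]; rewrite cmapK'//; exact: BD.
  by move=> Bu; exists (cinv phi u) => //; exact: cinvK (sub bu).
 rewrite chart_wt_out// mulr0 indicE memNset ?mul0r// => -[q Bq qu].
 by have [w bw wq] := BK q Bq; apply: nbu; rewrite -qu -wq cinvK//; exact: sub.
- apply/measurable_EFinP; apply: measurable_funM; last exact: measurable_chart_wt.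
 by apply: measurableT_comp measurable_chart_pt; exact: measurable_indic.
- by move=> u; rewrite lee_fin mulr_ge0// chart_wt_ge0.
Qed.

Lemma bfs_chart_wt : bfs mu (chart_wt : brow R m -> R).
Proof.
split; first exact: measurable_chart_wt.
have H := @continuous_compact _ _ (vdens psi phi) (box c r)
 (within_continuous_at (fun u bu => Sk_cont (vdens_smooth imm at_ 0) (sub bu))) (@box_compact R m c r).
have [C [_ HC]] := compact_bounded H.
exists (box c r), (`|C| + 1); split; [exact: measurable_box|exact: leb_box_fin|by rewrite addr_ge0|].
move=> u; rewrite indicE; have [bu|nbu] := pselect (box c r u).
 rewrite mem_set// mulr1 chart_wtE//; apply: (HC (`|C| + 1)); last by exists u.
 by apply: le_lt_trans (ler_norm C) _; rewrite ltrDl.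
by rewrite memNset// mulr0 chart_wt_out// normr0.
Qed.

Lemma volume_chart_fin : (dM K < +oo)%E.
Proof.
rewrite (volume_chart measurable_chart_box (@subset_refl _ _)).
have -> : (\int[mu]_u (\1_K (chart_pt u) * chart_wt u)%:E = \int[mu]_u `|(EFin \o chart_wt) u|)%E.
 apply: eq_integral => u _; rewrite /= ger0_norm ?chart_wt_ge0// indicE mem_set ?mul1r//.
 exact: chart_pt_in.
by have /integrableP[] := bfs_integrable bfs_chart_wt.
Qed.

Lemma J_chart (f : M -> R) : measurable_fun setT (f : borel M -> R) -> (forall q, ~ K q -> f q = 0) ->
 (\int[dM]_x f x = \int[mu]_u (f (chart_pt u) * chart_wt u))%R.
Proof.
move=> mf f0.
have T (g : borel M -> \bar R) : measurable_fun setT g -> (forall q, (0 <= g q)%E) -> (forall q, ~ K q -> g q = 0%E) ->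
 (\int[dM]_x g x = \int[mu]_u (g (chart_pt u) * (chart_wt u)%:E))%E.
 move=> mg g0 gK.
 have -> : (\int[dM]_x g x = \int[dM]_(x in K) g x)%E.
  rewrite [RHS]integral_mkcond; apply: eq_integral => x _; rewrite /patch.
  by case: ifP => // /negbT; rewrite notin_setE => /gK.
 apply: (@ge0_integral_transfer _ _ (borel M) (brow R m) R dM mu K chart_pt chart_wt measurable_chart_box
  measurable_chart_pt measurable_chart_wt chart_wt_ge0 _ volume_chart).
 - by move=> u _; exact: chart_pt_in.
 - exact: measurable_funTS.
 - by move=> q _.
have mE : measurable_fun setT (EFin \o (f : borel M -> R)) by exact/measurable_EFinP.
rewrite /Rintegral; congr fine; rewrite [LHS]integralE [RHS]integralE; congr (_ - _)%E.
 apply: etrans (T _ (measurable_funepos mE) (fun q => funepos_ge0 _ q) _) _.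
  by move=> q /f0 E; rewrite funeposE /= E maxxx.
 apply: eq_integral => u _; rewrite !funeposE /= -!EFin_max -EFinM; congr (_%:E).
 by rewrite maxr_pMl ?mul0r// chart_wt_ge0.
apply: etrans (T _ (measurable_funeneg mE) (fun q => funeneg_ge0 _ q) _) _.
 by move=> q /f0 E; rewrite funenegE /= E oppr0 maxxx.
apply: eq_integral => u _; rewrite !funenegE /= -!EFin_max -EFinM; congr (_%:E).
by rewrite maxr_pMl ?mul0r ?mulNr// chart_wt_ge0.
Qed.

End OneChart.

Lemma compact_volume_fin (K : set M) : compact K -> (dM K < +oo)%E.
Proof.
move=> Kc.
pose P (A : set M) := exists B : set M, [/\ A `<=` B, measurable (B : set (borel M)) & (dM B < +oo)%E].
have [B [KB mB fB]] : P K.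
 apply: compact_induction Kc _ _ _ _.
 - by exists set0; split=> //; rewrite measure0 ltry.
 - by move=> A B AB [C [BC mC fC]]; exists C; split=> //; exact: subset_trans BC.
 - move=> A B [C [AC mC fC]] [D [BD mD fD]]; exists (C `|` D); split; first exact: setUSS.
   exact: measurableU.
  by apply: le_lt_trans (measureU2 dM mC mD) _; exact: lte_add_pinfty.
 move=> p _; pose phi := chart_at p; have Dp : cdom phi p := chart_at_dom p.
 have at_ : atlas phi := chart_at_atlas p.
 have [r r0 Hr] := nbhs_box (open_nbhs_nbhs (conj (open_crange phi) (crange_cmap Dp))).
 exists (cdom phi `&` (cmap phi @^-1` box (cmap phi p) r)).
  by apply: cmap_nbhs => //; exact: box_nbhs.
 exists (cinv phi @` box (cmap phi p) r); split.
 - by move=> q [Dq bq]; exists (cmap phi q) => //; exact: cmapK'.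
 - exact: measurable_chart_box.
 - exact: volume_chart_fin at_ (ltW r0) Hr.
have Kcl := compact_closed (@carrier_hausdorff _ _ M) Kc.
apply: le_lt_trans fB; apply: le_measure => //; rewrite inE//.
rewrite -[X in measurable X]setCK; apply: measurableC; apply: sub_sigma_algebra; exact: closed_openC.
Qed.

Lemma compact_support_bfs (f : M -> R) (K : set M) : continuous f -> compact K -> (forall q, ~ K q -> f q = 0) ->
 bfs dM (f : borel M -> R).
Proof.
move=> fc Kc f0; split; first exact: continuous_borel.
have [C C0 H] := continuous_compact_bounded fc Kc.
have Kcl := compact_closed (@carrier_hausdorff _ _ M) Kc.
exists K, C; split=> //.
- rewrite -[X in measurable X]setCK; apply: measurableC; apply: sub_sigma_algebra; exact: closed_openC.
- exact: compact_volume_fin.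
move=> u; rewrite indicE; have [Ku|Ku] := pselect (K u); first by rewrite mem_set// mulr1 H.
by rewrite memNset// mulr0 f0// normr0.
Qed.

End ChartMeasure.

(** * Integration by parts in one chart *)

Section LocalWeak.
Variables (R : realType) (m n : nat) (M : manifold R m) (psi : M -> 'rV[R]_n).
Hypothesis imm : immersion psi.
Variable dM : {measure set (borel M) -> \bar R}.
Hypothesis dM_volume : is_volume psi dM.
Notation V := 'rV[R]_m.
Notation mu := (leb R m).
Notation Jac phi u := (jac (psi \o cinv phi) u).
Notation E phi u := (Emx psi phi u).

Lemma near_le2 (f : V -> R) c : {for c, continuous f} -> f c = 1 -> \forall u \near c, f u <= 2.
Proof.
move=> fc f1; apply: filterS (continuous_near fc ltr01) => u.
by rewrite f1 ler_norml => /andP[h1 h2]; lra.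
Qed.

(** A constant change of basis makes the coordinate vectors orthonormal at [p]; by continuity they
    and their duals have length at most 2 on a small box. This keeps the geometry of the chart out
    of later constants. *)
Lemma good_frame p : exists (r : R) (P Q : 'M[R]_m), [/\ 0 < r, P *m Q = 1%:M, Q *m P = 1%:M,
 box (cmap (chart_at p) p) r `<=` crange (chart_at p) &
 forall u k, box (cmap (chart_at p) p) r u ->
  enorm (row k P *m Jac (chart_at p) u) <= 2 /\ enorm (col k (E (chart_at p) u *m Q))^T <= 2].
Proof.
set phi := chart_at p; have at_ : atlas phi := chart_at_atlas p; have Dp : cdom phi p := chart_at_dom p.
have oU := open_crange phi; set c := cmap phi p; have Uc : crange phi c by exact: crange_cmap.
have Jf := jac_free imm at_ Uc.
have [P Pu PP] := orthonormal_rows Jf; pose Q := invmx P.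
have PQ : P *m Q = 1%:M by exact: mulmxV.
have QP : Q *m P = 1%:M by exact: mulVmx.
have E1 : E phi c *m Q = (P *m Jac phi c)^T.
 have gP : (Jac phi c *m (Jac phi c)^T) *m (P^T *m P) = 1%:M.
  have e1 : Jac phi c *m (Jac phi c)^T *m P^T = Q.
   by rewrite -[LHS]mul1mx -QP -!mulmxA -trmx_mul [P *m (_ *m _)]mulmxA PP mulmx1.
  by rewrite mulmxA e1.
 have iv : invmx (Jac phi c *m (Jac phi c)^T) = P^T *m P.
  have gu : Jac phi c *m (Jac phi c)^T \in unitmx by exact: gram_unit.
  by rewrite -[RHS](mulKmx gu) gP mulmx1.
 by rewrite /Emx /pinv iv -!mulmxA PQ mulmx1 trmx_mul.
have n1 k : enorm (row k P *m Jac phi c) = 1.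
 rewrite -row_mul /enorm -mulmx_dot PP mxE eqxx sqrtr1 //.
have n2 k : enorm (col k (E phi c *m Q))^T = 1 by rewrite E1 tr_col trmxK row_mul n1.
have c1 k : {for c, continuous (fun u => enorm (row k P *m Jac phi u))}.
 apply: enorm_continuous; apply: continuous_row => j.
 have C : Sk 0 (crange phi) (fun u => \sum_a P k a * jd psi phi a j u).
  by apply: Sk_sum => // a _; apply: SkM => //; [exact: Sk_cst|exact: jd_smooth].
 apply: (continuous_at_eq oU Uc _ (Sk_cont C Uc)) => u; rewrite inE => Uu.
 by rewrite mxE; apply: eq_bigr => a _; rewrite mxE jdE.
have c2 k : {for c, continuous (fun u => enorm (col k (E phi u *m Q))^T)}.
 apply: enorm_continuous; apply: continuous_row => j.
 have C : Sk 0 (crange phi) (fun u => \sum_a E phi u j a * Q a k).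
  apply: Sk_sum => // a _; apply: SkM => //; last exact: Sk_cst.
  exact: (@Emx_smooth _ _ _ _ _ imm phi 0 j a at_).
 apply: (continuous_at_eq oU Uc _ (Sk_cont C Uc)) => u; rewrite inE => Uu.
 by rewrite mxE [RHS]mxE mxE.
have N1 : \forall u \near c, forall k, enorm (row k P *m Jac phi u) <= 2.
 apply: (@filter_forall V 'I_m (fun k u => enorm (row k P *m Jac phi u) <= 2) (nbhs c) _) => k.
 exact: (near_le2 (c1 k) (n1 k)).
have N2 : \forall u \near c, forall k, enorm (col k (E phi u *m Q))^T <= 2.
 apply: (@filter_forall V 'I_m (fun k u => enorm (col k (E phi u *m Q))^T <= 2) (nbhs c) _) => k.
 exact: (near_le2 (c2 k) (n2 k)).
have [r r0 Hr] := nbhs_box (filterI (open_nbhs_nbhs (conj oU Uc)) (filterI N1 N2)).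
exists r, P, Q; split=> //; first by move=> u /Hr[].
by move=> u k /Hr[_ [h1 h2]].
Qed.

Lemma derive_out (xi : V -> R) c rho u v : (forall u, ~ box c rho u -> xi u = 0) -> ~ box c rho u ->
 'D_v xi u = 0.
Proof.
move=> x0 nbu; have oB : open (~` box c rho) by apply: closed_openC; exact: box_closed.
rewrite (derive_nbhs_eq (g := cst 0) v oB nbu _).2 ?derive_cst//.
by move=> w; rewrite inE; exact: x0.
Qed.

Definition tangent (Y : 'I_n -> M -> R) := forall phi u, atlas phi -> crange phi u ->
 yrow Y (cinv phi u) *m E phi u *m Jac phi u = yrow Y (cinv phi u).

Definition dvg (Y : 'I_n -> M -> R) (q : M) : R := \sum_i dl psi i (Y i) q.

Lemma dvg_continuous Y : (forall i, CM 1 (Y i)) -> continuous (dvg Y).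
Proof.
move=> YS q; apply: sum_continuous_at => i _.
exact: (CM_continuous (dl_smooth imm i (YS i))).
Qed.

(** The field [b Y] is compactly supported in the chart, so its divergence is a sum of directional
    derivatives along the rows of [P], and [weak_inequality] is applied in each of these [m]
    directions. *)
Lemma local_weak p : exists r : R, [/\ 0 < r, box (cmap (chart_at p) p) r `<=` crange (chart_at p) &
 forall (b : M -> R), b = bump (chart_at p) (cmap (chart_at p) p) r ->
 forall (Y : 'I_n -> M -> R) (f : M -> R) (ep : R), (forall i, CM 1 (Y i)) -> tangent Y -> 0 <= ep ->
 continuous f -> (forall q, 0 <= f q <= 1) ->
 (forall q q' a, (rdist psi q q' < a%:E)%E -> `|f q - f q'| <= ep * a) ->
 `|\int[dM]_q (f q ^+ 2 * dvg (fun i => b * Y i) q)| <=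
  (20 * m%:R * ep) * \int[dM]_q (f q * (b q * enorm (yrow Y q)))]%R.
Proof.
have [r [P [Q [r0 PQ QP sub fr]]]] := good_frame p.
exists r; split=> //.
set phi := chart_at p; set c := cmap phi p; move=> b bE Y f ep YS Ytan ep0 fc f01 fl.
have at_ : atlas phi := chart_at_atlas p; have oU := open_crange phi.
have bS : CM 1 b by rewrite bE; exact: bump_smooth.
have b01 q : 0 <= b q <= 1 by rewrite bE; exact: bump01.
pose Z i : M -> R := b * Y i.
have ZS i : CM 1 (Z i) by exact: CMM.
have Zrow q : yrow Z q = b q *: yrow Y q by apply/rowP => i; rewrite !mxE.
have Ztan u : crange phi u -> yrow Z (cinv phi u) *m E phi u *m Jac phi u = yrow Z (cinv phi u).
 by move=> Uu; rewrite Zrow -!scalemxAl Ytan.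
pose rho := 3 / 4 * r.
have bout u : crange phi u -> ~ box c rho u -> b (cinv phi u) = 0.
 move=> Uu nb; apply/eqP/negP => /negP; rewrite bE => /(bump_supp r0)[_]; rewrite cinvK//.
have rho0 : 0 <= rho by rewrite mulr_ge0// ltW.
pose z0 a u : R := vdens psi phi u * ycomp psi phi Z a u.
(* Extension by zero to all of R^m; it is of class C^1 because the bump vanishes before the boundary
   of the box. *)
pose z a u : R := if `[< crange phi u >] then z0 a u else 0.
have zE a : {in crange phi, z0 a =1 z a} by move=> u; rewrite inE => Uu; rewrite /z asboolT.
have zout a u : ~ box c rho u -> z a u = 0.
 move=> nb; rewrite /z; case: ifP => // /asboolP Uu; rewrite /z0 /ycomp big1 ?mulr0// => i _.
 have -> : Z i (cinv phi u) = b (cinv phi u) * Y i (cinv phi u) by [].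
 rewrite (bout u Uu nb) mul0r.
 exact: mul0r.
have z0S a : Sk 1 (crange phi) (z0 a).
 by apply: SkM => //; [exact: vdens_smooth|exact: ycomp_smooth].
have zS a : Sk 1 [set: V] (z a).
 apply: Sk_local => u _; have [Uu|nUu] := pselect (crange phi u).
  by exists (crange phi); split=> //; exact: (Sk_eq oU (zE a)).
 exists (~` box c rho); have oB : open (~` box c rho) by apply: closed_openC; exact: box_closed.
 split=> //; first by move=> bu; apply: nUu; apply: sub => k; apply: le_trans (bu k) _; rewrite /rho; lra.
 by apply: (Sk_eq oB _ (Sk_cst 1 _ 0)) => w; rewrite inE => nw; rewrite zout.
pose xi k u : R := \sum_a z a u * Q a k.
have oT : open [set: V] := openT.
have xiS k : Sk 1 [set: V] (xi k).
 by apply: Sk_sum => // a _; apply: SkM => //; exact: Sk_cst.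
have xiout k u : ~ box c rho u -> xi k u = 0.
 by move=> nb; rewrite /xi big1// => a _; rewrite zout// mul0r.
have xic k : continuous (xi k) by move=> u; exact: (Sk_cont (xiS k)).
have xidiff k u : differentiable (xi k) u by exact: Sk_differentiable oT (xiS k) _.
have xid k u v : derivable (xi k) u v by exact: diff_derivable.
have xiD k v u : 'D_v (xi k) u = \sum_a v 0 a * 'D_(e_ a) (xi k) u by exact: derive_sum_partial.
have xidc k v : continuous ('D_v (xi k)).
 have -> : 'D_v (xi k) = fun u => \sum_a v 0 a * 'D_(e_ a) (xi k) u by apply/funext => u; exact: xiD.
 move=> u; apply: sum_continuous_at => a _; apply: continuousM; first exact: cst_continuous.
 exact: (Sk_cont (Sk_partial a (xiS k))).
(* Since [P] and [Q] are inverse to each other, the coordinate divergence of [z] equals the sum of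
   the derivatives of [xi k] along [v k]. *)
pose v k := row k P.
have divE u : crange phi u -> vdens psi phi u * dvg Z (cinv phi u) = \sum_k 'D_(v k) (xi k) u.
 move=> Uu; rewrite /dvg (divergence_chart imm at_ ZS Ztan Uu).
 transitivity (\sum_a 'D_(e_ a) (z a) u).
  by apply: eq_bigr => a _; exact: (derive_nbhs_eq (e_ a) oU Uu (zE a)).2.
 have dxi k a : 'D_(e_ a) (xi k) u = \sum_l 'D_(e_ a) (z l) u * Q l k.
  have H l : is_derive u (e_ a) (z l * cst (Q l k)) ('D_(e_ a) (z l) u * Q l k).
   have d1 : is_derive u (e_ a) (z l) ('D_(e_ a) (z l) u) := derivableP (Sk_der a (zS l) I).
   apply: is_derive_eq (is_deriveM d1 (is_derive_cst (Q l k) u (e_ a))) _.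
   by rewrite scaler0 add0r /GRing.scale /= mulrC.
  have -> : xi k = \sum_l (z l * cst (Q l k)) by apply/funext => w; rewrite fct_sumE.
  by have [_ ->] := is_derive_sum (fun l => H l).
 under [RHS]eq_bigr do rewrite xiD.
 under [RHS]eq_bigr do under eq_bigr do rewrite dxi mulr_sumr.
 rewrite exchange_big; apply: eq_bigr => a _; rewrite exchange_big /=.
 have QPe l : \sum_k Q l k * P k a = (l == a)%:R by have /matrixP/(_ l a) := QP; rewrite mxE [RHS]mxE.
 transitivity (\sum_l 'D_(e_ a) (z l) u * \sum_k Q l k * P k a).
  rewrite (bigD1 a)//= QPe eqxx mulr1 big1 ?addr0// => l la.
  by rewrite QPe (negbTE la) mulr0.
 apply: eq_bigr => l _; rewrite mulr_sumr; apply: eq_bigr => k _; rewrite /v mxE; ring.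
pose t := chart_pt phi c r; pose wt := chart_wt psi phi c r.
have r0' := ltW r0.
have mt := measurable_chart_pt sub; have mw := measurable_chart_wt imm at_ sub.
have w0 u : 0 <= wt u by exact: chart_wt_ge0.
have wout u : ~ box c r u -> wt u = 0 by exact: chart_wt_out.
pose K : set M := cinv phi @` box c r.
have Kc : compact K by exact: box_image_compact.
pose K34 : set M := cinv phi @` box c rho.
have K34c : closed K34.
 by apply: compact_closed (@carrier_hausdorff _ _ M) (box_image_compact (box34 r0 sub)).
have K34K : K34 `<=` K by move=> q [u bu <-]; exists u => // k; apply: le_trans (bu k) _; rewrite /rho; lra.
have b34 q : ~ K34 q -> b q = 0 by rewrite bE; exact: bump_out.
have Z34 q i : ~ K34 q -> dl psi i (Z i) q = 0.
 move=> nq; rewrite (@dl_eq _ _ _ _ psi i (Z i) (cst 0) (~` K34) q (closed_openC K34c) nq) ?dl_cst//.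
 move=> q'; rewrite inE => /b34 E0; have -> : Z i q' = b q' * Y i q' by [].
 by rewrite E0 mul0r.
have dZ0 q : ~ K q -> dvg Z q = 0 by move=> nq; apply: big1 => i _; apply: Z34 => /K34K.
pose ft u : R := f (t u) * \1_(box c r) u.
have mft : measurable_fun setT (ft : brow R m -> R).
 apply: measurable_funM; last by apply: measurable_indic; exact: measurable_box.
 by apply: measurableT_comp mt; exact: continuous_borel.
have ftE u : box c r u -> ft u = f (cinv phi u).
 by move=> bu; rewrite /ft indicE mem_set// mulr1 /t chart_ptE.
have ft0 u : ~ box c r u -> ft u = 0 by move=> nbu; rewrite /ft indicE memNset// mulr0.
have ft01 u : 0 <= ft u <= 1.
 have [bu|nbu] := pselect (box c r u); first by rewrite ftE.
 by rewrite ft0// lexx ler01.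
have ft21 u : `|ft u ^+ 2| <= 1.
 by case/andP: (ft01 u) => p0 p1; rewrite ger0_norm ?sqr_ge0// exprn_ile1.
have mft2 : measurable_fun setT ((fun u => ft u ^+ 2) : brow R m -> R) by exact: measurable_funX.
have Fc : continuous (fun q => f q ^+ 2 * dvg Z q).
 have -> : (fun q => f q ^+ 2 * dvg Z q) = (fun q => (f q * f q) * dvg Z q) by apply/funext => q; rewrite expr2.
 move=> q; apply: (@continuousM _ _ (fun q => f q * f q) (dvg Z) q); last exact: dvg_continuous.
 by apply: (@continuousM _ _ f f q); exact: fc.
have LHS_ : (\int[dM]_q (f q ^+ 2 * dvg Z q) = \sum_k \int[mu]_u (ft u ^+ 2 * 'D_(v k) (xi k) u))%R.
 rewrite (J_chart imm dM_volume at_ r0' sub (continuous_borel Fc)); last first.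
  by move=> q /dZ0 E0; rewrite E0 mulr0.
 rewrite -J_sum; last first.
  move=> k; apply: bfs_mull mft2 ft21 _; apply: continuous_bfs (xidc k (v k)) _ => u.
  exact: derive_out (xiout k).
 apply: eq_Rintegral => u _; rewrite -mulr_sumr.
 have [bu|nbu] := pselect (box c r u).
  by rewrite chart_ptE// ftE// chart_wtE// -(divE _ (sub _ bu)) mulrAC mulrA.
 by rewrite chart_wt_out// ft0// expr0n mulr0 mul0r.
have Gc : continuous (fun q => f q * (b q * enorm (yrow Y q))).
 move=> q; apply: (@continuousM _ _ f (fun q => b q * enorm (yrow Y q)) q); first exact: fc.
 apply: (@continuousM _ _ b (fun q => enorm (yrow Y q)) q); first exact: (CM_continuous (CMW bS)).
 apply: enorm_continuous; apply: continuous_row => i.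
 have -> : (fun q => yrow Y q 0 i) = Y i by apply/funext => q'; rewrite mxE.
 exact: (CM_continuous (CMW (YS i))).
have G0 q : ~ K q -> f q * (b q * enorm (yrow Y q)) = 0.
 by move=> nq; rewrite b34 ?mul0r ?mulr0// => /K34K.
have RHS_ : (\int[dM]_q (f q * (b q * enorm (yrow Y q))) = \int[mu]_u (f (t u) * (b (t u) * enorm (yrow Y (t u))) * wt u))%R.
 exact: (J_chart imm dM_volume at_ r0' sub (continuous_borel Gc) G0).
have gb : bfs mu ((fun u => f (t u) * (b (t u) * enorm (yrow Y (t u))) * wt u) : brow R m -> R).
 have [C C0 HC] := continuous_compact_bounded Gc Kc.
 apply: (@bfs_mull _ _ _ _ _ _ C); last exact: bfs_chart_wt.
  exact: (measurableT_comp (continuous_borel Gc) mt).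
 by move=> u; apply: HC; exact: chart_pt_in.
have each k : `|\int[mu]_u (ft u ^+ 2 * 'D_(v k) (xi k) u)|%R <=
 (20 * ep) * (\int[mu]_u (f (t u) * (b (t u) * enorm (yrow Y (t u))) * wt u))%R.
 (* The support lies in the box of size [3 / 4 * r]; a shift by at most [r / 4] keeps the segment in
    the box of size [r]. *)
 pose del := r / 4 / (`|v k| + 1).
 have nv : 0 < `|v k| + 1 by rewrite ltr_wpDl.
 have del0 : 0 < del by rewrite !divr_gt0.
 have H := @weak_inequality R m ft (xi k) (v k) c rho (5 * ep) del mft ft01 (xic k) (fun u => xid k u (v k)) (xidc k (v k))
  (xiout k) rho0 _ del0.
 apply: le_trans (H _ _) _.
 - by rewrite mulr_ge0.
 - move=> h u h0 hd bu.
  have bu' : box c r u by move=> a; apply: le_trans (bu a) _; rewrite /rho; lra.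
  have bw : box c r (u - h *: v k).
   move=> a; have -> : (u - h *: v k) 0 a - c 0 a = (u 0 a - c 0 a) - h * v k 0 a by rewrite !mxE; ring.
   apply: le_trans (ler_normB _ _) _; rewrite normrM (gtr0_norm h0).
   have h1 : h * `|v k 0 a| <= r / 4.
    apply: le_trans (_ : h * (`|v k| + 1) <= _); last by rewrite -ler_pdivlMr.
    by apply: ler_wpM2l; [exact: ltW|have := coord_le (v k) a; lra].
   have h2 := bu a; rewrite /rho in h2; lra.
  (* The frame vector has length at most 2, and [rdist_segment] adds another factor 2: the shifted
     point is at distance at most [4 * h], hence strictly less than [5 * h]. *)
  rewrite ftE// ftE// -mulrA [ep * h]mulrC mulrA [(5 * h) * ep]mulrC; apply: fl.
  apply: le_lt_trans (rdist_segment imm (K := 2 * h) at_ _ sub bu' bw _) _.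
  + by rewrite mulr_ge0// ltW.
  + move=> w bw'; have -> : u - h *: v k - u = - h *: v k by rewrite addrAC subrr add0r scaleNr.
   rewrite -scalemxAl enormZ normrN (gtr0_norm h0) mulrC; apply: ler_wpM2r; first exact: ltW.
   by have [] := fr w k bw'.
  + by rewrite lte_fin; lra.
 (* The first 2 is the factor in [weak_inequality], [5 * ep] the Lipschitz constant in the chart,
    the last 2 the bound on the dual frame. *)
 rewrite (_ : 20 * ep = 2 * (5 * ep) * 2); last by ring.
 rewrite -[leRHS]mulrA; apply: ler_wpM2l; first by rewrite !mulr_ge0.
 rewrite -JZ//; apply: J_le.
 - apply: (@bfs_mull _ _ _ _ _ _ 1) => //.
   by move=> u; case/andP: (ft01 u) => p0 p1; rewrite ger0_norm.
  by apply: bfs_norm; exact: continuous_bfs (xic k) (xiout k).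
 - exact: bfsZ.
 move=> u; have [bu|nbu] := pselect (box c r u); last first.
  by rewrite ft0// mul0r mulr_ge0// mulr_ge0 ?w0// mulr_ge0 ?mulr_ge0 ?enorm_ge0//; [case/andP: (f01 (t u))|case/andP: (b01 (t u))].
 rewrite ftE// /t chart_ptE// /wt chart_wtE//.
 have Uu := sub _ bu; have f0 : 0 <= f (cinv phi u) by case/andP: (f01 (cinv phi u)).
 have vd := vdens_gt0 imm at_ Uu.
 have -> : 2 * (f (cinv phi u) * (b (cinv phi u) * enorm (yrow Y (cinv phi u))) * vdens psi phi u) =
  f (cinv phi u) * (vdens psi phi u * (enorm (yrow Z (cinv phi u)) * 2)).
  by rewrite Zrow enormZ ger0_norm; [ring|case/andP: (b01 (cinv phi u))].
 apply: ler_wpM2l => //.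
 have -> : xi k u = vdens psi phi u * dot (yrow Z (cinv phi u)) (col k (E phi u *m Q))^T.
  rewrite /xi dotE; under eq_bigr do rewrite -zE ?inE// /z0 -mulrA.
  rewrite -mulr_sumr; congr (_ * _).
  under eq_bigr do rewrite /ycomp mulr_suml.
  rewrite exchange_big; apply: eq_bigr => i _; rewrite [yrow _ _ _ _]mxE [(col _ _)^T _ _]mxE [col _ _ _ _]mxE [(_ *m _) _ _]mxE mulr_sumr.
  by apply: eq_bigr => a _; rewrite mulrA.
 rewrite normrM (gtr0_norm vd); apply: ler_wpM2l; first exact: ltW.
 apply: le_trans (dot_CS _ _) _; apply: ler_wpM2l; first exact: enorm_ge0.
 by have [] := fr u k bu.
rewrite LHS_ RHS_; apply: le_trans (ler_norm_sum _ _ _) _.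
apply: le_trans (ler_sum _ (fun k _ => each k)) _.
rewrite sumr_const card_ord -mulr_natr le_eqVlt; apply/orP; left; apply/eqP; ring.
Qed.

End LocalWeak.

(** * Globalization and the Liouville theorem *)

Section GlobalWeak.
Variables (R : realType) (m n : nat) (M : manifold R m) (psi : M -> 'rV[R]_n).
Hypothesis imm : immersion psi.
Variable dM : {measure set (borel M) -> \bar R}.
Hypothesis dM_volume : is_volume psi dM.
Notation J f := (\int[dM]_q f q)%R.

Section Cutoff.
Variables (f : M -> R) (ep : R) (K : set M).
Hypothesis ep0 : 0 <= ep.
Hypothesis fc : continuous f.
Hypothesis f01 : forall q, 0 <= f q <= 1.
Hypothesis f_lip : forall q q' a, (rdist psi q q' < a%:E)%E -> `|f q - f q'| <= ep * a.
Hypothesis Kc : compact K.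
Hypothesis fK : forall q, ~ K q -> f q = 0.

Definition good_bump (b : M -> R) := [/\ CM 1 b, forall q, 0 <= b q <= 1 &
 forall Y, (forall i, CM 1 (Y i)) -> tangent psi Y ->
 `|J (fun q => f q ^+ 2 * dvg psi (fun i : 'I_n => b * Y i) q)| <=
  (20 * m%:R * ep) * J (fun q => f q * (b q * enorm (yrow Y q)))].

Definition plateau (b : M -> R) (q : M) := \forall q' \near q, b q' = 1.

Fixpoint good_list (l : seq (M -> R)) : Prop :=
 if l is b :: l' then good_bump b /\ good_list l' else True.
Fixpoint covered (l : seq (M -> R)) (q : M) : Prop :=
 if l is b :: l' then plateau b q \/ covered l' q else False.

Lemma good_cat l1 l2 : good_list l1 -> good_list l2 -> good_list (l1 ++ l2).
Proof. by elim: l1 => //= b l IH [gb gl] g2; split=> //; exact: IH. Qed.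

Lemma covered_cat l1 l2 q : covered l1 q \/ covered l2 q -> covered (l1 ++ l2) q.
Proof.
elim: l1 => [|b l IH] /=; first by case.
by case=> [[pb|cl]|c2]; [left|right; apply: IH; left|right; apply: IH; right].
Qed.

Lemma good_cover : exists2 l, good_list l & forall q, K q -> covered l q.
Proof.
pose P (A : set M) := exists2 l, good_list l & forall q, A q -> covered l q.
suff : P K by [].
apply: compact_induction Kc _ _ _ _.
- by exists [::].
- by move=> A B AB [l gl H]; exists l => // q /AB/H.
- move=> A B [l1 g1 H1] [l2 g2 H2]; exists (l1 ++ l2); first exact: good_cat.
 by move=> q [/H1|/H2] h; apply: covered_cat; [left|right].
move=> p _; have [r [r0 sub H]] := local_weak imm dM_volume p.
have at_ := chart_at_atlas p; have Dp := chart_at_dom p.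
set phi := chart_at p in at_ Dp sub H *; set c := cmap phi p in sub H *.
pose W : set M := cdom phi `&` (cmap phi @^-1` box c (r / 4)).
have r4 : 0 < r / 4 by rewrite divr_gt0.
exists W; first by apply: cmap_nbhs => //; exact: box_nbhs.
exists [:: bump phi c r].
 split=> //; split; [exact: bump_smooth|by move=> q; exact: bump01|].
 by move=> Y YS Yt; exact: H.
move=> q [Dq bq]; left.
have := cmap_nbhs Dq (box_nbhs (cmap phi q) r4); apply: filterS => q' [Dq' bq'].
apply: bump1 => // a; have h1 := bq a; have h2 := bq' a.
have -> : cmap phi q' 0 a - c 0 a = (cmap phi q' 0 a - cmap phi q 0 a) + (cmap phi q 0 a - c 0 a) by ring.
apply: le_trans (ler_normD _ _) _; apply: le_trans (lerD h2 h1) _; lra.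
Qed.

Lemma b_dvg Y : (forall i, CM 1 (Y i)) -> bfs dM ((fun q => f q ^+ 2 * dvg psi Y q) : borel M -> R).
Proof.
move=> YS; apply: (compact_support_bfs imm dM_volume _ Kc).
 have -> : (fun q => f q ^+ 2 * dvg psi Y q) = (fun q => (f q * f q) * dvg psi Y q).
  by apply/funext => q; rewrite expr2.
 move=> q; apply: (@continuousM _ _ (fun q => f q * f q) (dvg psi Y) q); last exact: dvg_continuous.
 by apply: (@continuousM _ _ f f q); exact: fc.
by move=> q /fK ->; rewrite expr0n mul0r.
Qed.

Lemma enorm_yrow_continuous (Y : 'I_n -> M -> R) : (forall i, CM 1 (Y i)) -> continuous (fun q => enorm (yrow Y q)).
Proof.
move=> YS q; apply: enorm_continuous; apply: continuous_row => i.
have -> : (fun q => yrow Y q 0 i) = Y i by apply/funext => q'; rewrite mxE.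
exact: (CM_continuous (CMW (YS i))).
Qed.

Lemma b_norm (b : M -> R) (Y : 'I_n -> M -> R) : continuous b -> (forall i, CM 1 (Y i)) ->
 bfs dM ((fun q => f q * (b q * enorm (yrow Y q))) : borel M -> R).
Proof.
move=> bc YS; apply: (compact_support_bfs imm dM_volume _ Kc).
 move=> q; apply: (@continuousM _ _ f (fun q => b q * enorm (yrow Y q)) q); first exact: fc.
 apply: (@continuousM _ _ b (fun q => enorm (yrow Y q)) q); first exact: bc.
 exact: enorm_yrow_continuous.
by move=> q /fK ->; rewrite mul0r.
Qed.

(** In place of a partition of unity, the field is split as [b Y + (1 - b) Y] for each bump in turn;
    the second part vanishes near points where [b] is locally 1. As the norms of the two parts add
    up to the norm of [Y], the constant does not depend on the number of bumps. *)
Lemma global_weak Y : (forall i, CM 1 (Y i)) -> tangent psi Y ->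
 `|J (fun q => f q ^+ 2 * dvg psi Y q)| <= (20 * m%:R * ep) * J (fun q => f q * enorm (yrow Y q)).
Proof.
have C0 : 0 <= 20 * m%:R * ep by rewrite !mulr_ge0.
have [l gl Hl] := good_cover.
have base : forall q, f q != 0 -> covered l q.
 by move=> q fq; apply: Hl; apply: contrapT => /fK; exact/eqP.
suff main (Z : 'I_n -> M -> R) : (forall i, CM 1 (Z i)) -> tangent psi Z ->
 (forall q, f q != 0 -> covered l q \/ \forall q' \near q, forall i, Z i q' = 0) ->
 `|J (fun q => f q ^+ 2 * dvg psi Z q)| <= (20 * m%:R * ep) * J (fun q => f q * enorm (yrow Z q)).
 by move=> YS Yt; apply: main => // q /base; left.
move: gl; clear Hl base; elim: l Z => [|b l IH] Z /=.
 move=> _ ZS Zt Z0.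
 have E0 : forall q, f q ^+ 2 * dvg psi Z q = 0.
  move=> q; have [->|fq] := eqVneq (f q) 0; first by rewrite expr0n mul0r.
  have [//|Zq] := Z0 q fq; rewrite /dvg big1 ?mulr0// => i _.
  have [W [[oO Oq] OZ]] : exists O, open_nbhs q O /\ O `<=` [set q' | forall i, Z i q' = 0].
   have : nbhs q [set q' | forall i, Z i q' = 0] by exact: Zq.
   by rewrite nbhsE => -[W h1 h2]; exists W.
  rewrite (@dl_eq _ _ _ _ psi i (Z i) (cst 0) W q oO Oq) ?dl_cst//.
  by move=> q'; rewrite inE => /OZ.
 have -> : J (fun q => f q ^+ 2 * dvg psi Z q) = 0.
  by under eq_Rintegral do rewrite E0; rewrite Rintegral_cst// mul0r.
 rewrite normr0 mulr_ge0//; apply: J_ge0 => q; rewrite mulr_ge0 ?enorm_ge0//.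
 by case/andP: (f01 q).
move=> [[bS b01 gb] gl] ZS Zt Z0.
pose b' : M -> R := cst 1 - b.
have b'S : CM 1 b' by apply: CMD; [exact: CM_cst|exact: CMN].
pose Z1 i : M -> R := b * Z i; pose Z2 i : M -> R := b' * Z i.
have Z1S i : CM 1 (Z1 i) by exact: CMM.
have Z2S i : CM 1 (Z2 i) by exact: CMM.
have Z2row q : yrow Z2 q = (1 - b q) *: yrow Z q by apply/rowP => i; rewrite !mxE.
have Z2t : tangent psi Z2.
 by move=> phi u at_ Uu; rewrite Z2row -!scalemxAl Zt.
have I1 := gb Z ZS Zt.
have I2 : `|J (fun q => f q ^+ 2 * dvg psi Z2 q)| <= (20 * m%:R * ep) * J (fun q => f q * enorm (yrow Z2 q)).
 apply: IH => // q /Z0[[pb|cl]|zq]; [right|by left|right].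
  apply: filterS pb => q' bq' i; have -> : Z2 i q' = (1 - b q') * Z i q' by [].
  by rewrite bq' subrr mul0r.
 apply: filterS zq => q' H i; have -> : Z2 i q' = (1 - b q') * Z i q' by [].
 by rewrite H mulr0.
have dE q : dvg psi Z q = dvg psi Z1 q + dvg psi Z2 q.
 rewrite /dvg -big_split; apply: eq_bigr => i _.
 have ZE : Z i = Z1 i + Z2 i.
  by apply/funext => q'; rewrite /Z1 /Z2 /b' !fctE; ring.
 by rewrite {1}ZE (dlD psi i (Z1S i) (Z2S i)).
have -> : J (fun q => f q ^+ 2 * dvg psi Z q) = J (fun q => f q ^+ 2 * dvg psi Z1 q) + J (fun q => f q ^+ 2 * dvg psi Z2 q).
 rewrite -JD; [|exact: b_dvg|exact: b_dvg].
 by apply: eq_Rintegral => q _; rewrite dE mulrDr.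
have bc : continuous b by exact: (CM_continuous (CMW bS)).
have b'c : continuous b' by exact: (CM_continuous (CMW b'S)).
have -> : J (fun q => f q * enorm (yrow Z q)) = J (fun q => f q * (b q * enorm (yrow Z q))) + J (fun q => f q * enorm (yrow Z2 q)).
 have -> : J (fun q => f q * enorm (yrow Z2 q)) = J (fun q => f q * (b' q * enorm (yrow Z q))).
  apply: eq_Rintegral => q _; rewrite Z2row enormZ ger0_norm// subr_ge0.
  by case/andP: (b01 q).
 rewrite -JD; [|exact: b_norm|exact: b_norm].
 by apply: eq_Rintegral => q _; rewrite /b' !fctE; ring.
rewrite mulrDr; apply: le_trans (ler_normD _ _) _; exact: lerD.
Qed.

End Cutoff.

Hypothesis M_complete : complete_immersion psi.

Lemma positive_volume p (r : R) : 0 < r -> box (cmap (chart_at p) p) r `<=` crange (chart_at p) ->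
 (0 < dM (cinv (chart_at p) @` box (cmap (chart_at p) p) r))%E.
Proof.
move=> r0; set phi := chart_at p; set c := cmap phi p => sub.
have at_ : atlas phi := chart_at_atlas p; have Uc : crange phi c := crange_cmap (chart_at_dom p).
have oU := open_crange phi.
have v0 := vdens_gt0 imm at_ Uc; have v20 : 0 < vdens psi phi c / 2 by rewrite divr_gt0.
have [s s0 Hs] := nbhs_box (continuous_near (Sk_cont (vdens_smooth imm at_ 0) Uc) v20).
pose t := Num.min r s; have t0 : 0 < t by rewrite lt_min r0.
have tr : box c t `<=` box c r by move=> u H a; apply: le_trans (H a) _; rewrite ge_min lexx.
have ts : box c t `<=` box c s by move=> u H a; apply: le_trans (H a) _; rewrite ge_min lexx orbT.
have rr := ltW r0.
rewrite (volume_chart imm dM_volume at_ sub (measurable_chart_box sub) (@subset_refl _ _)).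
apply: (@lt_le_trans _ _ (\int[leb R m]_u ((vdens psi phi c / 2)%:E * (\1_(box c t) u)%:E))%E).
 rewrite ge0_integralZl//.
 - rewrite integral_indic// ?setIT; last exact: measurable_box.
  by have -> := leb_box c (ltW t0); rewrite -EFinM lte_fin mulr_gt0// exprn_gt0// mulr_gt0.
 - by apply/measurable_EFinP; apply: measurable_indic; exact: measurable_box.
 - by rewrite lee_fin ltW.
apply: ge0_le_integral => //.
- by move=> u _; rewrite -EFinM lee_fin mulr_ge0// ltW.
- apply/measurable_EFinP; apply: measurable_funM; first exact: measurable_cst.
 by apply: measurable_indic; exact: measurable_box.
- apply/measurable_EFinP; apply: measurable_funM; last exact: (measurable_chart_wt imm at_ sub).
 apply: measurableT_comp (measurable_chart_pt sub); apply: measurable_indic; exact: (measurable_chart_box sub).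
move=> u _; rewrite -EFinM lee_fin [\1_(_ @` _) _]indicE mem_set ?mul1r; last exact: (chart_pt_in phi c rr).
rewrite indicE; have [bu|nbu] := pselect (box c t u); last by rewrite memNset// mulr0 chart_wt_ge0.
rewrite mem_set// mulr1 chart_wtE; last exact: tr.
have := Hs u (ts u bu); rewrite /= ler_norml => /andP[_].
move: (vdens psi phi c) (vdens psi phi u) => a b; lra.
Qed.

(** A Caccioppoli argument: testing against the squared cutoff of radius [T], half of the AM-GM
    splitting is absorbed by [A] and the remainder is bounded by the integral of [H] divided by
    [T ^+ 2], which leaves no room for a positive value of [B]. *)
Lemma liouville (Y : 'I_n -> M -> R) (A B H : M -> R) (k : R) :
 (forall i, CM 1 (Y i)) -> tangent psi Y ->
 continuous A -> continuous B -> continuous H -> 0 <= k ->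
 (forall q, 0 <= A q) -> (forall q, 0 <= B q) -> (forall q, 0 <= H q) ->
 (forall q, A q + B q <= dvg psi Y q) ->
 (forall q, enorm (yrow Y q) ^+ 2 <= k * A q * H q) ->
 dM.-integrable setT (EFin \o (H : borel M -> R)) -> forall o, B o = 0.
Proof.
move=> YS Yt Ac Bc Hc k0 A0 B0 H0 dY nY Hint o; apply/eqP; rewrite eq_le B0 andbT leNgt; apply/negP => Bo.
pose I := J H; have I0 : 0 <= I by exact: J_ge0.
pose C : R := 20 * m%:R.
have C0 : 0 <= C by rewrite mulr_ge0.
pose phi := chart_at o; have Dp : cdom phi o := chart_at_dom o; pose c := cmap phi o.
have at_ : atlas phi := chart_at_atlas o.
have [W Wo HW] := near_rdist imm o ltr01.
have B20 : 0 < B o / 2 by rewrite divr_gt0.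
have Wc : nbhs c [set u | W (cinv phi u) /\ B o / 2 <= B (cinv phi u)].
 have cc := @cinv_continuous _ _ _ phi c (crange_cmap Dp).
 have nB : nbhs (cinv phi c) [set q | W q /\ B o / 2 <= B q].
  rewrite /c cmapK'//; apply: filterS2 Wo (continuous_near (Bc o) B20) => q Wq.
  by rewrite ler_norml => /andP[h1 h2]; split=> //; lra.
 exact: cc _ nB.
have [r r0 Hr] := nbhs_box (filterI (open_nbhs_nbhs (conj (open_crange phi) (crange_cmap Dp))) Wc).
have sub : box c r `<=` crange phi by move=> u /Hr[].
pose K0 : set M := cinv phi @` box c r.
have V0 := positive_volume r0 sub.
have mK0 := measurable_chart_box sub.
have fK0 := volume_chart_fin imm dM_volume at_ (ltW r0) sub.
have v0 : 0 < fine (dM K0) by rewrite fine_gt0// V0.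
have key (T : R) : 2 <= T -> (B o / 8) * fine (dM K0) * (T * T) <= C * C * k / 4 * I.
 move=> T2; have T0 : 0 < T by lra.
 pose f := cutoff psi o T.
 have fc : continuous f by exact: cutoff_continuous.
 have f01 q : 0 <= f q <= 1 by exact: cutoff01.
 have fl q q' a : (rdist psi q q' < a%:E)%E -> `|f q - f q'| <= T^-1 * a.
  by move=> h; rewrite mulrC; exact: cutoff_lip.
 have [K Kc HK] := dball_precompact imm M_complete o T.
 have fK q : ~ K q -> f q = 0.
  by move=> nK; apply/eqP; apply: contrapT => /negP fq; apply: nK; apply: HK; exact: (cutoff_supp T0).
 have Ti0 : 0 <= T^-1 by rewrite invr_ge0 ltW.
 have GW := global_weak Ti0 fc f01 fl Kc fK YS Yt.
 have Kcl := compact_closed (@carrier_hausdorff _ _ M) Kc.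
 have mK : measurable (K : set (borel M)).
  rewrite -[X in measurable X]setCK; apply: measurableC; apply: sub_sigma_algebra; exact: closed_openC.
 have bHK : bfs dM ((fun q => H q * \1_K q) : borel M -> R).
  have [CH CH0 HCH] := continuous_compact_bounded Hc Kc.
  split; first by apply: measurable_funM; [exact: continuous_borel|exact: measurable_indic].
  exists K, CH; split=> //; first exact: (compact_volume_fin imm dM_volume Kc).
  move=> q; rewrite indicE; have [Kq|Kq] := pselect (K q).
   by rewrite mem_set// !mulr1; exact: HCH.
  by rewrite memNset// !mulr0 normr0.
 have JHK : J (fun q => H q * \1_K q) <= I.
  apply: le_Rintegral => //; first exact: bfs_integrable.
  by move=> q _; rewrite indicE ler_piMr//; case: (_ \in _); rewrite ?ler01.
 have f2c : continuous (fun q => f q ^+ 2).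
  have -> : (fun q => f q ^+ 2) = (fun q => f q * f q) by apply/funext => q; rewrite expr2.
  by move=> q; apply: (@continuousM _ _ f f q); exact: fc.
 have bf2 (g : M -> R) : continuous g -> bfs dM ((fun q => f q ^+ 2 * g q) : borel M -> R).
  move=> gc; apply: (compact_support_bfs imm dM_volume _ Kc); last by move=> q /fK ->; rewrite expr0n mul0r.
  by move=> q; apply: (@continuousM _ _ (fun q => f q ^+ 2) g q); [exact: f2c|exact: gc].
 have bA := bf2 A Ac; have bB := bf2 B Bc.
 have bY : bfs dM ((fun q => f q ^+ 2 * dvg psi Y q) : borel M -> R) by apply: b_dvg; try eassumption; exact: ltW.
 have bN : bfs dM ((fun q => f q * enorm (yrow Y q)) : borel M -> R).
  apply: (compact_support_bfs imm dM_volume _ Kc); last by move=> q /fK ->; rewrite mul0r.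
  move=> q; apply: (@continuousM _ _ f (fun q => enorm (yrow Y q)) q); first exact: fc.
  exact: enorm_yrow_continuous.
 have s1 : J (fun q => f q ^+ 2 * A q) + J (fun q => f q ^+ 2 * B q) <= C * T^-1 * J (fun q => f q * enorm (yrow Y q)).
  rewrite -JD//; apply: le_trans GW; apply: le_trans (ler_norm _).
  apply: J_le => //; first exact: bfsD.
  by move=> q; rewrite -mulrDr; apply: ler_wpM2l; rewrite ?sqr_ge0.
 (* AM-GM: C T^-1 f |Y| <= f^2 A + C^2 k H / (4 T^2) *)
 have s2 : C * T^-1 * J (fun q => f q * enorm (yrow Y q)) <=
   J (fun q => f q ^+ 2 * A q) + C * C * k / 4 / (T * T) * J (fun q => H q * \1_K q).
  rewrite -!JZ//; rewrite -JD//; last exact: bfsZ.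
  apply: J_le; [exact: bfsZ|by apply: bfsD => //; exact: bfsZ|].
  move=> q; have [Kq|nK] := pselect (K q); last first.
   by rewrite fK// mul0r mulr0 expr0n mul0r add0r indicE memNset// mulr0 mulr0.
  rewrite indicE mem_set// mulr1.
  have f0 : 0 <= f q by case/andP: (f01 q).
  pose X := f q ^+ 2 * A q; pose Z := C * C * k / 4 / (T * T) * H q.
  have X0 : 0 <= X by rewrite mulr_ge0// sqr_ge0.
  have Z0 : 0 <= Z by rewrite !mulr_ge0// invr_ge0 ?mulr_ge0// ltW.
  have XZ0 : 0 <= X + Z by exact: addr_ge0.
  have a0 : 0 <= C / T * (f q * enorm (yrow Y q)) by rewrite !mulr_ge0// enorm_ge0.
  rewrite -/X -/Z -(ler_pXn2r (n := 2))// ?nnegrE//.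
  apply: (@le_trans _ _ (4 * X * Z)); last by have := sqr_ge0 (X - Z); rewrite !expr2; nra.
  have -> : (C / T * (f q * enorm (yrow Y q))) ^+ 2 = (C / T * f q) ^+ 2 * enorm (yrow Y q) ^+ 2 by ring.
  have -> : 4 * X * Z = (C / T * f q) ^+ 2 * (k * A q * H q).
   by rewrite /X /Z; field; exact: lt0r_neq0.
  by apply: ler_wpM2l; [exact: sqr_ge0|exact: nY].
 (* Near [o] the cutoff is at least [1/2], its square at least [1/4], and [B] at least [B o / 2]. *)
 have s3 : (B o / 8) * fine (dM K0) <= J (fun q => f q ^+ 2 * B q).
  rewrite -(J_indic _ mK0) -JZ; last exact: bfs_indic.
  apply: J_le => //; first by apply: bfsZ; exact: bfs_indic.
  move=> q; rewrite indicE; have [[u bu uq]|nK] := pselect (K0 q); last first.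
   by rewrite memNset// mulr0 mulr_ge0// sqr_ge0.
  rewrite mem_set; last by exists u.
  have [_ [Wq Bq]] := Hr u bu; rewrite uq in Wq Bq.
  have hf : 2^-1 <= f q.
   apply: cutoff_half => //; apply: rdist_le_lt (HW _ _ (nbhs_singleton Wo) Wq) _; lra.
  have h4 : 4^-1 <= f q ^+ 2.
   have -> : 4^-1 = 2^-1 ^+ 2 :> R by field.
   by rewrite ler_pXn2r// nnegrE ?invr_ge0//; case/andP: (f01 q).
  rewrite mulr1; have -> : B o / 8 = 4^-1 * (B o / 2) by field.
  by apply: ler_pM => //; rewrite ?invr_ge0 ?divr_ge0// ltW.
 have s4 : C * C * k / 4 / (T * T) * J (fun q => H q * \1_K q) <= C * C * k / 4 / (T * T) * I.
  by apply: ler_wpM2l => //; rewrite !mulr_ge0// invr_ge0 ?mulr_ge0// ltW.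
 have TT : 0 < T * T by rewrite mulr_gt0.
 rewrite -ler_pdivlMr//; have -> : C * C * k / 4 * I / (T * T) = C * C * k / 4 / (T * T) * I by ring.
 lra.
pose D := (B o / 8) * fine (dM K0); have D0 : 0 < D by rewrite mulr_gt0// divr_gt0.
pose X := C * C * k / 4 * I; have X0 : 0 <= X by rewrite !mulr_ge0.
have XD : 0 <= X / D by rewrite divr_ge0// ltW.
(* The radius [2 + X / D] is explicit: [D] times its square is at least [4 * D + 4 * X], which
   exceeds [X]. *)
have h2 : 2 <= 2 + X / D by lra.
have := key (2 + X / D) h2; rewrite -/D -/X => hk.
have e1 : D * ((2 + X / D) * (2 + X / D)) = 4 * D + 4 * X + X * (X / D) by field; exact: lt0r_neq0.
rewrite e1 in hk; have : 0 <= X * (X / D) by exact: mulr_ge0.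
lra.
Qed.

End GlobalWeak.

(** * The second fundamental form is parallel *)

(** Lagrange's identity writes the difference as half the sum of the squares of the 2 by 2
    minors. *)
Lemma cauchy_schwarz_sum (R : realFieldType) (I : finType) (a b : I -> R) :
 (\sum_i a i * b i) ^+ 2 <= (\sum_i a i * a i) * (\sum_i b i * b i).
Proof.
rewrite -subr_ge0.
suff -> : (\sum_i a i * a i) * (\sum_i b i * b i) - (\sum_i a i * b i) ^+ 2 =
  2^-1 * \sum_i \sum_j (a i * b j - a j * b i) ^+ 2.
 rewrite mulr_ge0 ?invr_ge0// sumr_ge0// => i _; rewrite sumr_ge0// => j _; exact: sqr_ge0.
have E : \sum_i \sum_j (a i * b j - a j * b i) ^+ 2 = 2 * ((\sum_i a i * a i) * (\sum_i b i * b i) - (\sum_i a i * b i) ^+ 2).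
 transitivity (\sum_i \sum_j (a i * a i * (b j * b j) + b i * b i * (a j * a j) - 2 * (a i * b i) * (a j * b j))).
  by apply: eq_bigr => i _; apply: eq_bigr => j _; ring.
 under eq_bigr do rewrite sumrB big_split /= -!mulr_sumr.
 rewrite sumrB big_split /= -!mulr_suml -mulr_sumr; ring.
by rewrite E mulrA mulVf// mul1r.
Qed.

Lemma sum_ge0_eq0 (R : realFieldType) (I : finType) (f : I -> R) i :
 (forall i, 0 <= f i) -> \sum_i f i = 0 -> f i = 0.
Proof.
by move=> f0 /eqP; rewrite psumr_eq0// => /allP/(_ i (mem_index_enum _)) /= /eqP.
Qed.

Section Simons.
Variables (R : realType) (m : nat) (M : manifold R m) (psi N : M -> 'rV[R]_m.+1).
Hypothesis imm : immersion psi.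
Hypothesis N_normal : unit_normal psi N.
Variable c : R.
Hypothesis soliton : soliton_for c psi.
Hypothesis c_lt0 : c < 0.
Notation d := (dsf imm).
Notation s := (support_fn imm N_normal).
Notation x := (xs imm).
Notation nn := (ns N_normal).
Notation cc := (cs M c).
Notation S i j := (d i (nn j)).
Variable r : sfun M.
Hypothesis rs : r * s = 1.

(* [BB] is [A / s] up to sign, [EE] its covariant derivative, [ww = |BB|^2],
 [GG = |EE|^2] and [DD = |grad ww|^2]. *)
Definition BB i j : sfun M := r * S i j.
Definition SB i j : sfun M := \sum_l S i l * BB l j.
Definition EE i j k : sfun M := d i (BB j k) + nn k * SB i j + nn j * SB i k.
Definition ww : sfun M := \sum_i \sum_j BB i j * BB i j.
Definition GG : sfun M := \sum_i \sum_j \sum_k EE i j k * EE i j k.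
Definition DD : sfun M := \sum_i d i ww * d i ww.
Definition bb i : sfun M := cc * x i + (r * d i s) *+ 2.

Lemma drift_ww : drift d bb ww = GG *+ 2.
Proof.
exact: (drift_normB (dsfD imm) (dsfM imm) (fun i => dsf_cst imm i c) (sum_NN N_normal)
 (Nd0 imm N_normal) (dx_proj imm N_normal) (S_symm imm N_normal) (d_commutator imm N_normal)
 (soliton_trace imm N_normal soliton) rs).
Qed.

Lemma d_ww i : d i ww = (\sum_j \sum_k BB j k * EE i j k) *+ 2.
Proof.
exact: (d_normB (dsfD imm) (dsfM imm) (Nd0 imm N_normal) (S_symm imm N_normal)).
Qed.

Lemma trace_BB : \sum_i BB i i = - cc.
Proof.
rewrite /BB -mulr_sumr (soliton_trace imm N_normal soliton) mulrN mulrCA.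
by rewrite rs mulr1.
Qed.

Lemma wwE p : ww p = \sum_i \sum_j BB i j p ^+ 2.
Proof. by rewrite sf_sum; apply: eq_bigr => i _; rewrite sf_sum; apply: eq_bigr => j _; rewrite sfM expr2. Qed.

Lemma GGE p : GG p = \sum_i \sum_j \sum_k EE i j k p ^+ 2.
Proof.
rewrite sf_sum; apply: eq_bigr => i _; rewrite sf_sum; apply: eq_bigr => j _; rewrite sf_sum.
by apply: eq_bigr => k _; rewrite sfM expr2.
Qed.

Lemma DDE p : DD p = \sum_i d i ww p ^+ 2.
Proof. by rewrite sf_sum; apply: eq_bigr => i _; rewrite sfM expr2. Qed.

(** The trace of [BB] is the nonzero constant [- c], so [BB] vanishes nowhere. All real powers of
    [ww] are therefore smooth, including those with small or negative exponent. *)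
Lemma ww_gt0 p : 0 < ww p.
Proof.
have w0 : 0 <= ww p by rewrite wwE; apply: sumr_ge0 => i _; apply: sumr_ge0 => j _; exact: sqr_ge0.
rewrite lt_def w0 andbT; apply/eqP => wp.
have B0 i : BB i i p = 0.
 have h j : 0 <= \sum_k BB j k p ^+ 2 by apply: sumr_ge0 => k _; exact: sqr_ge0.
 have := sum_ge0_eq0 i h (esym (etrans (esym wp) (wwE p))) => /(sum_ge0_eq0 i (fun k => sqr_ge0 _)) /eqP.
 by rewrite sqrf_eq0 => /eqP.
have := congr1 (fun f : sfun M => f p) trace_BB; rewrite /= sf_sum big1 // => h0.
suff : c = 0 by move=> c0; have := c_lt0; rewrite c0 ltxx.
have h1 : 0 = - c := h0; rewrite -[c]opprK -h1 oppr0//.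
Qed.

Lemma GG_ge0 p : 0 <= GG p.
Proof. by rewrite GGE; do 3! apply: sumr_ge0 => ? _; exact: sqr_ge0. Qed.

Lemma DD_ge0 p : 0 <= DD p.
Proof. by rewrite DDE; apply: sumr_ge0 => ? _; exact: sqr_ge0. Qed.

(** A Kato-type inequality: [d_ww] writes the gradient of [ww] as twice a contraction of [BB] with
    [EE], to which Cauchy-Schwarz applies. *)
Lemma DD_le p : DD p <= 4 * (ww p * GG p).
Proof.
rewrite DDE GGE mulr_sumr mulr_sumr; apply: ler_sum => i _.
have -> : d i ww p = (\sum_(jk : 'I_m.+1 * 'I_m.+1) BB jk.1 jk.2 p * EE i jk.1 jk.2 p) *+ 2.
 rewrite d_ww sfMn sf_sum; congr (_ *+ 2); under eq_bigr do rewrite sf_sum.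
 by rewrite pair_big.
have := cauchy_schwarz_sum (fun jk : 'I_m.+1 * 'I_m.+1 => BB jk.1 jk.2 p) (fun jk => EE i jk.1 jk.2 p).
have -> : \sum_jk BB jk.1 jk.2 p * BB jk.1 jk.2 p = ww p.
 by rewrite wwE pair_big; apply: eq_bigr => jk _; rewrite expr2.
have -> : \sum_(jk : 'I_m.+1 * 'I_m.+1) EE i jk.1 jk.2 p * EE i jk.1 jk.2 p = \sum_j \sum_k EE i j k p ^+ 2.
 by rewrite pair_big; apply: eq_bigr => jk _; rewrite expr2.
by set X := \sum_(_ | _) _; move=> h; rewrite -mulr_natl exprMn -natrX ler_pM2l.
Qed.

Definition kst a : sfun M := mksf (fun k => CM_cst k a).
Definition Wp a : sfun M := mksf (fun k => CM_powR a ww_gt0 (sfP ww k)).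

Lemma d_Wp a i : d i (Wp a) = kst a * Wp (a - 1) * d i ww.
Proof.
apply: sf_inj => p; rewrite dsfE !sfM.
exact: (dl_comp psi i (sfP ww 1) (is_derive1_powR a (ww_gt0 p))).
Qed.

Lemma eta_smooth k : CM k (eta psi).
Proof.
have -> : eta psi = kst 2^-1 * \sum_j x j * x j.
 apply/funext => p; rewrite /eta; congr (_ * _); rewrite dotE.
 by rewrite [RHS]sf_sum; apply: eq_bigr => j _.
exact: sfP.
Qed.

Definition et : sfun M := mksf eta_smooth.
Definition ex : sfun M := mksf (fun k => CM_exp (sfP (cc * et) k)).

Lemma d_et i : d i et = x i - nn i * s.
Proof.
have -> : et = kst 2^-1 * \sum_j x j * x j.
 apply: sf_inj => p; apply: (congr1 (fun z => _ * z)); rewrite dotE.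
 by rewrite [RHS]sf_sum; apply: eq_bigr => j _.
rewrite dsfM dsf_cst mulr0 addr0 (d_sum (dsfD imm)).
have -> : \sum_j d i (x j * x j) = kst 2 * (x i - nn i * s).
 transitivity (kst 2 * \sum_j ((i == j)%:R * x j - nn i * (x j * nn j))).
  rewrite mulr_sumr; apply: eq_bigr => j _; rewrite dsfM (dx_proj imm N_normal).
  have -> : kst 2 = 1 + 1 by apply: sf_inj => p; rewrite sfD sf1.
  ring.
 by rewrite sumrB delta_sum -mulr_sumr.
by rewrite mulrA; have -> : kst 2^-1 * kst 2 = 1;
 [apply: sf_inj => p; rewrite sfM sf1 mulVf|rewrite mul1r].
Qed.

Lemma d_ex i : d i ex = cc * (x i - nn i * s) * ex.
Proof.
have -> : cc * (x i - nn i * s) = d i (cc * et) by rewrite dsfM (dsf_cst imm i c) mulr0 addr0 d_et.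
apply: sf_inj => p; rewrite dsfE mulrC sfM.
exact: (dl_comp psi i (sfP (cc * et) 1) (is_derive_expR _)).
Qed.

Definition rho : sfun M := s * s * ex.

(** So [bb] is the gradient of [log rho] up to a normal term, and the divergence of [rho] times a
    gradient is [rho] times the drift Laplacian. *)
Lemma d_rho i : d i rho = rho * (bb i - cc * nn i * s).
Proof.
rewrite /rho /bb !dsfM d_ex.
have -> : s * s * ex * (cc * x i + (r * d i s) *+ 2 - cc * nn i * s) =
 (r * s) * (ex * s * d i s *+ 2) + s * s * ex * (cc * (x i - nn i * s)) by ring.
rewrite rs; ring.
Qed.

Variable q : R.
Hypothesis q_gt : 2^-1 < q.

Definition FF : sfun M := Wp q.
Definition YY i : sfun M := rho * d i FF.

Lemma div_YY : \sum_i d i (YY i) = rho * drift d bb FF.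
Proof.
rewrite /YY /drift; under eq_bigr do rewrite dsfM d_rho.
transitivity (\sum_i (rho * d i (d i FF) + rho * (bb i * d i FF) - rho * cc * s * (nn i * d i FF))).
 by apply: eq_bigr => i _; ring.
by rewrite sumrB big_split /= -!mulr_sumr (Nd0 imm N_normal) mulr0 subr0 mulrDr.
Qed.

Lemma drift_FF : drift d bb FF = kst (2 * q) * Wp (q - 1) * GG + kst (q * (q - 1)) * Wp (q - 1 - 1) * DD.
Proof.
have kM a b : kst (a * b) = kst a * kst b by apply: sf_inj.
have E i : d i (d i FF) = kst q * Wp (q - 1) * d i (d i ww) + kst (q * (q - 1)) * Wp (q - 1 - 1) * (d i ww * d i ww).
 rewrite /FF d_Wp !dsfM dsf_cst d_Wp kM; ring.
rewrite /drift; under eq_bigr do rewrite E.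
under [X in _ + X]eq_bigr do rewrite /FF d_Wp mulrCA.
rewrite big_split /= -!mulr_sumr addrAC -mulrDr -/(drift d bb ww) drift_ww -/DD.
have -> : kst (2 * q) = kst q *+ 2 by apply: sf_inj => p; rewrite sfMn mulr2n; rewrite /= mulrDl mul1r.
ring.
Qed.

Lemma s_neq0 p : s p != 0.
Proof.
apply/eqP => sp; have := congr1 (fun f : sfun M => f p) rs;
have E : (r * s) p = r p * s p by []. rewrite E.
by move=> h; have := oner_neq0 R; rewrite -[1]h {}sp mulr0 eqxx.
Qed.

Lemma rho_gt0 p : 0 < rho p.
Proof. by rewrite /rho !sfM mulr_gt0// ?expR_gt0// -expr2 exprn_even_gt0//= s_neq0. Qed.

Lemma Wp_gt0 a p : 0 < Wp a p.
Proof. exact: powR_gt0 (ww_gt0 p). Qed.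

Lemma WpD a b p : Wp (a + b) p = Wp a p * Wp b p.
Proof. by apply: powRD; rewrite (gt_eqF (ww_gt0 p)) implybT. Qed.

Lemma Wp1 p : Wp 1 p = ww p.
Proof. by apply: powRr1; rewrite ltW// ww_gt0. Qed.

Hypothesis M_complete : complete_immersion psi.
Variable dM : {measure set (borel M) -> \bar R}.
Hypothesis dM_volume : is_volume psi dM.
Hypothesis FF_int : dM.-integrable setT (EFin \o ((fun p => rho p * FF p) : borel M -> R)).

Lemma YY_tangent : tangent psi (fun i => YY i : M -> R).
Proof.
move=> phi u at_ Uu; have D := cinv_dom Uu.
have := chart_proj imm N_normal at_ D; rewrite cinvK// -mulmxA => ->.
rewrite mulmxBr mulmx1 mulmxA; set Nu := N _.
have -> : yrow (fun i => YY i : M -> R) (cinv phi u) *m Nu^T = 0.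
 apply/matrixP => a b; rewrite [a]ord1 [b]ord1 mxE [RHS]mxE.
 have := congr1 (fun f : sfun M => f (cinv phi u)) (Nd0 imm N_normal FF); rewrite /= sf_sum => h.
 transitivity (rho (cinv phi u) * \sum_i (nn i * d i FF) (cinv phi u)); last by rewrite h mulr0.
 rewrite mulr_sumr; apply: eq_bigr => i _; rewrite [yrow _ _ _ _]mxE [Nu^T _ _]mxE !sfM.
 by rewrite [RHS]mulrCA mulrC.
by rewrite mul0mx subr0.
Qed.

(** The Liouville theorem is applied to [YY], which is [rho] times the gradient of [ww] to the power
    [q]. Its divergence combines [GG] with a positive and [DD] with a possibly negative coefficient;
    for [q > 1/2] the Kato-type inequality leaves a positive remainder in both. *)
Lemma EE0 i j k : EE i j k = 0.
Proof.
apply: sf_inj => o; rewrite sf0.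
have q0 : 0 < q by apply: lt_trans q_gt; rewrite invr_gt0.
have q1 : 0 < 2 * q - 1 by rewrite subr_gt0; have := ltr_pM2l (ltr0n R 2) 2^-1 q; rewrite q_gt mulfV.
(* With [X = ww * GG], the reserve [e] must satisfy [2 - e >= 0] and, after replacing [DD] by its
   bound [4 * X] when its coefficient is negative, [2 * q - 1 - e >= 0]. *)
pose e : R := Num.min 1 (2 * q - 1).
have e0 : 0 < e by rewrite lt_min ltr01 /=; lra.
have e1 : e <= 1 by rewrite ge_min lexx.
have eq1 : e <= 2 * q - 1 by rewrite ge_min lexx orbT.
pose beta := q * e / 4; pose alpha := q * e.
have b0 : 0 < beta by rewrite /beta divr_gt0// mulr_gt0.
have a0 : 0 < alpha by rewrite /alpha mulr_gt0.
(* The powers are matched so that [|YY|^2] equals [q ^+ 2 / beta] times [A * H], with [H] the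
   function known to be integrable. *)
pose A : sfun M := kst beta * rho * Wp (q - 1 - 1) * DD.
pose B : sfun M := kst alpha * rho * Wp (q - 1) * GG.
pose H : sfun M := rho * FF.
have cont (f : sfun M) : continuous f by exact: (CM_continuous (sfP f 0)).
have W1E p : Wp (q - 1) p = Wp (q - 1 - 1) p * ww p by rewrite -Wp1 -WpD subrK.
have L := liouville imm dM_volume M_complete (Y := fun i => YY i : M -> R) (A := A) (B := B) (H := H)
 (k := q ^+ 2 / beta) (fun i => sfP (YY i) 1) YY_tangent (cont A) (cont B) (cont H).
have : B o = 0.
 apply: L => //.
 - by rewrite divr_ge0// ?sqr_ge0// ltW.
 - by move=> p; exact: mulr_ge0 (mulr_ge0 (mulr_ge0 (ltW b0) (ltW (rho_gt0 p))) (ltW (Wp_gt0 _ p))) (DD_ge0 p).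
 - by move=> p; exact: mulr_ge0 (mulr_ge0 (mulr_ge0 (ltW a0) (ltW (rho_gt0 p))) (ltW (Wp_gt0 _ p))) (GG_ge0 p).
 - by move=> p; exact: mulr_ge0 (ltW (rho_gt0 p)) (ltW (Wp_gt0 _ p)).
 - move=> p; have -> : dvg psi (fun i => YY i : M -> R) p = (\sum_i d i (YY i)) p.
   by rewrite sf_sum; apply: eq_bigr => i' _; rewrite dsfE.
  rewrite div_YY drift_FF.
  have -> : A p = beta * rho p * Wp (q - 1 - 1) p * DD p by [].
  have -> : B p = alpha * rho p * Wp (q - 1) p * GG p by [].
  have -> : (rho * (kst (2 * q) * Wp (q - 1) * GG + kst (q * (q - 1)) * Wp (q - 1 - 1) * DD)) p =
   rho p * (2 * q * Wp (q - 1) p * GG p + q * (q - 1) * Wp (q - 1 - 1) p * DD p) by [].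
  rewrite W1E.
  have := rho_gt0 p; have := Wp_gt0 (q - 1 - 1) p; have := DD_ge0 p; have := DD_le p.
  have := GG_ge0 p; have := ww_gt0 p.
  move: (rho p) (Wp _ p) (DD p) (GG p) (ww p) => rh W D G w w0 G0 DG D0 W0 rh0.
  have K : beta * D + alpha * (w * G) <= 2 * q * (w * G) + q * (q - 1) * D.
   have wG0 : 0 <= w * G by rewrite mulr_ge0// ltW.
   move: (w * G) wG0 DG => X X0 DX; rewrite /beta /alpha.
   rewrite -subr_ge0; have -> : 2 * q * X + q * (q - 1) * D - (q * e / 4 * D + q * e * X) =
    q * (X * (2 - e) + D * (q - 1 - e / 4)) by field.
   apply: mulr_ge0; first exact: ltW.
   have [h|h] := leP 0 (q - 1 - e / 4); first by rewrite addr_ge0// mulr_ge0//; lra.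
   have h1 : (4 * X) * (q - 1 - e / 4) <= D * (q - 1 - e / 4) by rewrite ler_nM2r.
   apply: le_trans (lerD (lexx _) h1).
   have -> : X * (2 - e) + 4 * X * (q - 1 - e / 4) = X * (2 * (2 * q - 1 - e)) by field.
   rewrite mulr_ge0// mulr_ge0//; lra.
  have -> : beta * rh * W * D + alpha * rh * (W * w) * G = rh * W * (beta * D + alpha * (w * G)) by ring.
  have -> : rh * (2 * q * (W * w) * G + q * (q - 1) * W * D) = rh * W * (2 * q * (w * G) + q * (q - 1) * D) by ring.
  by rewrite ler_pM2l// mulr_gt0.
 - move=> p; rewrite sqr_enorm dotE.
  have -> : \sum_i' yrow (fun i => YY i : M -> R) p 0 i' * yrow (fun i => YY i : M -> R) p 0 i' =
    (rho p * q * Wp (q - 1) p) ^+ 2 * DD p.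
   rewrite DDE mulr_sumr; apply: eq_bigr => i' _; rewrite mxE /YY /FF d_Wp.
   have -> : (rho * (kst q * Wp (q - 1) * d i' ww)) p = rho p * (q * Wp (q - 1) p * d i' ww p) by [].
   ring.
  have -> : A p = beta * rho p * Wp (q - 1 - 1) p * DD p by [].
  have -> : H p = rho p * Wp q p by [].
  have E : Wp (q - 1) p ^+ 2 = Wp (q - 1 - 1) p * Wp q p.
   by rewrite expr2 -!WpD; congr (Wp _ p); ring.
  rewrite le_eqVlt; apply/orP; left; apply/eqP; rewrite exprMn E.
  by field; exact: lt0r_neq0.
have -> : B o = alpha * rho o * Wp (q - 1) o * GG o by [].
have X0 : 0 < alpha * rho o * Wp (q - 1) o.
 exact: mulr_gt0 (mulr_gt0 a0 (rho_gt0 o)) (Wp_gt0 _ o).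
move: (_ * Wp _ o) X0 => X X0 /eqP; rewrite mulf_eq0 (gt_eqF X0) /= GGE => /eqP h.
have h1 i' : 0 <= \sum_j' \sum_k' EE i' j' k' o ^+ 2.
 by do 2! apply: sumr_ge0 => ? _; exact: sqr_ge0.
have h2 i' j' : 0 <= \sum_k' EE i' j' k' o ^+ 2 by apply: sumr_ge0 => ? _; exact: sqr_ge0.
have := sum_ge0_eq0 k (fun k => sqr_ge0 _) (sum_ge0_eq0 j (h2 i) (sum_ge0_eq0 i h1 h)).
by move=> /eqP; rewrite sqrf_eq0 => /eqP.
Qed.

End Simons.

(** * The integrability hypothesis in terms of B *)

Section Integrability.
Variables (R : realType) (m : nat) (M : manifold R m) (psi N : M -> 'rV[R]_m.+1).
Hypothesis imm : immersion psi.
Hypothesis N_normal : unit_normal psi N.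
Variable c : R.
Hypothesis soliton : soliton_for c psi.
Hypothesis c_lt0 : c < 0.
Notation s := (support_fn imm N_normal).
Variable r : sfun M.
Hypothesis rs : r * s = 1.
Variable dM : {measure set (borel M) -> \bar R}.
Variable p : R.
Hypothesis p_gt1 : 1 < p.
Hypothesis H_A_L1 : dM.-integrable [set: borel M] (fun x : borel M =>
  (HA_density p psi N x * expR (c * eta psi x))%:E).

(** With [H = c s] and [|A| = |s| |B|], the powers of [s] add up to 2 whatever the exponent: the
    hypothesis says precisely that [|B|^p] is integrable for the weight [s^2 e^(c eta)]. *)
Lemma HA_densityE x : HA_density p psi N x =
 `|c| `^ (2 - p) * (s x * s x * ww imm N_normal r x `^ (p / 2)).
Proof.
rewrite /HA_density (mean_curvatureE imm N_normal soliton) (norm_AE imm N_normal).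
have w0 : 0 < ww imm N_normal r x := ww_gt0 soliton c_lt0 rs x.
have s0 : 0 < `|s x| by rewrite normr_gt0; exact: s_neq0 rs x.
have -> : (\sum_i \sum_j dsf imm i (ns N_normal j) * dsf imm i (ns N_normal j)) x =
  s x ^+ 2 * ww imm N_normal r x.
 rewrite wwE sf_sum mulr_sumr; apply: eq_bigr => i _; rewrite sf_sum mulr_sumr; apply: eq_bigr => j _.
 have E := congr1 (fun f : sfun M => f x) (sB (dsf imm) rs i j).
 have E' : s x * BB imm N_normal r i j x = dsf imm i (ns N_normal j) x := E.
 have -> : (dsf imm i (ns N_normal j) * dsf imm i (ns N_normal j)) x =
  dsf imm i (ns N_normal j) x ^+ 2 by [].
 by rewrite -E' exprMn.
rewrite sqrtrM ?sqr_ge0// sqrtr_sqr normrM !powRM ?sqrtr_ge0//.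
rewrite -!mulrA; congr (_ * _); rewrite mulrA -powRD; last by rewrite (gt_eqF s0) implybT.
rewrite subrK powR_mulrn// -normrX ger0_norm ?sqr_ge0// expr2 -mulrA; congr (_ * (_ * _)).
by rewrite -powR12_sqrt ?ltW// -powRrM mulrC.
Qed.

Lemma weight_integrable : dM.-integrable setT
 (EFin \o ((fun x => rho imm N_normal c x * FF soliton c_lt0 rs (p / 2) x) : borel M -> R)).
Proof.
have := integrableZl measurableT (`|c| `^ (p - 2)) H_A_L1; apply: eq_integrable => // x _.
rewrite -[RHS]/((rho imm N_normal c x * FF soliton c_lt0 rs (p / 2) x)%:E) /= -EFinM HA_densityE; congr (_%:E).
transitivity (s x * s x * expR (c * eta psi x) * ww imm N_normal r x `^ (p / 2)); last by [].
have c0 : `|c| != 0 by rewrite normr_eq0 lt_eqF.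
have E : `|c| `^ (p - 2) * `|c| `^ (2 - p) = 1.
 by rewrite -powRD ?c0 ?implybT// addrA subrK subrr powRr0.
by move: E; move: (_ `^ (p - 2)) (_ `^ (2 - p)) (s x * s x) (_ `^ (p / 2)) (expR _) => a b t u v E;
 transitivity ((a * b) * (t * v * u)); [ring|rewrite E mul1r].
Qed.

Hypothesis M_complete : complete_immersion psi.
Hypothesis dM_volume : is_volume psi dM.

Theorem parallel i j k : EE imm N_normal r i j k = 0.
Proof.
apply: (EE0 _ M_complete dM_volume weight_integrable i j k).
by rewrite ltr_pdivlMr// mulVf.
Qed.

End Integrability.

(** * Classification *)

Section LinearODE.
Variables (R : realType) (I : finType).

Lemma segment_bounded (f : R -> R) (T : R) : continuous f ->
 exists2 C : R, 0 <= C & forall t : R, 0 <= t <= T -> `|f t| <= C.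
Proof.
move=> fc; have [C C0 H] := continuous_compact_bounded fc (@segment_compact R 0 T).
by exists C => // t tT; apply: H; rewrite /= in_itv.
Qed.

(** The sum of squares of the unknowns satisfies a linear differential inequality on [[0, T]], where
    the coefficients are bounded, and Gronwall's lemma applies. *)
Lemma linear_ode0 (u : I -> R -> R) (c : I -> I -> R -> R) (T : R) : 0 <= T ->
 (forall i t, is_derive t (1 : R) (u i) (\sum_j c i j t * u j t)) ->
 (forall i j, continuous (c i j)) -> (forall i, u i 0 = 0) ->
 forall i (t : R), 0 <= t <= T -> u i t = 0.
Proof.
move=> T0 ud cc u0.
have Hb (ij : I * I) : exists C : R, 0 <= C /\ forall t : R, 0 <= t <= T -> `|c ij.1 ij.2 t| <= C.
 by have [C h1 h2] := segment_bounded T (cc ij.1 ij.2); exists C.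
pose b ij := projT1 (cid (Hb ij)).
have b0 ij : 0 <= b ij := (projT2 (cid (Hb ij))).1.
have bH i j t : 0 <= t <= T -> `|c i j t| <= b (i, j) := (projT2 (cid (Hb (i, j)))).2 t.
pose C := \sum_ij b ij.
have bC i j : b (i, j) <= C by rewrite /C (bigD1 (i, j))//= lerDl sumr_ge0.
have C0 : 0 <= C by exact: sumr_ge0.
pose y t := \sum_i u i t * u i t.
pose dy t := \sum_i (u i t * (\sum_j c i j t * u j t) + u i t * (\sum_j c i j t * u j t)).
have yd t : is_derive t (1 : R) y (dy t).
 by apply: (@is_derive_bigsum _ _ _ (fun i t => u i t * u i t)
  (fun i t => u i t * (\sum_j c i j t * u j t) + u i t * (\sum_j c i j t * u j t))) => i; exact: is_deriveM.
pose K := 2 * C * #|I|%:R.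
have dyK t : 0 <= t <= T -> dy t <= K * y t.
 move=> tT; have S0 : forall i, 0 <= u i t * u i t by move=> i; rewrite -expr2 sqr_ge0.
 apply: (@le_trans _ _ (\sum_i \sum_j C * (u i t * u i t + u j t * u j t))).
  apply: ler_sum => i _; rewrite -mulr2n mulr_sumr -sumrMnl; apply: ler_sum => j _.
  have := le_trans (bH i j t tT) (bC i j); rewrite ler_norml => /andP[h1 h2].
  move: (u i t) (u j t) (c i j t) h1 h2 => p q a h1 h2.
  rewrite mulr2n; have := sqr_ge0 (p - q); have := sqr_ge0 (p + q); rewrite !expr2 => h3 h4.
  have h5 : 0 <= (C - a) * ((p + q) * (p + q)) by rewrite mulr_ge0// subr_ge0.
  have h6 : 0 <= (C + a) * ((p - q) * (p - q)) by rewrite mulr_ge0//; lra.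
  rewrite -subr_ge0.
  have -> : C * (p * p + q * q) - (p * (a * q) + p * (a * q)) =
   2^-1 * ((C - a) * ((p + q) * (p + q)) + (C + a) * ((p - q) * (p - q))) by field.
  by rewrite mulr_ge0 ?invr_ge0// addr_ge0.
 under eq_bigr do rewrite -mulr_sumr big_split /= sumr_const -mulr_natr.
 rewrite -mulr_sumr big_split /= -mulr_suml sumr_const -mulr_natr -/(y t).
 by rewrite le_eqVlt; apply/orP; left; apply/eqP; rewrite /K; ring.
have y0 : y 0 <= 0 by rewrite /y big1// => i _; rewrite u0 mulr0.
move=> i t tT; have := gronwall0 T0 (fun t _ => yd t) dyK y0 tT => yt.
have /eqP : u i t * u i t = 0.
 have s0 : 0 <= u i t * u i t by rewrite -expr2 sqr_ge0.
 apply/eqP; rewrite eq_le s0 andbT.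
 apply: le_trans yt; rewrite /y (bigD1 i)//= lerDl sumr_ge0// => j _.
 by rewrite -expr2 sqr_ge0.
by rewrite mulf_eq0 orbb => /eqP.
Qed.

End LinearODE.

(** * Curves with prescribed velocity and descent on M x R *)

Section Curves.
Variables (R : realType) (m n : nat) (M : manifold R m) (psi : M -> 'rV[R]_n).
Hypothesis imm : immersion psi.

Lemma vel_continuous (g : R -> M) k : C1_curve g -> continuous (fun t => vel psi g t 0 k).
Proof. by move=> gC t; apply: continuous_coord_at; exact: (curve_psi imm gC t).2. Qed.

Lemma curve_join : connected [set: M] -> forall o p, exists g : R -> M, [/\ C1_curve g, g 0 = o & g 1 = p].
Proof.
move=> Mc o p.
suff [a /rdist_lt[g [gC g0 g1 _]]] : exists a : R, (rdist psi o p < a%:E)%E by exists g.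
apply: (connected_propagate Mc (A := fun p => exists a : R, (rdist psi o p < a%:E)%E) (o := o)).
 by exists 1; exact: rdist_refl.
move=> q; have [W Wq H] := near_rdist imm q ltr01; exists W => // q1 q2 W1 W2 [a h].
exists (a + 1); exact: rdist_tri_lt h (H _ _ W1 W2).
Qed.

(* Restrict the system to a curve from [o]. *)
Lemma linear_system0 (I : finType) (u : I -> M -> R) (L : 'I_n -> I -> I -> M -> R) o :
 connected [set: M] -> (forall i, CM 1 (u i)) -> (forall k i j, continuous (L k i j)) ->
 (forall k i p, dl psi k (u i) p = \sum_j L k i j p * u j p) ->
 (forall i, u i o = 0) -> forall i p, u i p = 0.
Proof.
move=> Mc uS Lc ud uo i p; have [g [gC g0 g1]] := curve_join Mc o p.
have gc : continuous g by case: gC.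
pose c i j t := \sum_k vel psi g t 0 k * L k i j (g t).
have := @linear_ode0 R I (fun i => u i \o g) c 1 ler01 _ _ _ i 1.
rewrite /= g1; apply.
- move=> i' t; have := curve_fun imm t gC (uS i'); congr (is_derive _ _ _ _).
 transitivity (\sum_k \sum_j vel psi g t 0 k * (L k i' j (g t) * u j (g t))).
  by apply: eq_bigr => k _; rewrite ud mulr_sumr.
 rewrite exchange_big; apply: eq_bigr => j _; rewrite /c mulr_suml.
 by apply: eq_bigr => k _; rewrite mulrA.
- move=> i' j t; apply: sum_continuous_at => k _.
 apply: (@continuousM _ _ (fun t => vel psi g t 0 k) (fun t => L k i' j (g t)) t).
  exact: vel_continuous.
 by apply: continuous_comp; [exact: gc|exact: Lc].
- by move=> i'; rewrite g0.
- by rewrite ler01 lexx.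
Qed.

(** A curve has to be defined for all times and to stay in the chart. Replacing [t] by
    [d * sin (d^-1 * t)] keeps the displacement bounded by [d] in the parameter, with derivative 1
    at 0. *)
Lemma slope_curve p (h : 'rV[R]_m) : exists g : R -> M,
 [/\ C1_curve g, g 0 = p & vel psi g 0 = h *m jac (psi \o cinv (chart_at p)) (cmap (chart_at p) p)].
Proof.
have at_ := chart_at_atlas p; have Dp := chart_at_dom p; set phi := chart_at p in at_ Dp *.
set c := cmap phi p.
have [r r0 sub] := nbhs_box (open_nbhs_nbhs (conj (open_crange phi) (crange_cmap Dp))).
pose d := r / (`|h| + 1); have nh : 0 < `|h| + 1 by rewrite ltr_wpDl.
have d0 : 0 < d by rewrite divr_gt0.
pose b (t : R) := d * sin (d^-1 * t).
have bd (t : R) : is_derive t (1 : R) b (cos (d^-1 * t)).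
 have H : is_derive t (1 : R) (fun t => sin (d^-1 * t)) (cos (d^-1 * t) * d^-1).
  exact: is_derive1_comp (is_derive_sin _) (is_derive_mull _ _).
 have := is_derive1_comp (is_derive_mull d (sin (d^-1 * t))) H.
 by rewrite mulrCA divff ?gt_eqF// mulr1.
have b0 : b 0 = 0 by rewrite /b mulr0 sin0 mulr0.
pose G (t : R) : 'rV[R]_m := c + b t *: h.
have GU t : crange phi (G t).
 apply: sub => a; rewrite /G !mxE addrC addrK normrM.
 have h1 : `|b t| <= d by rewrite normrM (gtr0_norm d0) ler_piMr ?(ltW d0)// ler_norml sin_le1 sin_geN1.
 have h2 : `|h 0 a| <= `|h| + 1 by apply: le_trans (coord_le h a) _; rewrite lerDl.
 by apply: le_trans (ler_pM (normr_ge0 _) (normr_ge0 _) h1 h2) _; rewrite divfK// gt_eqF.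
have Gd (a : 'I_m) (t : R) : is_derive t (1 : R) (fun s => G s 0 a) (h 0 a * cos (d^-1 * t)).
 have -> : (fun s => G s 0 a) = (fun s => c 0 a + h 0 a * b s).
  by apply/funext => s; rewrite /G !mxE mulrC.
 have := is_deriveD (is_derive_cst (c 0 a) t (1 : R)) (is_derive1_comp (is_derive_mull (h 0 a) (b t)) (bd t)).
 by rewrite add0r.
have GC t : C1at G t.
 apply: C1at_row => a; apply: (@C1atI _ _ _ (fun s => h 0 a * cos (d^-1 * s))).
  by apply: (@filterS _ (nbhs t) _ setT) filterT => s _; exact: Gd.
 apply: (@continuousM _ _ (cst (h 0 a)) (fun s => cos (d^-1 * s)) t); first exact: cst_continuous.
 apply: (@continuous_comp _ _ _ (fun s : R => d^-1 * s) cos); last exact: continuous_cos.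
 by apply: differentiable_continuous; apply/derivable1_diffP; exact: (@ex_derive _ _ _ _ _ _ _ (is_derive_mull _ _)).
pose g t := cinv phi (G t).
have gE t : cmap phi (g t) = G t by rewrite /g cinvK.
have gC : C1_curve g.
 apply: C1_curve_intro.
  move=> t; apply: (@continuous_comp _ _ _ G (cinv phi)); last exact: (cinv_continuous (GU t)).
  exact: C1at_continuous (GC t).
 move=> t; exists phi; split=> //; first exact: cinv_dom.
 apply: C1at_eq (GC t); apply: (@filterS _ (nbhs t) _ setT) filterT => s _; exact/esym/gE.
have g0 : g 0 = p by rewrite /g /G b0 scale0r addr0 /c cmapK'.
exists g; split=> //; apply/rowP => k; rewrite (vel_chart imm k gC at_ (cinv_dom (GU 0))).
rewrite -/(g 0) g0; congr ((_ *m _) _ _).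
have -> : cmap phi \o g = G by apply/funext => t; exact: gE.
apply/rowP => a; rewrite (derive_row _ (C1at_der (GC 0))).
by rewrite (@derive_val _ _ _ _ _ _ _ (Gd a 0)) mulr0 cos0 mulr1.
Qed.

Lemma curve_rdist (g : R -> M) (v : R) : C1_curve g -> enorm (vel psi g 0) < v ->
 exists2 r : R, 0 < r & forall t : R, 0 < t -> t < r -> (rdist psi (g 0%R) (g t) < (v * t)%R%:E)%E.
Proof.
move=> gC gv; have [L Ld] := speed_primitive imm gC.
have e0 : 0 < (v - enorm (vel psi g 0)) / 2 by rewrite divr_gt0// subr_gt0.
have [r r0 H] := deriv_eps (Ld 0) e0; exists r => // t t0 tr.
apply: le_lt_trans (rdist_sub_curve imm 0 t gC Ld) _; rewrite lte_fin.
have := H t; rewrite add0r (gtr0_norm t0) => /(_ tr); rewrite -/(speed psi g 0) in e0 *.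
rewrite /speed; set w := enorm (vel psi g 0) in gv *.
move=> h; apply: le_lt_trans (_ : `|L t - L 0 - w * t| + `|w * t| < _).
 by rewrite -{1}[L t - L 0](subrK (w * t)) ler_normD.
rewrite [`|w * t|]ger0_norm; last by rewrite mulr_ge0 ?enorm_ge0// ltW.
apply: le_lt_trans (lerD h (lexx _)) _.
by rewrite -mulrDl ltr_pM2r//; rewrite /w in gv *; lra.
Qed.

Lemma curve_psi_eps (g : R -> M) (e : R) : C1_curve g -> 0 < e ->
 exists2 r : R, 0 < r & forall t : R, 0 < t -> t < r ->
  enorm (psi (g t) - (psi (g 0) + t *: vel psi g 0)) <= e * t.
Proof.
move=> gC e0; pose k : R := n%:R + 1; have k0 : 0 < k by rewrite ltr_wpDl.
have H (j : 'I_n) : exists r : R, 0 < r /\ forall t : R, 0 < t -> t < r ->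
  `|psi (g t) 0 j - psi (g 0) 0 j - vel psi g 0 0 j * t| <= e / k * t.
 have d : is_derive (0 : R) (1 : R) (fun t => psi (g t) 0 j) (vel psi g 0 0 j).
  have dg := C1at_der (curve_psi imm gC 0).
  rewrite /vel (derive_row _ dg); apply: derivableP.
  by have /derivable_mxP/(_ 0 j) := dg.
 have [r r0 hr] := deriv_eps d (divr_gt0 e0 k0); exists r; split=> // t t0 tr.
 by have := hr t; rewrite add0r (gtr0_norm t0); apply.
pose r j := projT1 (cid (H j)).
have rP j : 0 < r j /\ forall t, 0 < t -> t < r j ->
  `|psi (g t) 0 j - psi (g 0) 0 j - vel psi g 0 0 j * t| <= e / k * t := projT2 (cid (H j)).
exists (\big[Num.min/1]_j r j).
 by elim/big_ind: _ => // [x y x0 y0|j _]; [rewrite lt_min x0|exact: (rP j).1].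
move=> t t0 tr; apply: le_trans (enorm_le_sum _) _.
apply: (@le_trans _ _ (\sum_(j < n) e / k * t)).
 apply: ler_sum => j _; rewrite !mxE opprD addrA [t * _]mulrC; apply: (rP j).2 => //.
 apply: lt_le_trans tr _; exact: bigmin_le_cond.
rewrite sumr_const card_ord -mulr_natr mulrAC ler_pM2r//.
by rewrite mulrAC ler_pdivrMr// ler_pM2l// lerDl.
Qed.

Hypothesis M_complete : complete_immersion psi.

Lemma cauchy_real (t : nat -> R) : (forall e, 0 < e -> exists k, forall i j, (k <= i)%N -> (k <= j)%N -> `|t i - t j| < e) ->
 exists l, forall e, 0 < e -> exists k, forall i, (k <= i)%N -> `|t i - l| < e.
Proof.
move=> H; have tc : cvgn t.
 apply: cauchy_cvg; apply: cauchy_exP => e e0; have [k hk] := H e e0; exists (t k).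
 exists k => // i ki; rewrite /ball /=; exact: hk.
exists (limn t) => e e0; have /cvgrPdist_lt/(_ e e0)[k _ hk] := tc.
by exists k => i ki; rewrite distrC; exact: hk.
Qed.

(** The descent principle on [M * R]: the real coordinate is the parameter of a target curve, moved
    together with the point. Completeness of both factors and closedness of [S] give the limits. *)
Lemma descent_MR (S : M -> R -> Prop) (f : M -> R -> R) (C K : R) p0 t0 : 0 <= C -> 0 <= K ->
 (forall p t, 0 <= f p t) ->
 (forall p q t t' a, (rdist psi p q < a%:E)%E -> `|t - t'| < a -> `|f p t - f q t'| <= C * a) ->
 (forall p t, (forall e, 0 < e -> exists q t', [/\ S q t', (rdist psi q p < e%:E)%E & `|t' - t| < e]) -> S p t) ->
 (forall p t, S p t -> 0 < f p t -> exists q t' (a x : R), [/\ 0 < x, x <= f p t - f q t',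
  (rdist psi p q < a%:E)%E & a <= K * x /\ `|t - t'| < K * x /\ (f q t' < f p t -> S q t')]) ->
 S p0 t0 -> exists p t, S p t /\ f p t = 0.
Proof.
move=> C0 K0 f0 f_lip S_cl step S0.
pose T := (M * R)%type; pose S' (x : T) := S x.1 x.2; pose f' (x : T) := f x.1 x.2.
pose nr (x y : T) a := (rdist psi x.1 y.1 < a%:E)%E /\ `|x.2 - y.2| < a.
have [] := @descent R T S' f' nr C K C0 K0 _ _ _ _ _ _ _ _ (p0, t0) S0.
- by move=> x _; exact: f0.
- by move=> x a a0; split; [exact: rdist_refl|rewrite subrr normr0].
- move=> x y z a b [h1 h2] [h3 h4]; split; first exact: rdist_tri_lt h1 h3.
 by apply: le_lt_trans (ler_distD y.2 _ _) _; exact: ltrD.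
- by move=> x y a [h1 h2]; split; [exact: rdist_sym_lt|rewrite distrC].
- by move=> x y a b [h1 h2] ab; split; [exact: rdist_le_lt h1 ab|exact: lt_le_trans ab].
- by move=> x y a [h1 h2]; exact: f_lip.
- move=> x Sx cau.
 have [p Hp] : exists p, forall e : R, 0 < e -> exists k : nat, forall i : nat,
  (k <= i)%N -> (rdist psi (x i).1 p < e%:E)%E.
  apply: (M_complete (x := fun i => (x i).1)) => e e0; have [k hk] := cau e e0.
  by exists k => i j ki kj; exact: (hk i j ki kj).1.
 have [l Hl] : exists l : R, forall e, 0 < e -> exists k, forall i, (k <= i)%N -> `|(x i).2 - l| < e.
  apply: (@cauchy_real (fun i => (x i).2)) => e e0; have [k hk] := cau e e0.
  by exists k => i j ki kj; exact: (hk i j ki kj).2.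
 have lim e : 0 < e -> exists k, forall i, (k <= i)%N -> nr (x i) (p, l) e.
  move=> e0; have [k1 h1] := Hp e e0; have [k2 h2] := Hl e e0.
  by exists (maxn k1 k2) => i; rewrite geq_max => /andP[i1 i2]; split; [exact: h1|exact: h2].
 exists (p, l) => //; apply: S_cl => e e0; have [k /(_ k (leqnn k))[h1 h2]] := lim e e0.
 by exists (x k).1, (x k).2; split=> //; exact: Sx.
- move=> [p t] Sp fp; have [q [t' [a [x [x0 dec dq [ax [tx Sq]]]]]]] := step _ _ Sp fp.
 have fq : f q t' < f p t by rewrite -subr_gt0; exact: lt_le_trans dec.
 have Kx : K * x <= K * (f p t - f q t') by exact: ler_wpM2l.
 exists (q, t'); split=> //; first exact: Sq.
 by split; [exact: rdist_le_lt dq (le_trans ax Kx)|exact: lt_le_trans tx Kx].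
by move=> [p t] Sp fp; exists p, t.
Qed.

End Curves.

(** * Orthogonal splittings of the ambient space *)

Section Orthogonal.
Variable R : realType.

Lemma orthonormal_base r k n (A : 'M[R]_(r, n)) : \rank A = k ->
 exists2 P : 'M[R]_(k, n), P *m P^T = 1%:M & exists X, P = X *m A.
Proof.
move=> <-; have [T _ T1] := orthonormal_rows (row_base_free A).
exists (T *m row_base A) => //.
have /submxP[X EX] : (row_base A <= A)%MS by rewrite eq_row_base.
by exists (T *m X); rewrite EX mulmxA.
Qed.

Lemma orth_complete k l n (P : 'M[R]_(k, n)) (Q : 'M[R]_(l, n)) : (k + l)%N = n ->
 P *m P^T = 1%:M -> Q *m Q^T = 1%:M -> P *m Q^T = 0 -> P^T *m P + Q^T *m Q = 1%:M.
Proof.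
move=> e; case: n / e P Q => P Q PP QQ PQ.
have QP : Q *m P^T = 0 by rewrite -[LHS]trmxK trmx_mul trmxK PQ trmx0.
have /mulmx1C : col_mx P Q *m (col_mx P Q)^T = 1%:M.
 by rewrite tr_col_mx mul_col_row PP QQ PQ QP -scalar_mx_block.
by rewrite tr_col_mx mul_row_col.
Qed.

(** The rows of [P] span those of [A], and the rows of [Q] their orthogonal complement, obtained as
    the kernel of the transpose. *)
Lemma orth_split r k l n (A : 'M[R]_(r, n)) : \rank A = k -> (k + l)%N = n ->
 exists (P : 'M[R]_(k, n)) (Q : 'M[R]_(l, n)),
 [/\ P *m P^T = 1%:M, Q *m Q^T = 1%:M, P *m Q^T = 0,
 P^T *m P + Q^T *m Q = 1%:M & (exists X, P = X *m A) /\ A *m Q^T = 0].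
Proof.
move=> rA e; have [P PP [X PX]] := orthonormal_base rA.
have [|Q QQ [Y QY]] := @orthonormal_base _ l _ (kermx A^T).
 by rewrite mxrank_ker mxrank_tr rA -e addKn.
have AQ : A *m Q^T = 0 by rewrite -[LHS]trmxK trmx_mul trmxK QY -mulmxA mulmx_ker mulmx0 trmx0.
have PQ : P *m Q^T = 0 by rewrite PX -mulmxA AQ mulmx0.
exists P, Q; split=> //; [exact: orth_complete|by split=> //; exists X].
Qed.

Lemma dot_orth k n (P : 'M[R]_(k, n)) u v : P *m P^T = 1%:M -> dot (u *m P) (v *m P) = dot u v.
Proof. by move=> PP; rewrite /dot trmx_mul mulmxA -(mulmxA u) PP mulmx1. Qed.

Lemma enorm_orth k n (P : 'M[R]_(k, n)) u : P *m P^T = 1%:M -> enorm (u *m P) = enorm u.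
Proof. by move=> PP; rewrite /enorm dot_orth. Qed.

Lemma dot_mulmx_tr k n (P : 'M[R]_(k, n)) u v : dot (u *m P) v = dot u (v *m P^T).
Proof. by rewrite /dot trmx_mul trmxK mulmxA. Qed.

Lemma dot0P n (u v : 'rV[R]_n) : dot u v = 0 <-> u *m v^T = 0.
Proof.
split=> [H|H]; last by rewrite /dot H mxE.
by apply/matrixP => i j; rewrite [i]ord1 [j]ord1 [RHS]mxE.
Qed.

Lemma enorm_le_orth k n (P : 'M[R]_(k, n)) v : P *m P^T = 1%:M -> enorm (v *m P^T) <= enorm v.
Proof.
move=> PP; have [/eqP/eqP e|e] := eqVneq (enorm (v *m P^T)) 0; first by rewrite e enorm_ge0.
have e0 : 0 < enorm (v *m P^T) by rewrite lt_def e enorm_ge0.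
rewrite -(ler_pM2l e0) -expr2 sqr_enorm -dot_mulmx_tr.
apply: le_trans (ler_norm _) _; apply: le_trans (dot_CS _ _) _.
by rewrite enorm_orth.
Qed.

Lemma rank_pair n r (A : 'M[R]_(r, n)) (a b : 'rV[R]_n) : (a <= A)%MS -> (b <= A)%MS ->
 a != 0 -> b != 0 -> dot a b = 0 -> (1 < \rank A)%N.
Proof.
move=> aA bA a0 b0 ab.
have bb : dot b b != 0 by apply/eqP => /dot_eq0 /eqP; rewrite (negbTE b0).
have aa : dot a a != 0 by apply/eqP => /dot_eq0 /eqP; rewrite (negbTE a0).
have rf : row_free (col_mx a b).
 apply: row_free_kernel => v; rewrite -(hsubmxK v); move: (lsubmx v) (rsubmx v) => x y.
 rewrite mul_row_col => E.
 have E0 w : dot (x *m a) w + dot (y *m b) w = 0 by rewrite -dotDl E /dot mul0mx mxE.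
 have xa w : dot (x *m a) w = x 0 0 * dot a w.
  by rewrite (mx11_scalar x) mul_scalar_mx dotZl !mxE eqxx mulr1n.
 have yb w : dot (y *m b) w = y 0 0 * dot b w.
  by rewrite (mx11_scalar y) mul_scalar_mx dotZl !mxE eqxx mulr1n.
 have := E0 a; have := E0 b; rewrite !xa !yb ab dotC ab !mulr0 add0r addr0 => /eqP.
 rewrite mulf_eq0 (negbTE bb) orbF => /eqP y0 /eqP; rewrite mulf_eq0 (negbTE aa) orbF => /eqP x0.
 by rewrite (mx11_scalar x) (mx11_scalar y) x0 y0 raddf0 row_mx0.
have : (\rank (col_mx a b) <= \rank A)%N by apply: mxrankS; rewrite col_mx_sub aA.
by rewrite (eqP rf).
Qed.

End Orthogonal.

(** * Consequences of the vanishing of the covariant derivative of B *)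

Section Parallel.
Variables (R : realType) (m : nat) (M : manifold R m) (psi N : M -> 'rV[R]_m.+1).
Hypothesis imm : immersion psi.
Hypothesis N_normal : unit_normal psi N.
Hypothesis M_conn : connected [set: M].
Variable c : R.
Hypothesis soliton : soliton_for c psi.
Hypothesis c_lt0 : c < 0.
Notation d := (dsf imm).
Notation s := (support_fn imm N_normal).
Notation x := (xs imm).
Notation nn := (ns N_normal).
Notation S i j := (d i (nn j)).
Variable r : sfun M.
Hypothesis rs : r * s = 1.
Notation B := (BB imm N_normal r).
Hypothesis E0 : forall i j k, EE imm N_normal r i j k = 0.

Definition Bm p : 'M[R]_m.+1 := \matrix_(i, j) B i j p.

Lemma sBE i j : s * B i j = S i j.
Proof. exact: sB. Qed.

Lemma Bm_sym p : (Bm p)^T = Bm p.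
Proof. by apply/matrixP => i j; rewrite !mxE /BB (S_symm imm N_normal). Qed.

Lemma N_Bm p : N p *m Bm p = 0.
Proof.
apply/rowP => j; rewrite [RHS]mxE mxE.
have := congr1 (fun f : sfun M => f p) (NB (Nd0 imm N_normal) r j).
rewrite /= sf_sum => H; rewrite -[RHS]H; apply: eq_bigr => i _.
by rewrite [Bm _ _ _]mxE.
Qed.

Lemma tr_Bm p : \tr (Bm p) = - c.
Proof.
have := congr1 (fun f : sfun M => f p) (trace_BB soliton rs).
rewrite /= sf_sum => H; rewrite -[RHS]H; apply: eq_bigr => i _.
by rewrite [Bm _ _ _]mxE.
Qed.

Lemma d_BB i j k : d i (B j k) = - (nn k * SB imm N_normal r i j) - nn j * SB imm N_normal r i k.
Proof. by have := E0 i j k; rewrite /EE => /eqP; rewrite -addrA addr_eq0 opprD => /eqP. Qed.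

Lemma codazzi_parallel i j k : d i s * B j k = d j s * B i k.
Proof.
have := codazzi (dsfM imm) (S_symm imm N_normal) (d_commutator imm N_normal) rs i j k.
have e1 := E0 i j k; have e2 := E0 j i k.
by rewrite -/(EE imm N_normal r i j k) -/(EE imm N_normal r j i k) e1 e2 !mulr0 !addr0.
Qed.

Lemma d_sE k p : d k s p = s p * \sum_l psi p 0 l * Bm p k l.
Proof.
have := congr1 (fun f : sfun M => f p) (ds (dsfD imm) (dsfM imm) (sum_NN N_normal) (dx_proj imm N_normal) k).
rewrite /= sf_sum => H; apply: (etrans H); rewrite mulr_sumr; apply: eq_bigr => l _.
rewrite mxE mulrCA; have := congr1 (fun f : sfun M => f p) (sBE k l) => H2.
by apply: (congr1 (fun z => psi p 0 l * z)); exact: esym H2.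
Qed.

(* Since [EE = 0], the functions [<v, N>] and [v B] solve a linear system. *)
Lemma kernel_parallel (v : 'rV[R]_m.+1) o : dot v (N o) = 0 -> v *m Bm o = 0 ->
 forall p, dot v (N p) = 0 /\ v *m Bm p = 0.
Proof.
move=> vN vB.
pose u (a : 'I_m.+1 + unit) : sfun M := if a is inl k then \sum_j kst M (v 0 j) * B j k
 else \sum_j kst M (v 0 j) * nn j.
pose L i (a b : 'I_m.+1 + unit) : sfun M := match a, b with
 | inl k, inl l => - (nn k * S i l)
 | inl k, inr _ => - SB imm N_normal r i k
 | inr _, inl k => (k == i)%:R * s
 | inr _, inr _ => 0 end.
have ku k p : u (inl k) p = (v *m Bm p) 0 k.
 by rewrite sf_sum mxE; apply: eq_bigr => j _; rewrite [Bm _ _ _]mxE.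
have kN p : u (inr tt) p = dot v (N p).
 by rewrite sf_sum dotE; apply: eq_bigr => j _.
suff H : forall a p, u a p = 0.
 by move=> p; split; [rewrite -kN|apply/rowP => k; rewrite -ku [RHS]mxE].
have Bsym i j : B i j = B j i by rewrite /BB (S_symm imm N_normal).
have lin k (F : 'I_m.+1 -> sfun M) : d k (\sum_j kst M (v 0 j) * F j) = \sum_j kst M (v 0 j) * d k (F j).
 by rewrite (d_sum (dsfD imm)); apply: eq_bigr => j _; rewrite dsfM dsf_cst mulr0 addr0.
have ud k a : d k (u a) = \sum_b L k a b * u b.
 rewrite big_sumType /=.
 case: a => [l|[]]; rewrite /u /L lin.
  transitivity (- (\sum_j kst M (v 0 j) * (nn l * SB imm N_normal r k j))
   - \sum_j kst M (v 0 j) * (nn j * SB imm N_normal r k l)).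
   by rewrite -sumrN -sumrB; apply: eq_bigr => j _; rewrite d_BB mulrBr mulrN.
  have -> : \sum_(a : unit) - SB imm N_normal r k l * \sum_j kst M (v 0 j) * nn j =
   - SB imm N_normal r k l * \sum_j kst M (v 0 j) * nn j.
   by rewrite sumr_const card_unit mulr1n.
  congr (_ + _).
   transitivity (- (nn l * \sum_j kst M (v 0 j) * SB imm N_normal r k j)).
    by congr (- _); rewrite mulr_sumr; apply: eq_bigr => j _; rewrite mulrCA.
   under [RHS]eq_bigr do rewrite mulNr -mulrA.
   rewrite sumrN -mulr_sumr; congr (- (_ * _)).
   transitivity (\sum_j \sum_a S k a * (kst M (v 0 j) * B j a)).
    apply: eq_bigr => j _; rewrite mulr_sumr; apply: eq_bigr => a _.
    by rewrite mulrCA (Bsym a j).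
   by rewrite exchange_big; apply: eq_bigr => a _; rewrite mulr_sumr.
  rewrite mulNr mulr_sumr; congr (- _); apply: eq_bigr => j _.
  by rewrite mulrA mulrC.
 rewrite [X in _ = _ + X]big1 ?addr0; last by move=> _ _; rewrite mul0r.
 rewrite [RHS](bigD1 k)//= eqxx mul1r [X in _ = _ + X]big1 ?addr0.
  by rewrite mulr_sumr; apply: eq_bigr => j _; rewrite -sBE mulrCA (Bsym k j).
 by move=> i /negPf ->; rewrite !mul0r.
apply: (linear_system0 imm (u := fun a => u a : M -> R) (L := fun i a b => L i a b : M -> R) (o := o) M_conn).
- by move=> i; exact: sfP.
- by move=> k i j; exact: (CM_continuous (sfP (L k i j) 0)).
- by move=> k i q; rewrite -dsfE ud sf_sum.
- by case=> [k|[]]; rewrite ?ku ?vB ?mxE// kN.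
Qed.

Lemma tangent_curve p (xi : 'rV[R]_m.+1) : dot xi (N p) = 0 ->
 exists g : R -> M, [/\ C1_curve g, g 0 = p & vel psi g 0 = xi].
Proof.
move=> /dot0P xN; have at_ := chart_at_atlas p; have Dp := chart_at_dom p.
have [g [gC g0 gv]] := slope_curve imm p (xi *m Emx psi (chart_at p) (cmap (chart_at p) p)).
exists g; split=> //; rewrite gv -mulmxA (chart_proj imm N_normal at_ Dp).
by rewrite mulmxBr mulmx1 mulmxA xN mul0mx subr0.
Qed.

(** A first-order substitute for a flow: a short move along a curve with initial velocity [xi],
    controlling at once the displacement in space and the distance travelled in [M]. *)
Lemma advance p (xi : 'rV[R]_m.+1) (v e h0 : R) : dot xi (N p) = 0 -> enorm xi < v -> 0 < e -> 0 < h0 ->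
 exists q (h : R), [/\ 0 < h, h < h0, (rdist psi p q < (v * h)%R%:E)%E &
  enorm (psi q - (psi p + h *: xi)) <= e * h].
Proof.
move=> xN xv e0 h00; have [g [gC g0 gv]] := tangent_curve xN.
have [|r1 r10 H1] := curve_rdist imm gC (v := v); first by rewrite gv.
have [r2 r20 H2] := curve_psi_eps imm gC e0.
have m0 : 0 < Num.min (Num.min r1 r2) h0 by rewrite !lt_min r10 r20.
pose h := Num.min (Num.min r1 r2) h0 / 2.
have hp : 0 < h by rewrite divr_gt0.
have hm : h < Num.min (Num.min r1 r2) h0 by rewrite ltr_pdivrMr// ltr_pMr// ltr1n.
move: (hm); rewrite !lt_min => /andP[/andP[hr1 hr2] hh].
exists (g h), h; split=> //; first by rewrite -{1}g0; exact: H1.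
by have := H2 h hp hr2; rewrite g0 gv.
Qed.

End Parallel.

(** * Great circles *)

Section Circle.
Variables (R : realType) (k : nat).
Implicit Types u v w : 'rV[R]_k.

Lemma enorm_dist u v : `|enorm u - enorm v| <= enorm (u - v).
Proof.
rewrite ler_norml; apply/andP; split.
 by rewrite lerNl opprB lerBlDr -[enorm (u - v)]enormN opprB -{1}(subrK u v) enormD.
by rewrite lerBlDr -{1}(subrK v u) enormD.
Qed.

Lemma enorm_gt0 u : u != 0 -> 0 < enorm u.
Proof. by move=> u0; rewrite lt_def enorm_ge0 andbT; apply: contra u0 => /eqP/enorm_eq0 ->. Qed.

Lemma orthogonal_vector w : (1 < k)%N -> exists2 u, u != 0 & dot u w = 0.
Proof.
move=> k1; have : kermx w^T != 0.
 rewrite -mxrank_eq0 mxrank_ker mxrank_tr subn_eq0 -ltnNge.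
 exact: leq_ltn_trans (rank_leq_row w) k1.
by move=> /rowV0Pn[u /sub_kermxP uw u0]; exists u => //; exact/dot0P.
Qed.

(** [w1] is the normalized part of [w] orthogonal to [w0]. When [w] is a multiple of [w0] any
    orthogonal vector serves, and this is where the dimension must exceed 1. *)
Lemma circle_through (rr : R) w0 w : (1 < k)%N -> 0 < rr -> enorm w0 = rr -> enorm w = rr ->
 exists w1 (t : R), [/\ enorm w1 = rr, dot w0 w1 = 0 & w = cos t *: w0 + sin t *: w1].
Proof.
move=> k1 r0 e0 e1; have rr0 : rr != 0 by exact: lt0r_neq0.
have d0 : dot w0 w0 = rr ^+ 2 by rewrite -sqr_enorm e0.
have d1 : dot w w = rr ^+ 2 by rewrite -sqr_enorm e1.
pose a := dot w w0 / rr ^+ 2.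
have r20 : 0 < rr ^+ 2 by rewrite exprn_gt0.
have a1 : -1 <= a <= 1.
 rewrite -ler_norml normrM normfV [`|rr ^+ 2|]gtr0_norm// ler_pdivrMr// mul1r.
 by apply: le_trans (dot_CS _ _) _; rewrite e0 e1.
have ca : cos (acos a) = a by exact: (acos_def a1).2.
have sa := sin_acos a1.
have a2 : 0 <= 1 - a ^+ 2.
 have /andP[h1 h2] := a1; have -> : 1 - a ^+ 2 = (1 - a) * (1 + a) by ring.
 by rewrite mulr_ge0//; lra.
pose z := w - a *: w0.
have zw : dot z w0 = 0 by rewrite dotDl dotNl dotZl d0 divfK ?subrr// gt_eqF.
have zz : dot z z = rr ^+ 2 * (1 - a ^+ 2).
 have -> : dot z z = dot z w by rewrite {2}/z dotDr dotNr dotZr zw mulr0 subr0.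
 rewrite /z dotDl dotNl dotZl d1 dotC; have -> : dot w w0 = a * rr ^+ 2 by rewrite divfK// gt_eqF.
 ring.
have wz : w = a *: w0 + z by rewrite addrC subrK.
have [z0|z0] := eqVneq z 0.
 have [u u0 uw] := orthogonal_vector w0 k1.
 have nu := enorm_gt0 u0.
 exists ((rr / enorm u) *: u), (acos a); split.
 - by rewrite enormZ ger0_norm ?divfK ?gt_eqF// divr_ge0// ltW.
 - by rewrite dotZr dotC uw mulr0.
 have s0 : sin (acos a) = 0.
  have : rr ^+ 2 * (1 - a ^+ 2) = 0 by rewrite -zz z0 /dot mul0mx mxE.
  by move/eqP; rewrite mulf_eq0 gt_eqF//= => /eqP h; rewrite sa h sqrtr0.
 by rewrite ca s0 scale0r addr0 {1}wz z0 addr0.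
have s0 : 0 < sin (acos a).
 rewrite sa sqrtr_gt0 lt_def a2 andbT; apply: contra z0 => /eqP h.
 by apply/eqP/dot_eq0; rewrite zz h mulr0.
exists ((sin (acos a))^-1 *: z), (acos a); split.
- rewrite enormZ ger0_norm ?invr_ge0 ?ltW// /enorm zz sqrtrM ?ltW// sqrtr_sqr gtr0_norm// -sa.
 by rewrite mulrCA mulVf ?mulr1// gt_eqF.
- by rewrite dotZr dotC zw mulr0.
by rewrite ca scalerA divff ?gt_eqF// scale1r.
Qed.

Variables (rr : R) (w0 w1 : 'rV[R]_k).
Hypothesis r0 : 0 < rr.
Hypothesis e0 : enorm w0 = rr.
Hypothesis e1 : enorm w1 = rr.
Hypothesis o01 : dot w0 w1 = 0.
Definition circ t := cos t *: w0 + sin t *: w1.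
Definition dcirc t := - sin t *: w0 + cos t *: w1.

Let d0 : dot w0 w0 = rr ^+ 2. Proof. by rewrite -sqr_enorm e0. Qed.
Let d1 : dot w1 w1 = rr ^+ 2. Proof. by rewrite -sqr_enorm e1. Qed.

Lemma dot_comb a b a' b' : dot (a *: w0 + b *: w1) (a' *: w0 + b' *: w1) = (a * a' + b * b') * rr ^+ 2.
Proof. rewrite dotDl !dotDr !dotZl !dotZr (dotC w1 w0) o01 d0 d1; ring. Qed.

Lemma circ_norm t : dot (circ t) (circ t) = rr ^+ 2.
Proof. by rewrite dot_comb -!expr2 cos2Dsin2 mul1r. Qed.

Lemma dcirc_circ t : dot (dcirc t) (circ t) = 0.
Proof. by rewrite dot_comb mulNr [sin t * _]mulrC addNr mul0r. Qed.

Lemma dcirc_norm t : enorm (dcirc t) = rr.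
Proof.
by rewrite /enorm dot_comb mulrNN -!expr2 addrC cos2Dsin2 mul1r sqrtr_sqr gtr0_norm.
Qed.

Lemma comb_le a b : enorm (a *: w0 + b *: w1) <= (`|a| + `|b|) * rr.
Proof. by apply: le_trans (enormD _ _) _; rewrite !enormZ e0 e1 mulrDl. Qed.

Lemma trig_lip (f df : R -> R) : (forall t, is_derive t (1 : R) f (df t)) -> (forall t, `|df t| <= 1) ->
 forall t t', `|f t - f t'| <= `|t - t'|.
Proof.
move=> fd f1; suff H t t' : t <= t' -> `|f t - f t'| <= `|t - t'|.
 by move=> t t'; have [/H//|/ltW/H] := leP t t'; rewrite distrC (distrC t').
move=> tt; have [] := @MVT_segment R f df t t' tt.
- by apply: continuous_subspaceT => y; apply: differentiable_continuous; apply/derivable1_diffP; have [] := fd y.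
by move=> y _ E; rewrite distrC E normrM (distrC t) ler_piMl.
Qed.

Lemma cos_le t : `|cos t| <= 1 :> R. Proof. by rewrite ler_norml cos_le1 cos_geN1. Qed.
Lemma sin_le t : `|sin t| <= 1 :> R. Proof. by rewrite ler_norml sin_le1 sin_geN1. Qed.

Lemma cos_lip t t' : `|cos t - cos t'| <= `|t - t'| :> R.
Proof. by apply: (trig_lip (@is_derive_cos R)) => y; rewrite normrN sin_le. Qed.

Lemma sin_lip t t' : `|sin t - sin t'| <= `|t - t'| :> R.
Proof. by apply: (trig_lip (@is_derive_sin R)) => y; exact: cos_le. Qed.

Lemma circ_lip t t' : enorm (circ t - circ t') <= 2 * rr * `|t - t'|.
Proof.
have -> : circ t - circ t' = (cos t - cos t') *: w0 + (sin t - sin t') *: w1.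
 by rewrite /circ opprD addrACA !scalerBl.
apply: le_trans (comb_le _ _) _; have := cos_lip t t'; have := sin_lip t t' => h1 h2.
rewrite mulrAC mulr_natl ler_pM2r// mulr2n; exact: lerD.
Qed.

Lemma circ_diff t e : 0 < e -> exists2 r : R, 0 < r & forall h : R, `|h| < r ->
 enorm (circ (t + h) - (circ t + h *: dcirc t)) <= e * `|h|.
Proof.
move=> ep; have e2 : 0 < e / (2 * rr) by rewrite divr_gt0// mulr_gt0.
have [r1 r10 H1] := deriv_eps (is_derive_cos t) e2.
have [r2 r20 H2] := deriv_eps (is_derive_sin t) e2.
exists (Num.min r1 r2); first by rewrite lt_min r10.
move=> h; rewrite lt_min => /andP[/H1 h1 /H2 h2].
have -> : circ (t + h) - (circ t + h *: dcirc t) =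
 (cos (t + h) - cos t - - sin t * h) *: w0 + (sin (t + h) - sin t - cos t * h) *: w1.
 by rewrite /circ /dcirc; apply/rowP => i; rewrite !mxE; ring.
apply: le_trans (comb_le _ _) _.
have -> : e * `|h| = (e / (2 * rr) * `|h| + e / (2 * rr) * `|h|) * rr by field; exact: lt0r_neq0.
by rewrite ler_pM2r//; exact: lerD.
Qed.

End Circle.

Lemma ler_of_sqr (R : realFieldType) (a b : R) : 0 <= b -> a ^+ 2 <= b ^+ 2 -> a <= b.
Proof.
move=> b0 h; rewrite leNgt; apply/negP => ba.
have : 0 < (a - b) * (a + b) by rewrite mulr_gt0//; lra.
by rewrite mulrDr !mulrBl -!expr2; move: h; lra.
Qed.

(** * Arithmetic of the descent steps *)

Section DescentArithmetic.
Variable R : realFieldType.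
Implicit Types K e h Y T V D de rr aa : R.

(** The left side is [|Z - h a|^2] for a chord [Z] of length [de] and its tangential part [a], for
    which [|a|^2 = <a, Z> = aa]. A move by [h a] shortens the chord at least by the factor
    [1 - h / 2]. *)
Lemma chord_step de h aa : 0 < h -> h < 1 / 2 -> 3 / 4 * de ^+ 2 <= aa ->
 de ^+ 2 - 2 * h * aa + h ^+ 2 * aa <= (de * (1 - h / 2)) ^+ 2.
Proof.
move=> h0 h1 ha; have h2 : 0 <= h * (2 - h) by apply: mulr_ge0; [exact: ltW|lra].
have := ler_wpM2l h2 ha; have : 0 <= de ^+ 2 * (h * (1 / 2 - h / 2)).
 by apply: mulr_ge0; [exact: sqr_ge0|apply: mulr_ge0; [exact: ltW|lra]].
by rewrite !expr2; lra.
Qed.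

Lemma chord_dec K de h Y T V V' : 1 <= K -> 0 <= de * h -> Y <= de * (1 - h / 2) + de / 8 * h ->
 V' <= V + de / 8 * h -> h * de / 4 <= K * de + T + V - (K * Y + T + V').
Proof.
move=> K1 dh hY hV; have K0 : 0 <= K by lra.
have := ler_wpM2l K0 hY; have : 0 <= (K - 1) * (de * h) by rewrite mulr_ge0// subr_ge0.
lra.
Qed.

Lemma flat_dec K de e h Y T V : 0 <= K -> Y <= e * h -> V <= (1 - h) * de + e * h ->
 e * (K + 1) = de / 2 -> h * de / 2 <= K * 0 + T + de - (K * Y + T + V).
Proof.
move=> K0 /(ler_wpM2l K0) hY hV eK.
have : K * (e * h) + e * h = h * de / 2 by transitivity (h * (e * (K + 1))); [ring|rewrite eK mulrA].
lra.
Qed.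

Lemma shift_dec K e h Y V D : 0 <= K -> Y <= 2 * e * h -> V <= e * h ->
 e * (2 * K + 1) = 1 / 2 -> h / 2 <= D - (K * Y + (D - h) + V).
Proof.
move=> K0 /(ler_wpM2l K0) hY hV eK.
have : K * (2 * e * h) + e * h = h / 2 by transitivity (h * (e * (2 * K + 1))); [ring|rewrite eK mul1r].
lra.
Qed.

(** For a chord of length [de] between points of a sphere of radius [rr], the inner product with the
    radius is [- de ^+ 2 / 2]; projecting it off removes at most a quarter of the squared length
    when [de <= rr]. *)
Lemma chord_proj_bounds de rr : 0 < de -> 0 < rr -> de <= rr ->
 let aa := de ^+ 2 - (de ^+ 2 / 2) ^+ 2 / rr ^+ 2 in 3 / 4 * de ^+ 2 <= aa /\ aa <= de ^+ 2.
Proof.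
move=> d0 r0 dr aa; have d2 : 0 < de ^+ 2 by rewrite exprn_gt0.
have dr2 : de ^+ 2 <= rr ^+ 2 by rewrite !expr2; exact: (ler_pM (ltW d0) (ltW d0) dr dr).
have r2 : 0 < rr ^+ 2 by rewrite exprn_gt0.
have q1 : (de ^+ 2 / 2) ^+ 2 / rr ^+ 2 <= de ^+ 2 / 4.
 rewrite ler_pdivrMr//; have := dr2; rewrite -(ler_pM2l d2).
 by rewrite exprMn; move: (de ^+ 2) (rr ^+ 2) => a b; rewrite !expr2; lra.
split; rewrite /aa; last by rewrite gerBl divr_ge0 ?sqr_ge0.
by move: q1; lra.
Qed.

Lemma one_sub_half_ge0 h : h < 1 / 2 -> 0 <= 1 - h / 2.
Proof. lra. Qed.

Lemma step_rate (L h de x : R) (Kd : R) : 0 <= h * de -> L <= Kd / x -> 0 < x -> L * de * h <= Kd * (h * de / x).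
Proof.
move=> hd LK x0; have := ler_wpM2r hd LK; have -> : Kd / x * (h * de) = Kd * (h * de / x) by field; exact: lt0r_neq0.
by have -> : L * de * h = L * (h * de) by ring.
Qed.

Lemma shift_rate rr h : 0 < h -> 0 < rr -> (rr + 1) * h <= (2 * rr + 10) * (h / 2) /\ h < (2 * rr + 10) * (h / 2).
Proof.
move=> h0 r0; have -> : (2 * rr + 10) * (h / 2) = (rr + 5) * h by field.
by rewrite ler_pM2r// ltr_pMl//; split; lra.
Qed.

Lemma rate_ge rr : 0 < rr -> 2 <= (2 * rr + 10) / 4 /\ 2 <= (2 * rr + 10) / 2.
Proof. by move=> r0; split; lra. Qed.

Lemma flat_eps K de : 0 < K -> de / (2 * (K + 1)) * (K + 1) = de / 2.
Proof. by move=> K0; field; apply: lt0r_neq0; lra. Qed.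

Lemma shift_eps K : 0 < K -> (2 * (2 * K + 1))^-1 * (2 * K + 1) = 1 / 2.
Proof. by move=> K0; field; apply: lt0r_neq0; lra. Qed.

Lemma half_eq D a b : a = b - D *+ 2 - b -> D = - a / 2.
Proof. by rewrite mulr2n; lra. Qed.

End DescentArithmetic.

Section VectorIdentities.
Variables (R : realType) (k : nat).
Implicit Types a b u v w : 'rV[R]_k.

Lemma subBB u v w : u - v - (u - w) = - (v - w).
Proof. by apply/rowP => i; rewrite !mxE; ring. Qed.

Lemma sub_approx u v w a h : u - w = (u - v - h *: a) - (w - (v + h *: a)).
Proof. by apply/rowP => i; rewrite !mxE; ring. Qed.

Lemma sub_approx_self u v w h : u - w = (1 - h) *: (u - v) - (w - (v + h *: (u - v))).
Proof. by apply/rowP => i; rewrite !mxE; ring. Qed.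

Lemma sub_approx2 u v w a h e : u - w = (u - (v + (e * h) *: a)) - (w - (v + h *: (e *: a))).
Proof. by apply/rowP => i; rewrite !mxE; ring. Qed.

Lemma dot_sub u v : dot (u - v) (u - v) = dot u u - dot (u - v) v *+ 2 - dot v v.
Proof. rewrite !dotDl !dotDr !dotNl !dotNr (dotC v); ring. Qed.

Lemma dot_subZ u a h : dot (u - h *: a) (u - h *: a) = dot u u - 2 * h * dot a u + h ^+ 2 * dot a a.
Proof. rewrite !dotDl !dotDr !dotNl !dotNr !dotZl !dotZr (dotC u); ring. Qed.

End VectorIdentities.

(** * Constant support function: spheres and their products *)

Section CaseA.
Variables (R : realType) (m : nat) (M : manifold R m) (psi N : M -> 'rV[R]_m.+1).
Hypothesis imm : immersion psi.
Hypothesis N_normal : unit_normal psi N.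
Hypothesis M_conn : connected [set: M].
Hypothesis M_complete : complete_immersion psi.
Variable c : R.
Hypothesis soliton : soliton_for c psi.
Hypothesis c_lt0 : c < 0.
Notation d := (dsf imm).
Notation s := (support_fn imm N_normal).
Variable r : sfun M.
Hypothesis rs : r * s = 1.
Hypothesis E0 : forall i j k, EE imm N_normal r i j k = 0.
Notation Bm := (Bm imm N_normal r).

Lemma kernel_all l (Q : 'M[R]_(l, m.+1)) o : N o *m Q^T = 0 -> Q *m Bm o = 0 ->
 forall p, N p *m Q^T = 0 /\ Q *m Bm p = 0.
Proof.
move=> NQ QB p.
have H i : dot (row i Q) (N p) = 0 /\ row i Q *m Bm p = 0.
 apply: (kernel_parallel M_conn rs E0 (o := o)); last by rewrite -row_mul QB row0.
 rewrite dotC; apply/dot0P/rowP => j; have /rowP/(_ i) := NQ; rewrite !mxE => h.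
 by rewrite -[RHS]h; apply: eq_bigr => b _; rewrite !mxE.
split.
 apply/rowP => i; have := (H i).1; rewrite dotC => /dot0P/rowP/(_ 0); rewrite !mxE => h.
 by rewrite -[RHS]h; apply: eq_bigr => b _; rewrite !mxE.
by apply/row_matrixP => i; rewrite row_mul (H i).2 row0.
Qed.

Hypothesis ds0 : forall k p, d k s p = 0.

Lemma s_const p q : s p = s q.
Proof.
pose u : sfun M := s - kst M (s q).
suff H : u p = 0 by apply/eqP; rewrite -subr_eq0; apply/eqP.
apply: (linear_system0 imm (u := fun _ : unit => u : M -> R) (L := fun _ _ _ => cst 0) (o := q) M_conn) tt p.
- by move=> _; exact: sfP.
- by move=> _ _ _; exact: cst_continuous.
- move=> k _ p; rewrite big1; last by move=> _ _; rewrite mul0r.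
 rewrite -dsfE /u (dB (dsfD imm)) sfB dsf_cst ds0; exact: subr0.
by move=> _; exact: subrr.
Qed.

Lemma psi_Bm p : psi p *m Bm p = 0.
Proof.
rewrite -(Bm_sym imm N_normal r p); apply/rowP => k; rewrite [RHS]mxE mxE.
have := ds0 k p; rewrite (d_sE rs) => /eqP; rewrite mulf_eq0 (negbTE (s_neq0 rs p)) /= => /eqP h.
by rewrite -[RHS]h; apply: eq_bigr => l _; rewrite [_^T _ _]mxE.
Qed.

(** Splitting the space along the span of [N o] and the range of [Bm o], the component [y] of [psi]
    is [s N], hence of constant length, and the component [z] is unrestricted. That all pairs occur
    is shown by descent towards a prescribed pair. *)
Lemma constant_support : (exists (a : 'rV[R]_m.+1) (r : R), 0 < r /\ range psi = sphere a r) \/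
 (exists (k l : nat) (a : 'rV[R]_k.+1) (r : R),
  [/\ (0 < k)%N, (0 < l)%N, 0 < r &
   is_product (range psi) (sphere a r) [set: 'rV[R]_l]]).
Proof.
pose o : M := point.
have N1 p : enorm (N p) = 1 by case: N_normal => _ /(_ p)[].
(* The trace of [Bm o] is nonzero, so its range contains a nonzero vector orthogonal to [N o]; thus
   the rank is at least 2 and the sphere has positive dimension. *)
pose A := col_mx (Bm o) (N o).
have BA : (Bm o <= A)%MS by rewrite -addsmxE addsmxSl.
have NA : (N o <= A)%MS by rewrite -addsmxE addsmxSr.
have rA : (1 < \rank A)%N.
 have /rowV0Pn[b bB b0] : Bm o != 0.
  apply/eqP => B0; have := tr_Bm soliton rs o.
  by rewrite B0 mxtrace0 => /eqP; rewrite eq_sym oppr_eq0 lt_eqF.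
 apply: (rank_pair (submx_trans bB BA) NA b0).
  by apply/eqP => N0; have := N1 o; rewrite N0 enorm0 => /eqP; rewrite eq_sym oner_eq0.
 have /submxP[X ->] := bB; apply/dot0P; rewrite -mulmxA -[X in _ *m X]trmxK trmx_mul trmxK.
 by rewrite (Bm_sym imm N_normal) (N_Bm imm N_normal) trmx0 mulmx0.
have kl : (\rank A + (m.+1 - \rank A))%N = m.+1 by rewrite subnKC// rank_leq_col.
move: rA kl; move ek : (\rank A) => k; move: (m.+1 - k)%N => l k1 kl.
have [P [Q [PP QQ PQ PQ1 [[X PX] AQ]]]] := orth_split ek kl.
have QP : Q *m P^T = 0 by rewrite -[LHS]trmxK trmx_mul trmxK PQ trmx0.
have [BQ NQ] : Bm o *m Q^T = 0 /\ N o *m Q^T = 0.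
 by move: AQ; rewrite /A mul_col_mx => h; split;
  [rewrite -[LHS](col_mxKu _ (N o *m Q^T))|rewrite -[LHS](col_mxKd (Bm o *m Q^T))]; rewrite h ?linear0.
have QB : Q *m Bm o = 0 by rewrite -[LHS]trmxK trmx_mul (Bm_sym imm N_normal) BQ trmx0.
have KA := kernel_all NQ QB.
pose y p := psi p *m P^T; pose z p := psi p *m Q^T; pose rr : R := `|s o|.
have rr0 : 0 < rr by rewrite normr_gt0; exact: s_neq0 rs o.
(* As [s] is constant, [psi p] is killed by [Bm p]; then [psi p - s p *: N p] is orthogonal to [N]
   and in the kernel of [B], first at [p] and by [kernel_parallel] at [o], so it has no component
   along [P]. *)
have ysN p : y p = s p *: (N p *m P^T).
 apply/eqP; rewrite -subr_eq0 /y scalemxAl -mulmxBl; apply/eqP.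
 set v := psi p - _.
 have [vN vB] : dot v (N o) = 0 /\ v *m Bm o = 0.
  apply: (kernel_parallel M_conn rs E0 (o := p)).
   rewrite /v dotDl dotNl dotZl -sqr_enorm N1 expr1n mulr1 -(support_fnE imm N_normal).
   exact: subrr.
  by rewrite /v mulmxBl psi_Bm -scalemxAl (N_Bm imm N_normal) scaler0 subrr.
 have : A *m v^T = 0.
  rewrite /A mul_col_mx -[Bm o]trmxK -trmx_mul (Bm_sym imm N_normal) vB trmx0.
  by move/dot0P: vN => vN; rewrite -[N o]trmxK -trmx_mul vN trmx0 col_mx0.
 by move=> Av; rewrite -[LHS]trmxK trmx_mul trmxK PX -mulmxA Av mulmx0 trmx0.
have NP p : N p = N p *m P^T *m P.
 by rewrite -{1}[N p]mulmx1 -PQ1 mulmxDr !mulmxA (KA p).1 mul0mx addr0.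
have NP1 p : enorm (N p *m P^T) = 1 by rewrite -(enorm_orth _ PP) -NP.
have yn p : enorm (y p) = rr by rewrite ysN enormZ NP1 mulr1 (s_const p o).
have ydot p : dot (y p) (y p) = rr ^+ 2 by rewrite -sqr_enorm yn.
have tang p a b : dot a (y p) = 0 -> dot (a *m P + b *m Q) (N p) = 0.
 move=> ay; rewrite dotDl !dot_mulmx_tr (KA p).1 /dot trmx0 mulmx0 [X in _ + X]mxE addr0.
 move: ay; rewrite ysN dotZr => /eqP; rewrite mulf_eq0 (negbTE (s_neq0 rs p)) /=.
 by move/eqP.
have adv p a b v e h0 : dot a (y p) = 0 -> enorm a + enorm b < v -> 0 < e -> 0 < h0 ->
 exists q (h : R), [/\ 0 < h, h < h0, (rdist psi p q < (v * h)%R%:E)%E &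
  enorm (y q - (y p + h *: a)) <= e * h /\ enorm (z q - (z p + h *: b)) <= e * h].
 move=> ay abv ep h0p; have [|q [h [hp hh dq nq]]] := advance imm N_normal (tang p a b ay) (v := v) _ ep h0p.
  by apply: le_lt_trans abv; apply: le_trans (enormD _ _) _; rewrite !enorm_orth.
 exists q, h; split=> //; split; apply: le_trans nq.
  have -> : y q - (y p + h *: a) = (psi q - (psi p + h *: (a *m P + b *m Q))) *m P^T.
   rewrite mulmxBl !mulmxDl -scalemxAl mulmxDl -!mulmxA PP QP mulmx1 mulmx0 addr0.
   by [].
  exact: enorm_le_orth.
 have -> : z q - (z p + h *: b) = (psi q - (psi p + h *: (a *m P + b *m Q))) *m Q^T.
  rewrite mulmxBl !mulmxDl -scalemxAl mulmxDl -!mulmxA QQ PQ mulmx1 mulmx0 add0r.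
  by [].
 exact: enorm_le_orth.
have onto w v : enorm w = rr -> exists p, y p = w /\ z p = v.
 move=> wr; have [w1 [t1 [w1r w01 wE]]] := circle_through k1 rr0 (yn o) wr.
 pose rh := circ (y o) w1.
 pose f0 : R := `|t1| + enorm (v - z o).
 (* This weight makes [f0 < K * rr], so that in the sublevel set of the starting value [y] stays
    within [rr] of the moving target, away from its antipode, where the tangential part of the chord
    would vanish. *)
 pose K : R := f0 / rr + 1.
 have f00 : 0 <= f0 by rewrite addr_ge0// enorm_ge0.
 have K1 : 1 <= K by rewrite lerDr divr_ge0// ltW.
 have K0 : 0 < K by exact: lt_le_trans K1.
 (* The target on the sphere is not fixed: it moves along a great circle from [y o] to [w], with [t]
    as its parameter. *)
 pose f p t := K * enorm (rh t - y p) + `|t1 - t| + enorm (v - z p).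
 pose C : R := K * (2 * rr + 1) + 1 + 1.
 have C0 : 0 <= C by rewrite !addr_ge0// mulr_ge0 ?ltW// addr_gt0// mulr_gt0.
 have dlip p q a : (rdist psi p q < a%:E)%E -> enorm (y p - y q) <= a /\ enorm (z p - z q) <= a.
  move=> /(psi_lip imm) h; split; apply: le_trans h; rewrite -enormN opprB -mulmxBl; exact: enorm_le_orth.
 have f_lip p q t t' a : (rdist psi p q < a%:E)%E -> `|t - t'| < a -> `|f p t - f q t'| <= C * a.
  move=> /dlip[h1 h2] h3.
  have e1 : `|enorm (rh t - y p) - enorm (rh t' - y q)| <= (2 * rr + 1) * a.
   apply: le_trans (enorm_dist _ _) _.
   have -> : rh t - y p - (rh t' - y q) = (rh t - rh t') - (y p - y q) by move: (rh t) (rh t') (y p) (y q) => a1 a2 a3 a4; apply/rowP => i; rewrite !mxE; ring.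
   apply: le_trans (enormD _ _) _; rewrite enormN mulrDl mul1r; apply: lerD h1.
   apply: le_trans (circ_lip rr0 (yn o) w1r _ _) _.
   by rewrite ler_pM2l ?mulr_gt0// ltW.
  have e2 : `| `|t1 - t| - `|t1 - t'| | <= a.
   apply: le_trans (ler_dist_dist _ _) _.
   have -> : t1 - t - (t1 - t') = t' - t by ring.
   by rewrite distrC ltW.
  have e3 : `|enorm (v - z p) - enorm (v - z q)| <= a.
   apply: le_trans (enorm_dist _ _) _.
   by rewrite subBB enormN.
  have -> : f p t - f q t' = K * (enorm (rh t - y p) - enorm (rh t' - y q)) +
   (`|t1 - t| - `|t1 - t'|) + (enorm (v - z p) - enorm (v - z q)) by rewrite /f; ring.
  apply: le_trans (ler_normD _ _) _; apply: le_trans (lerD (ler_normD _ _) (lexx _)) _.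
  rewrite normrM (gtr0_norm K0); have e4 := e1; rewrite -(ler_pM2l K0) in e4.
  apply: le_trans (lerD (lerD e4 e2) e3) _.
  by rewrite le_eqVlt; apply/orP; left; apply/eqP; rewrite /C; ring.
 pose S p t := f p t <= f0.
 have S0 : S o 0.
  by rewrite /S /f /rh /circ cos0 sin0 scale1r scale0r addr0 subrr enorm0 mulr0 add0r subr0.
 have close p t : S p t -> enorm (rh t - y p) <= rr.
  move=> Sp; rewrite leNgt; apply/negP => h.
  have h1 : f0 < K * rr by rewrite /K mulrDl divfK ?gt_eqF// mul1r ltrDl.
  have h2 : K * rr < K * enorm (rh t - y p) by rewrite ltr_pM2l.
  have h3 : K * enorm (rh t - y p) <= f p t.
   by rewrite /f; have := normr_ge0 (t1 - t); have := enorm_ge0 (v - z p); lra.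
  by have := lt_le_trans (lt_trans h1 h2) (le_trans h3 Sp); rewrite ltxx.
 pose Kd : R := 2 * rr + 10.
 have Kd0 : 0 < Kd by rewrite addr_gt0// mulr_gt0.
 have Sd p t q t' : S p t -> f q t' < f p t -> S q t' by move=> Sp fq; exact: le_trans (ltW fq) Sp.
 have [] := descent_MR imm M_complete (S := S) (f := f) (C := C) (K := Kd) C0 (ltW Kd0) _ f_lip _ _ S0.
 - by move=> p t; rewrite /f !addr_ge0 ?enorm_ge0// mulr_ge0 ?enorm_ge0// ltW.
 - move=> p t H; rewrite /S; apply/ler_addgt0Pl => e e0.
  have C1 : 0 < C + 1 by rewrite ltr_wpDl.
  have [q [t' [Sq h1 h2]]] := H (e / (C + 1)) (divr_gt0 e0 C1).
  have := f_lip _ _ _ _ _ h1 h2; rewrite distrC => h3.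
  have h4 : C * (e / (C + 1)) <= e by rewrite mulrCA ger_pMr// ler_pdivrMr// mul1r lerDl.
  have h5 := le_trans (le_trans (ler_norm _) h3) h4.
  by rewrite lerBlDr in h5; apply: le_trans h5 _; rewrite lerD2l.
 - move=> p t Sp fp.
  (* If [y] is off the moving target, [t] is kept and [p] moves along the tangential part of the
     chord. *)
  have [yE|yE] := eqVneq (rh t - y p) 0; last first.
   pose de : R := enorm (rh t - y p); have de0 : 0 < de by exact: enorm_gt0.
   have der := close _ _ Sp; rewrite -/de in der.
   pose Z := rh t - y p; have ZZ : dot Z Z = de ^+ 2 by rewrite -sqr_enorm.
   have Zy : dot Z (y p) = - de ^+ 2 / 2.
    have h1 : dot (rh t) (rh t) = rr ^+ 2 by exact: circ_norm (yn o) w1r w01 t.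
    have : dot Z Z = dot (rh t) (rh t) - dot Z (y p) *+ 2 - dot (y p) (y p) by exact: dot_sub.
    by rewrite ZZ h1 ydot => /half_eq.
   pose a := Z - (dot Z (y p) / rr ^+ 2) *: y p.
   have r2 : rr ^+ 2 != 0 by rewrite expf_neq0// gt_eqF.
   have ay : dot a (y p) = 0 by rewrite /a dotDl dotNl dotZl ydot divfK// subrr.
   have aa : dot a a = de ^+ 2 - (de ^+ 2 / 2) ^+ 2 / rr ^+ 2.
    have -> : dot a a = dot a Z by rewrite {2}/a dotDr dotNr dotZr ay mulr0 subr0.
    by rewrite /a dotDl dotNl dotZl ZZ (dotC (y p)) Zy; field; exact: lt0r_neq0.
   have aZ : dot a Z = dot a a by apply/esym; rewrite {2}/a dotDr dotNr dotZr ay mulr0 subr0.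
   have [] := chord_proj_bounds de0 rr0 der; rewrite -aa => aL aU.
   have an : enorm a <= de by apply: ler_of_sqr (ltW de0) _; rewrite sqr_enorm.
   have ep : 0 < de / 8 by rewrite divr_gt0.
   have av : enorm a + enorm (0 : 'rV[R]_l) < 2 * de by rewrite enorm0 addr0 mulr_natl mulr2n; apply: le_lt_trans an _; rewrite ltrDl.
   have [q [h [h0 h1 dq [ny nz]]]] := adv p a 0 (2 * de) (de / 8) (1 / 2) ay av ep ltac:(by rewrite divr_gt0).
   have yq : enorm (rh t - y q) <= de * (1 - h / 2) + de / 8 * h.
    have -> : rh t - y q = (Z - h *: a) - (y q - (y p + h *: a)) by exact: sub_approx.
    apply: le_trans (enormD _ _) _; rewrite enormN; apply: lerD ny.
    have h2 : 0 <= de * (1 - h / 2).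
     by apply: mulr_ge0; [exact: ltW|exact: one_sub_half_ge0].
    by apply: ler_of_sqr h2 _; rewrite sqr_enorm dot_subZ aZ ZZ; exact: chord_step.
   have zq : enorm (v - z q) <= enorm (v - z p) + de / 8 * h.
    have -> : v - z q = (v - z p) - (z q - (z p + h *: 0)) by rewrite scaler0 addr0 opprB addrA subrK.
    by apply: le_trans (enormD _ _) _; rewrite enormN lerD2l.
   have dec : h * de / 4 <= f p t - f q t.
    by apply: chord_dec => //; exact: mulr_ge0 (ltW de0) (ltW h0).
   exists q, t, (2 * de * h), (h * de / 4); split=> //; last split; last split; last exact: Sd Sp.
   + by rewrite divr_gt0// mulr_gt0.
   + by apply: step_rate; [exact: mulr_ge0 (ltW h0) (ltW de0)|exact: (rate_ge rr0).1|].
   + by rewrite subrr normr0 mulr_gt0// divr_gt0// mulr_gt0.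
  (* If only [z] is wrong, [p] moves in the flat direction. The error in [y] is of order [e * h],
     with [e] so small that [K] times it is outweighed. *)
  have [zE|zE] := eqVneq (v - z p) 0; last first.
   pose de : R := enorm (v - z p); have de0 : 0 < de by exact: enorm_gt0.
   have K2 : 0 < 2 * (K + 1) by rewrite mulr_gt0// addr_gt0.
   have ep : 0 < de / (2 * (K + 1)) by rewrite divr_gt0.
   have av : enorm (0 : 'rV[R]_k) + enorm (v - z p) < 2 * de by rewrite enorm0 add0r mulr_natl mulr2n ltrDl.
   have ay : dot (0 : 'rV[R]_k) (y p) = 0 by rewrite /dot mul0mx mxE.
   have [q [h [h0 h1 dq [ny nz]]]] := adv p 0 (v - z p) (2 * de) _ 1 ay av ep ltr01.
   set e := de / _ in ep ny nz.
   have eK : e * (K + 1) = de / 2 by exact: flat_eps.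
   have yq : enorm (rh t - y q) <= e * h.
    have -> : rh t - y q = - (y q - (y p + h *: 0)).
     by rewrite scaler0 addr0 opprB; congr (_ - _); apply/eqP; rewrite -subr_eq0; apply/eqP.
    by rewrite enormN.
   have zq : enorm (v - z q) <= (1 - h) * de + e * h.
    rewrite (sub_approx_self v (z p) (z q) h).
    apply: le_trans (enormD _ _) _; rewrite enormN enormZ ger0_norm ?lerD2l//.
    by rewrite subr_ge0 ltW.
   have dec : h * de / 2 <= f p t - f q t.
    by rewrite /f yE enorm0; apply: flat_dec eK => //; exact: ltW.
   exists q, t, (2 * de * h), (h * de / 2); split=> //; last split; last split; last exact: Sd Sp.
   + by rewrite divr_gt0// mulr_gt0.
   + by apply: step_rate; [exact: mulr_ge0 (ltW h0) (ltW de0)|exact: (rate_ge rr0).2|].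
   + by rewrite subrr normr0 mulr_gt0// divr_gt0// mulr_gt0.
  (* If only [t] is wrong, the target advances by [h] towards [t1] along the circle, and [p] follows
     with the tangent velocity [dcirc]. *)
  have ft : f p t = `|t1 - t| by rewrite /f yE zE !enorm0 mulr0 add0r addr0.
  have tt : 0 < `|t1 - t| by rewrite -ft.
  pose sg : R := Num.sg (t1 - t).
  have sg1 : `|sg| = 1 by rewrite normr_sg -normr_eq0 gt_eqF.
  have sgE : t1 - t = sg * `|t1 - t| by exact: numEsg.
  have yrh : y p = rh t by apply/eqP; rewrite eq_sym -subr_eq0; apply/eqP.
  pose a := sg *: dcirc (y o) w1 t.
  have ay : dot a (y p) = 0 by rewrite yrh dotZl (dcirc_circ (yn o) w1r w01) mulr0.
  have an : enorm a = rr by rewrite enormZ sg1 mul1r (dcirc_norm rr0 (yn o) w1r w01).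
  pose e : R := (2 * (2 * K + 1))^-1.
  have K2 : 0 < 2 * (2 * K + 1) by rewrite mulr_gt0// addr_gt0// mulr_gt0.
  have ep : 0 < e by rewrite invr_gt0.
  have eK : e * (2 * K + 1) = 1 / 2 by exact: shift_eps.
  have [r1 r10 H1] := circ_diff rr0 (yn o) w1r t ep.
  have m0 : 0 < Num.min r1 `|t1 - t| by rewrite lt_min r10.
  have av : enorm a + enorm (0 : 'rV[R]_l) < rr + 1 by rewrite an enorm0 addr0 ltrDl.
  have [q [h [h0 h1 dq [ny nz]]]] := adv p a 0 (rr + 1) e _ ay av ep m0.
  move: h1; rewrite lt_min => /andP[hr1 ht].
  have hn : `|sg * h| = h by rewrite normrM sg1 mul1r gtr0_norm.
  have yq : enorm (rh (t + sg * h) - y q) <= 2 * e * h.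
   have -> : rh (t + sg * h) - y q = (rh (t + sg * h) - (rh t + (sg * h) *: dcirc (y o) w1 t)) - (y q - (y p + h *: a)).
    by rewrite yrh; exact: sub_approx2.
   apply: le_trans (enormD _ _) _; rewrite enormN -mulrA mulr_natl mulr2n; apply: lerD ny.
   by have := H1 (sg * h); rewrite hn => /(_ hr1).
  have zq : enorm (v - z q) <= e * h.
   have -> : v - z q = (v - z p) - (z q - (z p + h *: 0)) by rewrite scaler0 addr0 opprB addrA subrK.
   by rewrite zE sub0r enormN.
  have tq : `|t1 - (t + sg * h)| = `|t1 - t| - h.
   rewrite opprD addrA {1}sgE -mulrBr normrM sg1 mul1r ger0_norm// subr_ge0; exact: ltW.
  have dec : h / 2 <= f p t - f q (t + sg * h).
   by rewrite ft /f tq; apply: shift_dec eK => //; exact: ltW.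
  exists q, (t + sg * h), ((rr + 1) * h), (h / 2); split=> //; last split; last split; last exact: Sd Sp.
  + by rewrite divr_gt0.
  + exact: (shift_rate h0 rr0).1.
  + rewrite opprD addrA subrr sub0r normrN hn; exact: (shift_rate h0 rr0).2.
 move=> p [t [_ fp]]; exists p.
 have h1 : 0 <= K * enorm (rh t - y p) by rewrite mulr_ge0 ?enorm_ge0// ltW.
 have h2 := normr_ge0 (t1 - t); have h3 := enorm_ge0 (v - z p).
 have tE : t1 = t by apply/eqP; rewrite -subr_eq0 -normr_eq0; apply/eqP; rewrite /f in fp; lra.
 have vE : enorm (v - z p) = 0 by rewrite /f in fp; lra.
 have yE : K * enorm (rh t - y p) = 0 by rewrite /f in fp; lra.
 move/eqP: yE; rewrite mulf_eq0 (gt_eqF K0) /= => /eqP/enorm_eq0/eqP; rewrite subr_eq0 => /eqP yE.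
 split; first by rewrite -yE wE -tE.
 by apply/eqP; rewrite eq_sym -subr_eq0; apply/eqP/enorm_eq0.
have decomp p : psi p = y p *m P + z p *m Q.
 by rewrite /y /z -!mulmxA -mulmxDr PQ1 mulmx1.
(* Without flat directions the image is the sphere itself; otherwise it is a proper product. *)
have [l0|l0] := posnP l.
 left; exists 0, rr; split=> //; apply/seteqP; split=> [_ [p _ <-]|w].
  have z0 : z p = 0 by move: (z p); rewrite l0 => zz; apply/rowP => -[].
  by rewrite /sphere /= subr0 decomp z0 mul0mx addr0 enorm_orth.
 rewrite /sphere /= subr0 => wr.
 have wP : w = (w *m P^T) *m P.
  rewrite -mulmxA -{1}[w]mulmx1 -PQ1 mulmxDr.
  have -> : w *m (Q^T *m Q) = 0.
   by rewrite mulmxA; move: (w *m Q^T) (Q); rewrite l0 => u Q'; apply/rowP => j; rewrite !mxE big_ord0.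
  by rewrite addr0.
 have wn : enorm (w *m P^T) = rr by rewrite -(enorm_orth _ PP) -wP.
 have [p [yp _]] := onto (w *m P^T) 0 wn; exists p => //.
 have z0 : z p = 0 by move: (z p); rewrite l0 => zz; apply/rowP => -[].
 by rewrite decomp yp z0 mul0mx addr0 -wP.
right; case: k k1 kl P Q ek PP QQ PQ PQ1 X PX AQ QP BQ NQ QB KA y z ysN NP NP1 yn ydot tang adv onto decomp => // k k1 kl P Q _ PP QQ PQ _ _ _ _ _ _ _ _ _ y z _ _ _ yn _ _ _ onto decomp.
exists k, l, 0, rr; split=> //; split=> //; exists P, Q; split=> //.
apply/seteqP; split=> [_ [p _ <-]|_ [a [b [an _ ->]]]].
 by exists (y p), (z p); split=> //; rewrite /sphere /= subr0.
have [p [yp zp]] : exists p, y p = a /\ z p = b by apply: onto; rewrite /sphere /= subr0 in an.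
by exists p => //; rewrite decomp yp zp.
Qed.

End CaseA.

(** * Primitives and exponentially weighted bounds *)

Section Primitive.
Variable R : realType.
Implicit Types f g th ph : R -> R.

(** A total choice of primitive vanishing at 0; the value on discontinuous functions is junk. *)
Definition Prim f : R -> R :=
 if pselect (continuous f) is left H then projT1 (cid2 (primitive H)) else f.

Lemma Prim0 f : continuous f -> Prim f 0 = 0.
Proof. by move=> fc; rewrite /Prim; case: pselect => // H; case: cid2. Qed.

Lemma is_derive_Prim f (t : R) : continuous f -> is_derive t (1 : R) (Prim f) (f t).
Proof. by move=> fc; rewrite /Prim; case: pselect => // H; case: cid2. Qed.

Lemma is_derive_continuous f df : (forall t : R, is_derive t (1 : R) f (df t)) -> continuous f.
Proof. by move=> fd t; apply: differentiable_continuous; apply/derivable1_diffP; have [] := fd t. Qed.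

(** Integration gains a factor [1 / L] for the norm weighted by [expR (L * t)]. With [L] large this
    turns Picard iteration into a contraction on intervals of any length. *)
Lemma exp_bound_pos (F f : R -> R) (L M T : R) : 0 <= M -> F 0 = 0 ->
 (forall t : R, is_derive t (1 : R) F (f t)) ->
 (forall s, 0 <= s -> s <= T -> `|f s| <= M * L * expR (L * s)) ->
 forall t, 0 <= t -> t <= T -> `|F t| <= M * expR (L * t).
Proof.
move=> M0 F0 Fd fb t t0 tT.
have key (e : R) : e = 1 \/ e = -1 -> e * F t <= M * expR (L * t).
 move=> e1; pose G (s : R) := M * expR (L * s) - e * F s.
 pose dG (s : R) := M * (expR (L * s) * L) - e * f s.
 have Gd (s : R) : is_derive s (1 : R) G (dG s).
  have h1 : is_derive s (1 : R) (fun s => expR (L * s)) (expR (L * s) * L).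
   exact: is_derive1_comp (is_derive_expR _) (is_derive_mull _ _).
  have h2 := @is_derive1_comp R (fun x => M * x) (fun s => expR (L * s)) s _ _ (is_derive_mull M (expR (L * s))) h1.
  have h3 := @is_derive1_comp R (fun x => e * x) F s _ _ (is_derive_mull e (F s)) (Fd s).
  exact: is_deriveB h2 h3.
 have [x /andP[x0 xt] E] := mvt0 t0 (fun x (_ : 0 <= x <= t) => Gd x).
 have dG0 : 0 <= dG x.
  have := fb x x0 (le_trans xt tT); rewrite ler_norml => /andP[h1 h2].
  by rewrite /dG [expR _ * L]mulrC mulrA; case: e1 => ->; rewrite ?mul1r ?mulN1r; lra.
 have : 0 <= G t - G 0 by rewrite E mulr_ge0.
 by rewrite /G mulr0 expR0 mulr1 F0 mulr0 subr0; lra.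
by rewrite ler_norml; apply/andP; split;
 [have := key (-1) (or_intror erefl)|have := key 1 (or_introl erefl)]; lra.
Qed.

Lemma exp_bound (F f : R -> R) (L M T : R) : 0 <= M -> F 0 = 0 ->
 (forall t : R, is_derive t (1 : R) F (f t)) ->
 (forall s, `|s| <= T -> `|f s| <= M * L * expR (L * `|s|)) ->
 forall t, `|t| <= T -> `|F t| <= M * expR (L * `|t|).
Proof.
move=> M0 F0 Fd fb t tT; have [t0|/ltW t0] := leP 0 t.
 have := @exp_bound_pos F f L M T M0 F0 Fd; rewrite (ger0_norm t0) in tT *; apply=> // s s0 sT.
 by have := fb s; rewrite (ger0_norm s0); apply.
pose F' (s : R) := F (- s); pose f' (s : R) := - f (- s).
have Fd' (s : R) : is_derive s (1 : R) F' (f' s).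
 have h : is_derive s (1 : R) (fun s : R => - s) (- 1) by exact: is_deriveN.
 by have := is_derive1_comp (Fd (- s)) h; rewrite mulrN1.
have F0' : F' 0 = 0 by rewrite /F' oppr0.
have nt : 0 <= - t by rewrite oppr_ge0.
rewrite (ler0_norm t0) in tT *; have := @exp_bound_pos F' f' L M T M0 F0' Fd' _ (- t) nt tT.
rewrite /F' opprK; apply=> s s0 sT; rewrite /f' normrN.
by have := fb (- s); rewrite normrN (ger0_norm s0); apply.
Qed.

Lemma exp_ge1 (L t : R) : 0 <= L -> 1 <= expR (L * `|t|).
Proof. by move=> L0; apply: le_trans (expR_ge1Dx _); rewrite lerDl mulr_ge0. Qed.

End Primitive.

(** * Existence of planar solitons by Picard iteration *)

Section Picard.
Variables (R : realType) (c x0 y0 th0 : R).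
Implicit Types th ph : R -> R.

(** The unknown is the angle [th] of the unit tangent. [X_] and [Y_] integrate the direction, [W_]
    is the curvature prescribed by the soliton equation, and solutions are the fixed points of
    [Phi]. Since sine and cosine are bounded, [X_] and [Y_] grow at most linearly and solutions are
    global. *)
Definition X_ th (t : R) := x0 + Prim (fun s => cos (th s)) t.
Definition Y_ th (t : R) := y0 + Prim (fun s => sin (th s)) t.
Definition W_ th (t : R) := c * (- (X_ th t * sin (th t)) + Y_ th t * cos (th t)).
Definition Phi th (t : R) := th0 + Prim (W_ th) t.

Lemma cos_cont th : continuous th -> continuous (fun s => cos (th s)).
Proof. by move=> hc t; apply: (@continuous_comp _ _ _ th cos); [exact: hc|exact: continuous_cos]. Qed.

Lemma sin_cont th : continuous th -> continuous (fun s => sin (th s)).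
Proof. by move=> hc t; apply: (@continuous_comp _ _ _ th sin); [exact: hc|exact: continuous_sin]. Qed.

Lemma is_derive_shift (f : R -> R) (a d t : R) : is_derive t (1 : R) f d -> is_derive t (1 : R) (fun s => a + f s) d.
Proof. by move=> h; have := is_deriveD (is_derive_cst a t (1 : R)) h; rewrite add0r. Qed.

Lemma X_d th (t : R) : continuous th -> is_derive t (1 : R) (X_ th) (cos (th t)).
Proof. by move=> hc; apply: is_derive_shift; exact: (is_derive_Prim t (cos_cont hc)). Qed.

Lemma Y_d th (t : R) : continuous th -> is_derive t (1 : R) (Y_ th) (sin (th t)).
Proof. by move=> hc; apply: is_derive_shift; exact: (is_derive_Prim t (sin_cont hc)). Qed.

Lemma W_cont th : continuous th -> continuous (W_ th).
Proof.
move=> hc t; have Xc : continuous (X_ th) := is_derive_continuous (fun t => X_d t hc).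
have Yc : continuous (Y_ th) := is_derive_continuous (fun t => Y_d t hc).
apply: (@continuousM _ _ (cst c) (fun t => - (X_ th t * sin (th t)) + Y_ th t * cos (th t)) t); first exact: cst_continuous.
apply: (@continuousD _ _ _ (fun t => - (X_ th t * sin (th t))) (fun t => Y_ th t * cos (th t)) t).
 apply: (@continuousN _ _ _ (fun t => X_ th t * sin (th t)) t).
 by apply: (@continuousM _ _ (X_ th) (fun t => sin (th t)) t); [exact: Xc|exact: sin_cont].
by apply: (@continuousM _ _ (Y_ th) (fun t => cos (th t)) t); [exact: Yc|exact: cos_cont].
Qed.

Lemma Phi_d th (t : R) : continuous th -> is_derive t (1 : R) (Phi th) (W_ th t).
Proof. by move=> hc; apply: is_derive_shift; exact: (is_derive_Prim t (W_cont hc)). Qed.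

Lemma Phi_cont th : continuous th -> continuous (Phi th).
Proof. by move=> hc; apply: is_derive_continuous => t; exact: Phi_d. Qed.

Lemma Prim_trig_le (f : R -> R) (t : R) : continuous f -> (forall s, `|f s| <= 1) -> `|Prim f t| <= `|t|.
Proof.
move=> fc f1; have := trig_lip (fun t => is_derive_Prim t fc) f1 t 0.
by rewrite Prim0// !subr0.
Qed.

Section Bounds.
Variable T : R.
Hypothesis T0 : 0 <= T.
Let A : R := `|x0| + `|y0| + T.
Let L : R := 2 * (`|c| * (2 + 2 * A)) + 1.

Let A0 : 0 <= A. Proof. by rewrite !addr_ge0. Qed.
Let cA0 : 0 <= `|c| * (2 + 2 * A).
Proof. by apply: mulr_ge0 => //; apply: addr_ge0 => //; apply: mulr_ge0. Qed.
Lemma L_ge1 : 1 <= L. Proof. by rewrite /L lerDr mulr_ge0. Qed.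
Let L0 : 0 <= L. Proof. exact: le_trans ler01 L_ge1. Qed.

Lemma X_le th t : continuous th -> `|t| <= T -> `|X_ th t| <= A.
Proof.
move=> hc tT; apply: le_trans (ler_normD _ _) _; rewrite /A -addrA lerD2l.
apply: le_trans (Prim_trig_le t (cos_cont hc) (fun s => cos_le _)) _.
by apply: le_trans tT _; rewrite lerDr.
Qed.

Lemma Y_le th t : continuous th -> `|t| <= T -> `|Y_ th t| <= A.
Proof.
move=> hc tT; apply: le_trans (ler_normD _ _) _; rewrite /A [`|x0| + _]addrC -addrA lerD2l.
apply: le_trans (Prim_trig_le t (sin_cont hc) (fun s => sin_le _)) _.
by apply: le_trans tT _; rewrite lerDr.
Qed.

(** On [[-T, T]] the integrand [W_] has Lipschitz constant at most [|c| * (2 + 2 * A)] in the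
    weighted norm; [L] is twice that plus 1, whence the factor [1/2]. *)
Lemma Phi_contract th ph (M : R) : continuous th -> continuous ph -> 0 <= M ->
 (forall s, `|s| <= T -> `|th s - ph s| <= M * expR (L * `|s|)) ->
 forall t, `|t| <= T -> `|Phi th t - Phi ph t| <= M / 2 * expR (L * `|t|).
Proof.
move=> hc pc M0 H.
have Hl (s : R) : `|s| <= T -> M * expR (L * `|s|) <= M * L * expR (L * `|s|).
 by move=> _; apply: ler_wpM2r; [exact: expR_ge0|rewrite ler_peMr// L_ge1].
have dX (t : R) : `|t| <= T -> `|X_ th t - X_ ph t| <= M * expR (L * `|t|).
 apply: (@exp_bound R (fun t => X_ th t - X_ ph t) (fun t => cos (th t) - cos (ph t)) L M T M0).
 - by rewrite /X_ !Prim0 ?subrr//; exact: cos_cont.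
 - by move=> s; apply: is_deriveB; exact: X_d.
 - move=> s sT; have h1 := cos_lip (th s) (ph s); have h2 := le_trans h1 (H s sT); have h3 := le_trans h2 (Hl s sT); exact: h3.
have dY (t : R) : `|t| <= T -> `|Y_ th t - Y_ ph t| <= M * expR (L * `|t|).
 apply: (@exp_bound R (fun t => Y_ th t - Y_ ph t) (fun t => sin (th t) - sin (ph t)) L M T M0).
 - by rewrite /Y_ !Prim0 ?subrr//; exact: sin_cont.
 - by move=> s; apply: is_deriveB; exact: Y_d.
 - move=> s sT; have h1 := sin_lip (th s) (ph s); have h2 := le_trans h1 (H s sT); have h3 := le_trans h2 (Hl s sT); exact: h3.
have prod (a a' b b' : R) : `|b'| <= A -> `|a| <= 1 -> `|b * a - b' * a'| <= `|b - b'| + A * `|a - a'|.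
 move=> hb ha; have -> : b * a - b' * a' = (b - b') * a + b' * (a - a') by ring.
 apply: le_trans (ler_normD _ _) _; rewrite !normrM; apply: lerD; first by rewrite ler_piMr.
 exact: ler_wpM2r.
apply: (@exp_bound R (fun t => Phi th t - Phi ph t) (fun t => W_ th t - W_ ph t) L (M / 2) T).
- by rewrite divr_ge0.
- by rewrite /Phi !Prim0 ?subrr//; exact: W_cont.
- by move=> s; apply: is_deriveB; exact: Phi_d.
move=> s sT; set E := expR _; have E0 : 0 <= E by exact: expR_ge0.
have h1 := prod (sin (th s)) (sin (ph s)) (X_ th s) (X_ ph s) (X_le pc sT) (sin_le _).
have h2 := prod (cos (th s)) (cos (ph s)) (Y_ th s) (Y_ ph s) (Y_le pc sT) (cos_le _).
have h3 : `|sin (th s) - sin (ph s)| <= M * E by exact: le_trans (sin_lip _ _) (H s sT).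
have h4 : `|cos (th s) - cos (ph s)| <= M * E by exact: le_trans (cos_lip _ _) (H s sT).
have k1 := le_trans h1 (lerD (dX s sT) (ler_wpM2l A0 h3)).
have k2 := le_trans h2 (lerD (dY s sT) (ler_wpM2l A0 h4)).
rewrite -/E in k1 k2.
have -> : W_ th s - W_ ph s = c * (- (X_ th s * sin (th s) - X_ ph s * sin (ph s)) + (Y_ th s * cos (th s) - Y_ ph s * cos (ph s))).
 rewrite /W_; ring.
rewrite normrM; apply: le_trans (_ : `|c| * ((M * E + A * (M * E)) + (M * E + A * (M * E))) <= _).
 apply: ler_wpM2l => //; apply: le_trans (ler_normD _ _) _; rewrite normrN; exact: lerD.
have -> : M / 2 * L * E = `|c| * ((M * E + A * (M * E)) + (M * E + A * (M * E))) + M / 2 * E by rewrite /L; field.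
by rewrite lerDl mulr_ge0// divr_ge0.
Qed.

Fixpoint pic k : R -> R := if k is k'.+1 then Phi (pic k') else cst th0.

Lemma pic_cont k : continuous (pic k).
Proof. by elim: k => [|k IH] /=; [exact: cst_continuous|exact: Phi_cont]. Qed.

Lemma pic_step : exists2 M : R, 0 <= M & forall k (t : R), `|t| <= T ->
 `|pic k.+1 t - pic k t| <= M / 2 ^+ k * expR (L * `|t|).
Proof.
exists (`|c| * (A + A)); first by rewrite mulr_ge0// addr_ge0.
elim=> [|k IH] t tT.
 rewrite expr0 divr1 /= /Phi [_ + Prim _ _]addrC addrK.
 apply: (@exp_bound R (Prim (W_ (cst th0))) (W_ (cst th0)) L _ T) => //.
 - by rewrite mulr_ge0// addr_ge0.
 - by rewrite Prim0//; apply: W_cont; exact: cst_continuous.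
 - by move=> s; apply: is_derive_Prim; apply: W_cont; exact: cst_continuous.
 move=> s sT; apply: (@le_trans _ _ (`|c| * (A + A))).
  rewrite normrM; apply: ler_wpM2l => //; apply: le_trans (ler_normD _ _) _; rewrite normrN !normrM.
  apply: lerD; rewrite -[X in _ <= X]mulr1.
   by apply: ler_pM => //; [apply: X_le => //; exact: cst_continuous|exact: sin_le].
  by apply: ler_pM => //; [apply: Y_le => //; exact: cst_continuous|exact: cos_le].
 rewrite -mulrA ler_peMr//; first by rewrite mulr_ge0// addr_ge0.
 have := exp_ge1 s L0 => h; rewrite -[1]mulr1; apply: ler_pM => //; exact: L_ge1.
have -> : `|c| * (A + A) / 2 ^+ k.+1 = `|c| * (A + A) / 2 ^+ k / 2 by rewrite exprS invfM mulrCA mulrC.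
apply: (Phi_contract (@pic_cont k.+1) (@pic_cont k) _ IH tT).
by rewrite divr_ge0 ?exprn_ge0// mulr_ge0// addr_ge0.
Qed.

Lemma pic_cauchy : exists2 D : R, 0 <= D & forall j k (t : R), `|t| <= T -> `|pic (k + j) t - pic k t| <= D / 2 ^+ k.
Proof.
have [M M0 H] := pic_step; pose D1 : R := M * expR (L * T).
have D10 : 0 <= D1 by rewrite mulr_ge0// expR_ge0.
exists (2 * D1); first by rewrite mulr_ge0.
move=> j k t tT.
have step i : `|pic i.+1 t - pic i t| <= D1 / 2 ^+ i.
 apply: le_trans (H i t tT) _; rewrite /D1 mulrAC; apply: ler_wpM2r.
  by rewrite invr_ge0 exprn_ge0.
 by apply: ler_wpM2l => //; rewrite ler_expR; apply: ler_wpM2l.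
suff h : `|pic (k + j) t - pic k t| <= 2 * D1 / 2 ^+ k - 2 * D1 / 2 ^+ (k + j).
 by apply: le_trans h _; rewrite gerBl divr_ge0 ?exprn_ge0// mulr_ge0.
elim: j => [|j IH]; first by rewrite addn0 !subrr normr0.
have -> : pic (k + j.+1) t - pic k t = (pic (k + j).+1 t - pic (k + j) t) + (pic (k + j) t - pic k t).
 by rewrite addnS addrA subrK.
apply: le_trans (ler_normD _ _) _; apply: le_trans (lerD (step _) IH) _.
have -> : 2 * D1 / 2 ^+ (k + j.+1) = D1 / 2 ^+ (k + j).
 by rewrite addnS exprS invfM mulrA [2 * D1]mulrC -(mulrA D1) divff ?mulr1.
by rewrite -!mulrA; move: (D1 / 2 ^+ (k + j)) (D1 / 2 ^+ k) => a b; lra.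
Qed.

End Bounds.

(** The iterates converge uniformly on every bounded interval, which makes the limit continuous; the
    contraction property then passes the fixed-point equation to the limit. *)
Lemma theta_exists : exists2 th, continuous th & forall t : R, Phi th t = th t.
Proof.
have lim_ex (t : R) : exists l : R, forall e, 0 < e -> exists k, forall i, (k <= i)%N -> `|pic i t - l| < e.
 apply: (@cauchy_real R (fun i => pic i t)) => e e0.
 have [D D0 H] := pic_cauchy (normr_ge0 t).
 have e2 : 0 < e / 2 by rewrite divr_gt0.
 have [k hk] := half_pow_small D e2; exists k => i j ki kj.
 have h1 := H (i - k)%N k t (lexx _); have h2 := H (j - k)%N k t (lexx _).
 rewrite !subnKC// in h1 h2; have h3 := hk k (leqnn k).
 have -> : pic i t - pic j t = (pic i t - pic k t) - (pic j t - pic k t) by ring.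
 apply: le_lt_trans (ler_normB _ _) _; apply: le_lt_trans (lerD h1 h2) _.
 by move: h3; move: (D / _) => a; lra.
pose th t := projT1 (cid (lim_ex t)).
have thP t : forall e : R, 0 < e -> exists k, forall i, (k <= i)%N -> `|pic i t - th t| < e := projT2 (cid (lim_ex t)).
have unif T : 0 <= T -> exists2 D : R, 0 <= D & forall k t, `|t| <= T -> `|th t - pic k t| <= D / 2 ^+ k.
 move=> T0; have [D D0 H] := pic_cauchy T0; exists D => // k t tT.
 apply/ler_addgt0Pl => e e0; have [i hi] := thP t e e0.
 have h1 := H i k t tT; have h2 := hi (k + i)%N (leq_addl _ _).
 have -> : th t - pic k t = (pic (k + i) t - pic k t) - (pic (k + i) t - th t) by ring.
 apply: le_trans (ler_normB _ _) _; rewrite addrC; apply: lerD => //; exact: ltW.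
have thc : continuous th.
 move=> t; apply/cvgrPdist_lt => e e0.
 have T0 : 0 <= `|t| + 1 by rewrite addr_ge0.
 have [D D0 H] := unif _ T0; have e3 : 0 < e / 3 by rewrite divr_gt0.
 have [k hk] := half_pow_small D e3; have h3 := hk k (leqnn k).
 have /cvgrPdist_lt/(_ _ e3) pc := @pic_cont k t.
 have n1 : \forall s \near t, `|s| <= `|t| + 1.
  apply/nbhs_ballP; exists 1 => //= s; rewrite /ball /= => ts.
  rewrite -(subrK t s) addrC; apply: le_trans (ler_normD _ _) _.
  by rewrite lerD2l distrC ltW.
 apply: filterS2 pc n1 => s ps sT.
 have h1 := H k t (_ : `|t| <= `|t| + 1); have h2 := H k s sT.
 have {}h1 := h1 ltac:(by rewrite lerDl).
 have -> : th t - th s = (th t - pic k t) + (pic k t - pic k s) - (th s - pic k s) by ring.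
 apply: le_lt_trans (ler_normB _ _) _; apply: le_lt_trans (lerD (ler_normD _ _) h2) _.
 by move: h1 h3 ps; move: (D / _) => a; lra.
exists th => // t; apply/eqP; rewrite -subr_eq0 -normr_le0; apply/ler_addgt0Pl => e e0; rewrite addr0.
have [D D0 H] := unif _ (normr_ge0 t).
set L : R := 2 * (`|c| * (2 + 2 * (`|x0| + `|y0| + `|t|))) + 1.
have L0 : 0 <= L by apply: le_trans ler01 _; exact: (L_ge1 (normr_ge0 t)).
pose E : R := expR (L * `|t|); have E1 : 1 <= E by exact: exp_ge1.
have [k hk] := half_pow_small (D * E) (divr_gt0 e0 (ltr0Sn R 1)); have h3 := hk k (leqnn k).
have DP j : 0 <= D / 2 ^+ j by rewrite divr_ge0// exprn_ge0.
have := Phi_contract (normr_ge0 t) thc (@pic_cont k) (DP k) _ (lexx `|t|).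
move=> /(_ _)/wrap[s sT|h1].
 apply: le_trans (H k s sT) _; rewrite ler_peMr//; exact: exp_ge1.
have h2 := H k.+1 t (lexx _).
have -> : Phi th t - th t = (Phi th t - Phi (pic k) t) - (th t - pic k.+1 t) by rewrite /=; ring.
apply: le_trans (ler_normB _ _) _; apply: le_trans (lerD h1 h2) _.
rewrite -/L -/E.
have h4 : D / 2 ^+ k.+1 = D / 2 ^+ k / 2 by rewrite exprS invfM mulrCA mulrC.
have h5 : D / 2 ^+ k <= D / 2 ^+ k * E by rewrite ler_peMr.
by rewrite h4; move: h3 h5; rewrite mulrAC; move: (D / _) => a; lra.
Qed.

End Picard.

Lemma angle (R : realType) (C S : R) : C ^+ 2 + S ^+ 2 = 1 -> exists t, cos t = C /\ sin t = S.
Proof.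
move=> CS; have C1 : -1 <= C <= 1.
 rewrite -ler_norml -(ler_pXn2r (n := 2)) ?nnegrE// expr1n real_normK ?num_real//.
 by have := sqr_ge0 S; lra.
have cC : cos (acos C) = C := (acos_def C1).2.
have sC : sin (acos C) = `|S| by rewrite sin_acos// -sqrtr_sqr; congr Num.sqrt; lra.
have [S0|/ltW S0] := leP 0 S; first by exists (acos C); rewrite sC ger0_norm.
by exists (- acos C); rewrite cosN sinN sC ler0_norm// opprK.
Qed.

Theorem planar_curve (R : realType) (c x0 y0 C0 S0 : R) : C0 ^+ 2 + S0 ^+ 2 = 1 ->
 exists X Y C S : R -> R, [/\ X 0 = x0, Y 0 = y0, C 0 = C0 & S 0 = S0] /\
  forall t : R, [/\ C t ^+ 2 + S t ^+ 2 = 1, is_derive t (1 : R) X (C t), is_derive t (1 : R) Y (S t),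
  is_derive t (1 : R) C (- (S t * (c * (- (X t * S t) + Y t * C t)))) &
  is_derive t (1 : R) S (C t * (c * (- (X t * S t) + Y t * C t)))].
Proof.
move=> /angle[th0 [<- <-]]; have [th thc fix_] := theta_exists c x0 y0 th0.
have thd (t : R) : is_derive t (1 : R) th (W_ c x0 y0 th t).
 have := Phi_d c x0 y0 th0 t thc; have -> // : Phi c x0 y0 th0 th = th by apply/funext.
have th00 : th 0 = th0 by rewrite -fix_ /Phi Prim0 ?addr0//; exact: W_cont.
exists (X_ x0 th), (Y_ y0 th), (cos \o th), (sin \o th); split.
 by rewrite /X_ /Y_ !Prim0 ?addr0 /= ?th00//; [exact: sin_cont|exact: cos_cont].
move=> t; split.
- exact: cos2Dsin2.
- exact: X_d.
- exact: Y_d.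
- by rewrite -mulNr; exact: is_derive1_comp (is_derive_cos _) (thd t).
- exact: is_derive1_comp (is_derive_sin _) (thd t).
Qed.

(** * The real line as a manifold, and the planar soliton *)

Section RealLine.
Variable R : realType.

Definition to_row (t : R) : 'rV[R]_1 := const_mx t.
Definition of_row (u : 'rV[R]_1) : R := u 0 0.

Lemma to_rowK : cancel to_row of_row. Proof. by move=> t; rewrite /of_row mxE. Qed.
Lemma of_rowK : cancel of_row to_row.
Proof. by move=> u; apply/rowP => j; rewrite mxE /of_row [j]ord1. Qed.

Lemma to_row_continuous : continuous to_row.
Proof.
move=> t; apply: continuous_row => j.
have -> : (fun y => to_row y 0 j) = id by apply/funext => y; rewrite mxE.
exact: cvg_id.
Qed.

Lemma of_row_continuous : continuous of_row.
Proof. by move=> u; apply: continuous_coord_at; exact: cvg_id. Qed.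

Lemma image_to_row : to_row @` setT = setT.
Proof. by apply/seteqP; split=> // u _; exists (of_row u) => //; rewrite of_rowK. Qed.

Lemma open_image_to_row : open (to_row @` setT).
Proof. by rewrite image_to_row; exact: openT. Qed.

Definition line_chart : chart R 1 (R : ptopologicalType) :=
 @Chart R 1 _ setT to_row of_row openT open_image_to_row (fun t _ => to_rowK t)
 (fun t _ => @to_row_continuous t) (fun u _ => @of_row_continuous u).

Lemma real_second_countable : @second_countable (R : ptopologicalType).
Proof.
exists [set `]ratr z.1, ratr z.2[%classic | z in [set: rat * rat]].
 by apply: sub_countable (card_image_le _ _) _; exact: countableP.
split=> [_ [z _ <-]|x A /nbhs_ballP[e /= e0 eA]]; first exact: interval_open.
have h1 : x - e < x by rewrite gtrBl.
have h2 : x < x + e by rewrite ltrDl.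
have [a] := rat_in_itvoo h1; rewrite in_itv /= => /andP[a1 a2].
have [b] := rat_in_itvoo h2; rewrite in_itv /= => /andP[b1 b2].
exists `]ratr a, ratr b[%classic.
 by split; [exists (a, b)|rewrite /= in_itv /= a2].
move=> y /=; rewrite in_itv /= => /andP[y1 y2]; apply: eA; rewrite /ball /= ltr_norml.
by apply/andP; split; lra.
Qed.

Lemma line_compatible (phi1 phi2 : chart R 1 (R : ptopologicalType)) :
 phi1 = line_chart -> phi2 = line_chart -> compatible phi1 phi2.
Proof.
move=> -> ->; suff H : smooth_on (overlap line_chart line_chart) (transition line_chart line_chart) by split.
have -> : overlap line_chart line_chart = setT by rewrite /overlap /= setTI image_to_row.
have -> : transition line_chart line_chart = id by apply/funext => u; rewrite /transition /= of_rowK.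
move=> k; apply: Sk_Ck; first exact: openT.
by move=> j; apply: Sk_coord; exact: openT.
Qed.

Definition line : manifold R 1 :=
 @Manifold R 1 (R : ptopologicalType) (@Rhausdorff R) real_second_countable [set line_chart]
  (fun _ => line_chart) (fun _ => erefl) (fun _ => I) (fun _ _ => @line_compatible _ _).

Lemma line_connected : connected [set: line].
Proof. by apply/connected_intervalP => x y _ _ z _. Qed.

Lemma is_derive_of_row (f : R -> R) (d : R) (u : 'rV[R]_1) : is_derive (of_row u) (1 : R) f d ->
 is_derive u (e_ 0) (f \o of_row) d.
Proof.
move=> fd; apply/is_derive_lineP.
have -> : (fun h : R => (f \o of_row) (u + h *: e_ 0)) = (fun h => f (of_row u + h)).
 by apply/funext => h; rewrite /= /of_row !mxE !eqxx mulr1.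
have h : is_derive (0 : R) (1 : R) (fun h : R => of_row u + h) 1.
 by have := is_deriveD (is_derive_cst (of_row u) (0 : R) (1 : R)) (is_derive_id (0 : R) (1 : R)); rewrite add0r.
have fd' : is_derive (of_row u + 0) (1 : R) f d by rewrite addr0.
by have := @is_derive1_comp R f (fun h : R => of_row u + h) 0 _ _ fd' h; rewrite mulr1.
Qed.

Section Curve.
Variables (c : R) (X Y C S : R -> R).
Let w t := c * (- (X t * S t) + Y t * C t).
Hypothesis CS1 : forall t, C t ^+ 2 + S t ^+ 2 = 1.
Hypothesis Xd : forall t : R, is_derive t (1 : R) X (C t).
Hypothesis Yd : forall t : R, is_derive t (1 : R) Y (S t).
Hypothesis Cd : forall t : R, is_derive t (1 : R) C (- (S t * w t)).
Hypothesis Sd : forall t : R, is_derive t (1 : R) S (C t * w t).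

Definition pt (a b : R) : 'rV[R]_2 := \row_j (if j == 0 then a else b).

Lemma pt_dot a b a' b' : dot (pt a b) (pt a' b') = a * a' + b * b'.
Proof. by rewrite dotE big_ord_recl big_ord1 !mxE. Qed.

Lemma pt_eq a b (v : 'rV[R]_2) : v 0 0 = a -> v 0 1 = b -> v = pt a b.
Proof.
move=> h1 h2; apply/rowP => j; rewrite mxE; have [->//|] := eqVneq j 0.
by case: j => -[|[|//]] // i _; rewrite -h2; congr (v _ _); apply: val_inj.
Qed.

Definition gam (t : line) : 'rV[R]_2 := pt (X t) (Y t).

Lemma Sk_of_row k : [/\ Sk k setT (X \o of_row), Sk k setT (Y \o of_row), Sk k setT (C \o of_row) & Sk k setT (S \o of_row)].
Proof.
have oT : open [set: 'rV[R]_1] := openT.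
have cc (f df : R -> R) : (forall t : R, is_derive t (1 : R) f (df t)) -> forall u : 'rV[R]_1, [set: 'rV[R]_1] u -> {for u, continuous (f \o of_row)}.
 move=> fd u _; apply: continuous_comp; first exact: of_row_continuous.
 have fc := is_derive_continuous fd; exact: fc.
have dd (f df : R -> R) k' : (forall t : R, is_derive t (1 : R) f (df t)) -> Sk k' setT (df \o of_row) -> Sk k'.+1 setT (f \o of_row).
 move=> fd dS; split; first exact: (cc f df fd).
 move=> i; rewrite [i]ord1; have E u : is_derive u (e_ 0) (f \o of_row) (df (of_row u)) by exact: is_derive_of_row.
 split; first by move=> u _; have [] := E u.
 by apply: (Sk_eq oT _ dS) => u _; have [_ ->] := E u.
elim: k => [|k [IX IY IC IS]].
 by split; split=> //; [exact: (cc _ _ Xd)|exact: (cc _ _ Yd)|exact: (cc _ _ Cd)|exact: (cc _ _ Sd)].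
have Iw : Sk k setT (w \o of_row).
 have h := SkM oT (@Sk_cst R 1 k setT c) (SkD oT (SkN oT (SkM oT IX IS)) (SkM oT IY IC)).
 by apply: (Sk_eq oT _ h) => u _.
split.
- exact: dd Xd IC.
- exact: dd Yd IS.
- by apply: (dd _ _ k Cd); apply: (Sk_eq oT _ (SkN oT (SkM oT IS Iw))) => u _.
- by apply: (dd _ _ k Sd); apply: (Sk_eq oT _ (SkM oT IC Iw)) => u _.
Qed.

Lemma is_derive_pt (f g : R -> R) (a b : R) (u : 'rV[R]_1) :
 is_derive (of_row u) (1 : R) f a -> is_derive (of_row u) (1 : R) g b ->
 is_derive u (e_ 0) (fun u => pt (f (of_row u)) (g (of_row u))) (pt a b).
Proof.
move=> fd gd; have fd' := is_derive_of_row fd; have gd' := is_derive_of_row gd.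
have H j : is_derive u (e_ 0) (fun u => pt (f (of_row u)) (g (of_row u)) 0 j) (pt a b 0 j).
 rewrite mxE; have -> : (fun u => pt (f (of_row u)) (g (of_row u)) 0 j) = if j == 0 then f \o of_row else g \o of_row.
  by apply/funext => v; rewrite mxE; case: ifP.
 by case: ifP.
have d : derivable (fun u => pt (f (of_row u)) (g (of_row u))) u (e_ 0).
 by apply/derivable_mxP => i j; rewrite [i]ord1; have [] := H j.
split=> //; rewrite derive_mx//; apply/matrixP => i j; rewrite [i]ord1 mxE.
by have [_ ->] := H j.
Qed.

Let F : 'rV[R]_1 -> 'rV[R]_2 := fun u => pt (X (of_row u)) (Y (of_row u)).

Lemma partialF u : partial 0 F u = pt (C (of_row u)) (S (of_row u)).
Proof. by have [_ H] := is_derive_pt (Xd (of_row u)) (Yd (of_row u)). Qed.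

Lemma partial2F u : partial 0 (partial 0 F) u = pt (- (S (of_row u) * w (of_row u))) (C (of_row u) * w (of_row u)).
Proof.
have -> : partial 0 F = fun u => pt (C (of_row u)) (S (of_row u)) by apply/funext => v; exact: partialF.
by have [_ H] := is_derive_pt (Cd (of_row u)) (Sd (of_row u)).
Qed.

Lemma jacF u : jac F u = pt (C (of_row u)) (S (of_row u)).
Proof. by apply/rowP => j; rewrite mxE partialF. Qed.

Lemma gramF u : gram F u = 1%:M.
Proof.
rewrite /gram jacF; apply/matrixP => i j; rewrite [i]ord1 [j]ord1 [RHS]mxE eqxx mulr1n.
by have := pt_dot (C (of_row u)) (S (of_row u)) (C (of_row u)) (S (of_row u)); rewrite /dot -!expr2 CS1.
Qed.

Lemma normal_partF u v : normal_part F u v = v - dot v (jac F u) *: jac F u.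
Proof.
rewrite /normal_part gramF invmx1 mulmx1; congr (_ - _).
by rewrite (mx11_scalar (v *m _)) mul_scalar_mx.
Qed.

Lemma gam_par (p : line) : par_at gam p = F.
Proof. by []. Qed.

(** At unit speed the Gram matrix is 1 and the mean curvature vector is the second derivative,
    already normal; the rest is [C ^+ 2 + S ^+ 2 = 1]. *)
Lemma gam_soliton : soliton_for c gam.
Proof.
move=> p; rewrite /mean_curvature_vector gam_par; set u := crd_at p.
have up : of_row u = p by exact: to_rowK.
rewrite /mean_curvature_local gramF invmx1 !big_ord1 mxE eqxx scale1r.
rewrite !normal_partF jacF partial2F up /gam !pt_dot.
have cs := CS1 p.
apply/rowP => j; rewrite !mxE; case: ifP => _; rewrite /w; move: (X p) (Y p) (C p) (S p) cs => x y a b ab.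
 apply/eqP; rewrite -subr_eq0; apply/eqP.
 by transitivity (c * x * (1 - (a ^+ 2 + b ^+ 2))); [ring|rewrite ab subrr mulr0].
apply/eqP; rewrite -subr_eq0; apply/eqP.
by transitivity (c * y * (1 - (a ^+ 2 + b ^+ 2))); [ring|rewrite ab subrr mulr0].
Qed.

Lemma gam_immersion : immersion gam.
Proof.
split=> [phi /= -> k|phi /= -> u _].
 have -> : crange line_chart = setT by rewrite /crange /= image_to_row.
 apply: Sk_Ck; first exact: openT.
 move=> j; have [SX SY _ _] := Sk_of_row k; have oT : open [set: 'rV[R]_1] := openT.
 have [j0|j0] := eqVneq j 0.
  by apply: (Sk_eq oT _ SX) => v _; rewrite /= mxE j0.
 by apply: (Sk_eq oT _ SY) => v _; rewrite /= mxE (negbTE j0).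
apply: row_free_kernel => v vJ.
have : v *m gram F u = 0 by rewrite /gram mulmxA [v *m _]vJ mul0mx.
by rewrite gramF mulmx1.
Qed.

End Curve.
End RealLine.

(** * Uniqueness for moving planar frames *)

Section Tracking.
Variables (R : realType) (c : R).
Implicit Types x y C S : R -> R.

Definition frame_speed x y C S (t : R) := c * (- (x t * S t) + y t * C t).

(* [(x, y)] moves at speed [a] in the direction [(C, S)], which turns at the rate of a soliton. *)
Definition frame_motion (a : R -> R) x y C S := forall t : R, [/\ is_derive t (1 : R) x (a t * C t),
 is_derive t (1 : R) y (a t * S t), is_derive t (1 : R) C (a t * - (S t * frame_speed x y C S t)) &
 is_derive t (1 : R) S (a t * (C t * frame_speed x y C S t))].

Lemma frame_motion_continuous (a : R -> R) x y C S : frame_motion a x y C S ->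
 [/\ continuous x, continuous y, continuous C & continuous S].
Proof.
by move=> H; split; apply: is_derive_continuous => t; have [h1 h2 h3 h4] := H t;
 [exact: h1|exact: h2|exact: h3|exact: h4].
Qed.

(** Splitting the differences of products, the four differences of the unknowns solve a homogeneous
    linear system whose coefficients [k] involve both solutions, so [linear_ode0] applies. *)
Lemma frame_motion_unique (a : R -> R) x y C S x' y' C' S' : continuous a ->
 frame_motion a x y C S -> frame_motion a x' y' C' S' ->
 x 0 = x' 0 -> y 0 = y' 0 -> C 0 = C' 0 -> S 0 = S' 0 ->
 forall t, 0 <= t -> [/\ x t = x' t, y t = y' t, C t = C' t & S t = S' t].
Proof.
move=> ac M1 M2 x0 y0 C0 S0 t t0.
have [[xc yc Cc Sc] [xc' yc' Cc' Sc']] := (frame_motion_continuous M1, frame_motion_continuous M2).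
pose u (i : 'I_4) : R -> R := match val i with 0%N => x - x' | 1%N => y - y' | 2%N => C - C' | _ => S - S' end.
pose w : R -> R := cst c * (- (x * S) + y * C).
pose k (i j : 'I_4) : R -> R := match val i, val j with
 | 0%N, 2%N => a | 1%N, 3%N => a
 | 2%N, 0%N => a * (S' * (cst c * S)) | 2%N, 1%N => - (a * (S' * (cst c * C)))
 | 2%N, 2%N => - (a * (S' * (cst c * y'))) | 2%N, 3%N => a * (S' * (cst c * x')) - a * w
 | 3%N, 0%N => - (a * (C' * (cst c * S))) | 3%N, 1%N => a * (C' * (cst c * C))
 | 3%N, 2%N => a * (C' * (cst c * y')) + a * w | 3%N, 3%N => - (a * (C' * (cst c * x')))
 | _, _ => cst 0 end.
have cM (f g : R -> R) : continuous f -> continuous g -> continuous (f * g).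
 by move=> fc gc z; apply: (@continuousM _ _ f g z); [exact: fc|exact: gc].
have cN (f : R -> R) : continuous f -> continuous (- f).
 by move=> fc z; apply: (@continuousN _ _ _ f z); exact: fc.
have cD (f g : R -> R) : continuous f -> continuous g -> continuous (f + g).
 by move=> fc gc z; apply: (@continuousD _ _ _ f g z); [exact: fc|exact: gc].
have cC (b : R) : continuous (cst b : R -> R) by exact: cst_continuous.
have wc : continuous w := cM _ _ (cC c) (cD _ _ (cN _ (cM _ _ xc Sc)) (cM _ _ yc Cc)).
have q (f g : R -> R) : continuous f -> continuous g -> continuous (a * (f * (cst c * g))).
 by move=> fc gc; exact: (cM _ _ ac (cM _ _ fc (cM _ _ (cC c) gc))).
have kc i j : continuous (k i j).
 rewrite /k; case: i => -[|[|[|[|//]]]] i; case: j => -[|[|[|[|//]]]] j /=.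
 - exact: cC. - exact: cC. - exact: ac. - exact: cC.
 - exact: cC. - exact: cC. - exact: cC. - exact: ac.
 - exact: q Sc' Sc. - exact: cN (q _ _ Sc' Cc). - exact: cN (q _ _ Sc' yc').
 - exact: cD (q _ _ Sc' xc') (cN _ (cM _ _ ac wc)).
 - exact: cN (q _ _ Cc' Sc). - exact: q Cc' Cc.
 - exact: cD (q _ _ Cc' yc') (cM _ _ ac wc).
 exact: cN (q _ _ Cc' xc').
have ud i z : is_derive z (1 : R) (u i) (\sum_j k i j z * u j z).
 have [X1 Y1 C1 S1] := M1 z; have [X2 Y2 C2 S2] := M2 z.
 rewrite !big_ord_recl big_ord0 addr0.
 case: i => -[|[|[|[|//]]]] i; rewrite /u /k /=.
 - have := is_deriveB X1 X2; congr (is_derive _ _ _ _); rewrite !fctE; ring.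
 - have := is_deriveB Y1 Y2; congr (is_derive _ _ _ _); rewrite !fctE; ring.
 - have := is_deriveB C1 C2; congr (is_derive _ _ _ _); rewrite /frame_speed /w !fctE; ring.
 - have := is_deriveB S1 S2; congr (is_derive _ _ _ _); rewrite /frame_speed /w !fctE; ring.
have u0 i : u i 0 = 0.
 by case: i => -[|[|[|[|//]]]] i; rewrite /u /= fctE ?x0 ?y0 ?C0 ?S0 subrr.
have H i : u i t = 0 by apply: (linear_ode0 t0 ud kc u0); rewrite t0 lexx.
split; apply/eqP; rewrite -subr_eq0; apply/eqP.
- exact: H (Ordinal (isT : (0 < 4)%N)).
- exact: H (Ordinal (isT : (1 < 4)%N)).
- exact: H (Ordinal (isT : (2 < 4)%N)).
- exact: H (Ordinal (isT : (3 < 4)%N)).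
Qed.

Lemma frame_motion_comp (a h : R -> R) x y C S : frame_motion (cst 1) x y C S ->
 (forall t : R, is_derive t (1 : R) h (a t)) -> frame_motion a (x \o h) (y \o h) (C \o h) (S \o h).
Proof.
move=> M hd t; have [h1 h2 h3 h4] := M (h t).
by split; [have := is_derive1_comp h1 (hd t)|have := is_derive1_comp h2 (hd t)
 |have := is_derive1_comp h3 (hd t)|have := is_derive1_comp h4 (hd t)];
 congr (is_derive _ _ _ _); rewrite mul1r mulrC.
Qed.

(** A symmetric 2 by 2 matrix killing a unit vector is its trace times the projection on the
    orthogonal line. *)
Lemma rank_one_sym (b00 b01 b11 n0 n1 : R) : n0 ^+ 2 + n1 ^+ 2 = 1 ->
 n0 * b00 + n1 * b01 = 0 -> n0 * b01 + n1 * b11 = 0 ->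
 [/\ b00 = (b00 + b11) * n1 ^+ 2, b01 = - ((b00 + b11) * (n0 * n1)) & b11 = (b00 + b11) * n0 ^+ 2].
Proof.
move=> nn h1 h2; split; apply/eqP; rewrite -subr_eq0; apply/eqP.
- transitivity (b00 * (1 - (n0 ^+ 2 + n1 ^+ 2)) + n0 * (n0 * b00 + n1 * b01) - n1 * (n0 * b01 + n1 * b11)); first by ring.
 by rewrite nn h1 h2; ring.
- transitivity (b01 * (1 - (n0 ^+ 2 + n1 ^+ 2)) + n1 * (n0 * b00 + n1 * b01) + n0 * (n0 * b01 + n1 * b11)); first by ring.
 by rewrite nn h1 h2; ring.
transitivity (b11 * (1 - (n0 ^+ 2 + n1 ^+ 2)) + n1 * (n0 * b01 + n1 * b11) - n0 * (n0 * b00 + n1 * b01)); first by ring.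
by rewrite nn h1 h2; ring.
Qed.

End Tracking.

(** * Varying support function: products with a planar soliton *)

Section CaseB.
Variables (R : realType) (m : nat) (M : manifold R m) (psi N : M -> 'rV[R]_m.+1).
Hypothesis imm : immersion psi.
Hypothesis N_normal : unit_normal psi N.
Hypothesis M_conn : connected [set: M].
Hypothesis M_complete : complete_immersion psi.
Variable c : R.
Hypothesis soliton : soliton_for c psi.
Hypothesis c_lt0 : c < 0.
Notation d := (dsf imm).
Notation s := (support_fn imm N_normal).
Notation nn := (ns N_normal).
Variable r : sfun M.
Hypothesis rs : r * s = 1.
Hypothesis E0 : forall i j k, EE imm N_normal r i j k = 0.
Notation Bm := (Bm imm N_normal r).

Lemma is_derive_row_mul k n (G : R -> 'rV[R]_n) (v : 'rV[R]_n) (P : 'M[R]_(k, n)) (t : R) i :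
 (forall j, is_derive t (1 : R) (fun s => G s 0 j) (v 0 j)) ->
 is_derive t (1 : R) (fun s => (G s *m P^T) 0 i) ((v *m P^T) 0 i).
Proof.
move=> H; have -> : (fun s => (G s *m P^T) 0 i) = (fun s => \sum_j P i j * G s 0 j).
 by apply/funext => z; rewrite mxE; apply: eq_bigr => j _; rewrite [P^T _ _]mxE mulrC.
have -> : (v *m P^T) 0 i = \sum_j P i j * v 0 j.
 by rewrite mxE; apply: eq_bigr => j _; rewrite [P^T _ _]mxE mulrC.
apply: (@is_derive_bigsum R _ _ (fun j s => P i j * G s 0 j) (fun j _ => P i j * v 0 j)) => j.
Qed.

Lemma vel_coord (g : R -> M) (t : R) j : C1_curve g -> is_derive t (1 : R) (fun s => psi (g s) 0 j) (vel psi g t 0 j).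
Proof.
move=> gC; have dg := C1at_der (curve_psi imm gC t).
rewrite /vel (derive_row _ dg); apply: derivableP.
by have /derivable_mxP/(_ 0 j) := dg.
Qed.

Lemma vel_normal (g : R -> M) (t : R) : C1_curve g -> dot (vel psi g t) (N (g t)) = 0.
Proof.
move=> gC; have at_ := chart_at_atlas (g t); have Dt := chart_at_dom (g t).
apply/dot0P; have -> : vel psi g t = 'D_1 (cmap (chart_at (g t)) \o g) t *m
 jac (psi \o cinv (chart_at (g t))) (cmap (chart_at (g t)) (g t)).
 by apply/rowP => k; exact: (vel_chart imm k gC at_ Dt).
by rewrite -mulmxA (normal_chart imm N_normal at_ Dt) mulmx0.
Qed.

Lemma normal_coord (g : R -> M) (t : R) j : C1_curve g ->
 is_derive t (1 : R) (fun u => N (g u) 0 j) ((s (g t) *: (vel psi g t *m Bm (g t))) 0 j).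
Proof.
move=> gC; have := curve_fun imm t gC (sfP (nn j) 1); congr (is_derive _ _ _ _).
rewrite mxE mxE mulr_sumr; apply: eq_bigr => k _.
have E := congr1 (fun f : sfun M => f (g t)) (sBE rs k j).
by rewrite -dsfE -E [Bm _ _ _]mxE mulrCA.
Qed.

Section Frame.
Variables (l : nat) (P : 'M[R]_(2, m.+1)) (Q : 'M[R]_(l, m.+1)).
Hypothesis PP : P *m P^T = 1%:M.
Hypothesis QQ : Q *m Q^T = 1%:M.
Hypothesis PQ : P *m Q^T = 0.
Hypothesis PQ1 : P^T *m P + Q^T *m Q = 1%:M.
Hypothesis KA : forall p, N p *m Q^T = 0 /\ Q *m Bm p = 0.

Definition yy p := psi p *m P^T.
Definition zz p := psi p *m Q^T.
Definition nu p := N p *m P^T.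
Definition fx p := yy p 0 0.
Definition fy p := yy p 0 1.
(** The pair [(fC, fS)] is the planar normal [nu] turned by a quarter turn, hence a unit tangent to
    the planar projection. *)
Definition fC p := - nu p 0 1.
Definition fS p := nu p 0 0.

Lemma dot2 (u v : 'rV[R]_2) : dot u v = u 0 0 * v 0 0 + u 0 1 * v 0 1.
Proof.
rewrite dotE big_ord_recl big_ord1; congr (_ + u 0 _ * v 0 _); exact: val_inj.
Qed.

Lemma mul2 (u : 'rV[R]_2) (b : 'M[R]_2) i : (u *m b) 0 i = u 0 0 * b 0 i + u 0 1 * b 1 i.
Proof.
rewrite mxE big_ord_recl big_ord1; congr (_ + u 0 _ * b _ _); exact: val_inj.
Qed.

Lemma N_nu p : N p = nu p *m P.
Proof. by rewrite -{1}[N p]mulmx1 -PQ1 mulmxDr !mulmxA (KA p).1 mul0mx addr0. Qed.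

Lemma nu_unit p : nu p 0 0 ^+ 2 + nu p 0 1 ^+ 2 = 1.
Proof. by rewrite !expr2 -dot2 -(dot_orth _ _ PP) -N_nu (dotNN N_normal). Qed.

Lemma fCS p : fC p ^+ 2 + fS p ^+ 2 = 1.
Proof. by rewrite /fC /fS sqrrN addrC nu_unit. Qed.

Lemma s_frame p : s p = fx p * fS p - fy p * fC p.
Proof.
have -> : s p = dot (psi p) (N p) by exact: support_fnE.
by rewrite N_nu dotC dot_mulmx_tr dotC dot2 /fC mulrN opprK.
Qed.

Definition bmat p := P *m Bm p *m P^T.

Lemma Bm_bmat p : Bm p *m P^T = P^T *m bmat p.
Proof.
rewrite /bmat !mulmxA; have -> : P^T *m P = 1%:M - Q^T *m Q by rewrite -PQ1 addrK.
by rewrite !mulmxBl mul1mx -(mulmxA Q^T) (KA p).2 mulmx0 mul0mx subr0.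
Qed.

(** The planar block of [Bm] is symmetric, kills the unit vector [nu] and carries the whole trace
    [- c]. *)
Lemma bmat_entries p : [/\ bmat p 0 0 = - c * nu p 0 1 ^+ 2, bmat p 0 1 = - (- c * (nu p 0 0 * nu p 0 1)),
 bmat p 1 0 = - (- c * (nu p 0 0 * nu p 0 1)) & bmat p 1 1 = - c * nu p 0 0 ^+ 2].
Proof.
have sym : bmat p 1 0 = bmat p 0 1.
 have E : (bmat p)^T = bmat p.
  by rewrite /bmat !trmx_mul trmxK (Bm_sym imm N_normal) mulmxA.
 by rewrite -[in LHS]E mxE.
have BQ : Bm p *m Q^T = 0 by rewrite -[LHS]trmxK trmx_mul trmxK (Bm_sym imm N_normal) (KA p).2 trmx0.
have tr : bmat p 0 0 + bmat p 1 1 = - c.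
 have : \tr (bmat p) = - c.
  rewrite /bmat -mulmxA mxtrace_mulC -mulmxA; have -> : P^T *m P = 1%:M - Q^T *m Q by rewrite -PQ1 addrK.
  by rewrite mulmxBr mulmx1 mulmxA BQ mul0mx subr0 (tr_Bm soliton rs).
 rewrite /mxtrace big_ord_recl big_ord1 => <-; congr (_ + bmat p _ _); exact: val_inj.
have nb : nu p *m bmat p = 0.
 by rewrite /bmat !mulmxA -N_nu (N_Bm imm N_normal) mul0mx.
have h i : nu p 0 0 * bmat p 0 i + nu p 0 1 * bmat p 1 i = 0 by rewrite -mul2 nb mxE.
have h0 := h 0; rewrite sym in h0; have [e1 e2 e3] := rank_one_sym (nu_unit p) h0 (h 1).
by rewrite tr in e1 e2 e3; rewrite sym.
Qed.

(** The signed speed of the planar projection along the tangent [(fC, fS)]; it may vanish or change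
    sign. *)
Definition spd (g : R -> M) (t : R) := (vel psi g t *m P^T) 0 0 * fC (g t) + (vel psi g t *m P^T) 0 1 * fS (g t).

(** The planar velocity is orthogonal to [nu], hence [spd] times the tangent, and the derivative of
    the normal is [s * B] applied to it. So every curve in [M] drives the planar frame along one and
    the same soliton, only at its own speed. *)
Lemma frame_motion_curve (g : R -> M) : C1_curve g ->
 frame_motion c (spd g) (fx \o g) (fy \o g) (fC \o g) (fS \o g).
Proof.
move=> gC t; have dy i := is_derive_row_mul P i (fun j => vel_coord t j gC).
have dn i := is_derive_row_mul P i (fun j => normal_coord t j gC).
have vN : dot (vel psi g t *m P^T) (nu (g t)) = 0.
 by rewrite dotC -dot_mulmx_tr -N_nu dotC vel_normal.
rewrite dot2 in vN; have n1 := nu_unit (g t); have sf := s_frame (g t).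
have vb i : ((s (g t) *: (vel psi g t *m Bm (g t))) *m P^T) 0 i =
 s (g t) * ((vel psi g t *m P^T) 0 0 * bmat (g t) 0 i + (vel psi g t *m P^T) 0 1 * bmat (g t) 1 i).
 by rewrite -scalemxAl -mulmxA Bm_bmat mulmxA mxE mul2.
have [b1 b2 b3 b4] := bmat_entries (g t).
have fs : frame_speed c (fx \o g) (fy \o g) (fC \o g) (fS \o g) t = - (c * s (g t)).
 rewrite sf /frame_speed /=; ring.
split.
- have := dy 0; congr (is_derive _ _ _ _); rewrite /spd /fC /fS /=; apply/eqP; rewrite -subr_eq0; apply/eqP.
 move: vN n1; move: ((vel psi g t *m P^T) 0 0) ((vel psi g t *m P^T) 0 1) (nu (g t) 0 0) (nu (g t) 0 1) => vx vy n0 n1' vN nn1.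
 transitivity (vx * (1 - (n0 ^+ 2 + n1' ^+ 2)) + n0 * (vx * n0 + vy * n1')); first by ring.
 by rewrite nn1 vN; ring.
- have := dy 1; congr (is_derive _ _ _ _); rewrite /spd /fC /fS /=; apply/eqP; rewrite -subr_eq0; apply/eqP.
 move: vN n1; move: ((vel psi g t *m P^T) 0 0) ((vel psi g t *m P^T) 0 1) (nu (g t) 0 0) (nu (g t) 0 1) => vx vy n0 n1' vN nn1.
 transitivity (vy * (1 - (n0 ^+ 2 + n1' ^+ 2)) + n1' * (vx * n0 + vy * n1')); first by ring.
 by rewrite nn1 vN; ring.
- have h := is_deriveN (dn 1); move: h; congr (is_derive _ _ _ _).
 by rewrite vb fs b2 b4 /spd /fC /fS /=; ring.
have := dn 0; congr (is_derive _ _ _ _).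
by rewrite vb fs b1 b3 /spd /fC /fS /=; ring.
Qed.

Lemma row_coord_continuous k (f : M -> 'rV[R]_m.+1) (A : 'M[R]_(k, m.+1)) i :
 (forall j, continuous (fun p => f p 0 j)) -> continuous (fun p => (f p *m A^T) 0 i).
Proof.
move=> fc p; have -> : (fun p => (f p *m A^T) 0 i) = (fun p => \sum_j f p 0 j * A^T j i).
 by apply/funext => q; rewrite mxE.
apply: sum_continuous_at => j _.
by apply: (@continuousM _ _ (fun p => f p 0 j) (cst (A^T j i)) p); [exact: fc|exact: cst_continuous].
Qed.

Lemma psi_coord_continuous j : continuous (fun p => psi p 0 j).
Proof. exact: (CM_continuous (xx_smooth imm 0 j)). Qed.

Lemma N_coord_continuous j : continuous (fun p => N p 0 j).
Proof. exact: (CM_continuous (sfP (nn j) 0)). Qed.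

Lemma fx_continuous : continuous fx. Proof. exact: row_coord_continuous psi_coord_continuous. Qed.
Lemma fy_continuous : continuous fy. Proof. exact: row_coord_continuous psi_coord_continuous. Qed.
Lemma fS_continuous : continuous fS. Proof. exact: row_coord_continuous N_coord_continuous. Qed.
Lemma fC_continuous : continuous fC.
Proof.
have h : continuous (fun p => nu p 0 1) := @row_coord_continuous 2 N P 1 N_coord_continuous.
by move=> p; apply: (@continuousN _ _ _ (fun p => nu p 0 1) p); exact: h.
Qed.

Lemma spd_continuous (g : R -> M) : C1_curve g -> continuous (spd g).
Proof.
move=> gC; have gc : continuous g by case: gC.
have vc i : continuous (fun t => (vel psi g t *m P^T) 0 i).
 move=> t; have -> : (fun t => (vel psi g t *m P^T) 0 i) = (fun t => \sum_j vel psi g t 0 j * P^T j i).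
  by apply/funext => q; rewrite mxE.
 apply: sum_continuous_at => j _.
 apply: (@continuousM _ _ (fun t => vel psi g t 0 j) (cst (P^T j i)) t); last exact: cst_continuous.
 exact: vel_continuous.
have Cc : continuous (fC \o g) by move=> t; apply: continuous_comp; [exact: gc|exact: fC_continuous].
have Sc : continuous (fS \o g) by move=> t; apply: continuous_comp; [exact: gc|exact: fS_continuous].
move=> t; apply: (@continuousD _ _ _ (fun t => (vel psi g t *m P^T) 0 0 * fC (g t)) (fun t => (vel psi g t *m P^T) 0 1 * fS (g t)) t).
 by apply: (@continuousM _ _ (fun t => (vel psi g t *m P^T) 0 0) (fC \o g) t); [exact: vc|exact: Cc].
by apply: (@continuousM _ _ (fun t => (vel psi g t *m P^T) 0 1) (fS \o g) t); [exact: vc|exact: Sc].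
Qed.

Variables X Y C S : R -> R.
Hypothesis motion : frame_motion c (cst 1) X Y C S.

Definition state p t := [/\ fx p = X t, fy p = Y t, fC p = C t & fS p = S t].

(** The projected frame and the soliton reparametrized by the integral [h] of the signed speed solve
    the same system with the same initial values. *)
Lemma state_curve (g : R -> M) (h : R -> R) t : C1_curve g -> (forall u : R, is_derive u (1 : R) h (spd g u)) ->
 h 0 = 0 -> state (g 0) t -> forall u, 0 <= u -> state (g u) (t + h u).
Proof.
move=> gC hd h0 [s1 s2 s3 s4] u u0.
have hd' (z : R) : is_derive z (1 : R) (fun z => t + h z) (spd g z) by exact: is_derive_shift.
have M2 := frame_motion_comp motion hd'.
have [||||e1 e2 e3 e4] := frame_motion_unique (spd_continuous gC) (frame_motion_curve gC) M2 _ _ _ _ u0;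
 rewrite /= ?h0 ?addr0//.
Qed.

(** The curve behind [advance] again, now also carrying the soliton parameter, which changes to
    first order by the component of [xi] along the planar tangent. *)
Lemma advance_state p t (xi : 'rV[R]_m.+1) (v e h0 : R) : state p t -> dot xi (N p) = 0 -> enorm xi < v ->
 0 < e -> 0 < h0 -> exists q t' h, [/\ 0 < h, h < h0, (rdist psi p q < (v * h)%R%:E)%E,
  enorm (psi q - (psi p + h *: xi)) <= e * h &
  `|t' - (t + h * ((xi *m P^T) 0 0 * fC p + (xi *m P^T) 0 1 * fS p))| <= e * h /\ state q t'].
Proof.
move=> st xN xv e0 h00; have [g [gC g0 gv]] := tangent_curve imm N_normal xN.
have [|r1 r10 H1] := curve_rdist imm gC (v := v); first by rewrite gv.
have [r2 r20 H2] := curve_psi_eps imm gC e0.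
have [h h0_ hd] := primitive (spd_continuous gC).
have [r3 r30 H3] := deriv_eps (hd 0) e0.
have m0 : 0 < Num.min (Num.min r1 r2) (Num.min r3 h0) by rewrite !lt_min r10 r20 r30.
pose z : R := Num.min (Num.min r1 r2) (Num.min r3 h0) / 2.
have zp : 0 < z by rewrite divr_gt0.
have zm : z < Num.min (Num.min r1 r2) (Num.min r3 h0) by rewrite ltr_pdivrMr// ltr_pMr// ltr1n.
move: (zm); rewrite !lt_min => /andP[/andP[z1 z2] /andP[z3 z4]].
exists (g z), (t + h z), z; split=> //.
- by have := H1 z zp z1; rewrite g0.
- by have := H2 z zp z2; rewrite g0 gv.
split; last by apply: state_curve => //; [rewrite g0|exact: ltW].
have := H3 z; rewrite (gtr0_norm zp) add0r h0_ subr0 /spd gv g0 => /(_ z3).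
by rewrite [z * _]mulrC opprD addrACA subrr add0r.
Qed.

Lemma state_closed (f : M -> R) (x : R -> R) p t : continuous f -> continuous x ->
 (forall e, 0 < e -> exists q t', [/\ f q = x t', (rdist psi q p < e%:E)%E & `|t' - t| < e]) -> f p = x t.
Proof.
move=> fc xc H; apply/eqP; rewrite -subr_eq0 -normr_eq0; apply: contrapT => /negP D0.
pose e : R := `|f p - x t| / 2.
have e0 : 0 < e by rewrite divr_gt0// lt_def D0 normr_ge0.
have /cvgrPdist_lt/(_ e e0) nf := fc p; have /cvgrPdist_lt/(_ e e0) nx := xc t.
have [e1 e10 He1] := rdist_ball imm nf.
have /nbhs_ballP[e2 /= e20 He2] := nx.
have m0 : 0 < Num.min e1 e2 by rewrite lt_min e10.
have [q [t' [E h1 h2]]] := H _ m0.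
have k1 : `|f p - f q| < e.
 apply: He1; apply: (rdist_sym_lt imm); apply: rdist_le_lt h1 _; by rewrite ge_min lexx.
have k2 : `|x t - x t'| < e.
 apply: He2; rewrite /ball /= distrC; apply: lt_le_trans h2 _; by rewrite ge_min lexx orbT.
have : `|f p - x t| < e + e.
 have -> : f p - x t = (f p - f q) - (x t - x t') by rewrite E; ring.
 by apply: le_lt_trans (ler_normB _ _) _; exact: ltrD.
by rewrite /e -splitr ltxx.
Qed.

Lemma zz_lip p q a : (rdist psi p q < a%:E)%E -> enorm (zz p - zz q) <= a.
Proof.
move=> /(psi_lip imm) h; apply: le_trans h; rewrite -enormN opprB -mulmxBl; exact: enorm_le_orth.
Qed.

Lemma descent_rate (de h e f f' : R) : 0 < h -> 0 < de -> e = de / 4 -> f' <= f - h * de + 2 * e * h ->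
 h * de / 2 <= f - f' /\ 0 < h * de / 2.
Proof.
move=> h0 d0 -> hf; have hd : 0 < h * de by rewrite mulr_gt0.
by split; move: hd hf; have -> : 2 * (de / 4) * h = h * de / 2 by [field]; move: (h * de) => x; lra.
Qed.

(** Descent for the distance from [(t, zz p)] to the prescribed [(t1, v)] inside the closed set of
    pairs satisfying [state]: the flat component is corrected by moving along [Q], and the parameter
    by moving along the planar tangent. *)
Lemma state_onto p0 t1 (v : 'rV[R]_l) : state p0 0 -> exists p, state p t1 /\ zz p = v.
Proof.
move=> st0; pose f p t : R := `|t1 - t| + enorm (v - zz p).
have QP : Q *m P^T = 0 by rewrite -[LHS]trmxK trmx_mul trmxK PQ trmx0.
have f_lip p q t t' a : (rdist psi p q < a%:E)%E -> `|t - t'| < a -> `|f p t - f q t'| <= 2 * a.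
 move=> h1 h2; have -> : f p t - f q t' = (`|t1 - t| - `|t1 - t'|) + (enorm (v - zz p) - enorm (v - zz q)) by rewrite /f; ring.
 apply: le_trans (ler_normD _ _) _; rewrite mulr_natl mulr2n; apply: lerD.
  apply: le_trans (ler_dist_dist _ _) _; have -> : t1 - t - (t1 - t') = t' - t by ring.
  by rewrite distrC ltW.
 by apply: le_trans (enorm_dist _ _) _; rewrite subBB enormN; exact: zz_lip.
have C2 : (0 : R) <= 2 by []. have K10 : (0 : R) <= 10 by [].
have [] := descent_MR imm M_complete (S := state) (f := f) C2 K10 _ f_lip _ _ st0.
- by move=> p t; rewrite addr_ge0// enorm_ge0.
- move=> p t H; have [Xc Yc Cc Sc] := frame_motion_continuous motion.
 by split; [apply: (state_closed fx_continuous Xc)|apply: (state_closed fy_continuous Yc)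
  |apply: (state_closed fC_continuous Cc)|apply: (state_closed fS_continuous Sc)];
  move=> e /H[q [t' [[h1 h2 h3 h4] h5 h6]]]; exists q, t'.
- move=> p t st fp; have [z0|z0] := eqVneq (v - zz p) 0; last first.
  pose de : R := enorm (v - zz p); have de0 : 0 < de by exact: enorm_gt0.
  pose xi := (v - zz p) *m Q.
  have xN : dot xi (N p) = 0 by rewrite /xi dot_mulmx_tr (KA p).1 /dot trmx0 mulmx0 mxE.
  have xn : enorm xi < 2 * de by rewrite /xi enorm_orth// mulr_natl mulr2n ltrDl.
  have xP : xi *m P^T = 0 by rewrite /xi -mulmxA QP mulmx0.
  pose e : R := de / 4; have e0 : 0 < e by rewrite divr_gt0.
  have [q [t' [h [h0 h1 dq nq [tq sq]]]]] := advance_state st xN xn e0 ltr01.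
  rewrite xP !mxE !mul0r addr0 mulr0 addr0 in tq.
  have zq : enorm (v - zz q) <= (1 - h) * de + e * h.
   rewrite (sub_approx_self v (zz p) (zz q) h); apply: le_trans (enormD _ _) _.
   rewrite enormN enormZ ger0_norm; last by rewrite subr_ge0 ltW.
   rewrite lerD2l; have -> : zz q - (zz p + h *: (v - zz p)) = (psi q - (psi p + h *: xi)) *m Q^T.
    by rewrite mulmxBl mulmxDl -scalemxAl /xi -mulmxA QQ mulmx1.
   by apply: le_trans nq; exact: enorm_le_orth.
  have t'E : `|t1 - t'| <= `|t1 - t| + e * h.
   have -> : t1 - t' = (t1 - t) - (t' - t) by ring.
   by apply: le_trans (ler_normB _ _) _; rewrite lerD2l.
  have fq : f q t' <= f p t - h * de + 2 * e * h.
   apply: le_trans (lerD t'E zq) _; rewrite le_eqVlt /f -/de; apply/orP; left; apply/eqP; ring.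
  have [dec decp] := descent_rate h0 de0 erefl fq.
  exists q, t', (2 * de * h), (h * de / 2); split=> //; split; last split=> //.
  + by move: decp; have -> : 2 * de * h = 4 * (h * de / 2) by [field]; move=> decp; rewrite ler_pM2r// ler_nat.
  + rewrite distrC; apply: le_lt_trans tq _; have -> : e * h = 1 / 2 * (h * de / 2) by rewrite /e; field.
   by rewrite ltr_pM2r//; lra.
 have ft : f p t = `|t1 - t| by rewrite /f z0 enorm0 addr0.
 have tt : 0 < `|t1 - t| by rewrite -ft.
 pose sg : R := Num.sg (t1 - t).
 have sg1 : `|sg| = 1 by rewrite normr_sg -normr_eq0 gt_eqF.
 have sgE : t1 - t = sg * `|t1 - t| by exact: numEsg.
 pose tau := pt (fC p) (fS p); pose xi := sg *: (tau *m P).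
 have t1_ : dot tau tau = 1 by rewrite pt_dot -!expr2 fCS.
 have xN : dot xi (N p) = 0.
  rewrite /xi dotZl dot_mulmx_tr -/(nu p) (pt_eq (v := nu p) erefl erefl) /tau pt_dot /fC /fS.
  by rewrite mulNr [nu p 0 1 * _]mulrC addNr mulr0.
 have xn : enorm xi < 2 by rewrite /xi enormZ sg1 mul1r enorm_orth// /enorm t1_ sqrtr1 ltr1n.
 have xP : xi *m P^T = sg *: tau by rewrite /xi -scalemxAl -mulmxA PP mulmx1.
 have e0 : (0 : R) < 1 / 4 by rewrite divr_gt0.
 have [q [t' [h [h0 h1 dq nq [tq sq]]]]] := advance_state st xN xn e0 tt.
 rewrite xP in tq.
 have al : (sg *: tau) 0 0 * fC p + (sg *: tau) 0 1 * fS p = sg.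
  by rewrite !mxE /= -!mulrA -mulrDr -!expr2 fCS mulr1.
 rewrite al in tq.
 have zq : enorm (v - zz q) <= 1 / 4 * h.
  have -> : v - zz q = (v - zz p) - (zz q - (zz p + h *: 0)) by rewrite scaler0 addr0 opprB addrA subrK.
  rewrite z0 sub0r enormN; have -> : zz q - (zz p + h *: 0) = (psi q - (psi p + h *: xi)) *m Q^T.
   by rewrite mulmxBl mulmxDl -scalemxAl /xi -scalemxAl -mulmxA PQ mulmx0 !scaler0.
  by apply: le_trans nq; exact: enorm_le_orth.
 have t'E : `|t1 - t'| <= `|t1 - t| - h + 1 / 4 * h.
  have -> : t1 - t' = (t1 - (t + h * sg)) - (t' - (t + h * sg)) by ring.
  apply: le_trans (ler_normB _ _) _; apply: lerD tq.
  have -> : t1 - (t + h * sg) = sg * (`|t1 - t| - h) by rewrite mulrBr -sgE; ring.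
  by rewrite normrM sg1 mul1r ger0_norm// subr_ge0 ltW.
 have fq : f q t' <= f p t - h * 1 + 2 * (1 / 4) * h.
  by apply: le_trans (lerD t'E zq) _; rewrite ft le_eqVlt; apply/orP; left; apply/eqP; ring.
 have [dec decp] := descent_rate h0 ltr01 erefl fq.
 rewrite mulr1 in dec decp.
 exists q, t', (2 * h), (h / 2); split=> //; split; last split=> //.
 + have -> : 2 * h = 4 * (h / 2) by field.
  by rewrite ler_pM2r// ler_nat.
 + have -> : t - t' = - (t' - (t + h * sg)) - h * sg by ring.
  apply: le_lt_trans (ler_normB _ _) _; rewrite normrN normrM sg1 mulr1 (gtr0_norm h0).
  apply: le_lt_trans (lerD tq (lexx _)) _; have -> : 10 * (h / 2) = (1 / 4 * h + h) + 15 / 4 * h by field.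
  by rewrite ltrDl mulr_gt0// divr_gt0.
move=> p [t [st fp]]; exists p; have h1 := enorm_ge0 (v - zz p); have h2 := normr_ge0 (t1 - t).
have [e1 e2] : `|t1 - t| = 0 /\ enorm (v - zz p) = 0 by move: fp; rewrite /f; split; lra.
have tE : t1 = t by apply/eqP; rewrite -subr_eq0 -normr_eq0 e1.
by split; [rewrite tE|apply/eqP; rewrite eq_sym -subr_eq0; apply/eqP/enorm_eq0].
Qed.

End Frame.

Hypothesis m_gt0 : (0 < m)%N.
Variables (o : M) (k0 : 'I_m.+1).
Hypothesis ds_neq0 : d k0 s o != 0.

(** The plane is spanned by [N o] and the gradient of [s] at [o]. The planar soliton is the one
    starting at the frame of [o]; joining [o] to any point by a curve shows that the point lies over
    it, and [state_onto] gives the converse. *)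
Lemma varying_support : exists (C : manifold R 1) (gamma : C -> 'rV[R]_2),
  [/\ connected [set: C], mcf_soliton gamma &
   is_product (range psi) (range gamma) [set: 'rV[R]_m.-1]].
Proof.
pose a : 'rV[R]_m.+1 := \row_i d i s o.
have aB i j k : a 0 i * Bm o j k = a 0 j * Bm o i k.
 have E := congr1 (fun f : sfun M => f o) (codazzi_parallel rs E0 i j k).
 by rewrite /a !mxE.
have ak : a 0 k0 != 0 by rewrite mxE.
have a0 : a != 0 by apply: contra ak => /eqP ->; rewrite mxE.
have aN : dot a (N o) = 0.
 have := congr1 (fun f : sfun M => f o) (Nd0 imm N_normal s); rewrite /= sf_sum => h.
 by rewrite dotE -[RHS]h; apply: eq_bigr => i _; rewrite mxE mulrC.
have N1 : dot (N o) (N o) = 1 by rewrite (dotNN N_normal).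
have N0 : N o != 0 by apply/eqP => h; move: N1; rewrite h /dot mul0mx mxE => /eqP; rewrite eq_sym oner_eq0.
(* The gradient [a] is nonzero and tangent, so these two rows are independent and the plane is
   genuine. *)
pose A := col_mx a (N o).
have rA : \rank A = 2%N.
 apply/eqP; rewrite eqn_leq rank_leq_row.
 by apply: (rank_pair (a := a) (b := N o)) => //; [rewrite -addsmxE addsmxSl|rewrite -addsmxE addsmxSr].
have kl : (2 + m.-1)%N = m.+1 by case: m m_gt0.
have [P [Q [PP QQ PQ PQ1 [_ AQ]]]] := orth_split rA kl.
have [aQ NQ] : a *m Q^T = 0 /\ N o *m Q^T = 0.
 by move: AQ; rewrite /A mul_col_mx => h; split;
  [rewrite -[LHS](col_mxKu _ (N o *m Q^T))|rewrite -[LHS](col_mxKd (a *m Q^T))]; rewrite h ?linear0.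
(* By [aB], [a 0 k0] times a row of [Q] applied to [Bm o] becomes the inner product of that row with
   [a], which is 0, times an entry of [Bm o]; so [Bm o] has rank at most one. *)
have QB : Q *m Bm o = 0.
 apply/matrixP => i k; rewrite [RHS]mxE; apply: (mulfI ak); rewrite mulr0 [(Q *m _) _ _]mxE mulr_sumr.
 have /rowP/(_ i) := aQ; rewrite mxE [RHS]mxE => h.
 transitivity (Bm o k0 k * \sum_j a 0 j * Q^T j i); last by rewrite h mulr0.
 rewrite mulr_sumr; apply: eq_bigr => j _.
 by rewrite mulrCA aB [Q^T _ _]mxE; ring.
have KA := kernel_all M_conn rs E0 NQ QB.
have [X [Y [C [S [[X0 Y0 C0 S0] H]]]]] := planar_curve c (fx P o) (fy P o) (fCS PP PQ1 KA o).
have motion : frame_motion c (cst 1) X Y C S.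
 by move=> t; have [_ h1 h2 h3 h4] := H t; split; rewrite mul1r.
have st0 : state P X Y C S o 0 by split.
have decomp p : psi p = yy P p *m P + zz Q p *m Q.
 by rewrite /yy /zz -!mulmxA -mulmxDr PQ1 mulmx1.
have yE p t : state P X Y C S p t -> yy P p = gam X Y t.
 by case=> h1 h2 _ _; exact: pt_eq.
exists (line R), (gam X Y); split.
- exact: line_connected.
- split; last exists c.
  by apply: (gam_immersion (c := c) (C := C) (S := S)) => t; have [] := H t.
 by apply: (gam_soliton (C := C) (S := S)) => t; have [] := H t.
split=> //; exists P, Q; split=> //; apply/seteqP; split=> [_ [p _ <-]|_ [_ [v [[t1 _ <-] _ ->]]]].
 exists (yy P p), (zz Q p); split=> //.
 have [g [gC g0 g1]] := curve_join imm M_conn o p.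
 have gP : continuous (spd P g) by apply: spd_continuous.
 have [h h0 hd] := primitive gP.
 have st1 : state P X Y C S (g 1) (0 + h 1).
  have st00 : state P X Y C S (g 0) 0 by rewrite g0.
  exact: (state_curve PP PQ1 KA motion gC hd h0 st00 ler01).
 by exists (0 + h 1 : R) => //; apply/esym/yE; rewrite -g1.
have [p [st zp]] := state_onto PP QQ PQ PQ1 KA motion t1 v st0.
by exists p => //; rewrite decomp (yE _ _ st) zp.
Qed.

End CaseB.

Theorem corollary9p6 (R : realType) (m : nat) (m_gt0 : (0 < m)%N)
 (M : manifold R m) (psi : M -> 'rV[R]_m.+1) (c : R)
 (psi_immersion : immersion psi)
 (M_complete : complete_immersion psi)
 (M_connected : connected [set: M])
 (M_orientable : orientable M)
 (c_lt0 : c < 0)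
 (psi_soliton : soliton_for c psi)
 (N : M -> 'rV[R]_m.+1) (N_normal : unit_normal psi N)
 (H_neq0 : exists p, mean_curvature psi N p != 0)
 (H_sign : (forall p, 0 <= mean_curvature psi N p) \/
      (forall p, mean_curvature psi N p <= 0))
 (dM : {measure set (borel M) -> \bar R}) (dM_volume : is_volume psi dM)
 (p : R) (p_gt1 : 1 < p)
 (H_A_L1 : dM.-integrable [set: borel M] (fun x : borel M =>
  (HA_density p psi N x * expR (c * eta psi x))%:E)) :
 (exists (a : 'rV[R]_m.+1) (r : R), 0 < r /\ range psi = sphere a r) \/
 (exists (k l : nat) (a : 'rV[R]_k.+1) (r : R),
  [/\ (0 < k)%N, (0 < l)%N, 0 < r &
   is_product (range psi) (sphere a r) [set: 'rV[R]_l]]) \/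
 (exists (C : manifold R 1) (gamma : C -> 'rV[R]_2),
  [/\ connected [set: C], mcf_soliton gamma &
   is_product (range psi) (range gamma) [set: 'rV[R]_m.-1]]).
Proof.
pose rs := sinvK psi_immersion N_normal m_gt0 M_connected psi_soliton c_lt0 H_neq0 H_sign.
have E0 := parallel psi_soliton c_lt0 rs p_gt1 H_A_L1 M_complete dM_volume.
have [ds0|nds] := pselect (forall k q, dsf psi_immersion k (support_fn psi_immersion N_normal) q = 0).
 by case: (constant_support M_connected M_complete psi_soliton c_lt0 rs E0 ds0) => H; [left|right; left].
have /existsNP[k nk] := nds; have /existsNP[q0 /eqP dso] := nk.
by right; right; exact: (varying_support M_connected M_complete psi_soliton rs E0 m_gt0 dso).
Qed.
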